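(* Let $n\in\mathbb{N}$, $\alpha\in(0,1)$ and $p\in\left[1,\frac{n}{n-\alpha}\right)$. There exists a constant $c_{n,\alpha}>0$, depending only on $n$ and $\alpha$, such that $$\|f\|_{L^{\frac{n}{n-\alpha},r}(\mathbb{R}^n)}\le c_{n,\alpha}\,|D^\alpha f|(\mathbb{R}^n)$$ for all $f\in BV^{\alpha,p}(\mathbb{R}^n)$, where $r=+\infty$ if $n=1$ and $r=1$ if $n\ge2$. As a consequence, $BV^{\alpha,p}(\mathbb{R}^n)\subset L^q(\mathbb{R}^n)$ with continuous inclusion for all $q\in\left[p,\frac{n}{n-\alpha}\right)$, and also for $q=\frac{n}{n-\alpha}$ if $n\ge2$.
   Context: $L^{s,r}(\mathbb{R}^n)$ denotes the Lorentz space. For $\alpha\in(0,1)$ let $\mu_{n,\alpha}=2^{\alpha}\pi^{-n/2}\Gamma\left(\frac{n+\alpha+1}{2}\right)/\Gamma\left(\frac{1-\alpha}{2}\right)$ and, for $\varphi\in C^\infty_c(\mathbb{R}^n;\mathbb{R}^n)$, $\operatorname{div}^\alpha\varphi(x)=\mu_{n,\alpha}\int_{\mathbb{R}^n}\frac{(y-x)\cdot(\varphi(y)-\varphi(x))}{|y-x|^{n+\alpha+1}}\,dy$. For $p\in[1,+\infty]$, $BV^{\alpha,p}(\mathbb{R}^n)$ is the set of $f\in L^p(\mathbb{R}^n)$ with $|D^\alpha f|(\mathbb{R}^n):=\sup\{\int_{\mathbb{R}^n} f\operatorname{div}^\alpha\varphi\,dx:\varphi\in C^\infty_c(\mathbb{R}^n;\mathbb{R}^n),\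 \|\varphi\|_{L^\infty}\le1\}<+\infty$, normed by $\|f\|_{L^p}+|D^\alpha f|(\mathbb{R}^n)$. *)

(* Defs.v *)
(* R^n is modelled as 'rV[R]_n (normed space, used for
   derivatives / topology); Lebesgue integration on R^n is the iterated
   one-dimensional Lebesgue integral, computed through the isomorphism with
   n.-tuple R (which carries the product Borel sigma-algebra of the library). *)
From HB Require Import structures.
From mathcomp Require Import all_boot all_order all_algebra.
From mathcomp Require Import all_classical all_reals all_analysis.
Set Implicit Arguments. Unset Strict Implicit. Unset Printing Implicit Defensive.
Import Order.TTheory GRing.Theory Num.Theory.
Import numFieldNormedType.Exports.
Local Open Scope classical_set_scope.
Local Open Scope ring_scope.

Definition tup2row {R : realType} (n : nat) (t : n.-tuple R) : 'rV[R]_n :=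
  \row_i tnth t i.

Fixpoint iter_int {R : realType} (n : nat) : (n.-tuple R -> \bar R) -> \bar R :=
  match n return (n.-tuple R -> \bar R) -> \bar R with
  | 0 => fun g => g [tuple]
  | m.+1 => fun g =>
      (\int[@lebesgue_measure R]_(x in [set: R])
         iter_int (fun t : m.-tuple R => g (cons_tuple x t)))%E
  end.

Definition rV_int {R : realType} (n : nat) (h : 'rV[R]_n -> \bar R) : \bar R :=
  iter_int (h \o @tup2row R n).

Definition leb_n {R : realType} (n : nat) (A : set 'rV[R]_n) : \bar R :=
  rV_int (fun x => (\1_A x)%:E).

Definition measurable_rV {R : realType} (n : nat) (f : 'rV[R]_n -> R) : Prop :=
  measurable_fun [set: n.-tuple R] (f \o @tup2row R n).

Definition dotv {R : realType} (n : nat) (u v : 'rV[R]_n) : R :=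
  \sum_(i < n) u ord0 i * v ord0 i.
Definition enorm {R : realType} (n : nat) (u : 'rV[R]_n) : R :=
  Num.sqrt (dotv u u).

Definition Lp_norm {R : realType} (n : nat) (p : R) (f : 'rV[R]_n -> R) : \bar R :=
  poweR (rV_int (fun x => (`|f x| `^ p)%:E)) p^-1.
Definition Lp_mem {R : realType} (n : nat) (p : R) (f : 'rV[R]_n -> R) : Prop :=
  measurable_rV f /\ (rV_int (fun x => (`|f x| `^ p)%:E) < +oo)%E.

Definition distrib_fun {R : realType} (n : nat) (f : 'rV[R]_n -> R) (l : R) : \bar R :=
  leb_n [set x | l < `|f x|].
Definition rearrangement {R : realType} (n : nat) (f : 'rV[R]_n -> R) (t : R) : \bar R :=
  ereal_inf [set l%:E | l in [set l : R | 0 <= l /\ (distrib_fun f l <= t%:E)%E]].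

Definition lorentz_norm {R : realType} (n : nat) (s : R) (r : \bar R)
    (f : 'rV[R]_n -> R) : \bar R :=
  match r with
  | EFin r =>
      poweR (\int[@lebesgue_measure R]_(t in [set t : R | (0 < t)%R])
         (poweR ((powR t s^-1)%:E * rearrangement f t) r * (t^-1)%:E))%E r^-1
  | +oo%E => ereal_sup [set ((powR t s^-1)%:E * rearrangement f t)%E
                         | t in [set t : R | (0 < t)%R]]
  | -oo%E => +oo%E
  end.

Definition Gamma_fun {R : realType} (s : R) : R :=
  fine (\int[@lebesgue_measure R]_(t in [set t : R | (0 < t)%R])
          (powR t (s - 1) * expR (- t))%:E)%E.

Definition mu_const {R : realType} (n : nat) (a : R) : R :=
  2 `^ a * pi `^ (- (n%:R / 2)) * Gamma_fun ((n%:R + a + 1) / 2)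
  / Gamma_fun ((1 - a) / 2).

Definition frac_div {R : realType} (n : nat) (a : R)
    (phi : 'rV[R]_n -> 'rV[R]_n) (x : 'rV[R]_n) : R :=
  mu_const n a * fine (rV_int (fun y =>
     (dotv (y - x) (phi y - phi x) / (enorm (y - x)) `^ (n%:R + a + 1))%:E)).

Definition basis_rV {R : realType} (n : nat) (i : 'I_n) : 'rV[R]_n := delta_mx ord0 i.

Fixpoint iter_partial {R : realType} (n : nat) (l : seq 'I_n)
    (f : 'rV[R]_n -> 'rV[R]_n) : 'rV[R]_n -> 'rV[R]_n :=
  match l with
  | [::] => f
  | i :: l' => fun x => derive (iter_partial l' f) x (basis_rV i)
  end.

Definition smooth_rV {R : realType} (n : nat) (f : 'rV[R]_n -> 'rV[R]_n) : Prop :=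
  forall l : seq 'I_n, continuous (iter_partial l f) /\
    forall (i : 'I_n) (x : 'rV[R]_n), derivable (iter_partial l f) x (basis_rV i).

Definition test_field {R : realType} (n : nat) (phi : 'rV[R]_n -> 'rV[R]_n) : Prop :=
  [/\ smooth_rV phi, compact (closure [set x | phi x != 0])
    & forall x, enorm (phi x) <= 1].

Definition frac_var {R : realType} (n : nat) (a : R) (f : 'rV[R]_n -> R) : \bar R :=
  ereal_sup [set rV_int (fun x => (f x * frac_div a phi x)%:E) | phi in @test_field R n].

Definition BV_mem {R : realType} (n : nat) (a p : R) (f : 'rV[R]_n -> R) : Prop :=
  Lp_mem p f /\ (frac_var a f < +oo)%E.

(* Main.v *)
(** Let [b = (1 - a) / 2] and let [u] be the Riesz potential of order [2 b] of
    [f], written through the heat semigroup as [int t^(b-1) P_t f dt].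
    Testing the fractional variation with averages of smooth cut-offs over
    segments shows that the increments of [u] satisfy
    [int |u(x + z) - u(x)| dx <= C |z| V] with [V = |D^a f|(R^n)], i.e. [u] is
    [BV]. Inverting the potential bounds [int psi f] by
    [int t^(-1-b) osc t psi u dt], where [osc t psi u] is the average of
    [psi(x) |u(y) - u(x)|] against the heat kernel. By the coarea formula the
    oscillation splits over the level sets of [u], and for a set of finite
    perimeter it is at most the minimum of [C sqrt t Per], of [int psi] and of
    twice the volume. Optimising in [t] and using the isoperimetric inequality
    (itself read off the heat flow) yields a profile [Phi], with
    [|{|f| > c}| <= 2 t] as soon as [c > Phi t], which decays like
    [V t^(a/n - 1)] and, when [n >= 2], satisfies
    [int t^(-a/n) Phi(t) dt <= C V]. The Lorentz bounds follow from
    [f^*(2 t) <= Phi t], the Lebesgue bounds from the layer cake formula. *)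
Require Import Defs.
From HB Require Import structures.
From mathcomp Require Import all_boot all_order all_algebra.
From mathcomp Require Import all_classical all_reals all_analysis.
From mathcomp Require Import measurable_realfun ring lra.
Set Implicit Arguments. Unset Strict Implicit. Unset Printing Implicit Defensive.
Import Order.TTheory GRing.Theory Num.Theory.
Import numFieldNormedType.Exports.
Local Open Scope classical_set_scope.
Local Open Scope ring_scope.

(** * One-dimensional integrals *)

(** The order [b] is forced: the kernel of the fractional divergence is a multiple of
    [int t^(b-2) (y - x) G_t(y - x) dt], the gradient of the kernel of the potential. A test field
    with divergence proportional to [psi - psi(. - h e)] has the potential of that increment as
    fractional divergence, so neither [f] nor [u] is ever differentiated. The Lorentz constant must
    not involve [p]; there [f] in L^p serves only for qualitative facts: absolute convergence of
    pairings, finite volume of level sets, convergence of the heat flow at small times. Two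
    difficulties shape the estimates. The potentials of the positive and negative parts of [f] may
    be infinite at some points, so inequalities are kept additive between nonnegative integrals. And
    each level set must be bounded linearly in its perimeter P, since linear bounds can be summed
    over the levels. Optimising in time only gives [P^(1-a) m^a], with m the smaller of a mass t and
    twice the volume; writing [m^a = m^(a-a/n) m^(a/n)], the isoperimetric inequality bounds the
    first factor by a multiple of [P^a] and the second is at most [t^(a/n)]. *)

Section affine_lebesgue.
Context {R : realType}.
Notation leb := (@lebesgue_measure R).
Variables (a c : R).
Hypothesis a0 : 0 < a.

Let aff : measurableTypeR R -> measurableTypeR R := fun x => a * x + c.

Let maff : measurable_fun [set: measurableTypeR R] aff.
Proof.
by apply: measurable_funD; [exact: mulrl_measurable|exact: measurable_cst].
Qed.


Let a0n : (0 : R) <= a. Proof. exact: ltW. Qed.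
Let nna : {nonneg R} := NngNum a0n.

Let maffm : {measure set (measurableTypeR R) -> \bar R} :=
  mscale nna (measure_function_pushforward__canonical__measure_function_Measure leb maff).

(** The push-forward under [x |-> a x + c], scaled by [a], gives every half-open interval its
    length, so it is Lebesgue measure by uniqueness. *)
Lemma lebesgue_affine (A : set R) : measurable A ->
  leb A = (a%:E * leb (aff @^-1` A))%E.
Proof.
move=> mA; rewrite (@lebesgue_measure_unique _ maffm) //= => X /ocitvP[->|[[x y] /= xy ->]].
  by rewrite measure0 /mscale /= /pushforward preimage_set0 measure0 mule0.
rewrite lebesgue_measure_itv /= lte_fin xy /maffm /mscale /= /pushforward.
have -> : aff @^-1` `]x, y] = `](x - c) / a, (y - c) / a]%classic.
  apply/seteqP; split => z /=; rewrite !in_itv/= /aff ltr_pdivrMr// ler_pdivlMr//.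
    by rewrite ltrBlDr lerBrDr mulrC.
  by rewrite ltrBlDr lerBrDr mulrC.
rewrite lebesgue_measure_itv /= lte_fin ltr_pM2r ?invr_gt0// ltrD2r xy.
by rewrite -!EFinD -EFinM; congr EFin; field; rewrite gt_eqF.
Qed.

Lemma ge0_integral_affine (f : R -> \bar R) : measurable_fun setT f ->
  (forall x, 0 <= f x)%E ->
  (\int[leb]_x f x = a%:E * \int[leb]_x f (a * x + c)%R)%E.
Proof.
move=> mf f0.
rewrite (@eq_measure_integral _ _ _ _ maffm); last first.
  by move=> A mA _; rewrite [LHS]lebesgue_affine.
rewrite ge0_integral_mscale//=.
by rewrite ge0_integral_pushforward//= preimage_setT.
Qed.

End affine_lebesgue.

(** * Measurability of composite functions *)

Section measurability.
Context d (T : measurableType d) (R : realType).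
Implicit Types (D : set T) (f g : T -> R) (F H : T -> \bar R).

Lemma mfD D f g : measurable_fun D f -> measurable_fun D g ->
  measurable_fun D (fun x => f x + g x).
Proof. exact: measurable_funD. Qed.
Lemma mfB D f g : measurable_fun D f -> measurable_fun D g ->
  measurable_fun D (fun x => f x - g x).
Proof. exact: measurable_funB. Qed.
Lemma mfN D f : measurable_fun D f -> measurable_fun D (fun x => - f x).
Proof. exact: measurable_funN. Qed.
Lemma mfM D f g : measurable_fun D f -> measurable_fun D g ->
  measurable_fun D (fun x => f x * g x).
Proof. exact: measurable_funM. Qed.
Lemma mfX D f k : measurable_fun D f -> measurable_fun D (fun x => f x ^+ k).
Proof. exact: measurable_funX. Qed.
Lemma mf_exp D f : measurable_fun D f -> measurable_fun D (fun x => expR (f x)).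
Proof. by move=> mf; apply: (measurableT_comp (@measurable_expR R)). Qed.
Lemma mf_norm D f : measurable_fun D f -> measurable_fun D (fun x => `|f x|).
Proof. by move=> mf; apply: (measurableT_comp (@normr_measurable R _)). Qed.
Lemma mf_powR D f p : measurable_fun D f -> measurable_fun D (fun x => f x `^ p).
Proof. by move=> mf; apply: (measurableT_comp (@measurable_powR R p)). Qed.
Lemma mf_max D f g : measurable_fun D f -> measurable_fun D g ->
  measurable_fun D (fun x => Num.max (f x) (g x)).
Proof. exact: measurable_maxr. Qed.
Lemma mf_min D f g : measurable_fun D f -> measurable_fun D g ->
  measurable_fun D (fun x => Num.min (f x) (g x)).
Proof. exact: measurable_minr. Qed.
Lemma mf_lt D f g : measurable_fun D f -> measurable_fun D g ->
  measurable_fun D (fun x => f x < g x).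
Proof. exact: measurable_fun_ltr. Qed.
Lemma mf_le D f g : measurable_fun D f -> measurable_fun D g ->
  measurable_fun D (fun x => f x <= g x).
Proof. exact: measurable_fun_ler. Qed.
Lemma mf_eq D f g : measurable_fun D f -> measurable_fun D g ->
  measurable_fun D (fun x => f x == g x).
Proof. exact: measurable_fun_eqr. Qed.
Lemma mf_if (b : T -> bool) f g : measurable_fun setT b ->
  measurable_fun setT f -> measurable_fun setT g ->
  measurable_fun setT (fun x => if b x then f x else g x).
Proof. exact: measurable_fun_ifT. Qed.
Lemma mf_bool (b : T -> bool) : measurable_fun setT b ->
  measurable_fun setT (fun x => (b x)%:R : R).
Proof.
move=> mb; rewrite (_ : (fun x => _) = (fun x => if b x then 1 else 0)).
  exact: mf_if.
by apply/funext => x; case: (b x).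
Qed.
Lemma mf_sum I (s : seq I) (P : pred I) D (h : I -> T -> R) :
  (forall i, measurable_fun D (h i)) ->
  measurable_fun D (fun x => \sum_(i <- s | P i) h i x).
Proof.
move=> mh; elim: s => [|i s ih].
  by under eq_fun do rewrite big_nil; exact: measurable_cst.
under eq_fun do rewrite big_cons.
by case: (P i) => //; apply: mfD.
Qed.
Lemma mf_inv D f : measurable_fun D f -> measurable_fun D (fun x => (f x)^-1).
Proof.
move=> mf.
have mi : measurable_fun setT (fun x : R => x^-1).
  (* Inversion is the power -1 on the nonnegative half-line, extended as an odd function; at 0 both
     conventions give 0. *)
  rewrite (_ : (fun x => _) =
    (fun x : R => if 0 <= x then x `^ (-1) else - ((- x) `^ (-1)))).
    apply: measurable_fun_ifT => /=.
    - by apply: measurable_fun_ler.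
    - exact: measurable_powR.
    - apply: measurable_funN.
      by apply: (measurableT_comp (@measurable_powR R (-1))); exact: oppr_measurable.
  apply/funext => x; case: ifPn => [x0|]; first by rewrite powR_inv1.
  by rewrite -ltNge => x0; rewrite powR_inv1 ?oppr_ge0 1?ltW// invrN opprK.
by apply: (measurableT_comp mi).
Qed.
Lemma mf_EFin D f : measurable_fun D f -> measurable_fun D (fun x => (f x)%:E).
Proof. by move/measurable_EFinP. Qed.
Lemma mf_fine D F : measurable_fun D F -> measurable_fun D (fun x => fine (F x)).
Proof. by move=> mF; apply: (measurableT_comp (@fine_measurable R setT measurableT)). Qed.
Lemma mf_abse D F : measurable_fun D F -> measurable_fun D (fun x => `|F x|%E).
Proof. by move=> mF; apply: (measurableT_comp (@abse_measurable R _)). Qed.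
Lemma mf_oppe D F : measurable_fun D F -> measurable_fun D (fun x => - F x)%E.
Proof. by move=> mF; apply: (measurableT_comp (@oppe_measurable R _)). Qed.
Lemma mf_mule D F H : measurable_fun D F -> measurable_fun D H ->
  measurable_fun D (fun x => F x * H x)%E.
Proof. exact: emeasurable_funM. Qed.
Lemma mf_adde D F H : measurable_fun D F -> measurable_fun D H ->
  measurable_fun D (fun x => F x + H x)%E.
Proof. exact: emeasurable_funD. Qed.
Lemma mf_mine D F H : measurable_fun D F -> measurable_fun D H ->
  measurable_fun D (fun x => Order.min (F x) (H x)).
Proof. exact: measurable_mine. Qed.
Lemma mf_indic D (A : set T) : measurable A -> measurable_fun D (fun x => \1_A x : R).
Proof. exact: measurable_indic. Qed.
Lemma mf_fst d2 (T2 : measurableType d2) d3 (T3 : measurableType d3) D (f : T -> T2 * T3) :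
  measurable_fun D f -> measurable_fun D (fun x => (f x).1).
Proof. by move=> mf; apply: (measurableT_comp measurable_fst). Qed.
Lemma mf_snd d2 (T2 : measurableType d2) d3 (T3 : measurableType d3) D (f : T -> T2 * T3) :
  measurable_fun D f -> measurable_fun D (fun x => (f x).2).
Proof. by move=> mf; apply: (measurableT_comp measurable_snd). Qed.
Lemma mf_pair d2 (T2 : measurableType d2) d3 (T3 : measurableType d3)
  (f : T -> T2) (g : T -> T3) :
  measurable_fun setT f -> measurable_fun setT g ->
  measurable_fun setT (fun x => (f x, g x)).
Proof. exact: measurable_fun_pair. Qed.

End measurability.

Lemma mf_comp d1 (T1 : measurableType d1) d2 (T2 : measurableType d2)
  d3 (T3 : measurableType d3) (f : T2 -> T3) (g : T1 -> T2) D :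
  measurable_fun setT f -> measurable_fun D g -> measurable_fun D (fun x => f (g x)).
Proof. exact: measurableT_comp. Qed.

(** Measurability goals are decomposed along the head symbol of the function. [mea_ext] is a hook,
    redefined whenever a new kernel or operator enters the integrands. *)
Ltac mea_ext := fail.
Ltac mea_base := first
  [ match goal with
    | H : measurable_fun _ ?g |- measurable_fun _ ?g => exact: H
    end
  | lazymatch goal with
    | |- measurable_fun _ (fun w_ => w_) => exact: measurable_id
    | |- measurable_fun _ (fun _ => ?c) => exact: measurable_cst
    | |- measurable_fun _ id => exact: measurable_id
    | |- measurable_fun _ (cst _) => exact: measurable_cst
    | |- measurable_fun _ fst => exact: measurable_fst
    | |- measurable_fun _ snd => exact: measurable_snd
    end ].
Ltac mea_head := lazymatch goal with
  | |- measurable_fun _ (fun w_ => EFin _) => apply: mf_EFin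
  | |- measurable_fun _ (fun w_ => (_ * _)%E) => apply: mf_mule
  | |- measurable_fun _ (fun w_ => (_ + _)%E) => apply: mf_adde
  | |- measurable_fun _ (fun w_ => fine _) => apply: mf_fine
  | |- measurable_fun _ (fun w_ => abse _) => apply: mf_abse
  | |- measurable_fun _ (fun w_ => (- _)%E) => apply: mf_oppe
  | |- measurable_fun _ (fun w_ => (_ * _)%R) => apply: mfM
  | |- measurable_fun _ (fun w_ => (_ + _)%R) => first [apply: mfD | apply: mf_adde]
  | |- measurable_fun _ (fun w_ => (- _)%R) => first [apply: mfN | apply: mf_oppe]
  | |- measurable_fun _ (fun w_ => (_ ^+ _)%R) => apply: mfX
  | |- measurable_fun _ (fun w_ => (_ ^-1)%R) => apply: mf_inv
  | |- measurable_fun _ (fun w_ => expR _) => apply: mf_exp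
  | |- measurable_fun _ (fun w_ => powR _ _) => apply: mf_powR
  | |- measurable_fun _ (fun w_ => `|_|%R) => apply: mf_norm
  | |- measurable_fun _ (fun w_ => Num.max _ _) => apply: mf_max
  | |- measurable_fun _ (fun w_ => Num.min _ _) => apply: mf_min
  | |- measurable_fun _ (fun w_ => Order.min _ _) => first [apply: mf_min | apply: mf_mine]
  | |- measurable_fun _ (fun w_ => (_ %:R)%R) => apply: mf_bool
  | |- measurable_fun _ (fun w_ => (_ < _)%R) => apply: mf_lt
  | |- measurable_fun _ (fun w_ => (_ <= _)%R) => apply: mf_le
  | |- measurable_fun _ (fun w_ => _ == _) => apply: mf_eq
  | |- measurable_fun _ (fun w_ => if _ then _ else _) => apply: mf_if
  | |- measurable_fun _ (fun w_ => \sum_(i <- _ | _) _) => apply: mf_sum; let i := fresh "i" in move=> i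
  | |- measurable_fun _ (fun w_ => (_).1) => apply: mf_fst
  | |- measurable_fun _ (fun w_ => (_).2) => apply: mf_snd
  | |- measurable_fun _ (fun w_ => (_, _)) => apply: mf_pair
  | |- measurable_fun _ (fun w_ => _) => fail
  | |- @measurable_fun ?d1 ?d2 ?T1 ?T2 ?D ?f => change (@measurable_fun d1 d2 T1 T2 D (fun x => f x))
  end.
Ltac mea1 := first [mea_base | mea_ext | mea_head].
Ltac mea := repeat mea1.

(** * Power weights in time and their integrals *)

Section power_weights.
Context {R : realType}.
Notation leb := (@lebesgue_measure R).
Implicit Types (a b c t T : R).

(** The density may blow up at an endpoint, as negative powers do at 0. The closed-interval theorem
    is applied on an exhaustion, and monotone convergence needs limits of the primitive only. *)
Lemma ge0_FTC_oo (f F : R -> R) a b : a < b ->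
  {in `]a, b[, forall x, 0 <= f x} ->
  {in `]a, b[, forall x : R, is_derive x 1 F (f x)} ->
  {in `]a, b[, continuous f} ->
  F x @[x --> a^'+] --> F a -> F x @[x --> b^'-] --> F b ->
  (\int[leb]_(x in `]a, b[) (f x)%:E = (F b - F a)%:E)%E.
Proof.
move=> ab f0 dF cf Fa Fb.
(* The shift by 3 makes [2 * l k < b - a] hold already at [k = 0], so that every interval of the
   exhaustion is nondegenerate. *)
pose l : nat -> R := fun k => (b - a) / (k%:R + 3).
have l0 k : 0 < l k by rewrite divr_gt0 ?subr_gt0// ltr_wpDl.
have l3 k : l k + l k < b - a.
  rewrite /l -mulrDl ltr_pdivrMr ?ltr_wpDl//.
  have : 0 < b - a by rewrite subr_gt0.
  by have : (0 : R) <= k%:R by []; nra.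
have lnd : {homo l : m n / (m <= n)%N >-> n <= m}.
  move=> m k mk; rewrite ler_pM2l ?subr_gt0// lef_pV2 ?posrE ?ltr_wpDl//.
  by rewrite lerD2r ler_nat.
have lcv : l @ \oo --> 0.
  rewrite -[X in _ --> X](mulr0 (b - a)); apply: cvgM; first exact: cvg_cst.
  apply/gtr0_cvgV0; first by near=> k; rewrite ltr_wpDl.
  apply/cvgryPge => A; near=> k.
  have : A <= k%:R by near: k; exact: nbhs_infty_ger.
  by lra.
pose I k : set R := `[a + l k, b - l k]%classic.
have IU : `]a, b[%classic = \bigcup_k I k.
  apply/seteqP; split => x /=.
    rewrite in_itv/= => /andP[ax xb].
    have [k _ Hk] : exists2 k, True & l k < Num.min (x - a) (b - x).
      move/cvgrPdist_lt : lcv => /(_ (Num.min (x - a) (b - x))).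
      rewrite lt_min !subr_gt0 ax xb => /(_ isT)[k _ /(_ k (leqnn k))].
      by rewrite sub0r normrN gtr0_norm// => ?; exists k.
    exists k => //=; rewrite /I/= in_itv/=.
    by move: Hk; rewrite lt_min => /andP[? ?]; apply/andP; split; lra.
  move=> [k _]; rewrite /I/= !in_itv/= => /andP[? ?].
  by have := l0 k; move=> ?; apply/andP; split; lra.
have Isub k x : x \in `[a + l k, b - l k] -> x \in `]a, b[.
  rewrite !in_itv/= => /andP[? ?].
  by have := l0 k; move=> ?; apply/andP; split; lra.
have cfI k : {within I k, continuous f}.
  apply: continuous_in_subspaceT => x; rewrite inE /= => /Isub; exact: cf.
have mfI k : measurable_fun (I k) f.
  by apply: subspace_continuous_measurable_fun; [exact: measurable_itv|exact: cfI].
have E k : (\int[leb]_(x in I k) (f x)%:E = (F (b - l k) - F (a + l k))%:E)%E.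
  have lk3 := l3 k; have lk0 := l0 k.
  have dFI : {in `[a + l k, b - l k], forall x, derivable F x 1}.
    by move=> x /Isub /dF [].
  rewrite (@continuous_FTC2 _ f F)//; first lra.
  - exact: cfI.
  - split.
    + move=> x xi; apply: dFI; move: xi; rewrite !in_itv/= => /andP[? ?].
      by apply/andP; split; lra.
    + apply: cvg_at_right_filter; apply/differentiable_continuous/derivable1_diffP/dFI.
      by rewrite in_itv/= lexx/=; lra.
    + apply: cvg_at_left_filter; apply/differentiable_continuous/derivable1_diffP/dFI.
      by rewrite in_itv/= lexx/= andbT; lra.
  - move=> x xi; rewrite derive1E.
    have /Isub/dF dx : x \in `[a + l k, b - l k].
      by move: xi; rewrite !in_itv/= => /andP[? ?]; apply/andP; split; lra.
    exact: derive_val.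
have c1 : (\int[leb]_(x in I k) (f x)%:E @[k --> \oo] -->
    \int[leb]_(x in `]a, b[) (f x)%:E)%E.
  rewrite IU; apply: ge0_nondecreasing_set_cvg_integral => //.
  - apply/nondecreasing_seqP => k; rewrite subsetEset => x.
    rewrite /I /= !in_itv/= => /andP[? ?].
    by have := lnd _ _ (leqnSn k) => ?; apply/andP; split; lra.
  - by move=> i; exact: measurable_itv.
  - by move=> i; apply/measurable_EFinP; exact: mfI.
  - by move=> i x /= /Isub /f0; rewrite lee_fin.
have c2 : ((F (b - l k) - F (a + l k))%:E @[k --> \oo] --> (F b - F a)%:E)%E.
  apply/cvg_EFin; first by near=> k.
  apply: cvgB => /=.
  - apply: (cvg_at_leftP F b (F b)).1 => //; split.
      by move=> k; rewrite ltrBlDr ltrDl.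
    rewrite -[X in _ --> X]subr0; apply: cvgB => //; exact: cvg_cst.
  - apply: (cvg_at_rightP F a (F a)).1 => //; split.
      by move=> k; rewrite ltrDl.
    rewrite -[X in _ --> X]addr0; apply: cvgD => //; exact: cvg_cst.
rewrite -(cvg_lim _ c2)//; apply/esym/cvg_lim => //.
by under eq_fun do rewrite -E.
Unshelve. all: by end_near. Qed.

(** Extending the power by 0 lets all time integrals run over the whole line, so that shifts,
    dilations and Tonelli's theorem apply without domains. *)
Definition pw c t : R := if 0 < t then t `^ c else 0.

Lemma pw_ge0 c t : 0 <= pw c t.
Proof. by rewrite /pw; case: ifP => // _; exact: powR_ge0. Qed.

Lemma pwE c t : 0 < t -> pw c t = t `^ c. Proof. by rewrite /pw => ->. Qed.

Lemma pw_neg c t : t <= 0 -> pw c t = 0. Proof. by rewrite /pw ltNge => ->. Qed.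

Lemma measurable_pw c : measurable_fun setT (pw c).
Proof. by apply: mf_if; mea. Qed.

Lemma pwD c e t : pw (c + e) t = pw c t * pw e t.
Proof.
rewrite /pw; case: ifP => [t0|_]; last by rewrite mulr0.
by rewrite powRD// (gt_eqF t0) implybT.
Qed.

Lemma pwM c s t : 0 < s -> pw c (s * t) = s `^ c * pw c t.
Proof.
move=> s0; rewrite /pw pmulr_rgt0//; case: ifP => t0; last by rewrite mulr0.
by rewrite powRM// ltW.
Qed.

Lemma integral_pw_near c T : 0 < c -> 0 < T ->
  (\int[leb]_t (pw (c - 1) t * (t < T)%R%:R)%:E = (T `^ c / c)%:E)%E.
Proof.
move=> c0 T0.
have -> : (\int[leb]_t (pw (c - 1) t * (t < T)%R%:R)%:E =
    \int[leb]_(t in `]0%R, T[) (t `^ (c - 1))%:E)%E.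
  rewrite [RHS]integral_mkcond; apply: eq_integral => t _.
  rewrite patchE mem_setE in_itv/= /pw; case: ltP => //= _; last by rewrite mul0r.
  by case: ltP => //= _; rewrite ?mulr0 ?mulr1.
have -> : T `^ c / c = (fun x => x `^ c / c) T - (fun x => x `^ c / c) 0.
  by rewrite powR0 ?gt_eqF// mul0r subr0.
have dp (x : R) : 0 < x -> is_derive x 1 (fun x : R => x `^ c / c) (x `^ (c - 1)).
  move=> x0; have := is_derive1_powR c x0 => h.
  rewrite (_ : (fun y : R => _) = (c^-1 \*: (@powR R ^~ c))); last first.
    by apply/funext => y; rewrite /= mulrC.
  apply: is_derive_eq.
  by rewrite -[_ *: _]/(_ * _) mulrA mulVf ?mul1r// gt_eqF.
rewrite (@ge0_FTC_oo (fun x => x `^ (c - 1)) (fun x => x `^ c / c))//.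
- by move=> x _; exact: powR_ge0.
- by move=> x; rewrite in_itv/= => /andP[x0 _]; exact: dp.
- move=> x; rewrite in_itv/= => /andP[x0 _].
  apply/differentiable_continuous/derivable1_diffP.
  by have [] := is_derive1_powR (c - 1) x0.
- rewrite powR0 ?gt_eqF// mul0r -[X in _ --> X](mul0r c^-1).
  by apply: cvgM; [exact: powR_cvg0|exact: cvg_cst].
- have h : {for T, continuous (fun x : R => x `^ c / c)}.
    apply/differentiable_continuous/derivable1_diffP.
    by have [] := dp _ T0.
  by apply: cvg_at_left_filter; exact: h.
Qed.

Lemma powRN_cvgy c : 0 < c -> x `^ (- c) @[x --> +oo%R] --> (0 : R).
Proof.
move=> c0; apply/cvgrPdist_le => e e0.
near=> x; rewrite sub0r normrN ger0_norm ?powR_ge0//.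
have x0 : 0 < x by near: x; exact: nbhs_pinfty_gt.
rewrite powRN -lef_pV2 ?posrE ?invr_gt0 ?powR_gt0// invrK.
have -> : e^-1 = (e^-1 `^ c^-1) `^ c by rewrite -powRrM mulVf ?gt_eqF// powRr1// invr_ge0 ltW.
apply: ge0_ler_powR; rewrite ?nnegrE ?powR_ge0 ?(ltW x0) ?(ltW c0)//.
Unshelve. all: by end_near. Qed.

Lemma integral_pw_far c T : 0 < c -> 0 < T ->
  (\int[leb]_t (pw (- c - 1) t * (T <= t)%R%:R)%:E = (T `^ (- c) / c)%:E)%E.
Proof.
move=> c0 T0.
have -> : (\int[leb]_t (pw (- c - 1) t * (T <= t)%R%:R)%:E =
    \int[leb]_(t in `[T, +oo[) (t `^ (- c - 1))%:E)%E.
  rewrite [RHS]integral_mkcond; apply: eq_integral => t _.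
  rewrite patchE mem_setE in_itv/= andbT /pw; case: (leP T t) => Tt; last by rewrite mulr0.
  by rewrite (lt_le_trans T0 Tt) mulr1.
have dp (x : R) : 0 < x -> is_derive x 1 (fun x : R => - (x `^ (- c) / c)) (x `^ (- c - 1)).
  move=> x0; have := is_derive1_powR (- c) x0 => h.
  have h2 : is_derive x 1 (fun x : R => x `^ (- c) / c) (- x `^ (- c - 1)).
    rewrite (_ : (fun y : R => _) = (c^-1 \*: (@powR R ^~ (- c)))); last first.
      by apply/funext => y; rewrite /= mulrC.
    apply: is_derive_eq.
    by rewrite -[_ *: _]/(_ * _) mulrA mulrN mulVf ?mulN1r// gt_eqF.
  by apply: is_derive_eq; rewrite opprK.
have cp (x : R) : 0 < x -> {for x, continuous (fun x : R => x `^ (- c - 1))}.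
  move=> x0; apply/differentiable_continuous/derivable1_diffP.
  by have [] := is_derive1_powR (- c - 1) x0.
rewrite (@ge0_continuous_FTC2y _ _ (fun x => - (x `^ (- c) / c)) T 0)//.
- by rewrite -EFinB opprK add0r.
- by move=> x _; exact: powR_ge0.
- apply: continuous_in_subspaceT => x; rewrite inE/= in_itv/= andbT => Tx.
  by apply: cp; exact: lt_le_trans Tx.
- rewrite -[X in _ --> X]oppr0; apply: cvgN; rewrite -[X in _ --> X](mul0r c^-1).
  by apply: cvgM; [exact: powRN_cvgy|exact: cvg_cst].
- by move=> x Tx; have [] := dp _ (lt_trans T0 Tx).
- have h : {for T, continuous (fun x : R => - (x `^ (- c) / c))}.
    apply/differentiable_continuous/derivable1_diffP.
    by have [] := dp _ T0.
  by apply: cvg_at_right_filter; exact: h.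
- move=> x; rewrite in_itv/= andbT => Tx; rewrite derive1E.
  by have ? := dp _ (lt_trans T0 Tx); exact: derive_val.
Qed.

End power_weights.

Ltac mea_ext ::= lazymatch goal with
  | |- measurable_fun _ (fun w_ => pw _ _) => apply: (mf_comp (measurable_pw _))
  end.

(** * Integrals of nonnegative functions *)

Section tonelli_curried.
Local Open Scope ereal_scope.
Context d1 d2 (T1 : measurableType d1) (T2 : measurableType d2) (R : realType).
Variable m1 : {sigma_finite_measure set T1 -> \bar R}.
Variable m2 : {sigma_finite_measure set T2 -> \bar R}.
Variable f : T1 -> T2 -> \bar R.
Hypothesis mf : measurable_fun setT (fun p : T1 * T2 => f p.1 p.2).
Hypothesis f0 : forall x y, 0 <= f x y.

Lemma measurable_int2 : measurable_fun setT (fun x => \int[m2]_y f x y).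
Proof.
by apply: (@measurable_fun_fubini_tonelli_F _ _ _ _ _ m2 (fun p => f p.1 p.2)) => //= -[].
Qed.

Lemma measurable_int1 : measurable_fun setT (fun y => \int[m1]_x f x y).
Proof.
by apply: (@measurable_fun_fubini_tonelli_G _ _ _ _ _ m1 (fun p => f p.1 p.2)) => //= -[].
Qed.

Lemma tonelli : \int[m1]_x \int[m2]_y f x y = \int[m2]_y \int[m1]_x f x y.
Proof. by apply: (@fubini_tonelli _ _ _ _ _ m1 m2 (fun p => f p.1 p.2)) => //= -[]. Qed.

End tonelli_curried.
Arguments measurable_int2 {d1 d2 T1 T2 R} m2 f.
Arguments measurable_int1 {d1 d2 T1 T2 R} m1 f.
Arguments tonelli {d1 d2 T1 T2 R} m1 m2 f.

Section ge0_integralT.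
Local Open Scope ereal_scope.
Context d (T : measurableType d) (R : realType).
Variable m : {measure set T -> \bar R}.
Implicit Types f g : T -> \bar R.

Lemma int_ge0 f : (forall x, 0 <= f x) -> 0 <= \int[m]_x f x.
Proof. by move=> f0; apply: integral_ge0 => x _. Qed.

Lemma le_int f g : measurable_fun setT f -> measurable_fun setT g ->
  (forall x, 0 <= f x) -> (forall x, f x <= g x) -> \int[m]_x f x <= \int[m]_x g x.
Proof. by move=> mf mg f0 fg; apply: ge0_le_integral. Qed.

Lemma intZl (c : R) f : measurable_fun setT f -> (forall x, 0 <= f x) -> (0 <= c)%R ->
  \int[m]_x (c%:E * f x) = c%:E * \int[m]_x f x.
Proof. by move=> mf f0 c0; apply: ge0_integralZl. Qed.

Lemma intZr (c : R) f : measurable_fun setT f -> (forall x, 0 <= f x) -> (0 <= c)%R ->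
  \int[m]_x (f x * c%:E) = (\int[m]_x f x) * c%:E.
Proof. by move=> mf f0 c0; apply: ge0_integralZr. Qed.

Lemma intZle (c : \bar R) f : measurable_fun setT f -> (forall x, 0 <= f x) -> 0 <= c ->
  \int[m]_x (c * f x) = c * \int[m]_x f x.
Proof. by move=> mf f0 c0; apply: ge0_integralZl. Qed.

Lemma intD f g : measurable_fun setT f -> measurable_fun setT g ->
  (forall x, 0 <= f x) -> (forall x, 0 <= g x) ->
  \int[m]_x (f x + g x) = \int[m]_x f x + \int[m]_x g x.
Proof. by move=> mf mg f0 g0; apply: ge0_integralD. Qed.

End ge0_integralT.

(** * Lebesgue measure on row vectors *)

Section tuple_measure.
Context {R : realType}.
Notation leb := (@lebesgue_measure R).

Definition consT n (p : R * n.-tuple R) : n.+1.-tuple R := cons_tuple p.1 p.2.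

Lemma measurable_consT n : measurable_fun [set: R * n.-tuple R] (@consT n).
Proof. exact: measurable_cons. Qed.

Definition unconsT n (t : n.+1.-tuple R) : R * n.-tuple R := (thead t, behead_tuple t).

Lemma measurable_unconsT n : measurable_fun [set: n.+1.-tuple R] (@unconsT n).
Proof.
apply: measurable_fun_pair; first exact: measurable_tnth.
exact: measurable_behead.
Qed.

Lemma consTK n : cancel (@consT n) (@unconsT n).
Proof.
by case=> x t; rewrite /unconsT /consT /= theadE; congr pair; apply: val_inj.
Qed.

Section step.
Variables (n : nat) (m : {sigma_finite_measure set (n.-tuple R) -> \bar R}).

Let mm : {measure set (n.+1.-tuple R) -> \bar R} :=
  measure_function_pushforward__canonical__measure_function_Measure
    (leb \x m)%E (@measurable_consT n).

(** The iterated integral of the statement must become an integral against a sigma-finite measure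
    before limit theorems and Tonelli apply to it; this adds one coordinate. *)
Definition mtS : set (n.+1.-tuple R) -> \bar R := pushforward (leb \x m)%E (@consT n).

Let mtS0 : mtS set0 = 0%E. Proof. exact: (measure0 mm). Qed.
Let mtS_ge0 A : (0 <= mtS A)%E. Proof. exact: (measure_ge0 mm). Qed.
Let mtS_sadd : semi_sigma_additive mtS.
Proof. exact: (@measure_semi_sigma_additive _ _ _ mm). Qed.

HB.instance Definition _ := isMeasure.Build _ _ _ mtS mtS0 mtS_ge0 mtS_sadd.

Let mtS_sfin : sigma_finite setT mtS.
Proof.
have /sigma_finiteP[F [FT Fnd Ff]] := sigma_finiteT leb.
have /sigma_finiteP[G [GT Gnd Gf]] := sigma_finiteT m.
exists (fun i => @unconsT n @^-1` (F i `*` G i)).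
  rewrite -preimage_bigcup -[LHS](@preimage_setT _ _ (@unconsT n)); congr preimage.
  apply/seteqP; split => // -[x t] _.
  have [i _ Fi] : (\bigcup_i F i) x by rewrite -FT.
  have [j _ Gj] : (\bigcup_i G i) t by rewrite -GT.
  exists (maxn i j) => //; split => /=.
    by have := Fnd _ _ (leq_maxl i j); rewrite subsetEset; apply.
  by have := Gnd _ _ (leq_maxr i j); rewrite subsetEset; apply.
move=> i; have [mF Foo] := Ff i; have [mG Goo] := Gf i; split.
  by rewrite -[X in measurable X]setTI; apply: measurable_unconsT => //; exact: measurableX.
rewrite /mtS /pushforward (_ : _ @^-1` _ = F i `*` G i); last first.
  apply/seteqP; split => x Sx; first by rewrite -(consTK x); exact: Sx.
  by change ((F i `*` G i) (unconsT (consT x))); rewrite consTK.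
by rewrite product_measure1E// lte_mul_pinfty// ge0_fin_numE.
Qed.

HB.instance Definition _ := Measure_isSigmaFinite.Build _ _ _ mtS mtS_sfin.

End step.

(** The unit mass at the empty tuple matches the base case of [iter_int]. *)
Fixpoint mtuple n : {sigma_finite_measure set (n.-tuple R) -> \bar R} :=
  match n return {sigma_finite_measure set (n.-tuple R) -> \bar R} with
  | 0 => dirac (@nil_tuple R)
  | k.+1 => mtS (mtuple k)
  end.

Lemma integral_mtupleS n (f : n.+1.-tuple R -> \bar R) :
  measurable_fun setT f -> (forall x, 0 <= f x)%E ->
  (\int[mtuple n.+1]_t f t = \int[leb]_x \int[mtuple n]_t f (cons_tuple x t))%E.
Proof.
move=> mf f0; rewrite /= /mtS ge0_integral_pushforward//=; last exact: measurable_consT.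
rewrite preimage_setT (@fubini_tonelli1 _ _ _ _ _ leb (mtuple n) (f \o @consT n))//=.
by apply: measurableT_comp => //; exact: measurable_consT.
Qed.

Lemma iter_int_ge0 n (f : n.-tuple R -> \bar R) :
  measurable_fun setT f -> (forall x, 0 <= f x)%E ->
  iter_int f = (\int[mtuple n]_t f t)%E.
Proof.
elim: n f => [f mf f0|n ih f mf f0].
  by rewrite /= integral_dirac//= diracT mul1e; congr f; exact: val_inj.
rewrite integral_mtupleS//; apply: eq_integral => x _.
rewrite -[LHS]/(iter_int (fun t : n.-tuple R => f (cons_tuple x t))) ih//.
apply: (mf_comp (f := f)) => //.
exact: (measurable_cons (measurable_cst x) (@measurable_id _ _ setT)).
Qed.

(** For signed functions [iter_int] is defined without integrability. Its measurability in a
    parameter allows [iter_int_integrable] to replace inner integrals that are identified only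
    almost everywhere. *)
Lemma measurable_iter_int n d (X : measurableType d) (f : X * n.-tuple R -> \bar R) :
  measurable_fun setT f -> measurable_fun setT (fun x => iter_int (fun t => f (x, t))).
Proof.
elim: n d X f => [d X f mf|n ih d X f mf] /=.
  by apply: (mf_comp mf); apply: mf_pair; mea.
pose g (p : X * R) := iter_int (fun t : n.-tuple R => f (p.1, cons_tuple p.2 t)).
have mg : measurable_fun setT g.
  apply: (ih _ _ (fun q => f (q.1.1, cons_tuple q.1.2 q.2))).
  apply: (mf_comp mf); apply: mf_pair; mea.
  by apply: measurable_cons; mea.
rewrite (_ : (fun x => _) = (fun x => \int[leb]_y (g^\+ (x, y)) -
    \int[leb]_y (g^\- (x, y)))%E); last first.
  apply/funext => x; rewrite [LHS]integralE.
  by congr (_ - _)%E; apply: eq_integral => y _; rewrite ?funeposE ?funenegE.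
apply: emeasurable_funB.
- apply: (@measurable_fun_fubini_tonelli_F _ _ _ _ _ leb (fun p => g^\+ p)%E) => //.
  by apply: measurable_funepos.
- apply: (@measurable_fun_fubini_tonelli_F _ _ _ _ _ leb (fun p => g^\- p)%E) => //.
  by apply: measurable_funeneg.
Qed.

(** By Fubini almost every slice is integrable, so the induction hypothesis holds for almost every
    first coordinate, which is enough for the outer integral. *)
Lemma iter_int_integrable n (f : n.-tuple R -> \bar R) :
  (mtuple n).-integrable setT f -> iter_int f = (\int[mtuple n]_t f t)%E.
Proof.
elim: n f => [f /integrableP[mf _]|n ih f fi].
  by rewrite /= integral_dirac//= diracT mul1e; congr f; exact: val_inj.
have mf : measurable_fun setT f by move/integrableP : fi => [].
have mfc : measurable_fun setT (f \o @consT n).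
  by apply: measurableT_comp => //; exact: measurable_consT.
have fci : ((leb \x mtuple n)%E).-integrable setT (f \o @consT n).
  apply/integrableP; split=> //.
  move/integrableP : fi => [_].
  rewrite /= /mtS ge0_integral_pushforward//=; last 2 first.
  - exact: measurable_consT.
  - exact: measurableT_comp.
rewrite [RHS]/= /mtS integral_pushforward//=; last exact: measurable_consT.
rewrite preimage_setT -(integral12_prod_meas1 fci)/=.
apply: ae_eq_integral => //.
- apply: (measurable_iter_int (f := fun p : R * n.-tuple R => f (cons_tuple p.1 p.2))).
  exact: mfc.
- exact: (measurable_fubini_F fci).
- have := ae_integrable1 fci; apply: filterS => x xi _.
  by rewrite ih.
Qed.

End tuple_measure.

Fact rV_display : measure_display. Proof. exact: default_measure_display. Qed.

Section rV_measurable.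
Context {R : realType} {n : nat}.

(** With the sigma-algebra transported from tuples, [measurable_rV] of the statement is plain
    measurability on row vectors. *)
Definition measurable_rVset (A : set 'rV[R]_n) : Prop :=
  measurable (@tup2row R n @^-1` A).

Let mrV0 : measurable_rVset set0.
Proof. by rewrite /measurable_rVset preimage_set0. Qed.
Let mrVC A : measurable_rVset A -> measurable_rVset (~` A).
Proof. by rewrite /measurable_rVset preimage_setC; exact: measurableC. Qed.
Let mrVU (F : (set 'rV[R]_n)^nat) : (forall i, measurable_rVset (F i)) ->
  measurable_rVset (\bigcup_i F i).
Proof.
by rewrite /measurable_rVset preimage_bigcup => mF; exact: bigcupT_measurable.
Qed.

HB.instance Definition _ := @isMeasurable.Build rV_display 'rV[R]_n
  measurable_rVset mrV0 mrVC mrVU.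

Lemma measurable_tup2row : measurable_fun [set: n.-tuple R] (@tup2row R n).
Proof. by move=> _ A mA; rewrite setTI. Qed.

Definition row2tup (x : 'rV[R]_n) : n.-tuple R := [tuple x ord0 i | i < n].

Lemma tup2rowK : cancel (@tup2row R n) row2tup.
Proof. by move=> t; apply: eq_from_tnth => i; rewrite tnth_mktuple mxE. Qed.

Lemma row2tupK : cancel row2tup (@tup2row R n).
Proof. by move=> t; apply/rowP => i; rewrite mxE tnth_mktuple. Qed.

Lemma measurable_row2tup : measurable_fun [set: 'rV[R]_n] row2tup.
Proof.
move=> _ A mA; rewrite setTI /measurable/= /measurable_rVset.
by rewrite (_ : _ @^-1` _ = A)//; apply/seteqP; split => t /=; rewrite tup2rowK.
Qed.

Lemma measurable_coord i : measurable_fun [set: 'rV[R]_n] (fun x => x ord0 i).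
Proof.
rewrite (_ : (fun x => _) = (fun x => tnth (row2tup x) i)).
  by apply: (mf_comp (measurable_tnth i)); exact: measurable_row2tup.
by apply/funext => x; rewrite tnth_mktuple.
Qed.

Lemma measurable_rVP d (T : measurableType d) (f : T -> 'rV[R]_n) :
  (forall i, measurable_fun setT (fun x => f x ord0 i)) -> measurable_fun setT f.
Proof.
move=> mf; rewrite (_ : f = (fun x => tup2row (row2tup (f x)))).
  apply: (mf_comp measurable_tup2row).
  apply/measurable_fun_tnthP => i.
  by rewrite (_ : _ \o _ = (fun x => f x ord0 i))//; apply/funext => x /=; rewrite tnth_mktuple.
by apply/funext => x; rewrite row2tupK.
Qed.

Lemma measurable_rV_fun (f : 'rV[R]_n -> R) :
  measurable_rV f <-> measurable_fun [set: 'rV[R]_n] f.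
Proof.
split=> mf.
  rewrite (_ : f = (f \o @tup2row R n) \o row2tup).
    by apply: measurableT_comp => //; exact: measurable_row2tup.
  by apply/funext => x /=; rewrite row2tupK.
by apply: measurableT_comp => //; exact: measurable_tup2row.
Qed.

Let mm : {measure set 'rV[R]_n -> \bar R} :=
  measure_function_pushforward__canonical__measure_function_Measure
    (mtuple n) measurable_tup2row.

Definition lebn : set 'rV[R]_n -> \bar R := pushforward (mtuple n) (@tup2row R n).

Let lebn0 : lebn set0 = 0%E. Proof. exact: (measure0 mm). Qed.
Let lebn_ge0 A : (0 <= lebn A)%E. Proof. exact: (measure_ge0 mm). Qed.
Let lebn_sadd : semi_sigma_additive lebn.
Proof. exact: (@measure_semi_sigma_additive _ _ _ mm). Qed.

HB.instance Definition _ := isMeasure.Build _ _ _ lebn lebn0 lebn_ge0 lebn_sadd.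

Let lebn_sfin : sigma_finite setT lebn.
Proof.
have [F FT Ff] := sigma_finiteT (@mtuple R n).
exists (fun i => row2tup @^-1` F i).
  by rewrite -preimage_bigcup -FT preimage_setT.
move=> i; have [mF Foo] := Ff i; split.
  by rewrite -[X in measurable X]setTI; exact: measurable_row2tup.
rewrite /lebn /pushforward (_ : _ @^-1` _ = F i)//.
by apply/seteqP; split => x /=; rewrite tup2rowK.
Qed.

HB.instance Definition _ := Measure_isSigmaFinite.Build _ _ _ lebn lebn_sfin.

Lemma rV_int_ge0 (f : 'rV[R]_n -> \bar R) :
  measurable_fun setT f -> (forall x, 0 <= f x)%E -> rV_int f = (\int[lebn]_x f x)%E.
Proof.
move=> mf f0; rewrite /rV_int iter_int_ge0.
- by rewrite /lebn ge0_integral_pushforward//; exact: measurable_tup2row.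
- by apply: measurableT_comp => //; exact: measurable_tup2row.
- by move=> x; exact: f0.
Qed.

Lemma rV_int_integrable (f : 'rV[R]_n -> \bar R) :
  lebn.-integrable setT f -> rV_int f = (\int[lebn]_x f x)%E.
Proof.
move=> fi; have mf : measurable_fun setT f by move/integrableP : fi => [].
have mft : measurable_fun setT (f \o @tup2row R n).
  by apply: measurableT_comp => //; exact: measurable_tup2row.
have fit : (mtuple n).-integrable setT (f \o @tup2row R n).
  apply/integrableP; split=> //; move/integrableP : fi => [_].
  rewrite /lebn ge0_integral_pushforward//=; last 2 first.
  - exact: measurable_tup2row.
  - exact: measurableT_comp.
rewrite /rV_int iter_int_integrable// /lebn integral_pushforward//.
exact: measurable_tup2row.
Qed.

Lemma leb_nE (A : set 'rV[R]_n) : measurable A -> leb_n A = lebn A.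
Proof.
move=> mA; rewrite /leb_n rV_int_ge0.
- by rewrite integral_indic// setIT.
- by apply: mf_EFin; exact: mf_indic.
- by move=> x; rewrite lee_fin.
Qed.

End rV_measurable.
Arguments lebn {R} n.

Lemma mf_coord (R : realType) n d (T : measurableType d) (f : T -> 'rV[R]_n) i :
  measurable_fun setT f -> measurable_fun setT (fun x => f x ord0 i).
Proof. exact: (mf_comp (measurable_coord i)). Qed.
Lemma mf_addrV (R : realType) n d (T : measurableType d) (f g : T -> 'rV[R]_n) :
  measurable_fun setT f -> measurable_fun setT g -> measurable_fun setT (fun x => f x + g x).
Proof.
move=> mf mg; apply: measurable_rVP => i.
by under eq_fun do rewrite mxE; apply: mfD; exact: mf_coord.
Qed.
Lemma mf_opprV (R : realType) n d (T : measurableType d) (f : T -> 'rV[R]_n) :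
  measurable_fun setT f -> measurable_fun setT (fun x => - f x).
Proof.
move=> mf; apply: measurable_rVP => i.
by under eq_fun do rewrite mxE; apply: mfN; exact: mf_coord.
Qed.
Lemma mf_scalerV (R : realType) n d (T : measurableType d) (a : T -> R) (f : T -> 'rV[R]_n) :
  measurable_fun setT a -> measurable_fun setT f -> measurable_fun setT (fun x => a x *: f x).
Proof.
move=> ma mf; apply: measurable_rVP => i.
by under eq_fun do rewrite mxE; apply: mfM => //; exact: mf_coord.
Qed.

Ltac mea_ext ::= lazymatch goal with
  | |- measurable_fun _ (fun w_ => pw _ _) => apply: (mf_comp (measurable_pw _))
  | |- measurable_fun _ (fun w_ => fun_of_matrix _ _ _) => apply: mf_coord
  | |- measurable_fun _ (fun w_ => (_ + _)%R) => apply: mf_addrV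
  | |- measurable_fun _ (fun w_ => (- _)%R) => apply: mf_opprV
  | |- measurable_fun _ (fun w_ => (_ *: _)%R) => apply: mf_scalerV
  end.

Section rV_measure_theory.
Context {R : realType}.
Notation leb := (@lebesgue_measure R).

Definition rc n (x : R) (y : 'rV[R]_n) : 'rV[R]_n.+1 :=
  \row_i oapp (fun j => y ord0 j) x (unlift ord0 i).

Lemma rc0 n x (y : 'rV[R]_n) : rc x y ord0 ord0 = x.
Proof. by rewrite mxE unlift_none. Qed.

Lemma rcS n x (y : 'rV[R]_n) j : rc x y ord0 (lift ord0 j) = y ord0 j.
Proof. by rewrite mxE liftK. Qed.

Lemma rcP n (z : 'rV[R]_n.+1) : z = rc (z ord0 ord0) (\row_j z ord0 (lift ord0 j)).
Proof.
apply/rowP => i; rewrite mxE; case: unliftP => [j ->|->] //=.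
by rewrite mxE.
Qed.

Lemma tup2row_cons n x (t : n.-tuple R) : tup2row (cons_tuple x t) = rc x (tup2row t).
Proof.
apply/rowP => i; rewrite !mxE; case: unliftP => [j ->|->] /=.
  by rewrite mxE tnthS.
by rewrite tnth0.
Qed.

Lemma measurable_rc n d (T : measurableType d) (f : T -> R) (g : T -> 'rV[R]_n) :
  measurable_fun setT f -> measurable_fun setT g ->
  measurable_fun setT (fun x => rc (f x) (g x)).
Proof.
move=> mf mg; apply: measurable_rVP => i; under eq_fun do rewrite mxE.
case: (unlift ord0 i) => [j|] //=.
by apply: (mf_comp (measurable_coord j)).
Qed.

Lemma integral_rVS n (f : 'rV[R]_n.+1 -> \bar R) :
  measurable_fun setT f -> (forall x, 0 <= f x)%E ->
  (\int[lebn n.+1]_z f z = \int[leb]_x \int[lebn n]_y f (rc x y))%E.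
Proof.
move=> mf f0.
have mft k : measurable_fun setT (@tup2row R k) by exact: measurable_tup2row.
transitivity (\int[mtuple n.+1]_t f (tup2row t))%E.
  by rewrite /lebn ge0_integral_pushforward//; exact: mft.
rewrite (@integral_mtupleS _ n (f \o @tup2row R n.+1))//; last first.
  by move=> t; exact: f0.
apply: eq_integral => x _.
have mfx : measurable_fun setT (fun y : 'rV[R]_n => f (rc x y)).
  by apply: (mf_comp mf); apply: measurable_rc.
transitivity (\int[mtuple n]_t f (rc x (tup2row t)))%E.
  by apply: eq_integral => t _ /=; rewrite tup2row_cons.
by rewrite /lebn [RHS]ge0_integral_pushforward//; exact: mft.
Qed.

Lemma integral_rV0 (f : 'rV[R]_0 -> \bar R) :
  measurable_fun setT f -> (forall x, 0 <= f x)%E ->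
  (\int[lebn 0]_z f z = f 0%R)%E.
Proof.
move=> mf f0; rewrite -rV_int_ge0// /rV_int /=.
by congr f; apply/rowP => -[].
Qed.

(** The one-dimensional change of variables is applied one coordinate at a time, each contributing a
    factor [a]. The case [a = 1] is translation invariance, [a = 2] serves the scaling of the heat
    content. *)
Lemma ge0_integral_rV_affine n (a : R) (h : 'rV[R]_n) (f : 'rV[R]_n -> \bar R) :
  0 < a -> measurable_fun setT f -> (forall x, 0 <= f x)%E ->
  (\int[lebn n]_x f x = (a ^+ n)%:E * \int[lebn n]_x f (a *: x + h)%R)%E.
Proof.
move=> a0; elim: n h f => [h f mf f0|n ih h f mf f0].
  rewrite !integral_rV0//=; last first.
    apply: (mf_comp mf); apply: measurable_rVP => -[]//.
  by rewrite expr0 mul1e; congr f; apply/rowP => -[].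
have mf2 : measurable_fun setT (fun x : 'rV[R]_n.+1 => f (a *: x + h)).
  by apply: (mf_comp mf); mea.
rewrite !integral_rVS//.
pose h' := \row_j h ord0 (lift ord0 j).
have mF : measurable_fun setT (fun x : R => \int[lebn n]_y f (rc x y))%E.
  apply: (measurable_int2 (lebn n) (fun x y => f (rc x y))) => //.
  by apply: (mf_comp mf); apply: measurable_rc; mea.
rewrite (@ge0_integral_affine _ a (h ord0 ord0) a0)//; last first.
  by move=> x; apply: integral_ge0 => y _; exact: f0.
rewrite exprS EFinM -muleA; congr (_ * _)%E.
rewrite -ge0_integralZl//=; last 3 first.
- apply: (measurable_int2 (lebn n) (fun x y => f (a *: rc x y + h))) => //.
  by apply: (mf_comp mf2); apply: measurable_rc; mea.
- by move=> x _; apply: integral_ge0 => y _; exact: f0.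
- by rewrite lee_fin exprn_ge0// ltW.
apply: eq_integral => x _; rewrite (ih h')//; last first.
  by apply: (mf_comp mf); apply: measurable_rc; mea.
congr (_ * _)%E; apply: eq_integral => y _; congr f.
rewrite [RHS]rcP !mxE unlift_none /=; congr rc.
by apply/rowP => j; rewrite !mxE liftK.
Qed.

Lemma ge0_integral_rV_shift n (h : 'rV[R]_n) (f : 'rV[R]_n -> \bar R) :
  measurable_fun setT f -> (forall x, 0 <= f x)%E ->
  (\int[lebn n]_x f (x + h)%R = \int[lebn n]_x f x)%E.
Proof.
move=> mf f0; rewrite [RHS](@ge0_integral_rV_affine _ 1 h)// expr1n mul1e.
by apply: eq_integral => x _; rewrite scale1r.
Qed.

Lemma ge0_integral_rV_prod n (g : 'I_n -> R -> R) :
  (forall i, measurable_fun setT (g i)) -> (forall i x, 0 <= g i x) ->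
  (\int[lebn n]_x (\prod_i g i (x ord0 i))%:E = \prod_i \int[leb]_x (g i x)%:E)%E.
Proof.
elim: n g => [g mg g0|n ih g mg g0].
  rewrite integral_rV0; last 2 first.
  - rewrite (_ : (fun z => _) = cst 1%:E)//.
    by apply/funext => z; rewrite big_ord0.
  - by move=> x; rewrite big_ord0 lee_fin.
  by rewrite !big_ord0.
have mp (m : nat) (k : 'I_m -> R -> R) : (forall i, measurable_fun setT (k i)) ->
    measurable_fun setT (fun x : 'rV[R]_m => \prod_i k i (x ord0 i)).
  move=> mk.
  have : forall s : seq 'I_m, measurable_fun setT (fun x : 'rV[R]_m => \prod_(i <- s) k i (x ord0 i)).
    elim=> [|i s ihs].
      by rewrite (_ : (fun x => _) = cst 1)//; apply/funext => x; rewrite big_nil.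
    under eq_fun do rewrite big_cons.
    by apply: mfM => //; apply: (mf_comp (mk i)); exact: measurable_coord.
  by apply.
have pge (m : nat) (k : 'I_m -> R -> R) (x : 'rV[R]_m) : (forall i y, 0 <= k i y) ->
    0 <= \prod_i k i (x ord0 i) by move=> k0; apply: prodr_ge0 => i _.
rewrite integral_rVS//; last 2 first.
- by apply: mf_EFin; exact: mp.
- by move=> x; rewrite lee_fin pge.
rewrite big_ord_recl -ih//.
rewrite -ge0_integralZr//; last 3 first.
- by apply: mf_EFin; exact: mg.
- by move=> x _; rewrite lee_fin.
- by apply: integral_ge0 => x _; rewrite lee_fin (pge _ (fun i => g (lift ord0 i))).
apply: eq_integral => x _.
rewrite -ge0_integralZl//; last 3 first.
- by apply: mf_EFin; exact: (mp _ (fun i => g (lift ord0 i))).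
- by move=> y _; rewrite lee_fin (pge _ (fun i => g (lift ord0 i))).
- by rewrite lee_fin; exact: g0.
apply: eq_integral => y _; rewrite -EFinM; congr EFin.
rewrite big_ord_recl rc0; congr (_ * _).
by apply: eq_bigr => i _; rewrite rcS.
Qed.

End rV_measure_theory.

Fact G_key : unit. Proof. exact: tt. Qed.

(** * The Gaussian kernel *)

Section gaussian.
Context {R : realType} {n : nat}.
Notation leb := (@lebesgue_measure R).
Implicit Types (x y z : 'rV[R]_n) (s t : R).

Definition sq z : R := dotv z z.
(** The l1 norm is the length of a path along the coordinate axes, which is how increments of the
    potential are estimated. *)
Definition nrm1 z : R := \sum_i `|z ord0 i|.

Lemma sqE z : sq z = \sum_i z ord0 i ^+ 2.
Proof. by apply: eq_bigr => i _; rewrite expr2. Qed.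

Lemma sq_ge0 z : 0 <= sq z.
Proof. by rewrite sqE; apply: sumr_ge0 => i _; exact: sqr_ge0. Qed.

Lemma sqN z : sq (- z) = sq z.
Proof. by rewrite !sqE; apply: eq_bigr => i _; rewrite mxE sqrrN. Qed.

Lemma sqZ a z : sq (a *: z) = a ^+ 2 * sq z.
Proof. by rewrite !sqE mulr_sumr; apply: eq_bigr => i _; rewrite mxE exprMn. Qed.

Lemma nrm1_ge0 z : 0 <= nrm1 z.
Proof. exact: sumr_ge0. Qed.

Lemma coord_nrm1 z i : `|z ord0 i| <= nrm1 z.
Proof. by rewrite /nrm1 (bigD1 i)//= lerDl sumr_ge0. Qed.

Lemma nrm1_sq z : nrm1 z ^+ 2 <= n%:R * sq z.
Proof.
rewrite expr2 /nrm1 mulr_suml sqE.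
have -> : n%:R * \sum_i z ord0 i ^+ 2 =
    \sum_(i < n) \sum_(j < n) ((z ord0 i ^+ 2 + z ord0 j ^+ 2) / 2).
  have e i : \sum_(j < n) ((z ord0 i ^+ 2 + z ord0 j ^+ 2) / 2) =
      (n%:R * z ord0 i ^+ 2 + \sum_j z ord0 j ^+ 2) / 2.
    by rewrite -mulr_suml big_split/= sumr_const card_ord mulr_natl.
  rewrite (eq_bigr _ (fun i _ => e i)) -mulr_suml big_split/= -mulr_sumr.
  by rewrite sumr_const card_ord -[_ *+ n]mulr_natl; field.
apply: ler_sum => i _; rewrite mulr_sumr; apply: ler_sum => j _.
rewrite -(real_normK (num_real (z ord0 i))) -(real_normK (num_real (z ord0 j))).
by have := sqr_ge0 (`|z ord0 i| - `|z ord0 j|); lra.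
Qed.

Lemma measurable_sq : measurable_fun [set: 'rV[R]_n] sq.
Proof.
rewrite (_ : sq = (fun z => \sum_i z ord0 i ^+ 2)); last by apply/funext => z; exact: sqE.
by apply: mf_sum => i; apply: mfX; exact: measurable_coord.
Qed.

Lemma measurable_nrm1 : measurable_fun [set: 'rV[R]_n] nrm1.
Proof. by apply: mf_sum => i; apply: mf_norm; exact: measurable_coord. Qed.

Definition cG : R := (2 * pi) `^ (- (n%:R / 2)).

(** The heat kernel of half the Laplacian: variance [t] in each coordinate, zero at nonpositive
    times because [pw] is. The lock keeps it from being unfolded by unification. *)
Definition G t z : R :=
  locked_with G_key (cG * pw (- (n%:R / 2)) t * expR (- (sq z / (2 * t)))).

Lemma GE t z : G t z = cG * pw (- (n%:R / 2)) t * expR (- (sq z / (2 * t))).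
Proof. by rewrite /G unlock. Qed.

Lemma cG_gt0 : 0 < cG.
Proof. by rewrite powR_gt0// mulr_gt0// pi_gt0. Qed.

Lemma G_ge0 t z : 0 <= G t z.
Proof. by rewrite !GE !mulr_ge0 ?pw_ge0 ?expR_ge0// ltW// cG_gt0. Qed.

Lemma measurable_G d (T : measurableType d) (f : T -> R) (g : T -> 'rV[R]_n) :
  measurable_fun setT f -> measurable_fun setT g ->
  measurable_fun setT (fun w => G (f w) (g w)).
Proof.
move=> mf mg.
rewrite (_ : (fun w => _) = (fun w => cG * pw (- (n%:R / 2)) (f w) *
    expR (- (sq (g w) / (2 * f w))))); last by apply/funext => w; rewrite GE.
by mea; exact: (mf_comp measurable_sq).
Qed.


Ltac mea_ext ::= lazymatch goal with
  | |- measurable_fun _ (fun w_ => pw _ _) => apply: (mf_comp (measurable_pw _))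
  | |- measurable_fun _ (fun w_ => G _ _) => apply: measurable_G
  | |- measurable_fun _ (fun w_ => nrm1 _) => apply: (mf_comp measurable_nrm1)
  | |- measurable_fun _ (fun w_ => sq _) => apply: (mf_comp measurable_sq)
  | |- measurable_fun _ (fun w_ => fun_of_matrix _ _ _) => apply: mf_coord
  | |- measurable_fun _ (fun w_ => (_ + _)%R) => apply: mf_addrV
  | |- measurable_fun _ (fun w_ => (- _)%R) => apply: mf_opprV
  | |- measurable_fun _ (fun w_ => (_ *: _)%R) => apply: mf_scalerV
  end.

Lemma GN t z : G t (- z) = G t z.
Proof. by rewrite !GE sqN. Qed.

Lemma G_le t z : 0 < t -> G t z <= cG * t `^ (- (n%:R / 2)).
Proof.
move=> t0; rewrite !GE pwE// ler_piMr//.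
  by rewrite mulr_ge0 ?powR_ge0// ltW// cG_gt0.
by rewrite -expR0 ler_expR oppr_le0 divr_ge0 ?sq_ge0// mulr_ge0// ltW.
Qed.

(** The exponential increases with time and the prefactors differ by at most [4 ^ (n / 2)]. This
    allows a time to be replaced by a nearby power of 4. *)
Lemma G_compare s t z : 0 < s -> s <= t -> t <= 4 * s -> G s z <= 2 ^+ n * G t z.
Proof.
move=> s0 st ts; have t0 : 0 < t by exact: lt_le_trans st.
rewrite !GE !pwE// mulrA; apply: ler_pM; rewrite ?expR_ge0//.
- by rewrite mulr_ge0 ?powR_ge0// ltW// cG_gt0.
- rewrite mulrCA ler_pM2l ?cG_gt0//.
  have -> : 2 ^+ n = 4 `^ (n%:R / 2) :> R.
    rewrite (_ : 4 = 2 `^ 2); last by rewrite (powR_mulrn 2)//; lra.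
    by rewrite -powRrM (_ : 2 * (n%:R / 2) = n%:R) ?powR_mulrn//; field.
  rewrite !powRN -ler_pdivrMl ?powR_gt0// -invfM -powRM ?(ltW s0)//.
  rewrite lef_pV2 ?posrE ?powR_gt0// ?mulr_gt0//.
  by apply: ge0_ler_powR; rewrite ?nnegrE// ?divr_ge0// ltW// mulr_gt0.
- rewrite ler_expR lerN2; apply: ler_pM; rewrite ?sq_ge0 ?invr_ge0 ?mulr_ge0 ?(ltW t0)//.
  by rewrite lef_pV2 ?posrE ?mulr_gt0// ler_pM2l.
Qed.

Lemma G_scale a t z : 0 < a -> G (a ^+ 2 * t) (a *: z) = a ^- n * G t z.
Proof.
move=> a0; rewrite !GE sqZ pwM ?exprn_gt0//.
rewrite (_ : (a ^+ 2) `^ (- (n%:R / 2)) = a ^- n); last first.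
  rewrite -(powR_mulrn 2 (ltW a0)) -powRrM (_ : 2 * _ = - n%:R); last by field.
  by rewrite powR_invn// ltW.
have -> : a ^+ 2 * sq z / (2 * (a ^+ 2 * t)) = sq z / (2 * t).
  by rewrite mulrCA -mulf_div divff ?mul1r// expf_neq0// gt_eqF.
by rewrite !mulrA; congr (_ * _ * _); rewrite mulrC.
Qed.

Lemma G_prod t z : 0 < t -> G t z = \prod_i normal_pdf 0 (Num.sqrt t) (z ord0 i).
Proof.
move=> t0.
have st0 : Num.sqrt t != 0 by rewrite gt_eqF// sqrtr_gt0.
under eq_bigr => i _ do rewrite normal_pdfE// /normal_peak /normal_fun
  sqr_sqrtr ?(ltW t0)// subr0.
rewrite big_split/= prodr_const card_ord !GE pwE//; congr (_ * _).
  rewrite /cG -powRM ?mulr_ge0 ?pi_ge0 ?(ltW t0)//.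
  rewrite -powR12_sqrt; last by rewrite mulrn_wge0// mulr_ge0 ?pi_ge0 ?ltW.
  rewrite -powRN -powR_mulrn ?powR_ge0// -powRrM.
  have -> : t * pi *+ 2 = 2 * pi * t by rewrite mulr2n; ring.
  by congr (_ `^ _); field.
rewrite -expR_sum; congr expR.
by rewrite sqE mulr_suml -sumrN; apply: eq_bigr => i _; rewrite mulNr mulr_natl.
Qed.

Lemma G_mass t : 0 < t -> (\int[lebn n]_z (G t z)%:E = 1)%E.
Proof.
move=> t0; under eq_integral do rewrite G_prod//.
rewrite (@ge0_integral_rV_prod _ _ (fun=> normal_pdf 0 (Num.sqrt t))).
- by rewrite big1// => i _; rewrite integral_normal_pdf.
- by move=> i; exact: measurable_normal_pdf.
- by move=> i w; exact: normal_pdf_ge0.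
Qed.

(** Completing the square in [y]: the joint density of two independent centred normals is the
    density of their sum times the conditional density of the first. *)
Let normal_conv s t (x y : R) : 0 < s -> 0 < t ->
  normal_pdf 0 (Num.sqrt s) y * normal_pdf 0 (Num.sqrt t) (x - y) =
  normal_pdf 0 (Num.sqrt (s + t)) x *
  normal_pdf (x * s / (s + t)) (Num.sqrt (s * t / (s + t))) y.
Proof.
move=> s0 t0; have st0 : 0 < s + t by rewrite addr_gt0.
have m0 : 0 < s * t / (s + t) by rewrite divr_gt0// mulr_gt0.
have nz u : 0 < u -> Num.sqrt u != 0 :> R by move=> u0; rewrite gt_eqF// sqrtr_gt0.
rewrite !normal_pdfE ?nz// /normal_peak /normal_fun !sqr_sqrtr ?ltW//.
rewrite !subr0 mulrACA [RHS]mulrACA; congr (_ * _).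
  move: (@pi_ge0 R); move: (pi : R) => P P0.
  rewrite -!invfM -!sqrtrM ?mulrn_wge0 ?mulr_ge0 ?(ltW s0) ?(ltW st0)//.
  have -> : s * P *+ 2 * (t * P *+ 2) = (s + t) * P *+ 2 * (s * t / (s + t) * P *+ 2).
    by rewrite !mulr2n; field; rewrite gt_eqF.
  by [].
rewrite -!expRD; congr expR; rewrite !mulr2n; field.
by rewrite -!mulr2n !mulrn_eq0/= !gt_eqF// mulr_gt0.
Qed.

Lemma G_conv s t x : 0 < s -> 0 < t ->
  (\int[lebn n]_z (G s z * G t (x - z))%:E = (G (s + t) x)%:E)%E.
Proof.
move=> s0 t0; have st0 : 0 < s + t by rewrite addr_gt0.
transitivity (\int[lebn n]_z (\prod_i (normal_pdf 0 (Num.sqrt (s + t)) (x ord0 i) *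
    normal_pdf (x ord0 i * s / (s + t)) (Num.sqrt (s * t / (s + t))) (z ord0 i)))%:E)%E.
  apply: eq_integral => z _; congr EFin; rewrite !G_prod// -big_split/=.
  by apply: eq_bigr => i _; rewrite !mxE normal_conv.
rewrite (ge0_integral_rV_prod (g := fun i (y : R) => normal_pdf 0 (Num.sqrt (s + t)) (x ord0 i) *
    normal_pdf (x ord0 i * s / (s + t)) (Num.sqrt (s * t / (s + t))) y)); last 2 first.
- by move=> i; apply: mfM => //; exact: measurable_normal_pdf.
- by move=> i y; rewrite mulr_ge0// normal_pdf_ge0.
rewrite G_prod// -prodEFin; apply: eq_bigr => i _.
under eq_integral do rewrite EFinM.
rewrite intZl.
- by rewrite integral_normal_pdf mule1.
- by apply: mf_EFin; exact: measurable_normal_pdf.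
- by move=> y; rewrite lee_fin normal_pdf_ge0.
- exact: normal_pdf_ge0.
Qed.

(** Half of the exponent absorbs the square, by [q / (4 t) <= exp (q / (4 t))]; the other half is
    the kernel at time [2 t], whose prefactor costs [2 ^ (n / 2)]. *)
Lemma sqG t z : 0 < t -> sq z * G t z <= 4 * 2 `^ (n%:R / 2) * t * G (2 * t) z.
Proof.
move=> t0; rewrite !GE !pwE ?mulr_gt0//.
have q0 := sq_ge0 z.
set q := sq z in q0 *.
have h : q * expR (- (q / (2 * t))) <= 4 * t * expR (- (q / (2 * (2 * t)))).
  have -> : expR (- (q / (2 * t))) = expR (- (q / (4 * t))) * expR (- (q / (4 * t))).
    by rewrite -expRD; congr expR; field; rewrite gt_eqF.
  have -> : 2 * (2 * t) = 4 * t by ring.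
  rewrite mulrA ler_pM2r ?expR_gt0// expRN ler_pdivrMr ?expR_gt0//.
  have := expR_ge1Dx (q / (4 * t)) => h.
  rewrite -ler_pdivrMl ?mulr_gt0//; apply: le_trans h.
  by rewrite mulrC; lra.
have -> : (2 * t) `^ (- (n%:R / 2)) = 2 `^ (- (n%:R / 2)) * t `^ (- (n%:R / 2)).
  by rewrite powRM// ltW.
have -> : 4 * 2 `^ (n%:R / 2) * t * (cG * (2 `^ (- (n%:R / 2)) * t `^ (- (n%:R / 2))) *
   expR (- (q / (2 * (2 * t))))) = cG * t `^ (- (n%:R / 2)) *
   (4 * t * expR (- (q / (2 * (2 * t))))).
  by rewrite powRN; field; rewrite gt_eqF// powR_gt0.
rewrite mulrCA ler_pM2l//.
by rewrite mulr_gt0 ?cG_gt0 ?powR_gt0.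
Qed.

Definition cM : R := n%:R * (4 * 2 `^ (n%:R / 2)).

Lemma cM_ge0 : 0 <= cM.
Proof. by rewrite /cM !mulr_ge0 ?powR_ge0. Qed.

Lemma nrm1_2G t z : 0 < t -> nrm1 z ^+ 2 * G t z <= cM * t * G (2 * t) z.
Proof.
move=> t0; apply: (@le_trans _ _ (n%:R * (sq z * G t z))).
  by rewrite mulrA ler_wpM2r ?G_ge0 ?nrm1_sq.
rewrite /cM -!(mulrA n%:R) ler_wpM2l//; exact: sqG.
Qed.

Lemma nrm1_G t z : 0 < t ->
  nrm1 z * G t z <= Num.sqrt t * G t z + cM * Num.sqrt t * G (2 * t) z.
Proof.
move=> t0; have s0 : 0 < Num.sqrt t by rewrite sqrtr_gt0.
have h : nrm1 z <= Num.sqrt t + nrm1 z ^+ 2 / Num.sqrt t.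
  rewrite -(ler_pM2r s0) mulrDl divfK ?gt_eqF//.
  have := nrm1_ge0 z; set N := nrm1 z; set r := Num.sqrt t in s0 * => N0.
  by have := sqr_ge0 (N - r); nra.
apply: (@le_trans _ _ ((Num.sqrt t + nrm1 z ^+ 2 / Num.sqrt t) * G t z)).
  by rewrite ler_wpM2r ?G_ge0.
rewrite mulrDl lerD2l.
rewrite mulrAC ler_pdivrMr//.
apply: (le_trans (nrm1_2G z t0)).
rewrite [X in _ <= X](_ : _ = cM * (Num.sqrt t) ^+ 2 * G (2 * t) z); last by ring.
by rewrite sqr_sqrtr// ltW.
Qed.

Lemma moment2 t : 0 < t -> (\int[lebn n]_z (nrm1 z ^+ 2 * G t z)%:E <= (cM * t)%:E)%E.
Proof.
move=> t0; apply: (@le_trans _ _ (\int[lebn n]_z ((cM * t)%:E * (G (2 * t) z)%:E))%E).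
  apply: le_int.
  - by mea.
  - by mea.
  - by move=> z; rewrite lee_fin mulr_ge0 ?sqr_ge0 ?G_ge0.
  - by move=> z; rewrite -EFinM lee_fin nrm1_2G.
rewrite intZl ?G_mass ?mule1 ?mulr_gt0//.
- by mea.
- by move=> z; rewrite lee_fin G_ge0.
- by rewrite mulr_ge0 ?cM_ge0// ltW.
Qed.

Lemma moment1 t : 0 < t ->
  (\int[lebn n]_z (nrm1 z * G t z)%:E <= ((1 + cM) * Num.sqrt t)%:E)%E.
Proof.
move=> t0; apply: (@le_trans _ _ (\int[lebn n]_z ((Num.sqrt t)%:E * (G t z)%:E +
   (cM * Num.sqrt t)%:E * (G (2 * t) z)%:E))%E).
  apply: le_int.
  - by mea.
  - by mea.
  - by move=> z; rewrite lee_fin mulr_ge0 ?nrm1_ge0 ?G_ge0.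
  - by move=> z; rewrite -!EFinM -EFinD lee_fin nrm1_G.
rewrite intD.
- rewrite !intZl ?G_mass ?mule1 ?mulr_gt0//.
  + by rewrite -EFinD lee_fin mulrDl mul1r.
  + by mea.
  + by move=> z; rewrite lee_fin G_ge0.
  + by rewrite mulr_ge0 ?cM_ge0.
  + by mea.
  + by move=> z; rewrite lee_fin G_ge0.
- by mea.
- by mea.
- by move=> z; rewrite -EFinM lee_fin mulr_ge0 ?G_ge0.
- by move=> z; rewrite -EFinM lee_fin mulr_ge0 ?G_ge0 ?mulr_ge0 ?cM_ge0.
Qed.

Lemma sq_shift z i c : sq (z + c *: basis_rV i) = sq z + 2 * c * z ord0 i + c ^+ 2.
Proof.
rewrite !sqE (bigD1 i)//= [in RHS](bigD1 i)//= !mxE !eqxx/= mulr1.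
rewrite (eq_bigr (fun j => z ord0 j ^+ 2)); first by ring.
by move=> j ji; rewrite !mxE (negbTE ji) andbF mulr0 addr0.
Qed.

(** The increment of the kernel is an average of its derivative over a segment. Transferred to the
    other factor of an integral, this average becomes [Fint]. *)
Lemma G_FTC t z (i : 'I_n) (h : R) : 0 < t ->
  (\int[leb]_(th in `[0%R, 1%R]) (- h * (z + (th * h) *: basis_rV i) ord0 i / t *
     G t (z + (th * h) *: basis_rV i))%:E =
   (G t (z + h *: basis_rV i) - G t z)%:E)%E.
Proof.
move=> t0.
pose q := sq z; pose w := z ord0 i.
pose E (th : R) := - ((q + 2 * (th * h) * w + (th * h) ^+ 2) / (2 * t)).
pose F (th : R) := cG * t `^ (- (n%:R / 2)) * expR (E th).
have FE th : G t (z + (th * h) *: basis_rV i) = F th.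
  by rewrite !GE pwE// sq_shift.
pose f th := - h * (w + th * h) / t * F th.
have dE (th : R) : is_derive th 1 E (- h * (w + th * h) / t).
  rewrite /E; apply: is_derive_eq.
  rewrite ?scaler0 ?scale0r ?addr0 ?add0r ?mulr0 /GRing.scale/=.
  by field; rewrite gt_eqF.
have dF (th : R) : is_derive th 1 F (f th).
  have := dE th => dEt.
  have dX : is_derive th 1 (expR \o E) (expR (E th) * (- h * (w + th * h) / t)).
    exact: is_derive1_comp.
  rewrite (_ : F = (cG * t `^ (- (n%:R / 2))) \*: (expR \o E))//.
  apply: is_derive_eq; rewrite /f /F /GRing.scale/=; ring.
have cF : continuous F.
  by move=> x; apply/differentiable_continuous/derivable1_diffP; have [] := dF x.
have cf : continuous f.
  move=> x; apply: cvgM; last exact: cF.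
  apply: cvgM; last exact: cvg_cst.
  apply: cvgM; first exact: cvg_cst.
  apply: cvgD; first exact: cvg_cst.
  by apply: cvgM; [exact: cvg_id|exact: cvg_cst].
have -> : (G t (z + h *: basis_rV i) - G t z)%:E = ((F 1)%:E - (F 0)%:E)%E.
  by rewrite -!FE mul1r mul0r scale0r addr0.
rewrite -(@continuous_FTC2 _ f F 0 1)//.
- apply: eq_integral => th _; rewrite FE /f.
  by rewrite !mxE !eqxx/= mulr1.
- exact: continuous_subspaceT.
- split.
  + by move=> x _; have [] := dF x.
  + by apply: cvg_at_right_filter; exact: cF.
  + by apply: cvg_at_left_filter; exact: cF.
- by move=> x _; rewrite derive1E; have ? := dF x; exact: derive_val.
Qed.

End gaussian.
Arguments cG {R} n.
Arguments cM {R} n.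

Ltac mea_ext ::= lazymatch goal with
  | |- measurable_fun _ (fun w_ => pw _ _) => apply: (mf_comp (measurable_pw _))
  | |- measurable_fun _ (fun w_ => G _ _) => apply: measurable_G
  | |- measurable_fun _ (fun w_ => nrm1 _) => apply: (mf_comp measurable_nrm1)
  | |- measurable_fun _ (fun w_ => sq _) => apply: (mf_comp measurable_sq)
  | |- measurable_fun _ (fun w_ => fun_of_matrix _ _ _) => apply: mf_coord
  | |- measurable_fun _ (fun w_ => (_ + _)%R) => apply: mf_addrV
  | |- measurable_fun _ (fun w_ => (- _)%R) => apply: mf_opprV
  | |- measurable_fun _ (fun w_ => (_ *: _)%R) => apply: mf_scalerV
  end.

(** * Smooth cut-offs *)

Section derive_limit.
Context {R : realType} {V W : normedModType R}.
Implicit Types (f g : V -> W) (x v : V) (d : W).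

Lemma is_derive_lim f x v d :
  h^-1 *: (f (h *: v + x) - f x) @[h --> (0 : R)^'] --> d -> is_derive x v f d.
Proof.
move=> fd; split; first by apply/cvg_ex; exists d.
exact: (cvg_lim (@norm_hausdorff _ _) fd).
Qed.

Lemma lim_is_derive f x v d :
  is_derive x v f d -> h^-1 *: (f (h *: v + x) - f x) @[h --> (0 : R)^'] --> d.
Proof.
move=> [fd <-]; rewrite -[X in _ --> X]/(lim _) .
exact: fd.
Qed.

Lemma is_derive_near f g x v d : (\forall y \near x, f y = g y) ->
  is_derive x v g d -> is_derive x v f d.
Proof.
move=> fg /lim_is_derive gd; apply: is_derive_lim; apply: cvg_trans gd.
apply: near_eq_cvg; have fgx : f x = g x by exact: (nbhs_singleton fg).
have c : h *: v + x @[h --> (0 : R)] --> x.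
  rewrite -[X in _ --> X]add0r -(scale0r v); apply: cvgD; last exact: cvg_cst.
  by apply: cvgZl; exact: cvg_id.
have : \forall h \near (0 : R), f (h *: v + x) = g (h *: v + x).
  exact: (c _ fg).
move=> h0; near=> h; rewrite fgx; congr (_ *: (_ - _)); apply/esym.
by near: h; apply: cvg_within; exact: h0.
Unshelve. all: by end_near. Qed.

End derive_limit.

Section bump.
Context {R : realType}.
Implicit Types (x y : R) (m : nat).

(** The flat function [exp (-1/x)] with a negative power as parameter: the linear span of the family
    is closed under differentiation, by [dbump], and all members are bounded. *)
Definition bump m x : R := if 0 < x then x ^- m * expR (- x^-1) else 0.

Lemma bump_gt0E m x : 0 < x -> bump m x = x ^- m * expR (- x^-1).
Proof. by rewrite /bump => ->. Qed.

Lemma bump_le0E m x : x <= 0 -> bump m x = 0.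
Proof. by rewrite /bump ltNge => ->. Qed.

Lemma bump_ge0 m x : 0 <= bump m x.
Proof.
rewrite /bump; case: ifP => // x0.
by rewrite mulr_ge0 ?expR_ge0// invr_ge0 exprn_ge0// ltW.
Qed.

Lemma bump0_le1 x : bump 0 x <= 1.
Proof.
rewrite /bump; case: ifP => // x0.
by rewrite expr0 invr1 mul1r -expR0 ler_expR oppr_le0 invr_ge0 ltW.
Qed.

Lemma bumpS m x : bump m.+1 x = x^-1 * bump m x.
Proof.
rewrite /bump; case: ifP => x0; last by rewrite mulr0.
by rewrite exprS invfM mulrA.
Qed.

(** With [y = 1/x] this is one term of the exponential series, [y ^ m / m! <= exp y]. *)
Lemma bump_le m x : bump m x <= m`!%:R.
Proof.
rewrite /bump; case: ifP => x0; last by [].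
rewrite expRN ler_pdivrMr ?expR_gt0// -exprVn.
set y := x^-1; have y0 : 0 <= y by rewrite invr_ge0 ltW.
case: m => [|m]; first by rewrite expr0 mul1r; have := expR_ge1Dx y; lra.
have := expR_ge1Dxn m y0 => h.
rewrite mulrC -ler_pdivrMr ?ltr0n ?fact_gt0//; apply: le_trans h; lra.
Qed.

Lemma bump_norm m x : `|bump m x| <= m`!%:R.
Proof. by rewrite ger0_norm ?bump_le ?bump_ge0. Qed.

Definition dbump m x : R := bump m.+2 x - m%:R * bump m.+1 x.

Let dexp x : 0 < x -> is_derive x 1 (fun y : R => expR (- y^-1)) (dbump 0 x).
Proof.
move=> x0; have xn0 : x != 0 by rewrite gt_eqF.
have di : is_derive x 1 (fun y : R => y^-1) (- x ^- 2).
  have := @is_deriveV _ id x 1 1 xn0 (is_derive_id _ _).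
  by rewrite -[_ *: 1]/(_ * 1) mulr1.
have dn : is_derive x 1 (fun y : R => - y^-1) (x ^- 2).
  by apply: is_derive_eq; rewrite opprK.
have dc : is_derive x 1 (expR \o (fun y : R => - y^-1)) (expR (- x^-1) * x ^- 2).
  exact: is_derive1_comp.
by rewrite /dbump mul0r subr0 bump_gt0E// mulrC.
Qed.

Let near_gt0 (f g : R -> R) x d : 0 < x -> (forall y, 0 < y -> f y = g y) ->
  is_derive x 1 g d -> is_derive x 1 f d.
Proof.
move=> x0 fg; apply: is_derive_near; near=> y; apply: fg.
by near: y; exact: lt_nbhsr.
Unshelve. all: by end_near. Qed.

Let is_derive_bump_gt0 m x : 0 < x -> is_derive x 1 (bump m) (dbump m x).
Proof.
move=> x0; have xn0 : x != 0 by rewrite gt_eqF.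
elim: m => [|m ih].
  apply: near_gt0 (dexp x0) => // y y0.
  by rewrite bump_gt0E// expr0 invr1 mul1r.
apply: (@near_gt0 _ ((fun y : R => y^-1) * bump m)) => //.
  by move=> y y0; rewrite bumpS.
have di : is_derive x 1 (fun y : R => y^-1) (- x ^- 2).
  have := @is_deriveV _ id x 1 1 xn0 (is_derive_id _ _).
  by rewrite -[_ *: 1]/(_ * 1) mulr1.
apply: is_derive_eq; rewrite /dbump !bumpS /GRing.scale/=.
by rewrite -natr1; field.
Qed.

Lemma is_derive_bump m x : is_derive x 1 (bump m) (dbump m x).
Proof.
have [x0|x0|->] := ltgtP x 0; last 2 first.
- exact: is_derive_bump_gt0.
- rewrite /dbump !bump_le0E// mulr0 subr0; apply: is_derive_lim.
  apply/cvgrPdist_le => e e0; near=> h.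
  have h0 : h != 0 by near: h; exact: nbhs_dnbhs_neq.
  rewrite sub0r normrN addr0 (bump_le0E m (lexx 0)) subr0.
  rewrite -[h *: 1]/(h * 1) mulr1 -[_ *: _]/(_ * _) -bumpS.
  (* The difference quotient at 0 is [bump m.+1 h]; trading one factor [h] for one more negative
     power shows that it tends to 0 linearly. *)
  have hb : `|bump m.+1 h| <= (m.+2)`!%:R * `|h|.
    have -> : bump m.+1 h = bump m.+2 h * h.
      by rewrite [in RHS]bumpS mulrC mulrA divff// mul1r.
    by rewrite normrM ler_wpM2r// bump_norm.
  apply: le_trans hb _; rewrite mulrC -ler_pdivlMr ?ltr0n ?fact_gt0//.
  near: h; apply: dnbhs0_le; rewrite divr_gt0// ltr0n fact_gt0//.
- have z : is_derive x 1 (cst 0 : R -> R) 0 by exact: is_derive_cst.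
  rewrite /dbump !bump_le0E ?(ltW x0)// mulr0 subr0.
  apply: is_derive_near z; near=> y; rewrite bump_le0E// ltW//.
  by near: y; exact: lt_nbhsl.
Unshelve. all: by end_near. Qed.

Lemma continuous_bump m : continuous (bump m).
Proof.
move=> x; apply/differentiable_continuous/derivable1_diffP.
by have [] := is_derive_bump m x.
Qed.

Lemma lipschitz_bump m : exists2 L : R, 0 <= L & forall x y, `|bump m x - bump m y| <= L * `|x - y|.
Proof.
pose L : R := (m.+2)`!%:R + m%:R * (m.+1)`!%:R.
have dL x : `|dbump m x| <= L.
  rewrite /dbump (le_trans (ler_normB _ _))// lerD ?bump_norm// normrM ger0_norm//.
  by rewrite ler_wpM2l// bump_norm.
exists L; first by rewrite addr_ge0// mulr_ge0.
move=> x y; wlog xy : x y / x <= y.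
  move=> H; have [xy|/ltW yx] := leP x y; first exact: H.
  by rewrite distrC [X in _ <= _ * X]distrC; exact: H.
have [c _ e] := @MVT_segment _ (bump m) (dbump m) x y xy
  (fun z _ => is_derive_bump m z) (continuous_subspaceT (@continuous_bump m)).
by rewrite distrC e normrM [X in _ <= _ * X]distrC ler_wpM2r.
Qed.

End bump.

Section smooth_class.
Context {R : realType} {n : nat}.
Implicit Types (f g : 'rV[R]_n -> R) (z : 'rV[R]_n).

(** A syntactic class of smooth functions: it is stable under partial derivatives and its members
    are bounded and Lipschitz, so derivatives of every order are handled by structural induction. It
    is rich enough to approximate indicators. *)
Inductive Sm : ('rV[R]_n -> R) -> Prop :=
| Sm_cst c : Sm (fun=> c)
| Sm_bump m i a c : Sm (fun z => bump m (a * z ord0 i + c))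
| Sm_add f g : Sm f -> Sm g -> Sm (fun z => f z + g z)
| Sm_mul f g : Sm f -> Sm g -> Sm (fun z => f z * g z).

Lemma Sm_scale a f : Sm f -> Sm (fun z => a * f z).
Proof. by move=> ?; apply: Sm_mul => //; exact: Sm_cst. Qed.

Lemma Sm_onem f : Sm f -> Sm (fun z => 1 - f z).
Proof.
move=> Sf; rewrite (_ : (fun z => _) = (fun z => 1 + (-1) * f z)).
  by apply: Sm_add; [exact: Sm_cst|exact: Sm_scale].
by apply/funext => z; rewrite mulN1r.
Qed.

Lemma Sm_bounded f : Sm f -> exists2 M : R, 0 <= M & forall z, `|f z| <= M.
Proof.
elim=> {f} [c|m i a c|f g _ [M M0 Mf] _ [N N0 Ng]|f g _ [M M0 Mf] _ [N N0 Ng]].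
- by exists `|c|.
- by exists m`!%:R => // z; exact: bump_norm.
- exists (M + N); first exact: addr_ge0.
  by move=> z; rewrite (le_trans (ler_normD _ _))// lerD.
- exists (M * N); first exact: mulr_ge0.
  by move=> z; rewrite normrM ler_pM.
Qed.

Lemma Sm_lipschitz f : Sm f -> exists2 L : R, 0 <= L &
  forall z w, `|f (z + w) - f z| <= L * nrm1 w.
Proof.
elim=> {f} [c|m i a c|f g _ [M M0 Mf] _ [N N0 Ng]|f g Sf [M M0 Mf] Sg [N N0 Ng]].
- by exists 0 => // z w; rewrite subrr normr0 mul0r.
- have [L L0 bL] := @lipschitz_bump R m.
  exists (L * `|a|); first by rewrite mulr_ge0.
  move=> z w; apply: (le_trans (bL _ _)); rewrite -mulrA ler_wpM2l//.
  rewrite mxE (_ : _ - _ = a * w ord0 i); last by ring.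
  by rewrite normrM ler_wpM2l// coord_nrm1.
- exists (M + N); first exact: addr_ge0.
  move=> z w; rewrite (_ : _ - _ = (f (z + w) - f z) + (g (z + w) - g z)); last by ring.
  by rewrite (le_trans (ler_normD _ _))// mulrDl lerD.
- have [A A0 fA] := Sm_bounded Sf; have [B B0 gB] := Sm_bounded Sg.
  exists (M * B + A * N); first by rewrite addr_ge0// mulr_ge0.
  move=> z w.
  rewrite (_ : _ - _ = (f (z + w) - f z) * g (z + w) + f z * (g (z + w) - g z)); last by ring.
  rewrite (le_trans (ler_normD _ _))// !normrM mulrDl lerD//.
    by rewrite mulrAC ler_pM.
  by rewrite -mulrA ler_pM.
Qed.

Lemma lip_continuous f (L : R) : (forall z w, `|f (z + w) - f z| <= L * nrm1 w) ->
  continuous f.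
Proof.
move=> Lf z A /nbhs_ballP[e /= e0 eA].
have p0 : 0 < `|L| * n%:R + 1 by rewrite ltr_wpDl// mulr_ge0.
apply/nbhs_ballP; exists (e / (`|L| * n%:R + 1)); first by rewrite /= divr_gt0.
move=> y [_ zy]; apply: eA; rewrite /ball/= distrC.
have -> : y = z + (y - z) by rewrite addrC subrK.
apply: (@le_lt_trans _ _ (`|L| * nrm1 (y - z))).
  by rewrite (le_trans (Lf _ _))// ler_wpM2r ?nrm1_ge0// ler_norm.
apply: (@le_lt_trans _ _ (`|L| * (n%:R * (e / (`|L| * n%:R + 1))))).
  rewrite ler_wpM2l// /nrm1 mulr_natl -[X in _ *+ X]card_ord -sumr_const.
  apply: ler_sum => i _; rewrite !mxE distrC.
  by have := zy ord0 i; rewrite /ball/= => /ltW.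
rewrite mulrA mulrA ltr_pdivrMr//.
by rewrite mulrA mulrC ltr_pM2l// ltrDl.
Qed.

Lemma Sm_measurable f : Sm f -> measurable_fun setT f.
Proof.
elim=> {f} [c|m i a c|f g _ mf _ mg|f g _ mf _ mg]; mea.
apply: (@mf_comp _ _ _ _ _ _ (bump m) (fun z : 'rV[R]_n => a * z ord0 i + c)); mea.
exact: (continuous_measurable_fun (@continuous_bump R m)).
Qed.

Lemma Sm_derive f : Sm f -> forall j, exists2 f', Sm f' &
  forall z, is_derive z (basis_rV j) f (f' z).
Proof.
elim=> {f} [c|m i a c|f g Sf ihf Sg ihg|f g Sf ihf Sg ihg] j.
- by exists (fun=> 0); [exact: Sm_cst|move=> z; exact: is_derive_cst].
- exists (fun z => (a * (i == j)%:R) * (bump m.+2 (a * z ord0 i + c) +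
                   (- m%:R) * bump m.+1 (a * z ord0 i + c))).
    by apply: Sm_scale; apply: Sm_add; [|apply: Sm_scale]; exact: Sm_bump.
  move=> z; apply: is_derive_lim.
  pose k : R := a * (i == j)%:R.
  pose l (t : R) := k * t + (a * z ord0 i + c).
  have dl : is_derive (0 : R) 1 l k.
    by apply: is_derive_eq; rewrite /GRing.scale/= ?mulr1 ?mulr0 ?addr0 ?add0r.
  have dc : is_derive (0 : R) 1 (bump m \o l) (dbump m (l 0) * k).
    by have := is_derive_bump m (l 0) => ?; exact: is_derive1_comp.
  have H := lim_is_derive dc.
  rewrite [X in _ --> X](_ : _ = dbump m (l 0) * k); last first.
    by rewrite /dbump /l /k mulr0 add0r; ring.
  apply: cvg_trans H; apply: near_eq_cvg; near=> h => /=; rewrite /l.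
  congr (_ *: (bump _ _ - _)); last by rewrite mulr0 add0r.
  rewrite !mxE eqxx/= -[h *: 1]/(h * 1) /k; case: (i == j) => /=; ring.
- have [f' Sf' df] := ihf j; have [g' Sg' dg] := ihg j.
  exists (fun z => f' z + g' z); first exact: Sm_add.
  by move=> z; have ? := df z; have ? := dg z; exact: is_deriveD.
- have [f' Sf' df] := ihf j; have [g' Sg' dg] := ihg j.
  exists (fun z => f z * g' z + g z * f' z); first by apply: Sm_add; exact: Sm_mul.
  by move=> z; have ? := df z; have ? := dg z; exact: is_deriveM.
Unshelve. all: by end_near. Qed.

(** Minus its tangent, [f] has along the axis a derivative bounded by [L |t|], and the mean value
    theorem gives the remainder. Uniformity in [z] is what allows differentiation under the segment
    integral. *)
Lemma Sm_taylor f j f' : Sm f -> Sm f' ->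
  (forall z, is_derive z (basis_rV j) f (f' z)) ->
  exists2 C : R, 0 <= C & forall z t,
    `|f (t *: basis_rV j + z) - f z - t * f' z| <= C * t ^+ 2.
Proof.
move=> Sf Sf' df; have [L L0 Lf] := Sm_lipschitz Sf'.
exists L => // z.
pose g (t : R) := f (t *: basis_rV j + z) - t * f' z.
have dg (t : R) : is_derive t 1 g (f' (t *: basis_rV j + z) - f' z).
  have d1 : is_derive t 1 (fun t : R => f (t *: basis_rV j + z)) (f' (t *: basis_rV j + z)).
    apply: is_derive_lim; have := lim_is_derive (df (t *: basis_rV j + z)).
    apply: cvg_trans; apply: near_eq_cvg; near=> h.
    by rewrite -[h *: 1]/(h * 1) mulr1 scalerDl addrA.
  have d2 : is_derive t 1 (fun t : R => t * f' z) (f' z).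
    by apply: is_derive_eq; rewrite /GRing.scale/= mulr0 add0r mulr1.
  exact: is_deriveB.
have cg : continuous g.
  by move=> x; apply/differentiable_continuous/derivable1_diffP; have [] := dg x.
have n1 (t : R) : nrm1 (t *: basis_rV j : 'rV[R]_n) = `|t|.
  rewrite /nrm1 (bigD1 j)//= !mxE !eqxx/= mulr1 big1 ?addr0// => i ij.
  by rewrite !mxE (negbTE ij) andbF mulr0 normr0.
have key (u v c : R) : u <= v -> c \in `[u, v] -> g v - g u = (f' (c *: basis_rV j + z) - f' z) * (v - u) ->
    `|g v - g u| <= L * `|c| * `|v - u|.
  move=> uv cuv ->; rewrite normrM ler_wpM2r//.
  by rewrite [_ *: _ + _]addrC -n1 Lf.
move=> t; have -> : f (t *: basis_rV j + z) - f z - t * f' z = g t - g 0.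
  by rewrite /g mul0r scale0r add0r subr0; ring.
rewrite -(real_normK (num_real t)) expr2 mulrA.
have [t0|/ltW t0] := leP 0 t.
  have [c ci e] := @MVT_segment _ g _ 0 t t0 (fun w _ => dg w) (continuous_subspaceT cg).
  rewrite (le_trans (key _ _ _ t0 ci e))// subr0 ler_wpM2r// ler_wpM2l//.
  by move: ci; rewrite in_itv/= => /andP[c0 ct]; rewrite !ger0_norm.
have [c ci e] := @MVT_segment _ g _ t 0 t0 (fun w _ => dg w) (continuous_subspaceT cg).
rewrite distrC (le_trans (key _ _ _ t0 ci e))// sub0r normrN ler_wpM2r// ler_wpM2l//.
by move: ci; rewrite in_itv/= => /andP[c0 ct]; rewrite !ler0_norm// lerN2.
Unshelve. all: by end_near. Qed.

End smooth_class.

(** * Averages over segments as test fields *)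

Section segment_average.
Context {R : realType} {n : nat}.
Notation leb := (@lebesgue_measure R).
Implicit Types (f : 'rV[R]_n -> R) (z : 'rV[R]_n).
Notation I01 := (`[0%R, 1%R]%classic : set R).

(** For [h != 0] and continuous [f], the derivative of this average along the i-th axis is
    [(f z - f (z - h e_i)) / h]: the field [Ffield] has a difference quotient as its divergence. *)
Definition Fint f (i : 'I_n) (h : R) z : R :=
  (\int[leb]_(th in I01) f (z - (th * h) *: basis_rV i))%R.

Lemma leb01 : leb I01 = 1%E.
Proof. by rewrite lebesgue_measure_itv/= lte_fin ltr01 oppr0 adde0. Qed.

Lemma bounded_integrable01 (g : R -> R) (M : R) : measurable_fun setT g ->
  (forall x, `|g x| <= M) -> leb.-integrable I01 (EFin \o g).
Proof.
move=> mg gM; apply: measurable_bounded_integrable => //.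
- by rewrite (_ : _ _ = 1%E) ?ltry//; exact: leb01.
- exact: measurable_funTS.
- by exists M; split; rewrite ?num_real// => N MN x _ /=; rewrite (le_trans (gM _))// ltW.
Qed.

Lemma Rint01_le (g : R -> R) (M : R) : measurable_fun setT g ->
  (forall x, `|g x| <= M) -> `|\int[leb]_(th in I01) g th| <= M.
Proof.
move=> mg gM; have gi := bounded_integrable01 mg gM.
apply: le_trans (le_normr_Rintegral _ gi) _ => //.
have Mi : leb.-integrable I01 (EFin \o cst M).
  by apply: (@bounded_integrable01 (cst M) `|M|) => // x.
apply: (@le_trans _ _ (\int[leb]_(th in I01) (cst M th))%R).
  apply: le_Rintegral => //.
  apply: (@bounded_integrable01 (fun x => `|g x|) M); mea.
  by move=> x; rewrite normr_id.
by rewrite Rintegral_cst//= leb01 /= mulr1.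
Qed.

Let mshift f i h z : measurable_fun setT f ->
  measurable_fun setT (fun th : R => f (z - (th * h) *: basis_rV i)).
Proof. by move=> mf; apply: (mf_comp mf); mea. Qed.

Lemma Fint_le f i h z M : measurable_fun setT f -> (forall z, `|f z| <= M) ->
  `|Fint f i h z| <= M.
Proof. by move=> mf fM; apply: Rint01_le => //; exact: mshift. Qed.

Lemma Fint_lipschitz f i h L M : measurable_fun setT f -> (forall z, `|f z| <= M) ->
  (forall z w, `|f (z + w) - f z| <= L * nrm1 w) ->
  forall z w, `|Fint f i h (z + w) - Fint f i h z| <= L * nrm1 w.
Proof.
move=> mf fM fL z w; rewrite /Fint -RintegralB//; last 2 first.
- by apply: (@bounded_integrable01 _ M) => //; exact: mshift.
- by apply: (@bounded_integrable01 _ M) => //; exact: mshift.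
apply: Rint01_le.
- by apply: mfB; exact: mshift.
- by move=> x; rewrite addrAC fL.
Qed.

Lemma Fint_derive f f' i j h : Sm f -> Sm f' ->
  (forall z, is_derive z (basis_rV j) f (f' z)) ->
  forall z, is_derive z (basis_rV j) (Fint f i h) (Fint f' i h z).
Proof.
move=> Sf Sf' df z; have [C C0 fC] := Sm_taylor Sf Sf' df.
have [M _ fM] := Sm_bounded Sf; have [M' _ fM'] := Sm_bounded Sf'.
have mf := Sm_measurable Sf; have mf' := Sm_measurable Sf'.
have key (t : R) : `|Fint f i h (t *: basis_rV j + z) - Fint f i h z - t * Fint f' i h z| <= C * t ^+ 2.
  have i1 w : leb.-integrable I01 (EFin \o (fun th => f (w - (th * h) *: basis_rV i))).
    by apply: (@bounded_integrable01 _ M) => //; exact: mshift.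
  have i2 w : leb.-integrable I01 (EFin \o (fun th => f' (w - (th * h) *: basis_rV i))).
    by apply: (@bounded_integrable01 _ M') => //; exact: mshift.
  have i3 : leb.-integrable I01 (EFin \o (fun th => f (t *: basis_rV j + z - (th * h) *: basis_rV i)
      - f (z - (th * h) *: basis_rV i))).
    apply: (@bounded_integrable01 _ (M + M)); first by apply: mfB; exact: mshift.
    by move=> x; rewrite (le_trans (ler_normB _ _))// lerD.
  have i4 : leb.-integrable I01 (EFin \o (fun th => t * f' (z - (th * h) *: basis_rV i))).
    apply: (@bounded_integrable01 _ (`|t| * M')); first by apply: mfM => //; exact: mshift.
    by move=> x; rewrite normrM ler_wpM2l.
  rewrite /Fint -RintegralB// -RintegralZl// -RintegralB//.
  apply: Rint01_le.
    by apply: mfB; [apply: mfB|apply: mfM => //]; exact: mshift.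
  by move=> x; rewrite -(addrA (t *: _) z) fC.
apply: is_derive_lim; apply/cvgrPdist_le => e e0; near=> t.
have t0 : t != 0 by near: t; exact: nbhs_dnbhs_neq.
rewrite -[_ *: _]/(_ * _) distrC.
have -> : t^-1 * (Fint f i h (t *: basis_rV j + z) - Fint f i h z) - Fint f' i h z =
  t^-1 * (Fint f i h (t *: basis_rV j + z) - Fint f i h z - t * Fint f' i h z).
  by field.
rewrite normrM normfV ler_pdivrMl ?normr_gt0//.
apply: (le_trans (key t)); rewrite -(real_normK (num_real t)) expr2 mulrA mulrC.
rewrite ler_wpM2l//; apply: (@le_trans _ _ ((C + 1) * `|t|)).
  by rewrite ler_wpM2r// lerDl.
have C1 : 0 < C + 1 by rewrite ltr_wpDl.
rewrite mulrC -ler_pdivlMr//; near: t; apply: dnbhs0_le; by rewrite divr_gt0// ltr_wpDl.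
Unshelve. all: by end_near. Qed.

Definition Ffield f i h z : 'rV[R]_n := Fint f i h z *: basis_rV i.

Lemma Ffield_iter f i h (l : seq 'I_n) : Sm f ->
  exists2 g, Sm g & iter_partial l (Ffield f i h) = Ffield g i h.
Proof.
move=> Sf; elim: l => [|j l [g Sg E]]; first by exists f.
have [g' Sg' dg] := Sm_derive Sg j.
exists g' => //=; rewrite E; apply/funext => z.
have dF := Fint_derive i h Sg Sg' dg z.
have : is_derive z (basis_rV j) (Ffield g i h) (Ffield g' i h z).
  apply: is_derive_lim; rewrite /Ffield.
  under eq_fun do rewrite -scalerBl scalerA.
  apply: cvgZl; exact: (lim_is_derive dF).
by move=> [].
Qed.

Lemma Ffield_smooth f i h : Sm f -> smooth_rV (Ffield f i h).
Proof.
move=> Sf l; have [g Sg ->] := Ffield_iter i h l Sf.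
have [M _ gM] := Sm_bounded Sg; have mg := Sm_measurable Sg.
have [L _ gL] := Sm_lipschitz Sg.
split.
  have cF : continuous (Fint g i h) := lip_continuous (Fint_lipschitz i h mg gM gL).
  move=> z; apply: (@continuous_comp _ _ _ (Fint g i h) (fun c : R => c *: basis_rV i)).
    exact: cF.
  by apply: cvgZl; exact: cvg_id.
move=> j z; have [g' Sg' dg] := Sm_derive Sg j.
have dF := Fint_derive i h Sg Sg' dg z.
apply/cvg_ex; exists (Ffield g' i h z); rewrite /Ffield.
under eq_fun do rewrite -scalerBl scalerA.
apply: cvgZl; exact: (lim_is_derive dF).
Qed.

Lemma enorm_basis (c : R) (i : 'I_n) : enorm (c *: basis_rV i : 'rV[R]_n) = `|c|.
Proof.
rewrite /enorm /dotv (bigD1 i)//= !mxE !eqxx/= mulr1 big1 ?addr0.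
  by rewrite -expr2 sqrtr_sqr.
by move=> k ki; rewrite !mxE (negbTE ki) andbF !mulr0.
Qed.

Lemma Ffield_test f i h (K : R) : Sm f -> (forall z, `|f z| <= 1) ->
  (forall z k, K < `|z ord0 k| -> f z = 0) -> test_field (Ffield f i h).
Proof.
move=> Sf f1 fK; have mf := Sm_measurable Sf; split.
- exact: Ffield_smooth.
(* Points of the averaging segment differ from [z] by at most [|h|] in each coordinate, so the
   half-side of the supporting cube grows by [|h|]. *)
- pose B := [set z : 'rV[R]_n | forall k, `[- (K + `|h|), K + `|h|]%classic (z ord0 k)].
  have cB : compact B.
    by apply: (@rV_compact _ n (fun=> `[- (K + `|h|), K + `|h|]%classic)) => k; exact: segment_compact.
  have clB : closed B by apply: compact_closed cB; exact: norm_hausdorff.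
  apply: (subclosed_compact _ cB); first exact: closed_closure.
  have sB : [set z | Ffield f i h z != 0] `<=` B.
    move=> z /= zn0 k; rewrite /= in_itv/= -ler_norml leNgt; apply/negP => zk.
    move: zn0; rewrite /Ffield /Fint (_ : (\int[leb]_(th in I01) _)%R = 0) ?scale0r ?eqxx//.
    rewrite (@eq_Rintegral _ _ _ _ _ (cst 0)) ?Rintegral_cst//= ?mul0r//.
    move=> th; rewrite inE/= in_itv/= => /andP[th0 th1]; apply: (fK _ k).
    have : `|((th * h) *: basis_rV i : 'rV[R]_n) ord0 k| <= `|h|.
      rewrite !mxE eqxx/= normrM [X in _ * X]ger0_norm// normrM ger0_norm//.
      rewrite -[X in _ <= X]mulr1 ler_pM// ?mulr_ge0//; last by case: (_ == _).
      by rewrite ler_piMl.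
    move: zk; rewrite !mxE; set u := z ord0 k; set v := (th * h * _) => uK vh.
    have := ler_normD (u - v) v; rewrite subrK => t.
    by rewrite -(ltrD2r `|h|); apply: (lt_le_trans uK); apply: (le_trans t); rewrite lerD2l.
  by move/closure_id : clB => ->; exact: closure_subset.
- move=> z; rewrite /Ffield enorm_basis; exact: Fint_le.
Qed.

End segment_average.

(** * Smooth approximation of indicators in weighted L1 *)

Section smooth_approximation.
Context {R : realType} {n : nat}.
Notation mu := (@lebn R n).
Implicit Types (A : set 'rV[R]_n) (f : 'rV[R]_n -> R).

Definition Sm01 f := Sm f /\ forall z, 0 <= f z <= 1.

Lemma Sm01_onem f : Sm01 f -> Sm01 (fun z => 1 - f z).
Proof.
move=> [Sf f01]; split; first exact: Sm_onem.
by move=> z; have := f01 z; lra.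
Qed.

Lemma Sm01_mul f g : Sm01 f -> Sm01 g -> Sm01 (fun z => f z * g z).
Proof.
move=> [Sf f01] [Sg g01]; split; first exact: Sm_mul.
move=> z; have /andP[f0 f1] := f01 z; have /andP[g0 g1] := g01 z.
by rewrite mulr_ge0//= mulr_ile1.
Qed.

Lemma Sm01_bump i a c : Sm01 (fun z => bump 0 (a * z ord0 i + c)).
Proof. by split; [exact: Sm_bump|move=> z; rewrite bump_ge0 bump0_le1]. Qed.

Variable w : 'rV[R]_n -> R.
Hypothesis w0 : forall z, 0 <= w z.
Hypothesis mw : measurable_fun setT w.
Hypothesis wfin : (\int[mu]_z (w z)%:E < +oo)%E.

Let dist (g f : 'rV[R]_n -> R) : \bar R := (\int[mu]_z (`|g z - f z| * w z)%:E)%E.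

Let wint : mu.-integrable setT (EFin \o w).
Proof.
apply/integrableP; split; first exact: mf_EFin.
by under eq_integral do rewrite /= ger0_norm//.
Qed.

Let dist_triangle g k f : measurable_fun setT g -> measurable_fun setT k ->
  measurable_fun setT f -> (dist g f <= dist g k + dist k f)%E.
Proof.
move=> mg mk mf; rewrite /dist -intD; last 4 first.
- by mea.
- by mea.
- by move=> z; rewrite lee_fin mulr_ge0.
- by move=> z; rewrite lee_fin mulr_ge0.
apply: le_int.
- by mea.
- by mea.
- by move=> z; rewrite lee_fin mulr_ge0.
- by move=> z; rewrite -EFinD lee_fin -mulrDl ler_wpM2r// ler_distD.
Qed.

Let dist_cvg (g_ : nat -> 'rV[R]_n -> R) (g : 'rV[R]_n -> R) : (forall k, measurable_fun setT (g_ k)) ->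
  measurable_fun setT g -> (forall k z, `|g z - g_ k z| <= 1) ->
  (forall z, g_ k z @[k --> \oo] --> g z) ->
  forall e : R, 0 < e -> exists k, (dist g (g_ k) < e%:E)%E.
Proof.
move=> mg_ mg g1 gc e e0.
have := @dominated_cvg _ _ _ mu setT measurableT
  (fun k z => (`|g z - g_ k z| * w z)%:E) (cst 0%E) (EFin \o w).
have -> : (\int[mu]_x (cst 0%E : _ -> \bar R) x = 0)%E by rewrite integral0.
have m1 k : measurable_fun setT (fun z => (`|g z - g_ k z| * w z)%:E).
  by have := mg_ k => ?; mea.
move=> /(_ m1) H.
have {}H : (\int[mu]_x (`|g x - g_ k x| * w x)%:E @[k --> \oo] --> 0)%E.
  apply: H => //.
  - move=> z _; apply/cvg_EFin; first by near=> k.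
    rewrite -[X in _ --> X](mul0r (w z)); apply: cvgM; last exact: cvg_cst.
    rewrite -[X in _ --> X](@normr0 R R); apply: cvg_norm.
    rewrite -[X in _ --> X](subrr (g z)); apply: cvgB; [exact: cvg_cst|exact: gc].
  - move=> k z _; rewrite /= lee_fin normrM normr_id (ger0_norm (w0 z)).
    by rewrite ler_piMl.
have [k _ /(_ k (leqnn k))] : \forall k \near \oo, (dist g (g_ k) < e%:E)%E.
  apply: (H [set y | (y < e%:E)%E]).
  exact: (@open_ereal_lt' _ 0%E e%:E).
by exists k.
Unshelve. all: by end_near. Qed.

(** The sets with this property form a sigma-algebra containing the coordinate half-spaces, hence
    all measurable sets. The weight is an arbitrary integrable function, so that errors can later be
    measured against [|f|] or against an increment of [u]. *)
Definition approx A := measurable A /\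
  forall e : R, 0 < e -> exists2 f, Sm01 f & (dist (\1_A) f < e%:E)%E.

Let approx0 : approx set0.
Proof.
split=> // e e0; exists (fun=> 0).
  by split; [exact: Sm_cst|move=> z; rewrite lexx/=].
rewrite /dist; under eq_integral do rewrite indicE in_set0 subrr normr0 mul0r.
by rewrite integral0 lte_fin.
Qed.

Let approxC A : approx A -> approx (~` A).
Proof.
move=> [mA aA]; split; first exact: measurableC.
move=> e e0; have [f Sf fe] := aA e e0.
exists (fun z => 1 - f z); first exact: Sm01_onem.
rewrite (_ : dist _ _ = dist (\1_A) f)//.
apply: eq_integral => z _; congr (_ * _)%:E.
by rewrite !indicE in_setC; case: (_ \in _) => /=; rewrite distrC; congr `|_|; lra.
Qed.

Let approxI A B : approx A -> approx B -> approx (A `&` B).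
Proof.
move=> [mA aA] [mB aB]; split; first exact: measurableI.
move=> e e0; have e20 : 0 < e / 2 by rewrite divr_gt0.
have [f [Sf f01] fe] := aA _ e20; have [g [Sg g01] ge] := aB _ e20.
have mf := Sm_measurable Sf; have mg := Sm_measurable Sg.
exists (fun z => f z * g z); first exact: Sm01_mul.
apply: (@le_lt_trans _ _ (dist (\1_A) f + dist (\1_B) g)%E); last first.
  by rewrite [e]splitr EFinD lteD.
have m1 C : measurable C -> measurable_fun setT (\1_C : 'rV[R]_n -> R) by exact: mf_indic.
have ? := m1 _ mA; have ? := m1 _ mB; have ? := m1 _ (measurableI _ _ mA mB).
rewrite /dist -intD; last 4 first.
- by mea.
- by mea.
- by move=> z; rewrite lee_fin mulr_ge0.
- by move=> z; rewrite lee_fin mulr_ge0.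
apply: le_int.
- by mea.
- by mea.
- by move=> z; rewrite lee_fin mulr_ge0.
- move=> z; rewrite -EFinD lee_fin -mulrDl ler_wpM2r//.
  have -> : \1_(A `&` B) z = \1_A z * \1_B z :> R.
    by rewrite !indicE in_setI; case: (_ \in _); case: (_ \in _) => /=; rewrite ?mulr1 ?mulr0.
  set u := \1_A z : R; set v := \1_B z : R.
  have v01 : `|v| <= 1 by rewrite /v indicE; case: (_ \in _); rewrite /= ?normr1 ?normr0.
  have /andP[f0 f1] := f01 z.
  have -> : u * v - f z * g z = (u - f z) * v + f z * (v - g z) by ring.
  rewrite (le_trans (ler_normD _ _))// !normrM lerD//; first by rewrite ler_piMr.
  by rewrite ger0_norm// ler_piMl.
Qed.

Let approxU A B : approx A -> approx B -> approx (A `|` B).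
Proof.
move=> aA aB; rewrite -(setCK (A `|` B)) setCU.
by apply: approxC; apply: approxI; exact: approxC.
Qed.

Let approx_bigcup (F : (set 'rV[R]_n)^nat) : (forall i, approx (F i)) ->
  approx (\bigcup_i F i).
Proof.
move=> aF; have mF i : measurable (F i) by have [] := aF i.
split; first exact: bigcupT_measurable.
move=> e e0; have e20 : 0 < e / 2 by rewrite divr_gt0.
pose B k := \bigcup_(i in `I_k) F i.
have aB k : approx (B k).
  rewrite /B bigcup_mkord; elim: k => [|k ih]; first by rewrite big_ord0.
  by rewrite big_ord_recr/=; exact: approxU.
have mB k : measurable (B k) by have [] := aB k.
have m1 C : measurable C -> measurable_fun setT (\1_C : 'rV[R]_n -> R) by exact: mf_indic.
have mU : measurable (\bigcup_i F i) by exact: bigcupT_measurable.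
have [k Bk] : exists k, (dist (\1_(\bigcup_i F i)) (\1_(B k)) < (e / 2)%:E)%E.
  apply: dist_cvg => //.
  - move=> k z; rewrite !indicE.
    by case: (_ \in _); case: (_ \in _); rewrite /= ?subrr ?subr0 ?sub0r ?normrN ?normr0 ?normr1.
  - move=> z; have [[i _ Fi]|nF] := pselect ((\bigcup_i F i) z); last first.
      rewrite [X in _ --> X]indicE memNset//.
      rewrite (_ : (fun k => \1_(B k) z) = cst 0); first exact: cvg_cst.
      apply/funext => k; rewrite indicE memNset//.
      by move=> [i _ Fi]; apply: nF; exists i.
    apply: cvg_near_cst; near=> k.
    have Bz : B k z by exists i => //=; near: k; exact: nbhs_infty_gt.
    have Uz : (\bigcup_i F i) z by exists i.
    by rewrite !indicE !mem_set.
have [f Sf fe] := (aB k).2 _ e20; exists f => //.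
have mf : measurable_fun setT f by case: Sf => /Sm_measurable.
apply: (@le_lt_trans _ _ (dist (\1_(\bigcup_i F i)) (\1_(B k)) + dist (\1_(B k)) f)%E).
  by apply: dist_triangle => //; exact: m1.
by rewrite [e]splitr EFinD lteD.
Unshelve. all: by end_near. Qed.

Let approx_gt i (a : R) : approx [set z : 'rV[R]_n | a < z ord0 i].
Proof.
pose A := [set z : 'rV[R]_n | a < z ord0 i]; rewrite -/A.
have mA : measurable A.
  rewrite /A -[X in measurable X]setTI.
  rewrite (_ : [set z | _] = (fun z : 'rV[R]_n => z ord0 i) @^-1` `]a, +oo[).
    by apply: measurable_coord => //; exact: measurable_itv.
  by apply/seteqP; split => z /=; rewrite in_itv/= andbT.
split=> // e e0.
(* With slope [k] the bump is 0 off the half-space and [exp (-1 / (k (z_i - a)))] inside, which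
   tends to the indicator from below. *)
pose g_ (k : nat) (z : 'rV[R]_n) := bump 0 (k%:R * z ord0 i + - (k%:R * a)).
have Sg k : Sm01 (g_ k) by exact: Sm01_bump.
have [k ke] : exists k, (dist (\1_A) (g_ k) < e%:E)%E.
  apply: dist_cvg => //.
  - by move=> k; case: (Sg k) => /Sm_measurable.
  - move=> k z; have /andP[g0 g1] := (Sg k).2 z.
    rewrite indicE; case: (_ \in _) => /=; last by rewrite sub0r normrN ger0_norm.
    by rewrite ger0_norm ?subr_ge0//; lra.
  - move=> z; rewrite indicE; have [az|za] := ltP a (z ord0 i); last first.
      rewrite memNset/=; last by rewrite /A/= ltNge za.
      under eq_fun => k do rewrite /g_ -mulrBr bump_le0E ?mulr_ge0_le0 ?subr_le0//.
      exact: cvg_cst.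
    rewrite mem_set//=.
    have d0 : 0 < z ord0 i - a by rewrite subr_gt0.
    suff : expR (- (k%:R * (z ord0 i - a))^-1) @[k --> \oo] --> (1 : R).
      apply: cvg_trans; apply: near_eq_cvg; near=> k.
      have k0 : 0 < k%:R :> R by rewrite ltr0n; near: k; exact: nbhs_infty_gt.
      by rewrite /g_ -mulrBr bump_gt0E ?mulr_gt0// expr0 invr1 mul1r.
    rewrite -[X in _ --> X]expR0; apply: continuous_cvg; first exact: continuous_expR.
    rewrite -[X in _ --> X]oppr0; apply: cvgN.
    apply/gtr0_cvgV0.
      near=> k; rewrite mulr_gt0// ltr0n; near: k; exact: nbhs_infty_gt.
    apply/cvgryPge => M; near=> k.
    by rewrite -ler_pdivrMr//; near: k; exact: nbhs_infty_ger.
by exists (g_ k).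
Unshelve. all: by end_near. Qed.

Let approx_coord i (B : set R) : measurable B ->
  approx ((fun z : 'rV[R]_n => z ord0 i) @^-1` B).
Proof.
move=> mB.
have : <<s @RGenOInfty.G R >> B.
  have : (@ocitv R).-sigma.-measurable B := mB.
  by rewrite RGenOInfty.measurableE.
apply: (@smallest_sub _ (sigma_algebra setT) (@RGenOInfty.G R)
  [set B | approx ((fun z : 'rV[R]_n => z ord0 i) @^-1` B)]).
- split => /=.
  + by rewrite preimage_set0.
  + by move=> C aC; rewrite setTD preimage_setC; exact: approxC.
  + by move=> F aF; rewrite preimage_bigcup; exact: approx_bigcup.
- move=> C [a ->] /=.
  rewrite (_ : _ @^-1` _ = [set z : 'rV[R]_n | a < z ord0 i]); first exact: approx_gt.
  by apply/seteqP; split => z /=; rewrite in_itv/= andbT.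
Qed.

Lemma measurable_approx A : measurable A -> approx A.
Proof.
move=> mA; pose B := @tup2row R n @^-1` A.
have mB : measurable B by exact: mA.
suff : approx (@row2tup R n @^-1` B).
  rewrite (_ : _ @^-1` B = A)//; apply/seteqP; split => z; rewrite /B /=.
    by rewrite row2tupK.
  by rewrite /= row2tupK.
have : g_sigma_preimage (fun i (x : n.-tuple R) => tnth x i) B by exact: mB.
apply: (@smallest_sub _ (sigma_algebra setT) _ [set B | approx (@row2tup R n @^-1` B)]).
- split => /=.
  + by rewrite preimage_set0.
  + by move=> C aC; rewrite setTD preimage_setC; exact: approxC.
  + by move=> F aF; rewrite preimage_bigcup; exact: approx_bigcup.
- move=> C; rewrite -bigcup_seq => -[i _ [D mD <-]] /=.
  rewrite setTI (_ : _ @^-1` _ = (fun z : 'rV[R]_n => z ord0 i) @^-1` D); first exact: approx_coord.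
  by apply/seteqP; split => z /=; rewrite tnth_mktuple.
Qed.

Lemma smooth_approx A : measurable A -> forall e : R, 0 < e ->
  exists2 f, Sm01 f & (\int[mu]_z (`|\1_A z - f z| * w z)%:E < e%:E)%E.
Proof. by move=> /measurable_approx[]. Qed.

End smooth_approximation.

Ltac mea_ext ::= first [lazymatch goal with
  | |- measurable_fun _ (fun w_ => pw _ _) => apply: (mf_comp (measurable_pw _))
  | |- measurable_fun _ (fun w_ => G _ _) => apply: measurable_G
  | |- measurable_fun _ (fun w_ => nrm1 _) => apply: (mf_comp measurable_nrm1)
  | |- measurable_fun _ (fun w_ => sq _) => apply: (mf_comp measurable_sq)
  | |- measurable_fun _ (fun w_ => fun_of_matrix _ _ _) => apply: mf_coord
  end
  | match goal with
    | H : measurable_fun _ ?g |- measurable_fun _ (fun w_ => ?g _) => apply: (mf_comp H)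
    end
  | lazymatch goal with
  | |- measurable_fun _ (fun w_ => (_ + _)%R) => apply: mf_addrV
  | |- measurable_fun _ (fun w_ => (- _)%R) => apply: mf_opprV
  | |- measurable_fun _ (fun w_ => (_ *: _)%R) => apply: mf_scalerV
  end].

(** * Heat semigroup and Riesz potentials *)

Section fubini_curried.
Local Open Scope ereal_scope.
Context d1 d2 (T1 : measurableType d1) (T2 : measurableType d2) (R : realType).
Variable m1 : {sigma_finite_measure set T1 -> \bar R}.
Variable m2 : {sigma_finite_measure set T2 -> \bar R}.
Variable f : T1 -> T2 -> R.
Hypothesis mf : measurable_fun setT (fun p : T1 * T2 => f p.1 p.2).
Hypothesis fi : \int[m1]_x \int[m2]_y (`|f x y|%R)%:E < +oo.

Let fint : (m1 \x m2).-integrable setT (fun p => (f p.1 p.2)%:E).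
Proof. by apply/integrable12ltyP => //; exact: mf_EFin. Qed.

Lemma fubini : \int[m1]_x \int[m2]_y (f x y)%:E = \int[m2]_y \int[m1]_x (f x y)%:E.
Proof. exact: (Fubini fint). Qed.

Lemma fubini_integrable : m1.-integrable setT (fun x => \int[m2]_y (f x y)%:E).
Proof. exact: (integrable_fubini_F fint). Qed.

End fubini_curried.
Arguments fubini {d1 d2 T1 T2 R} m1 m2 f.
Arguments fubini_integrable {d1 d2 T1 T2 R} m1 m2 f.

Section int_fine.
Local Open Scope ereal_scope.
Context d (T : measurableType d) (R : realType) (m : {measure set T -> \bar R}).

(** [fine] replaces +oo by 0. Finiteness of the integral confines the points with [h = +oo] and
    [k > 0] to a null set. *)
Lemma int_fine (k : T -> R) (h : T -> \bar R) : measurable_fun setT k ->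
  measurable_fun setT h -> (forall x, 0 <= k x)%R -> (forall x, 0 <= h x) ->
  \int[m]_x ((k x)%:E * h x) < +oo ->
  \int[m]_x (k x * fine (h x))%:E = \int[m]_x ((k x)%:E * h x).
Proof.
move=> mk mh k0 h0 fin.
have i : m.-integrable setT (fun x => (k x)%:E * h x).
  apply/integrableP; split; first by mea.
  by under eq_integral do rewrite gee0_abs ?mule_ge0 ?lee_fin//.
apply: ge0_ae_eq_integral => //; try by mea.
- by move=> x _; rewrite lee_fin mulr_ge0// fine_ge0.
- by move=> x _; rewrite mule_ge0 ?lee_fin.
- have := integrable_ae measurableT i; apply: filterS => x /(_ I) fx _.
  rewrite EFinM; have := h0 x; case: (h x) fx => [r| |] //= + _.
  have := k0 x; rewrite le_eqVlt => /orP[/eqP<-|kx]; first by rewrite !mul0e.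
  by rewrite gt0_muley// lte_fin.
Qed.

End int_fine.

Section shift_signed.
Context {R : realType} {n : nat}.

Lemma integral_rV_shift (h : 'rV[R]_n) (f : 'rV[R]_n -> \bar R) :
  measurable_fun setT f ->
  (\int[lebn n]_x f (x + h)%R = \int[lebn n]_x f x)%E.
Proof.
move=> mf; rewrite [LHS]integralE [RHS]integralE; congr (_ - _)%E.
- rewrite -(@ge0_integral_rV_shift _ _ h f^\+%E)//.
  + by apply: eq_integral => x _; rewrite !funeposE.
  + exact: measurable_funepos.
- rewrite -(@ge0_integral_rV_shift _ _ h f^\-%E)//.
  + by apply: eq_integral => x _; rewrite !funenegE.
  + exact: measurable_funeneg.
Qed.

End shift_signed.

Section heat.
Local Open Scope ereal_scope.
Context {R : realType} {n : nat}.
Notation mu := (@lebn R n).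
Notation leb := (@lebesgue_measure R).
Notation E := ('rV[R]_n).
Implicit Types (g : E -> \bar R) (t T : R).

Definition heat t g (x : E) : \bar R := \int[mu]_y ((G t (y - x))%:E * g y).

(** For [0 < b < n / 2] this is convolution with a multiple of [|z| ^ (2 b - n)]. The usual factor
    [1 / Gamma b] is left out, and normalising constants appear as [kconst] and [Hinv]. *)
Definition riesz (b : R) g (x : E) : \bar R :=
  \int[leb]_t ((pw (b - 1) t)%:E * heat t g x).

Lemma Ge_ge0 t (z : E) : 0 <= (G t z)%:E. Proof. by rewrite lee_fin G_ge0. Qed.
Lemma pwe_ge0 (c t : R) : 0 <= (pw c t)%:E. Proof. by rewrite lee_fin pw_ge0. Qed.
Hint Resolve Ge_ge0 pwe_ge0 : core.

Lemma heat_ge0 t g x : (forall y, 0 <= g y) -> 0 <= heat t g x.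
Proof. by move=> g0; apply: int_ge0 => y; rewrite mule_ge0. Qed.

Lemma riesz_ge0 b g x : (forall y, 0 <= g y) -> 0 <= riesz b g x.
Proof. by move=> g0; apply: int_ge0 => t; rewrite mule_ge0// heat_ge0. Qed.

Lemma measurable_heat g d (T : measurableType d) (f : T -> R) (k : T -> E) :
  measurable_fun setT g -> (forall y, 0 <= g y) ->
  measurable_fun setT f -> measurable_fun setT k ->
  measurable_fun setT (fun w => heat (f w) g (k w)).
Proof.
move=> mg g0 mf mk.
apply: (measurable_int2 mu (fun w y => (G (f w) (y - k w))%:E * g y)); first by mea.
by move=> x y; rewrite mule_ge0.
Qed.

Lemma measurable_riesz b g d (T : measurableType d) (k : T -> E) :
  measurable_fun setT g -> (forall y, 0 <= g y) -> measurable_fun setT k ->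
  measurable_fun setT (fun w => riesz b g (k w)).
Proof.
move=> mg g0 mk.
apply: (measurable_int2 leb (fun w t => (pw (b - 1) t)%:E * heat t g (k w))).
  by mea; apply: measurable_heat => //; mea.
by move=> x y; rewrite mule_ge0// heat_ge0.
Qed.

Section nonneg.
Variable g : E -> \bar R.
Hypothesis mg : measurable_fun setT g.
Hypothesis g0 : forall y, 0 <= g y.

Let mh d (T : measurableType d) (f : T -> R) (k : T -> E) :
  measurable_fun setT f -> measurable_fun setT k ->
  measurable_fun setT (fun w => heat (f w) g (k w)).
Proof. by move=> mf mk; exact: measurable_heat. Qed.

Let h0 t x : 0 <= heat t g x. Proof. exact: heat_ge0. Qed.
Hint Resolve h0 : core.

Lemma le_heat t x g' : measurable_fun setT g' -> (forall y, g y <= g' y) ->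
  heat t g x <= heat t g' x.
Proof.
move=> mg' gg'; apply: le_int; try by mea.
- by move=> y; rewrite mule_ge0.
- by move=> y; rewrite lee_wpmul2l.
Qed.

Lemma le_riesz b x g' : measurable_fun setT g' -> (forall y, g y <= g' y) ->
  riesz b g x <= riesz b g' x.
Proof.
move=> mg' gg'; have g'0 y : 0 <= g' y by exact: le_trans (gg' y).
apply: le_int; try by mea; apply: measurable_heat; mea.
- by move=> y; rewrite mule_ge0.
- by move=> y; rewrite lee_wpmul2l// le_heat.
Qed.

Lemma heat_sym t (f : E -> \bar R) : measurable_fun setT f -> (forall y, 0 <= f y) ->
  \int[mu]_x (f x * heat t g x) = \int[mu]_y (g y * heat t f y).
Proof.
move=> mf f0.
transitivity (\int[mu]_x \int[mu]_y (f x * ((G t (y - x))%:E * g y))).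
  apply: eq_integral => x _; rewrite intZle//; first by mea.
  by move=> y; rewrite mule_ge0.
rewrite tonelli; last 2 first.
- by mea.
- by move=> x y; rewrite !mule_ge0.
apply: eq_integral => y _; rewrite -intZle//; last 2 first.
- by mea.
- by move=> x; rewrite mule_ge0.
apply: eq_integral => x _; rewrite -(GN t (y - x)) opprB.
by rewrite muleA muleC (muleC (f x)).
Qed.

Lemma riesz_sym b (f : E -> \bar R) : measurable_fun setT f -> (forall y, 0 <= f y) ->
  \int[mu]_x (f x * riesz b g x) = \int[mu]_y (g y * riesz b f y).
Proof.
move=> mf f0.
have H (p q : E -> \bar R) : measurable_fun setT p -> measurable_fun setT q ->
    (forall y, 0 <= p y) -> (forall y, 0 <= q y) ->
    \int[mu]_x (p x * riesz b q x) =
    \int[leb]_t ((pw (b - 1) t)%:E * \int[mu]_x (p x * heat t q x)).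
  move=> mp mq p0 q0.
  have hq d (T : measurableType d) (f' : T -> R) (k : T -> E) :
    measurable_fun setT f' -> measurable_fun setT k ->
    measurable_fun setT (fun w => heat (f' w) q (k w)).
    by move=> *; exact: measurable_heat.
  transitivity (\int[mu]_x \int[leb]_t (p x * ((pw (b - 1) t)%:E * heat t q x))).
    apply: eq_integral => x _; rewrite intZle//; first by mea; apply: hq; mea.
    by move=> t; rewrite mule_ge0// heat_ge0.
  rewrite tonelli; last 2 first.
  - by mea; apply: hq; mea.
  - by move=> x t; rewrite !mule_ge0// heat_ge0.
  apply: eq_integral => t _; rewrite -intZl ?pw_ge0//; last 2 first.
  - by mea; apply: hq; mea.
  - by move=> x; rewrite mule_ge0// heat_ge0.
  by apply: eq_integral => x _; rewrite muleCA.
rewrite (H f g mf mg f0 g0).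
rewrite (H g f mg mf g0 f0).
apply: eq_integral => t _.
by rewrite (heat_sym t mf f0).
Qed.

Lemma heat_conv s t x : (0 < s)%R -> (0 < t)%R ->
  heat s (heat t g) x = heat (s + t) g x.
Proof.
move=> s0 t0.
transitivity (\int[mu]_y \int[mu]_z ((G s (y - x))%:E * ((G t (z - y))%:E * g z))).
  apply: eq_integral => y _; rewrite intZl ?G_ge0//; first by mea.
  by move=> z; rewrite mule_ge0.
rewrite tonelli; last 2 first.
- by mea.
- by move=> y z; rewrite !mule_ge0.
apply: eq_integral => z _.
transitivity (\int[mu]_y (g z * (G s (y - x) * G t (z - y))%:E)).
  by apply: eq_integral => y _; rewrite muleC -muleA muleC EFinM -muleA (muleC (g z)).
rewrite intZle//; last 2 first.
- by mea.
- by move=> y; rewrite lee_fin mulr_ge0// G_ge0.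
rewrite muleC; congr (_ * _).
have H := @ge0_integral_rV_shift R n (- x) (fun y => (G s y * G t (z - x - y))%:E).
apply: etrans (G_conv (z - x) s0 t0); apply: etrans (H _ _).
- by apply: eq_integral => y _; rewrite opprB addrA subrK.
- by mea.
- by move=> y; rewrite lee_fin; apply: mulr_ge0; exact: G_ge0.
Qed.

Lemma heat_riesz b t x : (0 < t)%R ->
  heat t (riesz b g) x = \int[leb]_s ((pw (b - 1) s)%:E * heat (t + s) g x).
Proof.
move=> t0.
transitivity (\int[mu]_y \int[leb]_s ((G t (y - x))%:E * ((pw (b - 1) s)%:E * heat s g y))).
  apply: eq_integral => y _; rewrite intZl ?G_ge0//; first by mea; apply: mh; mea.
  by move=> s; rewrite mule_ge0.
rewrite tonelli; last 2 first.
- by mea; apply: mh; mea.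
- by move=> y s; rewrite !mule_ge0.
apply: eq_integral => s _; have [s0|s0] := ltP 0%R s; last first.
  by rewrite pw_neg//; under eq_integral do rewrite mul0e mule0; rewrite integral0 mul0e.
rewrite -heat_conv// /heat -intZl ?pw_ge0//; last 2 first.
- by mea; apply: mh; mea.
- by move=> y; rewrite mule_ge0// heat_ge0.
by apply: eq_integral => y _; rewrite muleCA.
Qed.

Lemma G_mass_shift t (x : E) : (0 < t)%R -> \int[mu]_y (G t (y - x))%:E = 1.
Proof.
move=> t0; rewrite (@ge0_integral_rV_shift _ _ (- x) (fun y => (G t y)%:E))//.
- exact: G_mass.
- by mea.
Qed.

Lemma heat_le_cst t x (M : R) : (0 < t)%R -> (forall y, g y <= M%:E) -> heat t g x <= M%:E.
Proof.
move=> t0 gM; have M0 : (0 <= M)%R by rewrite -lee_fin (le_trans (g0 0%R)).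
apply: (@le_trans _ _ (\int[mu]_y (M%:E * (G t (y - x))%:E))).
  apply: le_int; try by mea.
  - by move=> y; rewrite mule_ge0.
  - by move=> y; rewrite muleC lee_wpmul2r.
by rewrite intZl//; [rewrite G_mass_shift// mule1|mea].
Qed.

Lemma heat_le_int t x : (0 < t)%R ->
  heat t g x <= (@cG R n * t `^ (- (n%:R / 2)))%:E * \int[mu]_y g y.
Proof.
move=> t0; rewrite -intZl//; last by rewrite mulr_ge0 ?powR_ge0// ltW// cG_gt0.
apply: le_int; try by mea.
- by move=> y; rewrite mule_ge0.
- by move=> y; rewrite lee_wpmul2r// lee_fin G_le.
Qed.

Lemma heat_mass t : (0 < t)%R -> \int[mu]_x heat t g x = \int[mu]_x g x.
Proof.
move=> t0; rewrite /heat tonelli; last 2 first.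
- by mea.
- by move=> x y; rewrite mule_ge0.
apply: eq_integral => y _; under eq_integral do rewrite muleC.
rewrite intZle//; last by mea.
rewrite -[RHS]mule1; congr (_ * _); apply: etrans (G_mass_shift y t0).
by apply: eq_integral => x _; rewrite -GN opprB.
Qed.

End nonneg.

End heat.
#[global] Hint Resolve Ge_ge0 pwe_ge0 : core.

Ltac mea_nonneg := first
  [ assumption
  | by move=> ?; rewrite lee_fin ?powR_ge0 ?normr_ge0
  | idtac ].
Ltac mea_ext ::= first [lazymatch goal with
  | |- measurable_fun _ (fun w_ => pw _ _) => apply: (mf_comp (measurable_pw _))
  | |- measurable_fun _ (fun w_ => G _ _) => apply: measurable_G
  | |- measurable_fun _ (fun w_ => nrm1 _) => apply: (mf_comp measurable_nrm1)
  | |- measurable_fun _ (fun w_ => sq _) => apply: (mf_comp measurable_sq)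
  | |- measurable_fun _ (fun w_ => heat _ _ _) => apply: measurable_heat; [|mea_nonneg| |]
  | |- measurable_fun _ (fun w_ => riesz _ _ _) => apply: measurable_riesz; [|mea_nonneg|]
  | |- measurable_fun _ (fun w_ => fun_of_matrix _ _ _) => apply: mf_coord
  end
  | match goal with
    | H : measurable_fun _ ?g |- measurable_fun _ (fun w_ => ?g _) => apply: (mf_comp H)
    end
  | lazymatch goal with
  | |- measurable_fun _ (fun w_ => (_ + _)%R) => apply: mf_addrV
  | |- measurable_fun _ (fun w_ => (- _)%R) => apply: mf_opprV
  | |- measurable_fun _ (fun w_ => (_ *: _)%R) => apply: mf_scalerV
  end].

Section unfold.
Local Open Scope ereal_scope.
Context {R : realType} {n : nat}.
Implicit Types (g : 'rV[R]_n -> \bar R).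

Lemma heatE t g x : heat t g x = \int[lebn n]_y ((G t (y - x))%:E * g y).
Proof. by []. Qed.

Lemma rieszE b g x : riesz b g x =
  \int[@lebesgue_measure R]_t ((pw (b - 1) t)%:E * heat t g x).
Proof. by []. Qed.

End unfold.
#[global] Opaque heat riesz.

(** * Potentials of functions in L^p *)

Section Lp_potential.
Local Open Scope ereal_scope.
Context {R : realType} {n : nat}.
Notation mu := (@lebn R n).
Notation leb := (@lebesgue_measure R).
Notation E := ('rV[R]_n).
Variables (p b : R) (f : E -> R) (N : R).
Hypothesis p1 : (1 <= p)%R.
Hypothesis b0 : (0 < b)%R.
Hypothesis bp : (b < n%:R / (2 * p))%R.
Hypothesis mf : measurable_fun setT f.
Hypothesis fN : \int[mu]_x (`|f x| `^ p)%:E = N%:E.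

Let absf (x : E) := (`|f x|)%:E.
Let absp (x : E) := (`|f x| `^ p)%:E.
Let mabsf : measurable_fun setT absf. Proof. by rewrite /absf; mea. Qed.
Let mabsp : measurable_fun setT absp. Proof. by rewrite /absp; mea. Qed.
Let absf0 x : 0 <= absf x. Proof. by rewrite lee_fin. Qed.
Let absp0 x : 0 <= absp x. Proof. by rewrite lee_fin powR_ge0. Qed.
Let N0 : (0 <= N)%R.
Proof. by rewrite -lee_fin -fN; apply: int_ge0. Qed.
Let p0 : (0 < p)%R. Proof. by apply: lt_le_trans p1. Qed.

(** Above the level [d] the factor [(|y| / d) ^ (p - 1)] is at least 1. The free level takes the
    place of Hölder's inequality. *)
Lemma young_power (d y : R) : (0 < d)%R -> (`|y| <= d + d `^ (1 - p) * `|y| `^ p)%R.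
Proof.
move=> d0; have [yd|dy] := leP `|y|%R d.
  by rewrite (le_trans yd)// lerDl mulr_ge0 ?powR_ge0.
have y0 : (0 < `|y|)%R by exact: lt_trans dy.
have {1}-> : (`|y| = `|y| `^ (1 - p) * `|y| `^ p)%R.
  by rewrite -powRD ?subrK ?powRr1// (gt_eqF y0) implybT.
apply: (@le_trans _ _ (d `^ (1 - p) * `|y| `^ p))%R; last by rewrite lerDr ltW.
rewrite ler_wpM2r ?powR_ge0//.
rewrite -opprB !powRN lef_pV2 ?posrE ?powR_gt0//.
by rewrite ge0_ler_powR ?subr_ge0 ?nnegrE ?(ltW d0)// ltW.
Qed.

Lemma heat_young t d x : (0 < t)%R -> (0 < d)%R ->
  heat t absf x <= d%:E + (d `^ (1 - p))%:E * heat t absp x.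
Proof.
move=> t0 d0; rewrite !heatE.
apply: (@le_trans _ _ (\int[mu]_y (d%:E * (G t (y - x))%:E +
    (d `^ (1 - p))%:E * ((G t (y - x))%:E * absp y)))).
  apply: le_int; try by mea.
  - by move=> y; apply: mule_ge0.
  - move=> y; rewrite muleCA (muleC d%:E) -ge0_muleDr ?lee_fin ?(ltW d0) ?mulr_ge0 ?powR_ge0//.
    by rewrite ler_wpM2l ?G_ge0// young_power.
rewrite intD; try by mea.
- rewrite intZl ?(ltW d0)//; last by mea.
  rewrite G_mass_shift// mule1 intZl ?powR_ge0//; first by mea.
  by move=> y; rewrite mule_ge0.
- by move=> y; rewrite mule_ge0// lee_fin ltW.
- by move=> y; rewrite !mule_ge0// lee_fin powR_ge0.
Qed.

Let k := (n%:R / (2 * p))%R.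
Let c := (k - b)%R.
Let CN := (1 + @cG R n * N)%R.
Let c0 : (0 < c)%R. Proof. by rewrite subr_gt0. Qed.
Let CN0 : (0 < CN)%R.
Proof. by rewrite ltr_wpDr// mulr_ge0// ltW// cG_gt0. Qed.

(** The level [d = t ^ (-k)] with [k = n / (2 p)] gives both terms of [heat_young] the same power of
    [t], since the heat kernel is at most a multiple of [t ^ (-n/2)]. *)
Lemma heat_Lp t x : (0 < t)%R -> heat t absf x <= (CN * t `^ (- k))%:E.
Proof.
move=> t0; have d0 : (0 < t `^ (- k))%R by rewrite powR_gt0.
apply: le_trans (heat_young x t0 d0) _.
have := heat_le_int mabsp absp0 x t0; rewrite fN => h.
apply: (@le_trans _ _ ((t `^ (- k))%:E + (t `^ (- k) `^ (1 - p))%:E *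
   ((@cG R n * t `^ (- (n%:R / 2)))%:E * N%:E))).
  by rewrite leeD2l// lee_wpmul2l// lee_fin powR_ge0.
rewrite -!EFinM -EFinD lee_fin /CN mulrDl mul1r lerD2l.
rewrite -powRrM mulrCA -!mulrA ler_wpM2l//; first by rewrite ltW// cG_gt0.
rewrite mulrA mulrC ler_wpM2l// -powRD ?(gt_eqF t0) ?implybT//.
rewrite le_eqVlt (_ : (_ + _ = - k)%R) ?eqxx// /k; field.
by rewrite (gt_eqF p0).
Qed.

(** For large times the potential of [|f|] has a uniform bound; for small times only the potential
    of [|f| ^ p] is under control, and only after integration in space. *)
Definition nearpart (T : R) (x : E) : \bar R :=
  \int[leb]_t ((pw (b - 1) t * (t < T)%R%:R)%:E * heat t absp x).

Let hp0 t x : 0 <= heat t absp x. Proof. exact: heat_ge0. Qed.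
Let hf0 t x : 0 <= heat t absf x. Proof. exact: heat_ge0. Qed.
Let wb0 (e t : R) (B : bool) : (0 <= pw e t * B%:R)%R.
Proof. by rewrite mulr_ge0// pw_ge0. Qed.

Lemma nearpart_ge0 T x : 0 <= nearpart T x.
Proof. by apply: int_ge0 => t; rewrite mule_ge0// lee_fin. Qed.

Lemma measurable_nearpart T : measurable_fun setT (nearpart T).
Proof.
apply: (measurable_int2 leb (fun x t => (pw (b - 1) t * (t < T)%R%:R)%:E * heat t absp x)).
  by mea.
by move=> x t; rewrite mule_ge0// lee_fin.
Qed.

Lemma int_nearpart T : (0 < T)%R -> \int[mu]_x nearpart T x = (T `^ b / b * N)%:E.
Proof.
move=> T0; rewrite /nearpart tonelli; last 2 first.
- by mea.
- by move=> x t; rewrite mule_ge0// lee_fin.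
transitivity (\int[leb]_t ((pw (b - 1) t * (t < T)%R%:R)%:E * N%:E)).
  apply: eq_integral => t _; rewrite intZl//; last by mea.
  have [t0|t0] := ltP 0%R t; last by rewrite pw_neg// mul0r !mul0e.
  by rewrite heat_mass// fN.
rewrite intZr//; last 2 first.
- by mea.
- by move=> x; rewrite lee_fin.
by rewrite integral_pw_near.
Qed.

Lemma riesz_near_far e T x : (0 < e)%R -> (0 < T)%R ->
  riesz b absf x <= (e * (T `^ b / b) + CN * (T `^ (- c) / c))%:E +
    (e `^ (1 - p))%:E * nearpart T x.
Proof.
move=> e0 T0.
apply: (@le_trans _ _ (\int[leb]_t (e%:E * (pw (b - 1) t * (t < T)%R%:R)%:E +
   CN%:E * (pw (- c - 1) t * (T <= t)%R%:R)%:E +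
   (e `^ (1 - p))%:E * ((pw (b - 1) t * (t < T)%R%:R)%:E * heat t absp x)))).
  rewrite rieszE; apply: le_int.
  - by mea.
  - by mea.
  - by move=> t; rewrite mule_ge0.
  - move=> t; have [t0|t0] := ltP 0%R t; last first.
      by rewrite !pw_neg// !mul0r !mul0e !mule0 !adde0.
    have [tT|Tt] := ltP t T.
      rewrite mulr0 mule0 adde0 mulr1.
      apply: (@le_trans _ _ ((pw (b - 1) t)%:E * (e%:E + (e `^ (1 - p))%:E * heat t absp x))).
        by apply: lee_wpmul2l; [exact: pwe_ge0|exact: (heat_young x t0 e0)].
      rewrite ge0_muleDr ?lee_fin ?(ltW e0)//; last by rewrite mule_ge0// lee_fin powR_ge0.
      by rewrite muleC muleCA.
    rewrite mulr0 mul0e !mule0 adde0 add0e mulr1.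
    apply: (@le_trans _ _ ((pw (b - 1) t)%:E * (CN * t `^ (- k))%:E)).
      by apply: lee_wpmul2l; [exact: pwe_ge0|exact: (heat_Lp x t0)].
    rewrite -!EFinM lee_fin !pwE// mulrCA ler_wpM2l ?(ltW CN0)//.
    rewrite -powRD ?(gt_eqF t0) ?implybT// le_eqVlt.
    by rewrite (_ : (b - 1 + - k = - c - 1)%R) ?eqxx// /c; ring.
rewrite intD; last 4 first.
- by mea.
- by mea.
- by move=> t; rewrite adde_ge0// mule_ge0// lee_fin// ltW.
- by move=> t; rewrite !mule_ge0// lee_fin// powR_ge0.
rewrite intD; last 4 first.
- by mea.
- by mea.
- by move=> t; rewrite mule_ge0// lee_fin// ltW.
- by move=> t; rewrite mule_ge0// lee_fin// ltW.
rewrite intZl ?(ltW e0)//; last 2 first.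
- by mea.
- by move=> t; rewrite lee_fin.
rewrite intZl ?(ltW CN0)//; last 2 first.
- by mea.
- by move=> t; rewrite lee_fin.
rewrite integral_pw_near// integral_pw_far// intZl ?powR_ge0//.
- by mea.
- by move=> t; rewrite mule_ge0// lee_fin.
Qed.

Lemma riesz_pair_fin (psi : E -> R) (M : R) : measurable_fun setT psi ->
  (forall x, 0 <= psi x <= M)%R -> \int[mu]_x (psi x)%:E < +oo ->
  \int[mu]_x ((psi x)%:E * riesz b absf x) < +oo.
Proof.
move=> mpsi psiM psifin.
have psi0 x : (0 <= psi x)%R by have /andP[] := psiM x.
have M0 : (0 <= M)%R by have /andP[/le_trans] := psiM 0%R; apply.
have mnp := measurable_nearpart 1.
pose K := (1 * (1 `^ b / b) + CN * (1 `^ (- c) / c))%R.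
have K0 : (0 <= K)%R.
  by rewrite /K !powR1 addr_ge0// mulr_ge0// ?divr_ge0// ?(ltW CN0) ?(ltW b0) ?(ltW c0).
apply: (@le_lt_trans _ _ (\int[mu]_x (K%:E * (psi x)%:E + M%:E * nearpart 1 x))).
  apply: le_int.
  - by mea.
  - by mea.
  - by move=> x; rewrite mule_ge0 ?lee_fin// riesz_ge0.
  - move=> x; have := riesz_near_far x ltr01 ltr01; rewrite -/K powR1 mul1e => h.
    apply: (@le_trans _ _ ((psi x)%:E * (K%:E + nearpart 1 x))).
      by rewrite lee_wpmul2l// lee_fin.
    rewrite ge0_muleDr ?lee_fin ?nearpart_ge0// muleC leeD2l// lee_wpmul2r ?nearpart_ge0//.
    by rewrite lee_fin; have /andP[] := psiM x.
rewrite intD; last 4 first.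
- by mea.
- by mea.
- by move=> x; rewrite mule_ge0// lee_fin.
- by move=> x; rewrite mule_ge0 ?lee_fin// nearpart_ge0.
rewrite [X in X + _]intZl; [|by mea|by move=> x; rewrite lee_fin|by []].
rewrite [X in _ + X]intZl; [|by []|exact: nearpart_ge0|by []].
rewrite int_nearpart// lte_add_pinfty//.
- by rewrite lte_mul_pinfty// ?lee_fin.
- by rewrite -EFinM ltry.
Qed.

Lemma riesz_level_fin (l : R) : (0 < l)%R ->
  mu [set x | l%:E < riesz b absf x] < +oo.
Proof.
move=> l0.
(* [T] and then [e] make each of the two constants in [riesz_near_far] equal to [l / 4]; the
   remaining [l / 2] is left to Chebyshev's inequality for [nearpart]. *)
pose T := ((l * c / (4 * CN)) `^ (- c^-1))%R.
have q0 : (0 < l * c / (4 * CN))%R by rewrite divr_gt0// mulr_gt0.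
have T0 : (0 < T)%R by rewrite powR_gt0.
have Tc : (T `^ (- c) = l * c / (4 * CN))%R.
  by rewrite /T -powRrM mulrNN mulVf ?gt_eqF// powRr1// ltW.
pose e := (l * b / (4 * T `^ b))%R.
have Tb0 : (0 < T `^ b)%R by rewrite powR_gt0.
have e0 : (0 < e)%R by rewrite divr_gt0// mulr_gt0.
have h x : riesz b absf x <= (l / 2)%:E + (e `^ (1 - p))%:E * nearpart T x.
  apply: le_trans (riesz_near_far x e0 T0) _.
  rewrite Tc (_ : (_ + _ = l / 2)%R)// /e; field.
  by rewrite !gt_eqF.
have mnp := measurable_nearpart T.
have mr : measurable_fun setT (riesz b absf) by apply: measurable_riesz => //; mea.
have mg : measurable_fun setT (fun x => (e `^ (1 - p))%:E * nearpart T x) by mea.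
have l20 : (0 < l / 2)%R by rewrite divr_gt0.
have H : (l / 2)%:E * mu [set x | (l / 2)%:E <= `|(e `^ (1 - p))%:E * nearpart T x|] <=
    \int[mu]_x `|(e `^ (1 - p))%:E * nearpart T x|.
  by have := le_integral_abse mu measurableT mg l20; rewrite setTI.
have fin : mu [set x | (l / 2)%:E <= `|(e `^ (1 - p))%:E * nearpart T x|] < +oo.
  move: H; set S := mu _ => H; rewrite ltNge leye_eq; apply/negP => /eqP SE.
  move: H; rewrite SE gt0_muley ?lte_fin// leye_eq => /eqP.
  under eq_integral do rewrite gee0_abs ?mule_ge0 ?nearpart_ge0 ?lee_fin ?powR_ge0//.
  rewrite (@intZl _ _ _ mu (e `^ (1 - p)) (nearpart T) mnp (nearpart_ge0 T) (powR_ge0 _ _)).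
  by rewrite int_nearpart.
apply: le_lt_trans fin; apply: le_measure; rewrite ?inE.
- by rewrite -[X in measurable X]setTI; apply: emeasurable_fun_o_infty.
- rewrite -[X in measurable X]setTI; apply: emeasurable_fun_c_infty => //.
  exact: mf_abse.
- move=> x /= lx; rewrite gee0_abs ?mule_ge0 ?nearpart_ge0 ?lee_fin ?powR_ge0//.
  have := lt_le_trans lx (h x); rewrite {1}[l]splitr EFinD lteD2lE// => /ltW.
  by [].
Qed.

End Lp_potential.

Section four_integrals.
Local Open Scope ereal_scope.
Context d (T : measurableType d) (R : realType) (m : {measure set T -> \bar R}).

Lemma int4 (a1 a2 a3 a4 : T -> R) :
  m.-integrable setT (fun x => (a1 x)%:E) -> m.-integrable setT (fun x => (a2 x)%:E) ->
  m.-integrable setT (fun x => (a3 x)%:E) -> m.-integrable setT (fun x => (a4 x)%:E) ->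
  m.-integrable setT (fun x => (a1 x + a2 x - (a3 x + a4 x))%:E) /\
  \int[m]_x (a1 x + a2 x - (a3 x + a4 x))%:E =
  \int[m]_x (a1 x)%:E + \int[m]_x (a2 x)%:E - (\int[m]_x (a3 x)%:E + \int[m]_x (a4 x)%:E).
Proof.
move=> i1 i2 i3 i4.
rewrite (_ : (fun x => (a1 x + a2 x - (a3 x + a4 x))%:E) =
  ((fun x => (a1 x)%:E) \+ (fun x => (a2 x)%:E)) \-
  ((fun x => (a3 x)%:E) \+ (fun x => (a4 x)%:E)))//.
have i12 := integrableD measurableT i1 i2; have i34 := integrableD measurableT i3 i4.
split; first exact: (integrableB measurableT i12 i34).
rewrite (integralB measurableT i12 i34).
by rewrite (integralD measurableT i1 i2) (integralD measurableT i3 i4).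
Qed.

End four_integrals.

(** * The signed potential and its symmetry *)

Section duality.
Local Open Scope ereal_scope.
Context {R : realType} {n : nat}.
Notation mu := (@lebn R n).
Notation E := ('rV[R]_n).
Variable b : R.
Implicit Types f g : E -> R.

Definition pp f (x : E) : \bar R := (Num.max (f x) 0)%:E.
(** Either potential may be infinite at some points, where [fine] assigns 0; by [int_fine], pairings
    that converge absolutely do not see this. *)
Definition sriesz f (x : E) : R :=
  (fine (riesz b (pp f) x) - fine (riesz b (pp (fun y => - f y)) x))%R.
Definition pairing f g := \int[mu]_x (pp f x * riesz b (pp g) x).

Lemma pp_ge0 f x : 0 <= pp f x.
Proof. by rewrite /pp lee_fin le_max lexx orbT. Qed.

Lemma measurable_pp f : measurable_fun setT f -> measurable_fun setT (pp f).
Proof. by move=> mf; rewrite /pp; mea. Qed.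

Lemma pp_le f x : pp f x <= (`|f x|)%:E.
Proof. by rewrite /pp lee_fin ge_max ler_norm normr_ge0. Qed.

Lemma ppB f x : f x = (Num.max (f x) 0 - Num.max (- f x) 0)%R.
Proof.
have [f0|f0] := leP 0%R (f x).
  by rewrite max_r ?subr0// oppr_le0.
by rewrite max_l ?sub0r ?opprK// oppr_ge0 ltW.
Qed.

Lemma measurable_sriesz f : measurable_fun setT f -> measurable_fun setT (sriesz f).
Proof.
move=> mf; rewrite /sriesz; apply: mfB; apply: mf_fine; apply: measurable_riesz.
- exact: measurable_pp.
- exact: pp_ge0.
- exact: measurable_id.
- by apply: measurable_pp; mea.
- exact: pp_ge0.
- exact: measurable_id.
Qed.

Lemma pairing_sym f g : measurable_fun setT f -> measurable_fun setT g ->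
  pairing f g = pairing g f.
Proof.
by move=> mf mg; apply: riesz_sym; [exact: measurable_pp|exact: pp_ge0|
  exact: measurable_pp|exact: pp_ge0].
Qed.

Definition dual_fin f g := \int[mu]_x ((`|f x|)%:E * riesz b (fun y => (`|g y|)%:E) x) < +oo.

Lemma dual_fin_sym f g : measurable_fun setT f -> measurable_fun setT g ->
  dual_fin f g -> dual_fin g f.
Proof.
by move=> mf mg; rewrite /dual_fin riesz_sym//; mea.
Qed.

(** Splitting both factors by sign gives four pairings of nonnegative functions, all finite by
    comparison with [dual_fin]. Each of them is symmetric, which yields [sriesz_dual]. *)
Lemma sriesz_pair f g : measurable_fun setT f -> measurable_fun setT g -> dual_fin f g ->
  mu.-integrable setT (fun x => (f x * sriesz g x)%:E) /\
  \int[mu]_x (f x * sriesz g x)%:E =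
  (pairing f g + pairing (fun x => - f x)%R (fun x => - g x)%R) -
  (pairing f (fun x => - g x)%R + pairing (fun x => - f x)%R g).
Proof.
move=> mf mg fin.
have K f' g' : measurable_fun setT f' -> measurable_fun setT g' ->
    (forall x, `|f' x| = `|f x|)%R -> (forall x, `|g' x| = `|g x|)%R ->
    mu.-integrable setT (fun x => (Num.max (f' x) 0 * fine (riesz b (pp g') x))%:E) /\
    \int[mu]_x (Num.max (f' x) 0 * fine (riesz b (pp g') x))%:E = pairing f' g'.
  move=> mf' mg' ff' gg'; have mpg := measurable_pp mg'.
  have mr : measurable_fun setT (fun x => riesz b (pp g') x).
    by apply: measurable_riesz => //; exact: pp_ge0.
  have m0 x : (0 <= Num.max (f' x) 0)%R by rewrite le_max lexx orbT.
  have F : pairing f' g' < +oo.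
    apply: le_lt_trans fin; apply: le_int.
    - by rewrite /pp; mea.
    - by mea.
    - by move=> x; rewrite mule_ge0 ?pp_ge0// riesz_ge0// => y; exact: pp_ge0.
    - move=> x; apply: lee_pmul.
      + exact: pp_ge0.
      + by apply: riesz_ge0 => y; exact: pp_ge0.
      + by rewrite -ff'; exact: pp_le.
      + apply: le_riesz => //; first exact: pp_ge0.
        * by mea.
        * by move=> y; rewrite -gg'; exact: pp_le.
  have e : \int[mu]_x (Num.max (f' x) 0 * fine (riesz b (pp g') x))%:E = pairing f' g'.
    apply: int_fine => //; first by mea.
    by move=> x; apply: riesz_ge0 => y; exact: pp_ge0.
  split=> //; apply/integrableP; split; first by mea.
  under eq_integral => x _.
    rewrite gee0_abs; last first.
      by rewrite lee_fin mulr_ge0// fine_ge0// riesz_ge0// => y; exact: pp_ge0.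
    over.
  by rewrite e.
have mNf : measurable_fun setT (fun x => - f x)%R by mea.
have mNg : measurable_fun setT (fun x => - g x)%R by mea.
have nf x : (`|- f x| = `|f x|)%R by rewrite normrN.
have ng x : (`|- g x| = `|g x|)%R by rewrite normrN.
have [i1 e1] := K f g mf mg (fun=> erefl) (fun=> erefl).
have [i2 e2] := K _ _ mNf mNg nf ng.
have [i3 e3] := K _ _ mf mNg (fun=> erefl) ng.
have [i4 e4] := K _ _ mNf mg nf (fun=> erefl).
have [i e] := int4 i1 i2 i3 i4.
have aux (x1 x2 x3 x4 y1 y2 y3 y4 : \bar R) : x1 = y1 -> x2 = y2 -> x3 = y3 -> x4 = y4 ->
  x1 + x2 - (x3 + x4) = y1 + y2 - (y3 + y4) by move=> -> -> -> ->.
have {}e := etrans e (aux _ _ _ _ _ _ _ _ e1 e2 e3 e4).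
have aux2 (u v w z : R) : ((u - v) * (w - z) = u * w + v * z - (u * z + v * w))%R by ring.
have dec : (fun x : E => (f x * sriesz g x)%:E) = (fun x =>
   (Num.max (f x) 0 * fine (riesz b (pp g) x) +
    Num.max (- f x) 0 * fine (riesz b (pp (fun y => - g y)) x) -
    (Num.max (f x) 0 * fine (riesz b (pp (fun y => - g y)) x) +
     Num.max (- f x) 0 * fine (riesz b (pp g) x)))%:E)%R.
  apply/funext => x; rewrite /sriesz {1}(ppB f x); congr EFin.
  exact: aux2.
by rewrite dec; split; [exact: i|exact: e].
Qed.

#[local] Opaque pairing sriesz.

Lemma sriesz_dual f g : measurable_fun setT f -> measurable_fun setT g -> dual_fin f g ->
  \int[mu]_x (f x * sriesz g x)%:E = \int[mu]_x (g x * sriesz f x)%:E.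
Proof.
move=> mf mg fin.
have mNf : measurable_fun setT (fun x : E => - f x)%R by mea.
have mNg : measurable_fun setT (fun x : E => - g x)%R by mea.
apply: etrans (proj2 (sriesz_pair mf mg fin)) _; apply: esym.
apply: etrans (proj2 (sriesz_pair mg mf (dual_fin_sym mf mg fin))) _.
rewrite (pairing_sym mf mg) (pairing_sym mNf mNg) (pairing_sym mf mNg) (pairing_sym mNf mg).
have aux (x y z w : \bar R) : x + y - (z + w) = x + y - (w + z) by rewrite (addeC z).
exact: aux.
Qed.

End duality.

(** * The fractional divergence as a Riesz potential *)

Section fubini_sub.
Local Open Scope ereal_scope.
Context d1 d2 (T1 : measurableType d1) (T2 : measurableType d2) (R : realType).
Variable m1 : {sigma_finite_measure set T1 -> \bar R}.
Variable m2 : {sigma_finite_measure set T2 -> \bar R}.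

Lemma fubini_sub (f g : T1 -> T2 -> R) :
  measurable_fun setT (fun p : T1 * T2 => f p.1 p.2) ->
  measurable_fun setT (fun p : T1 * T2 => g p.1 p.2) ->
  (forall x y, 0 <= f x y)%R -> (forall x y, 0 <= g x y)%R ->
  \int[m1]_x \int[m2]_y (f x y)%:E < +oo -> \int[m1]_x \int[m2]_y (g x y)%:E < +oo ->
  \int[m1]_x \int[m2]_y (f x y - g x y)%:E =
  \int[m1]_x \int[m2]_y (f x y)%:E - \int[m1]_x \int[m2]_y (g x y)%:E.
Proof.
move=> mf mg f0 g0 ff gf.
have K (k : T1 -> T2 -> R) : measurable_fun setT (fun p : T1 * T2 => k p.1 p.2) ->
    (forall x y, 0 <= k x y)%R -> \int[m1]_x \int[m2]_y (k x y)%:E < +oo ->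
    (m1 \x m2).-integrable setT (fun p => (k p.1 p.2)%:E).
  move=> mk k0 kf; apply/integrable12ltyP; first exact: mf_EFin.
  apply: le_lt_trans kf; rewrite le_eqVlt; apply/orP; left; apply/eqP.
  by apply: eq_integral => x _; apply: eq_integral => y _; rewrite gee0_abs ?lee_fin.
have fi := K f mf f0 ff; have gi := K g mg g0 gf.
have fgi := integrableB measurableT fi gi.
have e1 := integral12_prod_meas1 fi; have e2 := integral12_prod_meas1 gi.
have e3 := integral12_prod_meas1 fgi.
apply: etrans e3 _; rewrite (integralB measurableT fi gi).
by congr (_ - _); apply: esym.
Qed.

End fubini_sub.
Arguments fubini_sub {d1 d2 T1 T2 R} m1 m2 f g.

Section power_bounds.
Local Open Scope ereal_scope.
Context {R : realType}.
Notation leb := (@lebesgue_measure R).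

(** The general estimate of a time integral: one power integrable at 0 below [T], another integrable
    at infinity above it. Optimisation in time is a choice of [T] here. *)
Lemma pw_split_bound (k : R -> \bar R) (c1 c2 A B T : R) : (0 < c1)%R -> (0 < c2)%R ->
  (0 < T)%R -> (0 <= A)%R -> (0 <= B)%R -> measurable_fun setT k -> (forall t, 0 <= k t) ->
  (forall t, (t <= 0)%R -> k t = 0) ->
  (forall t, (0 < t < T)%R -> k t <= (A * t `^ (c1 - 1))%:E) ->
  (forall t, (T <= t)%R -> k t <= (B * t `^ (- c2 - 1))%:E) ->
  \int[leb]_t k t <= (A * (T `^ c1 / c1) + B * (T `^ (- c2) / c2))%:E.
Proof.
move=> c10 c20 T0 A0 B0 mk k0 kn kA kB.
apply: (@le_trans _ _ (\int[leb]_t (A%:E * (pw (c1 - 1) t * (t < T)%R%:R)%:E +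
   B%:E * (pw (- c2 - 1) t * (T <= t)%R%:R)%:E))).
  apply: le_int => //; first by mea.
  move=> t; have [t0|t0] := ltP 0%R t; last first.
    by rewrite kn// !pw_neg// !mul0r !mule0 adde0.
  rewrite !pwE//; have [tT|Tt] := ltP t T.
    by rewrite mulr1 mulr0 mule0 adde0 -EFinM; apply: kA; rewrite t0.
  by rewrite mulr0 mulr1 mule0 add0e -EFinM; exact: kB.
have wb0 e (t : R) (C : bool) : 0 <= (pw e t * C%:R)%:E.
  by rewrite lee_fin mulr_ge0// pw_ge0.
rewrite intD; last 4 first.
- by mea.
- by mea.
- by move=> t; rewrite mule_ge0.
- by move=> t; rewrite mule_ge0.
rewrite [X in X + _]intZl//; last by mea.
rewrite [X in _ + X]intZl//; last by mea.
by rewrite integral_pw_near// integral_pw_far.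
Qed.

Lemma exp_power_bound (m : nat) (t : R) : (0 < t)%R -> (expR (- t) <= m`!%:R * t ^- m)%R.
Proof.
move=> t0; have := bump_norm m t^-1.
rewrite ger0_norm ?bump_ge0// bump_gt0E ?invr_gt0// invrK exprVn invrK => h.
by rewrite ler_pdivlMr ?exprn_gt0// mulrC.
Qed.

Lemma powR_le_far (c d t : R) : (1 <= t)%R -> (c <= d)%R -> (t `^ c <= t `^ d)%R.
Proof. by move=> t1 cd; rewrite ler_powR. Qed.

Lemma powR_le_near (c d t : R) : (0 < t < 1)%R -> (c <= d)%R -> (t `^ d <= t `^ c)%R.
Proof.
move=> /andP[t0 t1] cd.
have := @ler_powR _ t^-1 _ _ _ cd; rewrite invf_ge1// (ltW t1) => /(_ isT).
rewrite -!powR_inv1 ?(ltW t0)// -!powRrM !mulN1r !powRN lef_pV2 ?posrE ?powR_gt0//.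
Qed.

(** An infinite integral would become 0 under [fine], so convergence has to be shown along with a
    positive lower bound. *)
Lemma Gamma_fun_gt0 (s : R) : (0 < s)%R -> (0 < Gamma_fun s)%R.
Proof.
move=> s0; rewrite /Gamma_fun.
have -> : \int[leb]_(t in [set t : R | (0 < t)%R]) (powR t (s - 1) * expR (- t))%:E =
          \int[leb]_t (pw (s - 1) t * expR (- t))%:E.
  rewrite integral_mkcond; apply: eq_integral => t _; rewrite patchE.
  have [t0|t0] := ltP 0%R t; first by rewrite mem_set// pwE.
  by rewrite memNset/= ?pw_neg ?mul0r// ltNge t0.
have nn t : 0 <= (pw (s - 1) t * expR (- t))%:E.
  by rewrite lee_fin mulr_ge0 ?pw_ge0 ?expR_ge0.
rewrite fine_gt0//; apply/andP; split.
  apply: (@lt_le_trans _ _ (\int[leb]_t ((expR (-1))%:E * (pw (s - 1) t * (t < 1)%R%:R)%:E))).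
    rewrite intZl ?expR_ge0//; last 2 first.
    - by mea.
    - by move=> t; rewrite lee_fin mulr_ge0// pw_ge0.
    by rewrite integral_pw_near// -EFinM lte_fin mulr_gt0 ?expR_gt0// divr_gt0// powR_gt0.
  apply: le_int => //; try by mea.
  - by move=> t; rewrite mule_ge0 ?lee_fin ?expR_ge0// mulr_ge0// pw_ge0.
  - move=> t; rewrite -EFinM lee_fin mulrC; have [t1|t1] := ltP t 1%R; last first.
      by rewrite mulr0 mul0r -lee_fin.
    by rewrite mulr1 ler_wpM2l ?pw_ge0// ler_expR lerN2 ltW.
have [m sm] : exists m : nat, (s + 1 <= m%:R)%R.
  by exists (Num.bound (s + 1)); rewrite ltW// (le_lt_trans _ (archi_boundP _))//; lra.
apply: (@le_lt_trans _ _ (1 * (1 `^ s / s) + m`!%:R * (1 `^ (- 1) / 1))%:E); last exact: ltry.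
apply: pw_split_bound => //.
- by mea.
- by move=> t t0; rewrite pw_neg// mul0r.
- move=> t /andP[t0 t1]; rewrite pwE// mul1r lee_fin ler_piMr ?powR_ge0//.
  by rewrite -expR0 ler_expR oppr_le0 ltW.
- move=> t t1; have t0 : (0 < t)%R by exact: lt_le_trans t1.
  rewrite pwE// lee_fin; apply: (@le_trans _ _ (t `^ (s - 1) * (m`!%:R * t ^- m))%R).
    by rewrite ler_wpM2l ?powR_ge0// exp_power_bound.
  rewrite mulrCA ler_wpM2l// -powR_mulrn ?(ltW t0)// -powRN -powRD ?(gt_eqF t0) ?implybT//.
  by rewrite powR_le_far//; lra.
Qed.

Lemma mu_const_gt0 n (a : R) : (0 < a < 1)%R -> (0 < mu_const n a)%R.
Proof.
move=> /andP[a0 a1]; rewrite /mu_const.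
have h1 : (0 < (n%:R + a + 1) / 2)%R by rewrite divr_gt0//; have := ler0n R n; lra.
have h2 : (0 < (1 - a) / 2)%R by rewrite divr_gt0// subr_gt0.
by rewrite divr_gt0 ?Gamma_fun_gt0// !mulr_gt0 ?Gamma_fun_gt0 ?powR_gt0// pi_gt0.
Qed.

End power_bounds.

(** * The singular kernel as a superposition of Gaussians *)

Section kernel.
Local Open Scope ereal_scope.
Context {R : realType} {n : nat}.
Notation leb := (@lebesgue_measure R).
Notation E := ('rV[R]_n).
Variable b : R.
Hypothesis b01 : (0 < b < 1)%R.

Let kern (s : R) : R := (@cG R n * pw (b - 2 - n%:R / 2) s * expR (- (2 * s)^-1))%R.
Let kern0 s : (0 <= kern s)%R.
Proof. by rewrite /kern !mulr_ge0 ?expR_ge0 ?pw_ge0// ltW// cG_gt0. Qed.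
Let mkern : measurable_fun setT kern. Proof. by rewrite /kern; mea. Qed.

Let kern_fin : \int[leb]_s (kern s)%:E < +oo.
Proof.
have /andP[b0 b1] := b01; have cg := ltW (@cG_gt0 R n).
apply: (@le_lt_trans _ _ ((@cG R n * (n.+1)`!%:R * 2 ^+ n.+1) * (1 `^ b / b) +
   @cG R n * (1 `^ (- (1 - b)) / (1 - b)))%:E); last exact: ltry.
apply: pw_split_bound => //.
- by rewrite subr_gt0.
- by rewrite !mulr_ge0// exprn_ge0.
- exact: mf_EFin.
- by move=> t t0; rewrite /kern pw_neg// mulr0 mul0r.
- move=> t /andP[t0 t1]; have t20 : (0 < (2 * t)^-1)%R by rewrite invr_gt0 mulr_gt0.
  rewrite /kern pwE// lee_fin -!mulrA ler_wpM2l//.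
  apply: (@le_trans _ _ (t `^ (b - 2 - n%:R / 2) * ((n.+1)`!%:R * (2 * t) ^+ n.+1)))%R.
    rewrite ler_wpM2l ?powR_ge0//; have := exp_power_bound n.+1 t20.
    by rewrite exprVn invrK.
  have aux (u v A B : R) : (u * (v * (A * B)) = v * (A * (u * B)))%R by ring.
  rewrite exprMn aux; apply: ler_wpM2l; first by [].
  apply: ler_wpM2l; first by rewrite exprn_ge0.
  rewrite -powR_mulrn ?(ltW t0)// -powRD ?(gt_eqF t0) ?implybT//.
  apply: powR_le_near; first by rewrite t0.
  by have := ler0n R n; rewrite -(natr1 n); lra.
- move=> t t1; have t0 : (0 < t)%R by exact: lt_le_trans t1.
  rewrite /kern pwE// lee_fin -mulrA ler_wpM2l//.
  rewrite (@le_trans _ _ (t `^ (b - 2 - n%:R / 2)))%R//.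
    by rewrite ler_piMr ?powR_ge0// -expR0 ler_expR oppr_le0 invr_ge0 mulr_ge0// ltW.
  by rewrite powR_le_far//; have := ler0n R n; lra.
Qed.

Definition kconst : R := fine (\int[leb]_s (kern s)%:E).

Lemma kconstE : \int[leb]_s (kern s)%:E = kconst%:E.
Proof. rewrite /kconst fineK// ge0_fin_numE; first exact: kern_fin.
by apply: int_ge0 => t; rewrite lee_fin. Qed.

Lemma kconst_gt0 : (0 < kconst)%R.
Proof.
have /andP[b0 b1] := b01; have cg := @cG_gt0 R n.
pose c := (1 + n%:R / 2 - b)%R; have c0 : (0 < c)%R by have := ler0n R n; rewrite /c; lra.
rewrite -lte_fin -kconstE.
apply: (@lt_le_trans _ _ (\int[leb]_t ((@cG R n * expR (- 2^-1))%:E *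
    (pw (- c - 1) t * (1 <= t)%R%:R)%:E))).
  rewrite intZl ?mulr_ge0 ?expR_ge0 ?(ltW cg)//; last 2 first.
  - by mea.
  - by move=> t; rewrite lee_fin mulr_ge0// pw_ge0.
  by rewrite integral_pw_far// -EFinM lte_fin !mulr_gt0 ?expR_gt0// ?invr_gt0// powR_gt0.
apply: le_int.
- by mea.
- exact: mf_EFin.
- by move=> t; rewrite mule_ge0 ?lee_fin ?mulr_ge0 ?expR_ge0 ?pw_ge0// ltW.
- move=> t; rewrite -EFinM lee_fin; have [t1|t1] := leP 1%R t; last by rewrite !mulr0.
  have t0 : (0 < t)%R by exact: lt_le_trans t1.
  rewrite /kern mulr1 -!mulrA ler_wpM2l ?(ltW cg)// mulrC.
  rewrite (_ : (- c - 1 = b - 2 - n%:R / 2)%R); last by rewrite /c; ring.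
  rewrite ler_wpM2l ?pw_ge0// ler_expR lerN2 lef_pV2 ?posrE ?mulr_gt0//.
  by rewrite ler_pMr.
Qed.

(** The substitution of [|z|^2 t] for [t] extracts the power of [|z|]. For [b = (1 - a) / 2] the
    exponent is [-(n + a + 1)], that of the fractional divergence. *)
Lemma kernel_power (z : E) : z != 0%R ->
  \int[leb]_t (pw (b - 2) t * G t z)%:E = (kconst * enorm z `^ (2 * b - 2 - n%:R))%:E.
Proof.
move=> z0; have s0 : (0 < sq z)%R.
  rewrite lt_neqAle sq_ge0 andbT eq_sym; apply: contra z0 => /eqP sz.
  apply/eqP/rowP => i; rewrite !mxE; apply/eqP; rewrite -sqrf_eq0.
  have : (z ord0 i ^+ 2 <= 0)%R.
    by rewrite -sz sqE (bigD1 i)//= lerDl sumr_ge0// => j _; rewrite sqr_ge0.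
  by move=> h; rewrite eq_le h sqr_ge0.
rewrite (@ge0_integral_affine _ (sq z) 0 s0); last 2 first.
- by mea.
- by move=> t; rewrite lee_fin mulr_ge0 ?pw_ge0 ?G_ge0.
rewrite (_ : \int[leb]_t _ = \int[leb]_t (((sq z) `^ (b - 2 - n%:R / 2))%:E * (kern t)%:E)); last first.
  apply: eq_integral => t _; rewrite addr0 -EFinM; congr EFin.
  rewrite GE !pwM// /kern.
  have [t0|t0] := ltP 0%R t; last by rewrite !(pw_neg _ t0) !mulr0 !mul0r !mulr0.
  rewrite (_ : (sq z / (2 * (sq z * t)) = (2 * t)^-1)%R); last first.
    by field; rewrite !gt_eqF.
  have aux (u v w x y e : R) : (u * v * (w * (x * y) * e) = u * x * (w * (v * y) * e))%R by ring.
  by rewrite aux -pwD -powRD ?(gt_eqF s0) ?implybT.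
rewrite intZl ?powR_ge0//; last exact: mf_EFin.
rewrite kconstE -!EFinM; congr EFin.
rewrite mulrA [in RHS]mulrC; congr (_ * _)%R.
rewrite -{1}(powRr1 (ltW s0)) -powRD ?(gt_eqF s0) ?implybT//.
rewrite /enorm -/(sq z) -powR12_sqrt ?(ltW s0)// -powRrM; congr (powR _ _).
by field.
Qed.

End kernel.

Section real_integrable.
Local Open Scope ereal_scope.
Context d (T : measurableType d) (R : realType) (m : {measure set T -> \bar R}).
Implicit Types f g : T -> R.

Lemma integrable_dom f g : measurable_fun setT f -> measurable_fun setT g ->
  (forall x, `|f x| <= g x)%R -> \int[m]_x (g x)%:E < +oo ->
  m.-integrable setT (fun x => (f x)%:E).
Proof.
move=> mf mg fg gf; apply/integrableP; split; first exact: mf_EFin.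
apply: le_lt_trans gf; by apply: le_int; mea.
Qed.

Lemma intBR f g : m.-integrable setT (fun x => (f x)%:E) ->
  m.-integrable setT (fun x => (g x)%:E) ->
  \int[m]_x (f x - g x)%:E = \int[m]_x (f x)%:E - \int[m]_x (g x)%:E.
Proof. by move=> fi gi; rewrite -(integralB measurableT fi gi). Qed.

Lemma intZR (c : R) f : m.-integrable setT (fun x => (f x)%:E) ->
  \int[m]_x (c * f x)%:E = c%:E * \int[m]_x (f x)%:E.
Proof. by move=> fi; rewrite -(integralZl measurableT fi). Qed.

Lemma integrable_fineK f : m.-integrable setT (fun x => (f x)%:E) ->
  (fine (\int[m]_x (f x)%:E))%:E = \int[m]_x (f x)%:E.
Proof. by move=> fi; rewrite fineK// integrable_fin_num. Qed.

End real_integrable.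

(** * Integration by parts against the Gaussian *)

Section gaussian_ibp.
Local Open Scope ereal_scope.
Context {R : realType} {n : nat}.
Notation mu := (@lebn R n).
Notation leb := (@lebesgue_measure R).
Notation E := ('rV[R]_n).
Notation I01 := (`[0%R, 1%R]%classic : set R).
Notation chi := (\1_I01 : R -> R).

Let mchi : measurable_fun setT chi. Proof. exact: mf_indic. Qed.
Let chi0 th : (0 <= chi th)%R. Proof. by rewrite indicE. Qed.
Let int_chi : \int[leb]_th (chi th)%:E = 1.
Proof. by rewrite integral_indic// setIT; exact: leb01. Qed.

Lemma int01 (g : R -> R) :
  \int[leb]_(th in I01) (g th)%:E = \int[leb]_th (g th * chi th)%:E.
Proof.
rewrite integral_mkcond; apply: eq_integral => th _; rewrite patchE indicE.
by case: (_ \in _); rewrite ?mulr1 ?mulr0.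
Qed.

Lemma integrable01 (g : R -> R) (B : R) : measurable_fun setT g -> (0 <= B)%R ->
  (forall th, (0 <= th <= 1)%R -> `|g th| <= B)%R ->
  leb.-integrable setT (fun th => (g th * chi th)%:E).
Proof.
move=> mg B0 gB; apply: (@integrable_dom _ _ _ leb _ (fun th => B * chi th)%R); try by mea.
- move=> th; rewrite normrM (ger0_norm (chi0 th)) indicE.
  have [h|h] := boolP (th \in I01); rewrite ?mulr1 ?mulr0//.
  by apply: gB; move: h; rewrite inE/= in_itv.
- under eq_integral do rewrite EFinM.
  rewrite intZl//; [by rewrite int_chi mule1 ltry|by mea].
Qed.

Lemma FintE (psi : E -> R) (M : R) i h y : measurable_fun setT psi ->
  (forall z, `|psi z| <= M)%R ->
  (Fint psi i h y)%:E = \int[leb]_th (psi (y - (th * h) *: basis_rV i) * chi th)%:E.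
Proof.
move=> mpsi pM; rewrite -int01 /Fint /Rintegral fineK// integrable_fin_num//.
by apply: (@bounded_integrable01 _ _ M) => //; mea.
Qed.

Lemma Fint_subc (psi : E -> R) (M : R) i h y c : measurable_fun setT psi ->
  (forall z, `|psi z| <= M)%R ->
  Fint (fun z => psi z - c)%R i h y = (Fint psi i h y - c)%R.
Proof.
move=> mpsi pM.
have M0 : (0 <= M)%R by apply: le_trans (pM 0%R).
have i1 : leb.-integrable setT (fun th => (psi (y - (th * h) *: basis_rV i) * chi th)%:E).
  by apply: (@integrable01 _ M) => //; mea.
have i2 : leb.-integrable setT (fun th => (c * chi th)%:E).
  by apply: (@integrable01 (cst c) `|c|%R) => //; mea.
apply: EFin_inj; rewrite EFinB (FintE _ _ _ mpsi pM).
rewrite (@FintE _ (M + `|c|)%R); last 2 first.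
- by mea.
- by move=> z; rewrite (le_trans (ler_normB _ _))// lerD.
transitivity (\int[leb]_th (psi (y - (th * h) *: basis_rV i) * chi th - c * chi th)%:E).
  by apply: eq_integral => th _; rewrite mulrBl.
rewrite (intBR i1 i2); congr (_ - _).
under eq_integral do rewrite EFinM.
rewrite integralZl//; first by rewrite int_chi mule1.
rewrite (_ : (fun=> _) = (fun th => (1 * chi th)%:E)); last by apply/funext => x; rewrite mul1r.
by apply: (@integrable01 (cst 1%R) 1%R) => // th _ /=; rewrite normr1.
Qed.

Lemma moment1_shift (t : R) (x : E) : (0 < t)%R ->
  \int[mu]_y (nrm1 (y - x) * G t (y - x))%:E <= ((1 + cM n) * Num.sqrt t)%:E.
Proof.
move=> t0; have := @ge0_integral_rV_shift R n (- x) (fun y => (nrm1 y * G t y)%:E).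
move=> -> //; [exact: moment1|by mea|].
by move=> y; rewrite lee_fin mulr_ge0 ?nrm1_ge0 ?G_ge0.
Qed.

Lemma integrable_G_bounded (M t : R) (x : E) (g : E -> R) : (0 < t)%R -> measurable_fun setT g ->
  (forall z, `|g z| <= M)%R -> mu.-integrable setT (fun y => (G t (y - x) * g y)%:E).
Proof.
move=> t0 mg gM; have M0 : (0 <= M)%R by apply: le_trans (gM 0%R).
 apply: (@integrable_dom _ _ _ mu _ (fun y => M * G t (y - x))%R); try by mea.
- by move=> y; rewrite normrM (ger0_norm (G_ge0 _ _)) mulrC ler_wpM2r ?G_ge0.
- under eq_integral do rewrite EFinM.
  rewrite intZl//; last by mea.
  by rewrite G_mass_shift// mule1 ltry.
Qed.

Section fixed_time.
Variables (phi : E -> R) (M : R) (i : 'I_n) (h t : R) (x : E).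
Hypothesis mphi : measurable_fun setT phi.
Hypothesis phiM : forall z, (`|phi z| <= M)%R.
Hypothesis t0 : (0 < t)%R.

Let e (th : R) : E := (th * h) *: basis_rV i.
Let D (y : E) : R := ((y - x) ord0 i / t * G t (y - x))%R.
Let K2 (y : E) (th : R) : R := (h * D y * phi (y - e th) * chi th)%R.
Let K1 (y : E) (th : R) : R := (h * D (y + e th) * phi y * chi th)%R.

Let M0 : (0 <= M)%R. Proof. by apply: le_trans (phiM 0%R). Qed.
Let mD : measurable_fun setT D. Proof. by rewrite /D; mea. Qed.
Let me : measurable_fun setT e. Proof. by rewrite /e; mea. Qed.
Let mK2 : measurable_fun setT (fun p : E * R => K2 p.1 p.2).
Proof. by rewrite /K2; mea. Qed.
Let mK1 : measurable_fun setT (fun p : E * R => K1 p.1 p.2).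
Proof. by rewrite /K1; mea. Qed.

Let K2fin : \int[leb]_th \int[mu]_y (`|K2 y th|)%:E < +oo.
Proof.
pose c := (`|h| * (M / t))%R.
have c0 : (0 <= c)%R by rewrite mulr_ge0// divr_ge0// ltW.
have B0 y : (0 <= nrm1 (y - x) * G t (y - x))%R by rewrite mulr_ge0 ?nrm1_ge0 ?G_ge0.
apply: (@le_lt_trans _ _ (\int[leb]_th ((c * ((1 + cM n) * Num.sqrt t))%:E * (chi th)%:E))).
  apply: le_int.
  - apply: (measurable_int2 mu (fun th y => (`|K2 y th|)%:E)); last by [].
    by rewrite /K2; mea.
  - by mea.
  - by move=> th; apply: int_ge0 => y; rewrite lee_fin.
  - move=> th.
    apply: (@le_trans _ _ (\int[mu]_y ((c * chi th)%:E * (nrm1 (y - x) * G t (y - x))%:E))).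
      apply: le_int; try by rewrite /K2; mea.
      - move=> y; rewrite -EFinM lee_fin /K2 /D.
        rewrite [X in (X <= _)%R]normrM (ger0_norm (chi0 th)).
        rewrite [X in (X * _ <= _)%R]normrM [X in (X * _ * _ <= _)%R]normrM.
        rewrite [X in (_ * X * _ * _ <= _)%R]normrM (ger0_norm (G_ge0 _ _)).
        rewrite normrM normfV (gtr0_norm t0) /c.
        have := coord_nrm1 (y - x) i; have := phiM (y - e th).
        set u := `|phi _|%R; set v := `|(y - x) ord0 i|%R => uM vn.
        have -> : (`|h| * (v / t * G t (y - x)) * u * chi th =
                  (`|h| / t * G t (y - x) * chi th) * (u * v))%R by ring.
        have -> : (`|h| * (M / t) * chi th * (nrm1 (y - x) * G t (y - x)) =
                  (`|h| / t * G t (y - x) * chi th) * (M * nrm1 (y - x)))%R by ring.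
        apply: ler_wpM2l; last by apply: ler_pM => //; exact: normr_ge0.
        by apply: mulr_ge0 => //; apply: mulr_ge0; [rewrite divr_ge0// ltW|exact: G_ge0].
    rewrite (@intZl _ _ _ mu (c * chi th)); [|by mea|by move=> y; rewrite lee_fin|by rewrite mulr_ge0].
    apply: (@le_trans _ _ ((c * chi th)%:E * ((1 + cM n) * Num.sqrt t)%:E)).
      by apply: lee_wpmul2l; [rewrite lee_fin mulr_ge0|exact: (moment1_shift x t0)].
    by rewrite -!EFinM lee_fin le_eqVlt; apply/orP; left; apply/eqP; ring.
rewrite intZl//; [by rewrite int_chi mule1 ltry|by mea|].
by rewrite mulr_ge0// mulr_ge0 ?sqrtr_ge0// addr_ge0// cM_ge0.
Qed.

Let K2fin' : \int[mu]_y \int[leb]_th (`|K2 y th|)%:E < +oo.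
Proof. 
have m2 : measurable_fun setT (fun p : E * R => (`|K2 p.1 p.2|)%:E) by rewrite /K2; mea.
by rewrite (tonelli mu leb (fun y th => (`|K2 y th|)%:E)).
 Qed.

Let K1K2 y th : K1 y th = K2 (y + e th) th.
Proof. by rewrite /K1 /K2 addrK. Qed.

Let K1fin : \int[mu]_y \int[leb]_th (`|K1 y th|)%:E < +oo.
Proof.
have m1 : measurable_fun setT (fun p : E * R => (`|K1 p.1 p.2|)%:E) by rewrite /K1; mea.
have n1 y th : 0 <= (`|K1 y th|)%:E by rewrite lee_fin normr_ge0.
rewrite (tonelli mu leb (fun y th => (`|K1 y th|)%:E) m1 n1).
apply: le_lt_trans K2fin; rewrite le_eqVlt; apply/orP; left; apply/eqP.
apply: eq_integral => th _.
have := @ge0_integral_rV_shift R n (e th) (fun y => (`|K2 y th|)%:E).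
move=> <- //; last by rewrite /K2; mea.
by apply: eq_integral => y _; rewrite K1K2.
Qed.

Let FTC y : (phi y * (G t (y - x) - G t (y - x + h *: basis_rV i)))%:E =
  \int[leb]_th (K1 y th)%:E.
Proof.
have := @G_FTC R n t (y - x) i h t0; rewrite int01 => H.
pose B := ((`|h| * (`|(y - x) ord0 i| + `|h|) / t) * (@cG R n * t `^ (- (n%:R / 2))))%R.
have I : leb.-integrable setT (fun th => (- h * (y - x + (th * h) *: basis_rV i) ord0 i / t *
   G t (y - x + (th * h) *: basis_rV i) * chi th)%:E).
  apply: (@integrable01 _ B); first by mea.
    by rewrite /B !mulr_ge0 ?powR_ge0 ?invr_ge0 ?addr_ge0// ltW// cG_gt0.
  move=> th /andP[th0 th1]; rewrite /B [X in (X <= _)%R]normrM (ger0_norm (G_ge0 _ _)).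
  rewrite !normrM normrN normfV (gtr0_norm t0).
  rewrite ler_pM ?G_ge0 ?G_le//.
    by rewrite !mulr_ge0// invr_ge0 ltW.
  rewrite ler_wpM2r ?invr_ge0 ?(ltW t0)// ler_wpM2l// !mxE eqxx/=.
  rewrite (le_trans (ler_normD _ _))// lerD2l mulr_natr.
  by rewrite eqxx mulr1n normrM (ger0_norm th0) ler_piMl.
have := intZR (- phi y) I; rewrite H -EFinM => H2.
transitivity ((- phi y * (G t (y - x + h *: basis_rV i) - G t (y - x)))%:E).
  by congr EFin; rewrite mulNr -mulrN opprB.
rewrite -H2; apply: eq_integral => th _; congr EFin; rewrite /K1 /D /e addrAC.
by ring.
Qed.

(** The shift of [phi] is moved to the kernel, whose increment is an integral over a segment by
    [G_FTC]. For each point of the segment a shift in space, from [K1] to [K2], moves the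
    displacement back to [phi], leaving a fixed derivative of the kernel and an average of [phi]. *)
Lemma gaussian_ibp0 :
  \int[mu]_y (G t (y - x) * (phi y - phi (y - h *: basis_rV i)))%:E =
  \int[mu]_y (h * ((y - x) ord0 i / t * G t (y - x)) * Fint phi i h y)%:E.
Proof.
pose w := h *: basis_rV i : E.
have i1 := integrable_G_bounded x t0 mphi phiM.
have mphi' : measurable_fun setT (fun y : E => phi (y - w)) by mea.
have i2 := integrable_G_bounded x t0 mphi' (fun z => phiM (z - w)).
have mk : measurable_fun setT (fun y : E => (G t (y - x) * phi (y - w))%:E) by mea.
have sh := integral_rV_shift w mk.
have i3 : mu.-integrable setT (fun y => (G t (y - x + w) * phi y)%:E).
  apply: (@integrable_dom _ _ _ mu _ (fun y => M * G t (y - (x - w)))%R); try by mea.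
  - move=> y; rewrite opprB addrA (addrAC y) normrM (ger0_norm (G_ge0 _ _)) mulrC.
    by rewrite ler_wpM2r ?G_ge0.
  - under eq_integral do rewrite EFinM.
    rewrite intZl//; last by mea.
    by rewrite G_mass_shift// mule1 ltry.
transitivity (\int[mu]_y \int[leb]_th (K1 y th)%:E).
  transitivity (\int[mu]_y (G t (y - x) * phi y - G t (y - x) * phi (y - w))%:E).
    by apply: eq_integral => y _; rewrite mulrBr.
  rewrite (intBR i1 i2) -sh.
  transitivity (\int[mu]_y (G t (y - x) * phi y)%:E - \int[mu]_y (G t (y - x + w) * phi y)%:E).
    by congr (_ - _); apply: eq_integral => y _; rewrite addrK addrAC.
  rewrite -(intBR i1 i3); apply: eq_integral => y _; rewrite -FTC; congr EFin.
  by rewrite -mulrBl mulrC.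
rewrite (fubini mu leb K1 mK1 K1fin).
transitivity (\int[leb]_th \int[mu]_y (K2 y th)%:E).
  apply: eq_integral => th _.
  have mk2 : measurable_fun setT (fun y : E => (K2 y th)%:E) by rewrite /K2; mea.
  rewrite -(integral_rV_shift (e th) mk2).
  by apply: eq_integral => y _; rewrite K1K2.
rewrite -(fubini mu leb K2 mK2 K2fin').
apply: eq_integral => y _; rewrite EFinM (FintE _ _ _ mphi phiM).
rewrite -intZR; last by apply: (@integrable01 _ M) => //; mea.
by apply: eq_integral => th _; rewrite /K2 /D /e !mulrA.
Qed.

End fixed_time.

(** [phi] and [phi - c] have the same increments. Taking [c] as the average at [x] makes the
    integrand vanish there, which is needed for the time integral to converge absolutely. *)
Lemma gaussian_ibp (phi : E -> R) (M : R) i h t x c : measurable_fun setT phi ->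
  (forall z, `|phi z| <= M)%R -> (0 < t)%R ->
  \int[mu]_y (G t (y - x) * (phi y - phi (y - h *: basis_rV i)))%:E =
  \int[mu]_y (h * ((y - x) ord0 i / t * G t (y - x)) * (Fint phi i h y - c))%:E.
Proof.
move=> mphi phiM t0.
have m' : measurable_fun setT (fun z => phi z - c)%R by mea.
have b' z : (`|phi z - c| <= M + `|c|)%R by rewrite (le_trans (ler_normB _ _))// lerD.
have := gaussian_ibp0 i h x m' b' t0.
under eq_integral do rewrite opprB addrA subrK.
move=> ->; apply: eq_integral => y _; congr (_ * _)%:E.
exact: (Fint_subc _ _ _ _ mphi phiM).
Qed.

End gaussian_ibp.

Section cube.
Local Open Scope ereal_scope.
Context {R : realType} {n : nat}.
Notation mu := (@lebn R n).
Notation E := ('rV[R]_n).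

Lemma cube_support_fin (psi : E -> R) (M K : R) : measurable_fun setT psi ->
  (0 <= M)%R -> (forall z, `|psi z| <= M)%R ->
  (forall (z : E) (k : 'I_n), (K < `|z ord0 k|)%R -> psi z = 0%R) ->
  \int[mu]_z (`|psi z|)%:E < +oo.
Proof.
move=> mpsi M0 psiM psiK.
pose J := `[(- K)%R, K]%classic : set R.
have mJ : measurable_fun setT (\1_J : R -> R) by apply: mf_indic; exact: measurable_itv.
have mp : measurable_fun setT (fun z : E => \prod_i (\1_J (z ord0 i) : R))%R.
  by apply: measurable_prod => k _; apply: (mf_comp mJ); exact: measurable_coord.
have p0 (z : E) : (0 <= \prod_i (\1_J (z ord0 i) : R))%R by apply: prodr_ge0 => i _; rewrite indicE.
apply: (@le_lt_trans _ _ (\int[mu]_z (M%:E * (\prod_i (\1_J (z ord0 i) : R))%:E))).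
  apply: le_int.
  - by mea.
  - by apply: mf_mule; mea.
  - by move=> z; rewrite lee_fin.
  - move=> z; rewrite -EFinM lee_fin.
    have [/existsP[k zk]|/existsPn h] := boolP [exists k, (K < `|z ord0 k|)%R].
      by rewrite (psiK z k zk) normr0 mulr_ge0.
    rewrite big1 ?mulr1// => k _; rewrite indicE mem_set// /J/= in_itv/= -ler_norml leNgt.
    exact: h.
rewrite intZl//; [|by apply: mf_EFin].
rewrite (@ge0_integral_rV_prod _ _ (fun=> \1_J))//.
rewrite lte_mul_pinfty// ?lee_fin// -ge0_fin_numE; last first.
  by apply: prode_ge0 => i _; apply: int_ge0 => x; rewrite lee_fin indicE.
apply: (big_ind (fun x => x \is a fin_num)) => //.
  by move=> x y xf yf; rewrite fin_numM.
have mJ' : measurable J by exact: measurable_itv.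
move=> i _; rewrite integral_indic// setIT ge0_fin_numE//.
have := @lebesgue_measure_itv R `[(- K)%R, K]; rewrite -/J /= => ->.
by case: ifP => _; rewrite ?ltry// -EFinB ltry.
Qed.

End cube.

Section sriesz_iterated.
Local Open Scope ereal_scope.
Context {R : realType} {n : nat}.
Notation mu := (@lebn R n).
Notation leb := (@lebesgue_measure R).
Notation E := ('rV[R]_n).
Variables (b : R) (g : E -> R) (M : R) (x : E).
Hypothesis b0 : (0 < b)%R.
Hypothesis bn : (b < n%:R / 2)%R.
Hypothesis mg : measurable_fun setT g.
Hypothesis gM : forall z, (`|g z| <= M)%R.
Hypothesis gfin : \int[mu]_z (`|g z|)%:E < +oo.

Lemma riesz_bounded_fin : riesz b (fun z => (`|g z|)%:E) x < +oo.
Proof.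
have M0 : (0 <= M)%R by apply: le_trans (gM 0%R).
pose N := fine (\int[mu]_z (`|g z|)%:E).
have NE : \int[mu]_z (`|g z|)%:E = N%:E.
  by rewrite fineK// ge0_fin_numE// int_ge0.
have N0 : (0 <= N)%R by rewrite -lee_fin -NE int_ge0.
have cg := ltW (@cG_gt0 R n).
rewrite rieszE.
apply: (@le_lt_trans _ _ (M * (1 `^ b / b) +
   (@cG R n * N) * (1 `^ (- (n%:R / 2 - b)) / (n%:R / 2 - b)))%:E); last exact: ltry.
apply: pw_split_bound => //.
- by rewrite subr_gt0.
- by rewrite mulr_ge0.
- by mea.
- by move=> t; rewrite mule_ge0// heat_ge0.
- by move=> t t0; rewrite pw_neg// mul0e.
- move=> t /andP[t0 _]; rewrite pwE// mulrC EFinM.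
  apply: lee_wpmul2l; first by rewrite lee_fin powR_ge0.
  by apply: heat_le_cst => //; mea.
- move=> t t1; have t0 : (0 < t)%R by exact: lt_le_trans t1.
  have mag : measurable_fun setT (fun z : E => (`|g z|)%:E) by mea.
  have ag z : 0 <= (`|g z|)%:E by rewrite lee_fin.
  have h := heat_le_int mag ag x t0; rewrite NE -EFinM in h.
  rewrite pwE//; apply: (@le_trans _ _ ((t `^ (b - 1))%:E * (@cG R n * t `^ (- (n%:R / 2)) * N)%:E)).
    by apply: lee_wpmul2l; rewrite ?lee_fin ?powR_ge0.
  rewrite -EFinM lee_fin (_ : (- (n%:R / 2 - b) - 1 = (b - 1) + - (n%:R / 2))%R); last by ring.
  rewrite [in X in (_ <= X)%R]powRD ?(gt_eqF t0) ?implybT//.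
  by rewrite le_eqVlt; apply/orP; left; apply/eqP; ring.
Qed.

Let k (s : E -> R) (t : R) (y : E) : R := (pw (b - 1) t * (G t (y - x) * s y))%R.

Let riesz_ppE (s : E -> R) : measurable_fun setT s ->
  riesz b (pp s) x = \int[leb]_t \int[mu]_y (k (fun y => Num.max (s y) 0) t y)%:E.
Proof.
move=> ms; rewrite rieszE; apply: eq_integral => t _; rewrite heatE.
have mpp := measurable_pp ms.
rewrite -intZl ?pw_ge0//; first by apply: mf_mule => //; mea.
by move=> y; rewrite mule_ge0 ?pp_ge0.
Qed.

Lemma sriesz_iter :
  (sriesz b g x)%:E = \int[leb]_t \int[mu]_y (pw (b - 1) t * (G t (y - x) * g y))%:E.
Proof.
have mNg : measurable_fun setT (fun y : E => - g y)%R by mea.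
have F (s : E -> R) : measurable_fun setT s -> (forall z, `|s z| = `|g z|)%R ->
    riesz b (pp s) x \is a fin_num.
  move=> ms sg; rewrite ge0_fin_numE; last by apply: riesz_ge0 => y; exact: pp_ge0.
  apply: le_lt_trans riesz_bounded_fin; apply: le_riesz.
  - exact: measurable_pp.
  - exact: pp_ge0.
  - by mea.
  - by move=> y; rewrite -sg; exact: pp_le.
have f1 := F g mg (fun=> erefl).
have f2 := F _ mNg (fun z => normrN (g z)).
rewrite /sriesz EFinB (fineK f1) (fineK f2) (riesz_ppE mg) (riesz_ppE mNg).
have mx0 (r : R) : (0 <= Num.max r 0)%R by rewrite le_max lexx orbT.
rewrite -(fubini_sub leb mu); last 6 first.
- by rewrite /k; mea.
- by rewrite /k; mea.
- by move=> t y; apply: mulr_ge0; [exact: pw_ge0|apply: mulr_ge0; [exact: G_ge0|]].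
- by move=> t y; apply: mulr_ge0; [exact: pw_ge0|apply: mulr_ge0; [exact: G_ge0|]].
- by rewrite -(riesz_ppE mg) ltey_eq f1.
- by rewrite -(riesz_ppE mNg) ltey_eq f2.
apply: eq_integral => t _; apply: eq_integral => y _; congr EFin.
by rewrite /k -!mulrBr -ppB.
Qed.

End sriesz_iterated.

(** * The fractional divergence of a segment average *)

Section fractional_divergence.
Local Open Scope ereal_scope.
Context {R : realType} {n : nat}.
Notation mu := (@lebn R n).
Notation leb := (@lebesgue_measure R).
Notation E := ('rV[R]_n).
Variables (a : R) (psi : E -> R) (M L : R) (i : 'I_n) (h : R) (x : E).
Hypothesis a01 : (0 < a < 1)%R.
Let b := ((1 - a) / 2)%R.
Hypothesis h0 : h != 0%R.
Hypothesis mpsi : measurable_fun setT psi.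
Hypothesis psiM : forall z, (`|psi z| <= M)%R.
Hypothesis psiL : forall z w, (`|psi (z + w) - psi z| <= L * nrm1 w)%R.
Hypothesis L0 : (0 <= L)%R.
Hypothesis psifin : \int[mu]_z (`|psi z|)%:E < +oo.

Let F := Fint psi i h.
Definition dpsi (y : E) : R := (psi y - psi (y - h *: basis_rV i))%R.
Let q (y : E) : R := (h * (y - x) ord0 i * (F y - F x))%R.
Let k (t : R) (y : E) : R := (pw (b - 2) t * G t (y - x) * q y)%R.

Let M0 : (0 <= M)%R. Proof. by apply: le_trans (psiM 0%R). Qed.
Let b0 : (0 < b)%R. Proof. by rewrite /b; have /andP[? ?] := a01; lra. Qed.
Let b2 : (b < 2^-1)%R. Proof. by rewrite /b; have /andP[? ?] := a01; lra. Qed.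
Let bn : (b < n%:R / 2)%R.
Proof.
(* The index [i] witnesses that the dimension is at least 1. *)
apply: (lt_le_trans b2); rewrite -[X in (X <= _)%R]mul1r ler_wpM2r// ler1n.
by case: (n) (i) => // -[].
Qed.
Let FL z w : (`|F (z + w) - F z| <= L * nrm1 w)%R.
Proof. exact: (Fint_lipschitz i h mpsi psiM psiL). Qed.
Let FM z : (`|F z| <= M)%R. Proof. exact: Fint_le. Qed.
Let mF : measurable_fun setT F.
Proof.
have mchi : measurable_fun setT (\1_(`[0%R, 1%R]%classic : set R) : R -> R) by exact: mf_indic.
(* [psi + M] is nonnegative, so its segment average is measurable as a parametrised integral; the
   constant is subtracted afterwards. *)
have m' : measurable_fun setT (fun z : E => psi z - (- M))%R by mea.
have b' z : (`|psi z - - M| <= M + `|- M|)%R by rewrite (le_trans (ler_normB _ _))// lerD.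
rewrite (_ : F = (fun z => fine (\int[leb]_th ((psi (z - (th * h) *: basis_rV i) - - M) *
    \1_(`[0%R, 1%R]%classic : set R) th)%:E) - M)%R); last first.
  apply/funext => z; rewrite -(FintE i h z m' b') /= (Fint_subc i h z (- M) mpsi psiM).
  by rewrite opprK addrK.
apply: mfB; last by mea.
apply: mf_fine; apply: (measurable_int2 leb (fun (z : E) (th : R) =>
  ((psi (z - (th * h) *: basis_rV i) - - M) * \1_(`[0%R, 1%R]%classic : set R) th)%:E)).
  by mea.
move=> z th; rewrite lee_fin mulr_ge0 ?indicE// opprK.
by have := psiM (z - (th * h) *: basis_rV i); rewrite ler_norml => /andP[h1 _]; lra.
Qed.
Let mq : measurable_fun setT q. Proof. by rewrite /q; mea. Qed.
Let mk : measurable_fun setT (fun p : R * E => k p.1 p.2).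
Proof. by rewrite /k; mea. Qed.

Let moment2_shift t : (0 < t)%R -> \int[mu]_y (nrm1 (y - x) ^+ 2 * G t (y - x))%:E <= (cM n * t)%:E.
Proof.
move=> t0; have := @ge0_integral_rV_shift R n (- x) (fun y => (nrm1 y ^+ 2 * G t y)%:E).
move=> -> //; [exact: moment2|by mea|].
by move=> y; rewrite lee_fin mulr_ge0 ?exprn_ge0 ?nrm1_ge0 ?G_ge0.
Qed.

Let kfin : \int[leb]_t \int[mu]_y (`|k t y|)%:E < +oo.
Proof.
have c20 : (0 < 2^-1 - b)%R by rewrite subr_gt0.
have cm := @cM_ge0 R n.
have ck (t : R) (u : E -> R) (c C : R) : (0 < t)%R -> measurable_fun setT u -> (0 <= c)%R ->
    (forall y, 0 <= u y)%R -> (forall y, `|q y| <= c * u y)%R ->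
    \int[mu]_y (u y * G t (y - x))%:E <= C%:E ->
    \int[mu]_y (`|k t y|)%:E <= (t `^ (b - 2) * c * C)%:E.
  move=> t0 mu' c0 u0 qu uC.
  apply: (@le_trans _ _ (\int[mu]_y ((t `^ (b - 2) * c)%:E * (u y * G t (y - x))%:E))).
    apply: le_int; try by mea.
    - by rewrite /k; mea.
    - move=> y; rewrite -EFinM lee_fin /k pwE//.
      rewrite [X in (X <= _)%R]normrM [X in (X * _ <= _)%R]normrM.
      rewrite (ger0_norm (powR_ge0 _ _)) (ger0_norm (G_ge0 _ _)).
      have -> : (t `^ (b - 2) * c * (u y * G t (y - x)) =
         t `^ (b - 2) * G t (y - x) * (c * u y))%R by ring.
      by apply: ler_wpM2l => //; apply: mulr_ge0; [exact: powR_ge0|exact: G_ge0].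
  rewrite intZl; [|by mea| |by rewrite mulr_ge0 ?powR_ge0].
    by rewrite [X in _ <= X]EFinM; apply: lee_wpmul2l; rewrite ?lee_fin ?mulr_ge0 ?powR_ge0.
  by move=> y; rewrite lee_fin mulr_ge0 ?G_ge0.
have qh y : (`|q y| <= `|h| * (nrm1 (y - x) * `|F y - F x|))%R.
  rewrite /q !normrM -mulrA ler_wpM2l// ler_wpM2r//; exact: coord_nrm1.
(* Before time 1 the Lipschitz bound on [F] and the second moment of the kernel give [t ^ (b - 1)].
   After time 1 the bound on [F] and the first moment give [t ^ (b - 3/2)], integrable because
   [b < 1/2]. *)
apply: (@le_lt_trans _ _ ((`|h| * L * cM n) * (1 `^ b / b) +
   (`|h| * (2 * M) * (1 + cM n)) * (1 `^ (- (2^-1 - b)) / (2^-1 - b)))%:E); last exact: ltry.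
apply: pw_split_bound => //.
- by rewrite !mulr_ge0.
- by rewrite !mulr_ge0// addr_ge0.
- apply: (measurable_int2 mu (fun t y => (`|k t y|)%:E)); last by [].
  by rewrite /k; mea.
- by move=> t; apply: int_ge0.
- move=> t t0; rewrite (_ : (fun y => _) = cst 0) ?integral0//.
  by apply/funext => y; rewrite /k pw_neg// !mul0r normr0.
- move=> t /andP[t0 _].
  apply: (le_trans (ck t (fun y => nrm1 (y - x) ^+ 2) (`|h| * L) (cM n * t) t0 _ _ _ _ _))%R.
  + by mea.
  + by rewrite mulr_ge0.
  + by move=> y; rewrite exprn_ge0// nrm1_ge0.
  + move=> y; apply: (le_trans (qh y)); rewrite -mulrA ler_wpM2l// mulrC expr2 mulrA.
    rewrite ler_wpM2r ?nrm1_ge0//; have := FL x (y - x).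
    by rewrite addrCA subrr addr0.
  + exact: moment2_shift.
  + rewrite lee_fin (_ : (b - 1 = (b - 2) + 1)%R); last by ring.
    rewrite [in X in (_ <= X)%R]powRD ?(gt_eqF t0) ?implybT// powRr1 ?(ltW t0)//.
    by rewrite le_eqVlt; apply/orP; left; apply/eqP; ring.
- move=> t t1; have t0 : (0 < t)%R by exact: lt_le_trans t1.
  apply: (le_trans (ck t (fun y => nrm1 (y - x)) (`|h| * (2 * M)) ((1 + cM n) * Num.sqrt t) t0 _ _ _ _ _))%R.
  + by mea.
  + by rewrite !mulr_ge0.
  + by move=> y; rewrite nrm1_ge0.
  + move=> y; apply: (le_trans (qh y)); rewrite -mulrA ler_wpM2l// mulrC ler_wpM2r ?nrm1_ge0//.
    by rewrite (le_trans (ler_normB _ _))// mulr2n mulrDl mul1r lerD.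
  + exact: moment1_shift.
  + rewrite lee_fin (_ : (- (2^-1 - b) - 1 = (b - 2) + 2^-1)%R); last by field.
    rewrite [in X in (_ <= X)%R]powRD ?(gt_eqF t0) ?implybT// powR12_sqrt ?(ltW t0)//.
    by rewrite le_eqVlt; apply/orP; left; apply/eqP; ring.
Qed.

Let inner y : \int[leb]_t (k t y)%:E =
  (kconst (n := n) b * enorm (y - x) `^ (2 * b - 2 - n%:R) * q y)%:E.
Proof.
have q0 : q x = 0%R by rewrite /q (subrr (F x)) mulr0.
have [->|yx] := eqVneq y x.
  rewrite (_ : (fun t => _) = cst 0) ?integral0.
    by rewrite q0 mulr0.
  by apply/funext => t; rewrite /k q0 mulr0.
have yx0 : (y - x)%R != 0%R by rewrite subr_eq0.
have b01 : (0 < b < 1)%R by rewrite b0/=; have := b2; lra.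
have K := kernel_power b01 yx0.
have I : leb.-integrable setT (fun t => (pw (b - 2) t * G t (y - x))%:E).
  apply/integrableP; split; first by mea.
  rewrite (_ : (\int[leb]_t `|_|) = \int[leb]_t (pw (b - 2) t * G t (y - x))%:E); last first.
    apply: eq_integral => t _; rewrite gee0_abs// lee_fin.
    by apply: mulr_ge0; [exact: pw_ge0|exact: G_ge0].
  by rewrite K ltry.
transitivity (\int[leb]_t (q y * (pw (b - 2) t * G t (y - x)))%:E).
  by apply: eq_integral => t _; rewrite /k mulrC.
by rewrite (intZR _ I) K -EFinM mulrC.
Qed.

Let mdpsi : measurable_fun setT dpsi. Proof. by rewrite /dpsi; mea. Qed.
Let dpsiM z : (`|dpsi z| <= M + M)%R.
Proof. by rewrite /dpsi (le_trans (ler_normB _ _))// lerD. Qed.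

Lemma dpsi_fin : \int[mu]_z (`|dpsi z|)%:E < +oo.
Proof.
apply: (@le_lt_trans _ _ (\int[mu]_z ((`|psi z|)%:E + (`|psi (z - h *: basis_rV i)|)%:E))).
  apply: le_int; try by mea.
  by move=> z; rewrite -EFinD lee_fin ler_normB.
rewrite intD//; try by mea.
have := @ge0_integral_rV_shift R n (- (h *: basis_rV i)) (fun z => (`|psi z|)%:E).
move=> -> //; last by mea.
by rewrite lte_add_pinfty.
Qed.

Let sE : (sriesz b dpsi x)%:E = \int[leb]_t \int[mu]_y (k t y)%:E.
Proof.
rewrite (sriesz_iter x b0 bn mdpsi dpsiM dpsi_fin).
apply: eq_integral => t _; have [t0|t0] := ltP 0%R t; last first.
  by apply: eq_integral => y _; rewrite /k !pw_neg// !mul0r.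
have I1 := integrable_G_bounded x t0 mdpsi dpsiM.
have mI2 : measurable_fun setT (fun y : E => h * ((y - x) ord0 i / t * G t (y - x)) * (F y - F x))%R.
  by mea.
have I2 : mu.-integrable setT (fun y : E => (h * ((y - x) ord0 i / t * G t (y - x)) * (F y - F x))%:E).
  apply: (@integrable_dom _ _ _ mu _ (fun y => `|h| / t * (M + M) * (nrm1 (y - x) * G t (y - x)))%R) => //.
  - by mea.
  - move=> y; have -> : (h * ((y - x) ord0 i / t * G t (y - x)) * (F y - F x) =
      (h / t * (y - x) ord0 i * (F y - F x)) * G t (y - x))%R by ring.
    rewrite normrM (ger0_norm (G_ge0 _ _)) mulrA.
    apply: ler_wpM2r; first exact: G_ge0.
    rewrite !normrM normfV (gtr0_norm t0) mulrAC.
    apply: ler_pM => //; first by rewrite !mulr_ge0// invr_ge0 ltW.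
      rewrite ler_wpM2l ?mulr_ge0 ?invr_ge0 ?(ltW t0)//.
      by rewrite (le_trans (ler_normB _ _))// lerD.
    exact: coord_nrm1.
  - under eq_integral do rewrite EFinM.
    rewrite intZl; last 3 first.
    - by mea.
    - by move=> y; rewrite lee_fin; apply: mulr_ge0; [exact: nrm1_ge0|exact: G_ge0].
    - by rewrite mulr_ge0// ?divr_ge0 ?addr_ge0// ltW.
    apply: lte_mul_pinfty => //; first by rewrite lee_fin mulr_ge0// ?divr_ge0 ?addr_ge0// ltW.
    by apply: (le_lt_trans (moment1_shift _ t0)); exact: ltry.
rewrite (intZR (pw (b - 1) t) I1) (gaussian_ibp i h x (F x) mpsi psiM t0) -(intZR _ I2).
apply: eq_integral => y _; congr EFin; rewrite /k /q.
rewrite (_ : (b - 1 = (b - 2) + 1)%R); last by ring.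
rewrite pwD (pwE 1)// powRr1 ?(ltW t0)//.
by field; rewrite gt_eqF.
Qed.

Let C := (h * kconst (n := n) b)%R.
Let C0 : C != 0%R.
Proof.
rewrite /C mulf_neq0// gt_eqF// kconst_gt0// b0/=.
by have := b2; lra.
Qed.

(** The double integral of [k t y] in the two orders: time first produces the singular kernel by
    [kernel_power], space first produces the potential of the increment by [gaussian_ibp]. *)
Lemma frac_divE : frac_div a (Ffield psi i h) x = (mu_const n a / C * sriesz b dpsi x)%R.
Proof.
pose D (y : E) := (dotv (y - x) (Ffield psi i h y - Ffield psi i h x) /
  (enorm (y - x)) `^ (n%:R + a + 1))%R.
have DE y : (C * D y)%:E = \int[leb]_t (k t y)%:E.
  rewrite inner /C /D /q; congr EFin.
  have -> : (dotv (y - x) (Ffield psi i h y - Ffield psi i h x) = (y - x) ord0 i * (F y - F x))%R.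
    rewrite /Ffield -scalerBl /dotv (bigD1 i)//= big1 ?addr0.
      by rewrite !mxE !eqxx mulr1.
    by move=> j ji; rewrite !mxE (negbTE ji) andbF !mulr0.
  rewrite (_ : (2 * b - 2 - n%:R = - (n%:R + a + 1))%R); last by rewrite /b; field.
  by rewrite powRN; ring.
have kfin' : \int[mu]_y \int[leb]_t (`|k t y|)%:E < +oo.
  have mk' : measurable_fun setT (fun p : E * R => (`|k p.2 p.1|)%:E) by rewrite /k; mea.
  by rewrite (tonelli mu leb (fun y t => (`|k t y|)%:E) mk').
have mk2 : measurable_fun setT (fun p : E * R => k p.2 p.1) by rewrite /k; mea.
have I := fubini_integrable mu leb (fun y t => k t y) mk2 kfin'.
have ID : mu.-integrable setT (fun y => (D y)%:E).
  rewrite (_ : (fun y => _) = (fun y => C^-1%:E * \int[leb]_t (k t y)%:E)).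
    exact: integrableZl.
  by apply/funext => y; rewrite -DE -EFinM mulKf.
have S : (sriesz b dpsi x)%:E = C%:E * \int[mu]_y (D y)%:E.
  rewrite sE (fubini leb mu k mk kfin) -(intZR _ ID).
  by apply: eq_integral => y _; rewrite DE.
rewrite /frac_div -/(D _) (rV_int_integrable ID).
rewrite -(integrable_fineK ID) -EFinM in S.
rewrite (EFin_inj S).
by field.
Qed.

End fractional_divergence.

(** * Increments of the potential *)

Section fatou_bound.
Local Open Scope ereal_scope.
Context d (T : measurableType d) (R : realType) (m : {measure set T -> \bar R}).

Lemma fatou_bound (g_ : nat -> T -> \bar R) (g : T -> \bar R) (M : \bar R) :
  (forall k, measurable_fun setT (g_ k)) -> (forall k x, 0 <= g_ k x) ->
  (forall x, g_ k x @[k --> \oo] --> g x) ->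
  (forall k, \int[m]_x g_ k x <= M) -> \int[m]_x g x <= M.
Proof.
move=> mg g0 gc gM.
have -> : \int[m]_x g x = \int[m]_x limn_einf (g_^~ x).
  by apply: eq_integral => x _; have [-> _] := cvg_limn_einf_sup (gc x).
apply: (@le_trans _ _ (limn_einf (fun k => \int[m]_x g_ k x))).
  by apply: fatou => // k x _.
rewrite limn_einf_lim; apply: lime_le; first exact: is_cvg_einfs.
near=> k; apply: le_trans (gM k); apply: ereal_inf_lbound.
by exists k => /=.
Unshelve. all: by end_near. Qed.

End fatou_bound.

Section cutoff.
Context {R : realType} {n : nat}.
Notation E := ('rV[R]_n).

Lemma Sm01_prod (s : seq 'I_n) (F : 'I_n -> E -> R) : (forall i, Sm01 (F i)) ->
  Sm01 (fun z => \prod_(i <- s) F i z).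
Proof.
move=> SF; elim: s => [|i s ih].
  rewrite (_ : (fun z => _) = (fun=> 1)); last by apply/funext => z; rewrite big_nil.
  by split; [exact: Sm_cst|move=> z; rewrite ler01 lexx].
rewrite (_ : (fun z => _) = (fun z => F i z * \prod_(j <- s) F j z)).
  exact: Sm01_mul.
by apply/funext => z; rewrite big_cons.
Qed.

(** The cut-off need not equal 1 near the origin. Smoothness, support in a cube and pointwise
    convergence to 1 are enough, as global bounds are recovered by Fatou's lemma. *)
Definition cutoff (j : nat) (z : E) : R :=
  \prod_i (bump 0 (1 * z ord0 i + j%:R) * bump 0 (-1 * z ord0 i + j%:R)).

Lemma cutoff_Sm01 j : Sm01 (cutoff j).
Proof.
apply: (@Sm01_prod _ (fun i z => bump 0 (1 * z ord0 i + j%:R) * bump 0 (-1 * z ord0 i + j%:R))).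
by move=> i; apply: Sm01_mul; exact: Sm01_bump.
Qed.

Lemma cutoff_support (j : nat) (z : E) k : j%:R < `|z ord0 k| -> cutoff j z = 0.
Proof.
move=> jz; rewrite /cutoff (bigD1 k)//=.
suff -> : bump 0 (1 * z ord0 k + j%:R) * bump 0 (-1 * z ord0 k + j%:R) = 0 by rewrite mul0r.
have [z0|z0] := leP 0 (z ord0 k); rewrite mul1r mulN1r.
  rewrite ger0_norm// in jz.
  by rewrite [X in _ * X]bump_le0E ?mulr0// addrC subr_le0 ltW.
rewrite ltr0_norm// in jz.
by rewrite bump_le0E ?mul0r//; rewrite -(opprK (z ord0 k)) addrC subr_le0 ltW.
Qed.

Lemma bump0_cvg1 (x : R) : bump 0 (x + j%:R) @[j --> \oo] --> (1 : R).
Proof.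
suff : expR (- (x + j%:R)^-1) @[j --> \oo] --> (1 : R).
  apply: cvg_trans; apply: near_eq_cvg; near=> k.
  have k0 : 0 < x + k%:R.
    rewrite -ltrBlDl sub0r; near: k; exact: nbhs_infty_gtr.
  by rewrite bump_gt0E// expr0 invr1 mul1r.
rewrite -[X in _ --> X]expR0; apply: continuous_cvg; first exact: continuous_expR.
rewrite -[X in _ --> X]oppr0; apply: cvgN.
apply/gtr0_cvgV0.
  near=> k; rewrite -ltrBlDl sub0r; near: k; exact: nbhs_infty_gtr.
apply/cvgryPge => M; near=> k.
rewrite -lerBlDl; near: k; exact: nbhs_infty_ger.
Unshelve. all: by end_near. Qed.

Lemma cutoff_cvg1 (z : E) : cutoff j z @[j --> \oo] --> (1 : R).
Proof.
rewrite /cutoff.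
rewrite [X in _ --> X](_ : (1 : R) = \prod_(i < n) (1 * 1)); last first.
  by rewrite big1// => i _; rewrite mulr1.
elim: (index_enum _) => [|i s ih].
  rewrite big_nil; under eq_fun do rewrite big_nil; exact: cvg_cst.
rewrite big_cons; under eq_fun do rewrite big_cons.
by apply: cvgM => //; apply: cvgM; exact: bump0_cvg1.
Qed.

End cutoff.

Lemma abs_shift_fin {R : realType} {n : nat} (psi : 'rV[R]_n -> R) (w : 'rV[R]_n) :
  measurable_fun setT psi -> (\int[lebn n]_z (`|psi z|)%:E < +oo)%E ->
  (\int[lebn n]_z (`|psi (z - w)|)%:E < +oo)%E.
Proof.
move=> mpsi fin; have := @ge0_integral_rV_shift R n (- w) (fun z => (`|psi z|)%:E).
by move=> -> //; mea.
Qed.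

Section local_integrability.
Local Open Scope ereal_scope.
Context {R : realType} {n : nat}.
Notation mu := (@lebn R n).
Notation E := ('rV[R]_n).
Variable u : E -> R.
Hypothesis mu_ : measurable_fun setT u.
Hypothesis Hint : forall (psi : E -> R) (M : R), measurable_fun setT psi ->
  (forall z, `|psi z| <= M)%R -> \int[mu]_z (`|psi z|)%:E < +oo ->
  mu.-integrable setT (fun x => (psi x * u x)%:E).

Lemma integrable_pair_shift (psi : E -> R) (M : R) (w : E) : measurable_fun setT psi ->
  (forall z, `|psi z| <= M)%R -> \int[mu]_z (`|psi z|)%:E < +oo ->
  mu.-integrable setT (fun x => (psi x * u (x + w))%:E).
Proof.
move=> mpsi psiM psifin.
have m' : measurable_fun setT (fun z : E => psi (z - w)%R) by mea.
have fin' : \int[mu]_z (`|psi (z - w)|)%:E < +oo.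
  exact: abs_shift_fin.
have /integrableP[_ i1] := Hint m' (fun z => psiM (z - w)%R) fin'.
apply/integrableP; split; first by mea.
apply: le_lt_trans i1; rewrite le_eqVlt; apply/orP; left; apply/eqP.
have := @ge0_integral_rV_shift R n w (fun x => `|(psi (x - w) * u x)%:E|).
move=> <- //; last by mea.
by apply: eq_integral => x _; rewrite addrK.
Qed.

Lemma integrable_diff (psi : E -> R) (M : R) (w : E) : measurable_fun setT psi ->
  (forall z, `|psi z| <= M)%R -> \int[mu]_z (`|psi z|)%:E < +oo ->
  mu.-integrable setT (fun y => (psi y * (u (y + w) - u y))%:E).
Proof.
move=> mpsi psiM psifin.
have i1 := Hint mpsi psiM psifin.
have i2 := integrable_pair_shift w mpsi psiM psifin.
rewrite (_ : (fun y => _) = (fun y => (psi y * u (y + w))%:E) \- (fun y => (psi y * u y)%:E)).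
  exact: (integrableB measurableT i2 i1).
by apply/funext => y; rewrite mulrBr EFinB.
Qed.

Lemma pair_difference (psi : E -> R) (M : R) (w : E) : measurable_fun setT psi ->
  (forall z, `|psi z| <= M)%R -> \int[mu]_z (`|psi z|)%:E < +oo ->
  \int[mu]_x ((psi x - psi (x - w)) * u x)%:E =
  - \int[mu]_x (psi x * (u (x + w) - u x))%:E.
Proof.
move=> mpsi psiM psifin.
have i1 := Hint mpsi psiM psifin.
have i2 := integrable_pair_shift w mpsi psiM psifin.
have mpw : measurable_fun setT (fun z : E => psi (z - w)%R) by mea.
have i3 := Hint mpw (fun z => psiM (z - w)%R) (abs_shift_fin w mpsi psifin).
transitivity (\int[mu]_x (psi x * u x - psi (x - w) * u x)%:E).
  by apply: eq_integral => x _; rewrite mulrBl.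
transitivity (- \int[mu]_x (psi x * u (x + w) - psi x * u x)%:E); last first.
  by congr (- _); apply: eq_integral => x _; rewrite mulrBr.
rewrite (intBR i1 i3) (intBR i2 i1).
have m3 : measurable_fun setT (fun x : E => (psi (x - w) * u x)%:E) by mea.
rewrite -(integral_rV_shift w m3).
have -> : \int[mu]_x (psi (x + w - w) * u (x + w))%:E = \int[mu]_x (psi x * u (x + w))%:E.
  by apply: eq_integral => x _; rewrite addrK.
rewrite -(integrable_fineK i1) -(integrable_fineK i2) -!EFinB -EFinN.
by congr EFin; rewrite opprB.
Qed.

End local_integrability.

(** * From smooth test functions to increments in L1 *)

Section abstract_variation.
Local Open Scope ereal_scope.
Context {R : realType} {n : nat}.
Notation mu := (@lebn R n).
Notation E := ('rV[R]_n).
Variables (u : E -> R) (cV V : R).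
Hypothesis mu_ : measurable_fun setT u.
Hypothesis Hint : forall (psi : E -> R) (M : R), measurable_fun setT psi ->
  (forall z, `|psi z| <= M)%R -> \int[mu]_z (`|psi z|)%:E < +oo ->
  mu.-integrable setT (fun x => (psi x * u x)%:E).
Hypothesis Hvar : forall (i : 'I_n) (h : R) (psi : E -> R) (K : R), h != 0%R ->
  Sm psi -> (forall z, `|psi z| <= 1)%R ->
  (forall z k, (K < `|(z : E) ord0 k|)%R -> psi z = 0%R) ->
  (fine (\int[mu]_y (psi y * (u (y + h *: basis_rV i) - u y))%:E) <= cV * `|h| * V)%R.

Section direction.
Variables (i : 'I_n) (h : R).
Let w : E := h *: basis_rV i.
Hypothesis h0 : h != 0%R.
Let g (y : E) : R := (u (y + w) - u y)%R.

Let mg : measurable_fun setT g. Proof. by rewrite /g; mea. Qed.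

(** The optimal test function is the cut-off times the sign of the increment [g]. The sign is
    replaced by [2 phi - 1], with [phi] smooth and close to the indicator of [g > 0] in L1 with
    weight [cutoff * |g|]. *)
Lemma L1_cutoff j : \int[mu]_y (cutoff j y * `|g y|)%:E <= (cV * `|h| * V)%:E.
Proof.
have [SX X01] := cutoff_Sm01 (R := R) (n := n) j.
have mX := Sm_measurable SX.
have X1 (z : E) : (`|cutoff j z| <= 1)%R by have /andP[? ?] := X01 z; rewrite ger0_norm.
have XK z k : (j%:R < `|(z : E) ord0 k|)%R -> cutoff j z = 0%R by exact: cutoff_support.
have Xfin := cube_support_fin mX ler01 X1 XK.
have /integrableP[_ I] := integrable_diff mu_ Hint w mX X1 Xfin.
have w0 y : (0 <= cutoff j y * `|g y|)%R by rewrite mulr_ge0//; have /andP[] := X01 y.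
have mw : measurable_fun setT (fun y => cutoff j y * `|g y|)%R by mea.
have wfin : \int[mu]_y (cutoff j y * `|g y|)%:E < +oo.
  apply: le_lt_trans I; rewrite le_eqVlt; apply/orP; left; apply/eqP.
  apply: eq_integral => y _; rewrite /= normrM [in RHS]ger0_norm//.
  by have /andP[] := X01 y.
pose A := [set y | (0 < g y)%R].
have mA : measurable A.
  rewrite /A -[X in measurable X]setTI.
  rewrite (_ : [set y | _] = g @^-1` `]0%R, +oo[).
    by apply: mg => //; exact: measurable_itv.
  by apply/seteqP; split => z /=; rewrite in_itv/= andbT.
apply/lee_addgt0Pr => e e0.
have e20 : (0 < e / 2)%R by rewrite divr_gt0.
have [phi [Sphi phi01] phie] := smooth_approx w0 mw wfin mA e20.
have mphi := Sm_measurable Sphi.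
pose psi (y : E) := (cutoff j y * (2 * phi y + (-1)))%R.
have Spsi : Sm psi.
  by apply: Sm_mul => //; apply: Sm_add; [exact: Sm_scale|exact: Sm_cst].
have psi1 z : (`|psi z| <= 1)%R.
  rewrite /psi normrM mulr_ile1 ?normr_ge0//.
  by have /andP[? ?] := phi01 z; rewrite ler_norml; lra.
have psiK z k : (j%:R < `|(z : E) ord0 k|)%R -> psi z = 0%R.
  by move=> /XK; rewrite /psi => ->; rewrite mul0r.
have S := Hvar i h0 Spsi psi1 psiK.
have psifin := cube_support_fin (Sm_measurable Spsi) ler01 psi1 psiK.
have Ip := integrable_diff mu_ Hint w (Sm_measurable Spsi) psi1 psifin.
pose r (y : E) := (`|\1_A y - phi y| * (cutoff j y * `|g y|))%R.
have m1A : measurable_fun setT (\1_A : E -> R) by exact: mf_indic.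
have Ir : mu.-integrable setT (fun y => (r y)%:E).
  apply/integrableP; split; first by rewrite /r; mea.
  apply: (@le_lt_trans _ _ (e / 2)%:E); last exact: ltry.
  apply: le_trans (ltW phie); rewrite le_eqVlt; apply/orP; left; apply/eqP.
  by apply: eq_integral => y _; rewrite /= ger0_norm// /r mulr_ge0.
have Iw : mu.-integrable setT (fun y => (cutoff j y * `|g y|)%:E).
  apply/integrableP; split; first by mea.
  by under eq_integral do rewrite /= ger0_norm//.
have Is : mu.-integrable setT (fun y => (psi y * g y + 2 * r y)%:E).
  rewrite (_ : (fun y => _) = (fun y => (psi y * g y)%:E) \+ (fun y => 2%:E * (r y)%:E)).
    apply: integrableD => //; exact: integrableZl.
  by [].
apply: (@le_trans _ _ (\int[mu]_y (psi y * g y + 2 * r y)%:E)).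
  apply: le_integral => // y _; rewrite lee_fin.
  have -> : (cutoff j y * `|g y| = cutoff j y * (2 * \1_A y + (-1)) * g y)%R.
    rewrite -mulrA; congr (_ * _)%R; rewrite indicE /A.
    have [gy|gy] := ltP 0%R (g y).
      by rewrite mem_set//= gtr0_norm//; ring.
    rewrite memNset/=; last by rewrite ltNge gy.
    by rewrite ler0_norm//; ring.
  rewrite -lerBlDl /psi -mulrBl -mulrBr.
  rewrite (_ : (2 * \1_A y + -1 - (2 * phi y + -1) = 2 * (\1_A y - phi y))%R); last by ring.
  rewrite /r; have X0 : (0 <= cutoff j y)%R by have /andP[] := X01 y.
  apply: (le_trans (ler_norm _)); rewrite !normrM (ger0_norm X0) (@ger0_norm _ 2)//.
  by rewrite le_eqVlt; apply/orP; left; apply/eqP; ring.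
rewrite (_ : (fun y => _) = (fun y => (psi y * g y)%:E) \+ (fun y => 2%:E * (r y)%:E))//.
rewrite (integralD measurableT Ip (integrableZl measurableT 2 Ir)) (integralZl measurableT Ir).
rewrite -(integrable_fineK Ip); apply: leeD; first by rewrite lee_fin.
rewrite [X in _ <= X](_ : _ = 2%:E * (e / 2)%:E); last by rewrite -EFinM; congr EFin; field.
by apply: lee_wpmul2l; [rewrite lee_fin|exact: ltW].
Qed.

Lemma L1_direction : \int[mu]_y (`|u (y + h *: basis_rV i) - u y|)%:E <= (cV * `|h| * V)%:E.
Proof.
apply: (@fatou_bound _ _ _ mu (fun j y => (cutoff j y * `|g y|)%:E)).
- by move=> j; have mX := Sm_measurable (proj1 (cutoff_Sm01 (R := R) (n := n) j)); mea.
- move=> j y; rewrite lee_fin mulr_ge0//.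
  by have /andP[] := (proj2 (cutoff_Sm01 (R := R) (n := n) j)) y.
- move=> y; apply/cvg_EFin; first by near=> j.
  rewrite -[X in _ --> X]mul1r; apply: cvgM; last exact: cvg_cst.
  exact: cutoff_cvg1.
- exact: L1_cutoff.
Unshelve. all: by end_near. Qed.

End direction.

(** The increment is telescoped along the coordinate steps of [z]; translation invariance makes each
    step an increment from the origin of the step. *)
Lemma L1_translation (z : E) : \int[mu]_y (`|u (y + z) - u y|)%:E <= (cV * nrm1 z * V)%:E.
Proof.
have base (i : 'I_n) (h : R) :
    \int[mu]_y (`|u (y + h *: basis_rV i) - u y|)%:E <= (cV * `|h| * V)%:E.
  have [->|h0] := eqVneq h 0%R; last exact: (L1_direction i h0).
  rewrite scale0r normr0 mulr0 mul0r (_ : (fun y => _) = cst 0) ?integral0//.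
  by apply/funext => y; rewrite addr0 subrr normr0.
rewrite {1}(row_sum_delta z) /nrm1.
elim: (index_enum _) => [|i s ih].
  rewrite !big_nil mulr0 mul0r (_ : (fun y => _) = cst 0) ?integral0//.
  by apply/funext => y; rewrite addr0 subrr normr0.
rewrite !big_cons; set w := (\sum_(j <- s) _)%R in ih *.
set e := (_ *: _ : E).
apply: (@le_trans _ _ (\int[mu]_y ((`|u (y + w + e) - u (y + w)|)%:E + (`|u (y + w) - u y|)%:E))).
  apply: le_int; try by mea.
  move=> y; rewrite -EFinD lee_fin (addrC e) addrA.
  by rewrite -[X in (`|X| <= _)%R](subrKA (u (y + w))) ler_normD.
rewrite intD//; try by mea.
have := @ge0_integral_rV_shift R n w (fun y => (`|u (y + e) - u y|)%:E).
move=> -> //; last by mea.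
by rewrite mulrDr mulrDl EFinD; apply: leeD => //; exact: base.
Qed.

End abstract_variation.

Section variation.
Local Open Scope ereal_scope.
Context {R : realType} {n : nat}.
Notation mu := (@lebn R n).
Notation leb := (@lebesgue_measure R).
Notation E := ('rV[R]_n).
Variables (a p : R) (f : E -> R) (N V : R).
Let b := ((1 - a) / 2)%R.
Hypothesis a01 : (0 < a < 1)%R.
Hypothesis p1 : (1 <= p)%R.
Hypothesis bp : (b < n%:R / (2 * p))%R.
Hypothesis mf : measurable_fun setT f.
Hypothesis fN : \int[mu]_x (`|f x| `^ p)%:E = N%:E.
Hypothesis fV : frac_var a f <= V%:E.

Notation u := (sriesz b f).

Let b0 : (0 < b)%R. Proof. by rewrite /b; have /andP[? ?] := a01; lra. Qed.
Let b1 : (b < 1)%R. Proof. by rewrite /b; have /andP[? ?] := a01; lra. Qed.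
Let mu_ : measurable_fun setT u. Proof. exact: measurable_sriesz. Qed.

Lemma dual_fin_bounded (psi : E -> R) (M : R) : measurable_fun setT psi ->
  (forall z, `|psi z| <= M)%R -> \int[mu]_z (`|psi z|)%:E < +oo -> dual_fin b psi f.
Proof.
move=> mpsi psiM psifin; rewrite /dual_fin.
apply: (@riesz_pair_fin _ _ p b f N _ _ _ _ _ _ M) => //; first by mea.
by move=> x; rewrite normr_ge0 psiM.
Qed.

Lemma integrable_pair (psi : E -> R) (M : R) : measurable_fun setT psi ->
  (forall z, `|psi z| <= M)%R -> \int[mu]_z (`|psi z|)%:E < +oo ->
  mu.-integrable setT (fun x => (psi x * u x)%:E).
Proof.
move=> mpsi psiM psifin.
exact: (proj1 (sriesz_pair mpsi mf (dual_fin_bounded mpsi psiM psifin))).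
Qed.

Definition cV : R := (kconst (n := n) b / mu_const n a)%R.

Lemma cV_gt0 : (0 < cV)%R.
Proof. by rewrite /cV divr_gt0 ?mu_const_gt0// kconst_gt0// b0. Qed.

Section direction.
Variables (i : 'I_n) (h : R).
Let w : E := h *: basis_rV i.
Hypothesis h0 : h != 0%R.
Let g (y : E) : R := (u (y + w) - u y)%R.

(** [Ffield psi] is an admissible test field whose fractional divergence is the potential of an
    increment of [psi]. Symmetry moves the potential to [f], and a shift moves the increment to
    [u]. *)
Let one_sided (psi : E -> R) (K : R) : Sm psi -> (forall z, `|psi z| <= 1)%R ->
  (forall z k, (K < `|(z : E) ord0 k|)%R -> psi z = 0%R) ->
  (- (mu_const n a / (h * kconst (n := n) b)) * fine (\int[mu]_y (psi y * g y)%:E) <= V)%R.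
Proof.
move=> Sp psi1 psiK.
have mpsi := Sm_measurable Sp; have [L L0 psiL] := Sm_lipschitz Sp.
have psifin := cube_support_fin mpsi ler01 psi1 psiK.
have dE x := frac_divE i x a01 h0 mpsi psi1 psiL L0 psifin.
have dfin := dpsi_fin i h mpsi psifin.
have md : measurable_fun setT (dpsi psi i h) by rewrite /dpsi; mea.
have dM z : (`|dpsi psi i h z| <= 1 + 1)%R by rewrite /dpsi (le_trans (ler_normB _ _))// lerD.
have df := dual_fin_bounded md dM dfin.
have df' := dual_fin_sym md mf df.
have [I _] := sriesz_pair mf md df'.
have D := sriesz_dual mf md df'.
pose c := (mu_const n a / (h * kconst (n := n) b))%R.
have FE x : (f x * frac_div a (Ffield psi i h) x)%:E = (c * (f x * sriesz b (dpsi psi i h) x))%:E.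
  by rewrite dE -/b -/c; congr EFin; ring.
have ub : rV_int (fun x => (f x * frac_div a (Ffield psi i h) x)%:E) <= V%:E.
  apply: le_trans fV; apply: ereal_sup_ubound.
  by exists (Ffield psi i h); [exact: (Ffield_test i h Sp psi1 psiK)|reflexivity].
have I2 : mu.-integrable setT (fun x => (c * (f x * sriesz b (dpsi psi i h) x))%:E).
  by apply: (integrableZl measurableT c I).
rewrite (_ : (fun x => _) = (fun x => (c * (f x * sriesz b (dpsi psi i h) x))%:E)) in ub; last first.
  exact/funext.
rewrite (rV_int_integrable I2) (intZR c I) D in ub.
have P : \int[mu]_x (dpsi psi i h x * u x)%:E = - \int[mu]_x (psi x * g x)%:E.
  exact: (pair_difference mu_ integrable_pair w mpsi psi1 psifin).
have I3 : mu.-integrable setT (fun y => (psi y * g y)%:E).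
  exact: (integrable_diff mu_ integrable_pair w mpsi psi1 psifin).
move: ub; rewrite P -(integrable_fineK I3) -EFinN -EFinM lee_fin -/c.
by rewrite mulrN mulNr.
Qed.

Lemma variation_smooth (psi : E -> R) (K : R) : Sm psi -> (forall z, `|psi z| <= 1)%R ->
  (forall z k, (K < `|(z : E) ord0 k|)%R -> psi z = 0%R) ->
  (fine (\int[mu]_y (psi y * g y)%:E) <= cV * `|h| * V)%R.
Proof.
move=> Sp psi1 psiK.
have s1 := one_sided Sp psi1 psiK.
have SN : Sm (fun z => - psi z)%R.
  rewrite (_ : (fun z => _) = (fun z => -1 * psi z)%R); first exact: Sm_scale.
  by apply/funext => z; rewrite mulN1r.
have N1 z : (`|- psi z| <= 1)%R by rewrite normrN.
have NK z k : (K < `|(z : E) ord0 k|)%R -> (- psi z)%R = 0%R by move=> /psiK ->; rewrite oppr0.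
have s2 := one_sided SN N1 NK.
have psifin := cube_support_fin (Sm_measurable Sp) ler01 psi1 psiK.
have I := integrable_diff mu_ integrable_pair w (Sm_measurable Sp) psi1 psifin.
have e : \int[mu]_y (- psi y * g y)%:E = - \int[mu]_y (psi y * g y)%:E.
  rewrite -mulN1e -EFinN -(intZR (-1) I).
  by apply: eq_integral => y _; rewrite mulN1r mulNr.
rewrite e fineN in s2.
move: s1 s2; set I0 := fine _; set c := (mu_const n a / _)%R => s1 s2.
have muk : (0 < mu_const n a)%R by exact: mu_const_gt0.
have kk : (0 < kconst (n := n) b)%R by rewrite kconst_gt0// b0.
(* The sign of the constant is that of [h]; testing with both [psi] and [- psi] covers either
   case. *)
have X : (`|c * I0| <= V)%R by rewrite ler_norml; apply/andP; split; lra.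
have Y : I0 = (c * I0 * (cV * h))%R.
  by rewrite /c /cV; field; rewrite h0 !gt_eqF.
rewrite Y; apply: (le_trans (ler_norm _)); rewrite normrM.
have -> : (`|cV * h| = cV * `|h|)%R by rewrite normrM (gtr0_norm cV_gt0).
by rewrite mulrC ler_wpM2l// mulr_ge0// ltW// cV_gt0.
Qed.

End direction.

Lemma L1_sriesz (z : E) : \int[mu]_y (`|u (y + z) - u y|)%:E <= (cV * nrm1 z * V)%:E.
Proof.
apply: (L1_translation mu_ integrable_pair).
by move=> i h psi K h0; exact: variation_smooth.
Qed.

End variation.

Fact hinv_key : unit. Proof. exact: tt. Qed.

(** * Inversion of the potential *)

Section inversion_weight.
Context {R : realType}.
Notation leb := (@lebesgue_measure R).
Variable b : R.
Hypothesis b01 : 0 < b < 1.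

Let b0 : 0 < b. Proof. by have /andP[] := b01. Qed.
Let b1 : b < 1. Proof. by have /andP[] := b01. Qed.

(** Inversion rests on the integral of [t^(-b-1) (u - P_t u)]. Truncated at [t >= e], it becomes
    [b^-1] times the average of [P_(e s) f] with this weight in [s], an approximate identity as [e]
    tends to 0. *)
Definition hinv (s : R) : R := locked_with hinv_key (pw (-1) s * (pw b s - pw b (s - 1))).

Lemma hinvE s : hinv s = pw (-1) s * (pw b s - pw b (s - 1)).
Proof. by rewrite /hinv unlock. Qed.

Lemma measurable_hinv : measurable_fun setT hinv.
Proof.
rewrite (_ : hinv = (fun s => pw (-1) s * (pw b s - pw b (s - 1)))); first by mea.
by apply/funext => s; exact: hinvE.
Qed.

Lemma pw_le (s t : R) : s <= t -> pw b s <= pw b t.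
Proof.
move=> st; have [s0|s0] := leP s 0; first by rewrite pw_neg// pw_ge0.
have t0 := lt_le_trans s0 st.
by rewrite !pwE// ge0_ler_powR ?nnegrE ?(ltW b0) ?(ltW s0) ?(ltW t0).
Qed.

Lemma hinv_ge0 s : 0 <= hinv s.
Proof. by rewrite hinvE mulr_ge0 ?pw_ge0// subr_ge0 pw_le// gerBl. Qed.

Lemma hinv_near s : 0 < s -> hinv s <= s `^ (b - 1).
Proof.
move=> s0; rewrite hinvE (pwE (-1) s0) (pwE b s0) (addrC b) powRD ?(gt_eqF s0) ?implybT//.
by rewrite ler_wpM2l ?powR_ge0// gerBl pw_ge0.
Qed.

(* For s >= 2 the mean value inequality is replaced by Bernoulli's
   [x `^ b <= 1 + b * (x - 1)] at [x = s / (s - 1)]. *)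
Lemma hinv_far s : 2 <= s -> hinv s <= 2 * s `^ (- (1 - b) - 1).
Proof.
move=> s2; have s0 : 0 < s by lra. have s10 : 0 < s - 1 by lra.
rewrite hinvE !pwE//.
have e1 : (s - 1) `^ b >= (1 - s^-1) * s `^ b.
  have -> : s - 1 = s * (1 - s^-1) by field; rewrite gt_eqF.
  have r0 : 0 < 1 - s^-1 by rewrite subr_gt0 invf_lt1//; lra.
  rewrite powRM ?(ltW r0) ?(ltW s0)// mulrC ler_wpM2l ?powR_ge0//.
  have r1 : 1 - s^-1 < 1 by rewrite gtrBl invr_gt0.
  have := @powR_le_near R b 1 (1 - s^-1); rewrite r0 r1 (ltW b1) powRr1 ?(ltW r0)//.
  exact.
have e2 : s `^ (- (1 - b) - 1) = s `^ (-1) * (s^-1 * s `^ b).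
  have -> : - (1 - b) - 1 = -1 + (-1 + b) by ring.
  by rewrite !powRD ?(gt_eqF s0) ?implybT// powR_inv1 ?(ltW s0).
rewrite e2 mulrCA ler_wpM2l ?powR_ge0//.
have h0 : 0 <= s^-1 * s `^ b by rewrite mulr_ge0 ?powR_ge0// invr_ge0 ltW.
move: e1 h0; rewrite mulrBl mul1r; lra.
Qed.

Lemma hinv_int_fin : (\int[leb]_s (hinv s)%:E < +oo)%E.
Proof.
apply: (@le_lt_trans _ _ (1 * (2 `^ b / b) + 2 * (2 `^ (- (1 - b)) / (1 - b)))%:E); last exact: ltry.
apply: pw_split_bound => //.
- by rewrite subr_gt0.
- by apply: mf_EFin; exact: measurable_hinv.
- by move=> t; rewrite lee_fin hinv_ge0.
- by move=> t t0; rewrite hinvE pw_neg// mul0r.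
- by move=> t /andP[t0 _]; rewrite lee_fin mul1r hinv_near.
- by move=> t t2; rewrite lee_fin hinv_far.
Qed.

Definition Hinv : R := fine (\int[leb]_s (hinv s)%:E).

Lemma HinvE : (\int[leb]_s (hinv s)%:E = Hinv%:E)%E.
Proof.
rewrite /Hinv fineK// ge0_fin_numE; first exact: hinv_int_fin.
by apply: int_ge0 => s; rewrite lee_fin hinv_ge0.
Qed.

Lemma Hinv_gt0 : 0 < Hinv.
Proof.
rewrite -lte_fin -HinvE.
apply: (@lt_le_trans _ _ (\int[leb]_t (pw (b - 1) t * (t < 1)%R%:R)%:E)%E).
  by rewrite integral_pw_near// lte_fin divr_gt0// powR_gt0.
apply: le_int.
- by mea.
- by apply: mf_EFin; exact: measurable_hinv.
- by move=> t; rewrite lee_fin mulr_ge0 ?pw_ge0.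
- move=> t; rewrite lee_fin; have [t1|t1] := ltP t 1; last by rewrite mulr0 hinv_ge0.
  have t10 : t - 1 <= 0 by rewrite subr_le0 ltW.
  by rewrite mulr1 hinvE (pw_neg b t10) subr0 -pwD (addrC b) lexx.
Qed.

(* The primitive of [t `^ (- b - 1) * (r - t) `^ (b - 1)] is
   [- (b * r)^-1 * ((r - t) / t) `^ b]. *)
Lemma beta_integral (e r : R) : 0 < e -> 0 < r ->
  (\int[leb]_t (pw (- b - 1) t * (e <= t)%R%:R * pw (b - 1) (r - t))%:E =
   (pw b (r - e) * e `^ (- b) / (b * r))%:E)%E.
Proof.
move=> e0 r0; have [re|er] := leP r e.
  rewrite (pw_neg _ (_ : r - e <= 0)) ?subr_le0// !mul0r.
  under eq_integral => t _.
    rewrite (_ : pw (- b - 1) t * (e <= t)%R%:R * pw (b - 1) (r - t) = 0); first over.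
    have [et|te] := leP e t; last by rewrite mulr0 mul0r.
    by rewrite (@pw_neg _ _ (r - t)) ?mulr0// subr_le0 (le_trans re).
  by rewrite integral0.
rewrite pwE ?subr_gt0//.
pose F (t : R) : R := - (b * r)^-1 * ((r - t) / t) `^ b.
pose k (t : R) : R := t `^ (- b - 1) * (r - t) `^ (b - 1).
have -> : (\int[leb]_t (pw (- b - 1) t * (e <= t)%R%:R * pw (b - 1) (r - t))%:E =
           \int[leb]_(t in `]e, r[) (k t)%:E)%E.
  have mk : measurable_fun setT k by rewrite /k; mea.
  rewrite [RHS]integral_itv_obnd_cbnd; last first.
    by apply: mf_EFin; exact: measurable_funTS.
  rewrite [RHS]integral_mkcond; apply: eq_integral => t _.
  rewrite patchE mem_setE in_itv/= /k.
  have [et|te] := leP e t => /=; last by rewrite mulr0 mul0r.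
  have t0 := lt_le_trans e0 et; have [tr|rt] := ltP t r.
    by rewrite mulr1 !pwE// subr_gt0.
  by rewrite (@pw_neg _ _ (r - t)) ?mulr0// subr_le0.
have dF (t : R) : 0 < t -> t < r -> is_derive t 1 F (k t).
  move=> t0 tr; have v0 : 0 < (r - t) / t by rewrite divr_gt0// subr_gt0.
  have dv : is_derive t 1 (fun x : R => (r - x) / x) (- r / t ^+ 2).
    have tn0 : t != 0 by rewrite gt_eqF.
    have d1 : is_derive t 1 (fun x : R => x^-1) (- t ^- 2).
      have := @is_deriveV _ id t 1 1 tn0 (is_derive_id _ _).
      by rewrite -[_ *: _]/(_ * _) mulr1.
    have := is_deriveB (is_deriveZ r d1) (is_derive_cst (1 : R) t 1).
    rewrite (_ : r *: - t ^- 2 - 0 = - r / t ^+ 2) => [d2|]; last first.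
      by rewrite subr0 -[_ *: _]/(_ * _) mulrN mulNr.
    apply: is_derive_near d2; near=> x.
    have x0 : x != 0.
      rewrite gt_eqF//; near: x; exact: lt_nbhsr.
    by rewrite mulrBl divff.
  have dp := is_derive1_powR b v0.
  have := @is_derive1_comp _ (@powR R ^~ b) (fun x : R => (r - x) / x) t _ _ dp dv.
  move=> dc.
  have := is_deriveZ (- (b * r)^-1) dc.
  rewrite (_ : _ *: _ = k t)//.
  rewrite /k -[_ *: _]/(_ * _) powRM ?subr_ge0 ?(ltW tr) ?invr_ge0 ?(ltW t0)//.
  rewrite -(powR_inv1 (ltW t0)) -powRrM mulN1r.
  have -> : t `^ (- b - 1) = t `^ (- (b - 1)) * t ^- 2.
    have -> : - b - 1 = - (b - 1) + - 2%:R by ring.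
    by rewrite powRD ?(gt_eqF t0) ?implybT// [X in _ * X]powRN powR_mulrn// ltW.
  set A := (r - t) `^ _; set B := t `^ _.
  by field; rewrite !gt_eqF// exprn_gt0.
rewrite (@ge0_FTC_oo _ k F)//.
- congr EFin; rewrite /F subrr mul0r powR0 ?gt_eqF// mulr0 sub0r mulNr opprK.
  rewrite powRM ?subr_ge0 ?(ltW er) ?invr_ge0 ?(ltW e0)//.
  rewrite -(powR_inv1 (ltW e0)) -powRrM mulN1r.
  by rewrite mulrC.
- by move=> t _; rewrite mulr_ge0 ?powR_ge0.
- move=> t; rewrite in_itv/= => /andP[et tr]; apply: dF => //.
  exact: lt_trans et.
- move=> t; rewrite in_itv/= => /andP[et tr]; have t0 := lt_trans e0 et.
  have c1 (c x : R) : 0 < x -> {for x, continuous (@powR R ^~ c)}.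
    move=> x0; apply/differentiable_continuous/derivable1_diffP.
    by have [] := is_derive1_powR c x0.
  apply: cvgM; first exact: c1.
  apply: (@continuous_comp _ _ _ (fun x => r - x) (@powR R ^~ (b - 1))).
    by apply: cvgB; [exact: cvg_cst|exact: cvg_id].
  by apply: c1; rewrite subr_gt0.
- have h : {for e, continuous F}.
    apply/differentiable_continuous/derivable1_diffP.
    by have [] := dF e e0 er.
  by apply: cvg_at_right_filter; exact: h.
- rewrite [X in _ --> X](_ : F r = - (b * r)^-1 * 0); last first.
    by rewrite /F subrr mul0r powR0// gt_eqF.
  apply: cvgM; first exact: cvg_cst.
  have vc : (r - t) / t @[t --> r^'-] --> (0 : R)^'+.
    move=> A [d /= d0 dA].
    have h : {for r, continuous (fun t : R => (r - t) / t)}.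
      apply: cvgM; first by apply: cvgB; [exact: cvg_cst|exact: cvg_id].
      by apply: cvgV; [rewrite gt_eqF|exact: cvg_id].
    have : (r - t) / t @[t --> r^'-] --> (r - r) / r by apply: cvg_at_left_filter; exact: h.
    rewrite subrr mul0r => /cvgrPdist_lt /(_ _ d0) H.
    change (\forall t \near r^'-, A ((r - t) / t)); near=> t; apply: dA.
      by rewrite /ball_/=; near: t.
    apply: divr_gt0; first by rewrite subr_gt0; near: t; exact: nbhs_left_lt.
    by near: t; exact: nbhs_left_gt.
  exact: (cvg_comp _ _ vc (powR_cvg0 b0)).
Unshelve. all: by end_near. Qed.

End inversion_weight.

Section abstract_inversion.
Local Open Scope ereal_scope.
Context {R : realType}.
Notation leb := (@lebesgue_measure R).
Variables (b : R) (al : R -> \bar R).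
Hypothesis b01 : (0 < b < 1)%R.
Hypothesis mal : measurable_fun setT al.
Hypothesis al0 : forall r, 0 <= al r.
Let b0 : (0 < b)%R. Proof. by have /andP[] := b01. Qed.

Lemma convolution_shift t :
  \int[leb]_s ((pw (b - 1) s)%:E * al (t + s)%R) = \int[leb]_r ((pw (b - 1) (r - t))%:E * al r).
Proof.
have m1 : measurable_fun setT (fun s => (pw (b - 1) s)%:E * al (t + s)%R) by mea.
have n1 s : 0 <= (pw (b - 1) s)%:E * al (t + s)%R by rewrite mule_ge0.
rewrite (@ge0_integral_affine R 1 (- t) ltr01 _ m1 n1) mul1e.
by apply: eq_integral => s _; rewrite mul1r (addrC t) subrK.
Qed.

(** [al r] stands for the pairing of [psi] with [P_r f]. The potential integrates it against
    [r^(b-1)], its heat flow at time [t] against [(r - t)^(b-1)]; Tonelli's theorem reduces the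
    truncated time integral to [beta_integral]. *)
Lemma inversion_identity e : (0 < e)%R ->
  (e `^ (- b) / b)%:E * \int[leb]_r ((pw (b - 1) r)%:E * al r) =
  \int[leb]_t ((pw (- b - 1) t * (e <= t)%R%:R)%:E * \int[leb]_r ((pw (b - 1) (r - t))%:E * al r)) +
  b^-1%:E * \int[leb]_s (al (e * s)%R * (hinv b s)%:E).
Proof.
move=> e0; have mh := measurable_hinv b.
have ei : (0 <= e^-1)%R by rewrite invr_ge0 ltW.
have eh r : (0 <= e^-1 * hinv b (e^-1 * r))%R by apply: mulr_ge0 => //; exact: hinv_ge0.
have beh r : (0 <= b^-1 * (e^-1 * hinv b (e^-1 * r)))%R.
  by apply: mulr_ge0 => //; rewrite invr_ge0 ltW.
have h0 s : 0 <= (hinv b s)%:E by rewrite lee_fin hinv_ge0.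
have -> : \int[leb]_s (al (e * s)%R * (hinv b s)%:E) = \int[leb]_r (al r * (e^-1 * hinv b (e^-1 * r))%:E).
  rewrite (@ge0_integral_affine R e 0 e0 (fun r => al r * (e^-1 * hinv b (e^-1 * r))%:E)); last 2 first.
  - by mea.
  - by move=> r; rewrite mule_ge0 ?al0// lee_fin.
  rewrite -intZl ?(ltW e0)//; last 2 first.
  - by mea.
  - by move=> r; rewrite mule_ge0 ?al0// lee_fin.
  apply: eq_integral => s _; rewrite addr0 muleCA -EFinM; congr (_ * _%:E).
  by rewrite mulrA divff ?gt_eqF// mul1r mulKf// gt_eqF.
have -> : \int[leb]_t ((pw (- b - 1) t * (e <= t)%R%:R)%:E * \int[leb]_r ((pw (b - 1) (r - t))%:E * al r)) =
    \int[leb]_r (al r * \int[leb]_t (pw (- b - 1) t * (e <= t)%R%:R * pw (b - 1) (r - t))%:E).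
  transitivity (\int[leb]_t \int[leb]_r (al r * (pw (- b - 1) t * (e <= t)%R%:R * pw (b - 1) (r - t))%:E)).
    apply: eq_integral => t _; have [t0|t0] := ltP 0%R t; last first.
      rewrite pw_neg// mul0r mul0e.
      by under eq_integral do rewrite !mul0r mule0; rewrite integral0.
    rewrite -intZl; last 3 first.
    - by mea.
    - by move=> r; rewrite mule_ge0// al0.
    - by rewrite mulr_ge0// pw_ge0.
    by apply: eq_integral => r _; rewrite muleA -EFinM muleC.
  rewrite tonelli; last 2 first.
  - by mea.
  - by move=> t r; rewrite mule_ge0 ?al0// lee_fin !mulr_ge0 ?pw_ge0.
  apply: eq_integral => r _; rewrite intZle ?al0//; first by mea.
  by move=> t; rewrite lee_fin !mulr_ge0 ?pw_ge0.
rewrite -intZl; last 3 first.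
- by mea.
- by move=> r; rewrite mule_ge0 ?al0.
- by rewrite divr_ge0 ?powR_ge0// ltW.
pose J r : R := (pw b (r - e) * e `^ (- b) / (b * r))%R.
(* The density [(e^(-b) / b) r^(b-1)] is split by adding and subtracting [(r - e)^b]: one part is
   the beta integral [J], the other the rescaled weight [hinv]. *)
transitivity (\int[leb]_r (al r * (pw 0 r * J r)%:E + al r * (b^-1 * (e^-1 * hinv b (e^-1 * r)))%:E)).
  apply: eq_integral => r _; have [r0|r0] := ltP 0%R r; last first.
    rewrite !(pw_neg _ r0) mul0e mule0 mul0r mule0 hinvE (@pw_neg _ (-1)); last first.
      by rewrite mulr_ge0_le0// invr_ge0 ltW.
    by rewrite mul0r !mulr0 mule0 adde0.
  rewrite -ge0_muleDr; last 2 first.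
  - rewrite lee_fin /J !mulr_ge0 ?pw_ge0 ?powR_ge0// invr_ge0 mulr_ge0// ltW//.
  - by rewrite lee_fin.
  rewrite muleA muleC -!EFinM -EFinD; congr (_ * _%:E).
  rewrite (pwE 0 r0) powRr0 mul1r /J hinvE.
  rewrite (_ : (e^-1 * r - 1 = e^-1 * (r - e))%R); last by rewrite mulrBr mulVf// gt_eqF.
  rewrite !pwM ?invr_gt0// (pwE (b - 1) r0) (pwE (-1) r0) (pwE b r0).
  rewrite (_ : (e^-1 `^ b = e `^ (- b))%R); last first.
    by rewrite -powR_inv1 ?(ltW e0)// -powRrM mulN1r.
  rewrite powR_inv1 ?invr_ge0 ?(ltW e0)// invrK powR_inv1 ?(ltW r0)//.
  rewrite (powRD _) ?(gt_eqF r0) ?implybT// powR_inv1 ?(ltW r0)//.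
  set A := (r `^ b)%R; set B := (e `^ _)%R; set D := pw b _.
  by field; rewrite !gt_eqF.
have J0 r : 0 <= (pw 0 r * J r)%:E.
  have [r0|r0] := ltP 0%R r; last by rewrite pw_neg// mul0r.
  by rewrite lee_fin /J !mulr_ge0 ?pw_ge0 ?powR_ge0// invr_ge0 mulr_ge0// ltW.
have mJ : measurable_fun setT J by rewrite /J; mea.
rewrite intD; last 4 first.
- by mea.
- by mea.
- by move=> r; rewrite mule_ge0 ?al0.
- by move=> r; rewrite mule_ge0 ?al0// lee_fin.
congr (_ + _).
  apply: eq_integral => r _; have [r0|r0] := ltP 0%R r.
    by rewrite (beta_integral b01 e0 r0) (pwE 0 r0) powRr0 mul1r.
  rewrite pw_neg// mul0r mule0.
  rewrite (_ : (fun t => _) = cst 0) ?integral0 ?mule0//.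
  apply/funext => t; have [et|te] := leP e t; last by rewrite mulr0 mul0r.
  by rewrite (@pw_neg _ _ (r - t)) ?mulr0//; lra.
rewrite -intZl ?invr_ge0 ?(ltW b0)//; last 2 first.
- by mea.
- by move=> r; rewrite mule_ge0 ?al0// lee_fin.
by apply: eq_integral => r _; rewrite muleCA -EFinM.
Qed.

End abstract_inversion.

Section inversion.
Local Open Scope ereal_scope.
Context {R : realType} {n : nat}.
Notation mu := (@lebn R n).
Notation leb := (@lebesgue_measure R).
Notation E := ('rV[R]_n).
Variables (p b : R) (f : E -> R) (N : R).
Hypothesis p1 : (1 <= p)%R.
Hypothesis b01 : (0 < b < 1)%R.
Hypothesis bp : (b < n%:R / (2 * p))%R.
Hypothesis mf : measurable_fun setT f.
Hypothesis fN : \int[mu]_x (`|f x| `^ p)%:E = N%:E.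
Variables (psi : E -> R) (S L : R).
Hypothesis mpsi : measurable_fun setT psi.
Hypothesis psi01 : forall z, (0 <= psi z <= 1)%R.
Hypothesis psiS : \int[mu]_z (psi z)%:E = S%:E.
Hypothesis psiL : forall z w, (`|psi (z + w) - psi z| <= L * nrm1 w)%R.
Hypothesis L0 : (0 <= L)%R.

Let b0 : (0 < b)%R. Proof. by have /andP[] := b01. Qed.
Let psi0 z : (0 <= psi z)%R. Proof. by have /andP[] := psi01 z. Qed.
Let psie (z : E) : \bar R := (psi z)%:E.
Let psie0 z : 0 <= psie z. Proof. by rewrite lee_fin. Qed.
Let mpsie : measurable_fun setT psie. Proof. by rewrite /psie; mea. Qed.
Let S0 : (0 <= S)%R. Proof. by rewrite -lee_fin -psiS int_ge0. Qed.
Let N0 : (0 <= N)%R.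
Proof. by rewrite -lee_fin -fN int_ge0// => x; rewrite lee_fin powR_ge0. Qed.

Section piece.
Variable g : E -> R.
Hypothesis mg : measurable_fun setT g.
Hypothesis g0 : forall z, (0 <= g z)%R.
Hypothesis gf : forall z, (g z <= `|f z|)%R.
Let ge (z : E) : \bar R := (g z)%:E.
Let ge0 z : 0 <= ge z. Proof. by rewrite lee_fin. Qed.
Let mge : measurable_fun setT ge. Proof. by rewrite /ge; mea. Qed.

(** [g] will be the positive or the negative part of [f]: for nonnegative functions the identity
    below is between sums of nonnegative terms, and only the pairing [Xp] has to be finite. *)
Definition al (r : R) : \bar R := \int[mu]_x (psie x * heat r ge x).
Definition Xp : \bar R := \int[mu]_x (psie x * riesz b ge x).
Definition Yp (t : R) : \bar R := \int[mu]_x (psie x * heat t (riesz b ge) x).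

Lemma al_ge0 r : 0 <= al r.
Proof. by apply: int_ge0 => x; rewrite mule_ge0// heat_ge0. Qed.

Lemma measurable_al : measurable_fun setT al.
Proof.
apply: (measurable_int2 mu (fun (r : R) (x : E) => psie x * heat r ge x)).
  by mea; exact: ge0.
by move=> r x; rewrite mule_ge0// heat_ge0.
Qed.

Lemma Xp_fin : Xp < +oo.
Proof.
apply: (@le_lt_trans _ _ (\int[mu]_x (psie x * riesz b (fun z => (`|f z|)%:E) x))).
  apply: le_int.
  - by mea; exact: ge0.
  - by mea.
  - by move=> x; rewrite mule_ge0// riesz_ge0.
  - by move=> x; apply: lee_wpmul2l => //; apply: le_riesz => //; mea.
by apply: (@riesz_pair_fin _ _ p b f N _ _ _ _ _ _ 1) => //; rewrite psiS ltry.
Qed.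

Lemma XpE : Xp = \int[leb]_r ((pw (b - 1) r)%:E * al r).
Proof.
rewrite /Xp.
transitivity (\int[mu]_x \int[leb]_r (psie x * ((pw (b - 1) r)%:E * heat r ge x))).
  apply: eq_integral => x _; rewrite rieszE intZle//; first by mea; exact: ge0.
  by move=> r; rewrite mule_ge0// heat_ge0.
rewrite tonelli; last 2 first.
- by mea; exact: ge0.
- by move=> x r; rewrite !mule_ge0// heat_ge0.
apply: eq_integral => r _; rewrite /al -intZl ?pw_ge0//; last 2 first.
- by mea; exact: ge0.
- by move=> x; rewrite mule_ge0// heat_ge0.
by apply: eq_integral => x _; rewrite muleCA.
Qed.

Lemma YpE t : (0 < t)%R -> Yp t = \int[leb]_r ((pw (b - 1) (r - t))%:E * al r).
Proof.
move=> t0; rewrite /Yp.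
transitivity (\int[mu]_x \int[leb]_s (psie x * ((pw (b - 1) s)%:E * heat (t + s) ge x))).
  apply: eq_integral => x _; rewrite heat_riesz// intZle//; first by mea; exact: ge0.
  by move=> s; rewrite mule_ge0// heat_ge0.
rewrite tonelli; last 2 first.
- by mea; exact: ge0.
- by move=> x s; rewrite !mule_ge0// heat_ge0.
transitivity (\int[leb]_s ((pw (b - 1) s)%:E * al (t + s)%R)).
  apply: eq_integral => s _; rewrite /al -intZl ?pw_ge0//; last 2 first.
  - by mea; exact: ge0.
  - by move=> x; rewrite mule_ge0// heat_ge0.
  by apply: eq_integral => x _; rewrite muleCA.
exact: (convolution_shift _ measurable_al al_ge0).
Qed.

Let w (e t : R) : \bar R := (pw (- b - 1) t * (e <= t)%R%:R)%:E.
Let w0 e t : 0 <= w e t. Proof. by rewrite lee_fin mulr_ge0// pw_ge0. Qed.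
Let mw e : measurable_fun setT (w e). Proof. by rewrite /w; mea. Qed.

Definition Ah (e : R) : \bar R := \int[leb]_s (al (e * s)%R * (hinv b s)%:E).

Lemma measurable_Yp : measurable_fun setT Yp.
Proof.
have mr : measurable_fun setT (riesz b ge) by apply: measurable_riesz => //; mea.
apply: (measurable_int2 mu (fun (t : R) (x : E) => psie x * heat t (riesz b ge) x)).
  by mea => y; exact: riesz_ge0.
by move=> r x; rewrite mule_ge0// heat_ge0// => y; exact: riesz_ge0.
Qed.

Lemma Yp_ge0 t : 0 <= Yp t.
Proof.
by apply: int_ge0 => x; rewrite mule_ge0// heat_ge0// => y; exact: riesz_ge0.
Qed.

Lemma piece_identity e : (0 < e)%R ->
  (e `^ (- b) / b)%:E * Xp = \int[leb]_t (w e t * Yp t) + b^-1%:E * Ah e.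
Proof.
move=> e0; rewrite XpE (inversion_identity b01 measurable_al al_ge0 e0); congr (_ + _).
apply: eq_integral => t _; have [t0|t0] := ltP 0%R t; first by rewrite YpE.
by rewrite /w pw_neg// mul0r !mul0e.
Qed.

End piece.
End inversion.

Section int_le5.
Local Open Scope ereal_scope.
Context d (T : measurableType d) (R : realType) (m : {measure set T -> \bar R}).

Lemma int_le5 (A B C D F : T -> \bar R) : measurable_fun setT A -> measurable_fun setT B ->
  measurable_fun setT C -> measurable_fun setT D -> measurable_fun setT F ->
  (forall x, 0 <= A x) -> (forall x, 0 <= B x) -> (forall x, 0 <= C x) ->
  (forall x, 0 <= D x) -> (forall x, 0 <= F x) ->
  (forall x, A x + B x <= C x + D x + F x) ->
  \int[m]_x A x + \int[m]_x B x <= \int[m]_x C x + \int[m]_x D x + \int[m]_x F x.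
Proof.
move=> mA mB mC mD mF A0 B0 C0 D0 F0 h.
have mCD : measurable_fun setT (fun x => C x + D x) by mea.
have CD0 x : 0 <= C x + D x by rewrite adde_ge0.
rewrite -(intD m mA mB A0 B0) -(intD m mC mD C0 D0) -(intD m mCD mF CD0 F0).
apply: le_int => //; [by mea|by mea|by move=> x; rewrite adde_ge0].
Qed.

End int_le5.

(** * Comparison of the potential with its heat flow *)

Section heat_comparison.
Local Open Scope ereal_scope.
Context {R : realType} {n : nat}.
Notation mu := (@lebn R n).
Notation E := ('rV[R]_n).
Variables (t : R).
Hypothesis t0 : (0 < t)%R.

Definition osc (psi u : E -> R) : \bar R :=
  \int[mu]_x ((psi x)%:E * \int[mu]_y (G t (y - x) * `|u y - u x|)%:E).

Lemma measurable_osc_inner (u : E -> R) : measurable_fun setT u ->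
  measurable_fun setT (fun x : E => \int[mu]_y (G t (y - x) * `|u y - u x|)%:E).
Proof.
move=> mu_; apply: (measurable_int2 mu (fun x y : E => (G t (y - x) * `|u y - u x|)%:E)).
  by mea.
by move=> x y; rewrite lee_fin mulr_ge0 ?G_ge0.
Qed.

(** This is [u x - u y <= |u y - u x|] for [u = r1 - r2], averaged against the heat kernel and
    [psi], with the negative terms moved across. The constants [r1 x] and [r2 x] are averages
    because the kernel has mass 1. *)
Lemma heat_comparison (psi r1 r2 : E -> R) : measurable_fun setT psi ->
  measurable_fun setT r1 -> measurable_fun setT r2 ->
  (forall x, 0 <= psi x)%R -> (forall x, 0 <= r1 x)%R -> (forall x, 0 <= r2 x)%R ->
  \int[mu]_x ((psi x)%:E * (r1 x)%:E) +
  \int[mu]_x ((psi x)%:E * heat t (fun y => (r2 y)%:E) x) <=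
  \int[mu]_x ((psi x)%:E * heat t (fun y => (r1 y)%:E) x) +
  \int[mu]_x ((psi x)%:E * (r2 x)%:E) + osc psi (fun x => r1 x - r2 x)%R.
Proof.
move=> mpsi m1 m2 psi0 p1 p2.
have mu_ : measurable_fun setT (fun x => r1 x - r2 x)%R by mea.
have mo := measurable_osc_inner mu_.
have o0 (x : E) : 0 <= \int[mu]_y (G t (y - x) * `|r1 y - r2 y - (r1 x - r2 x)|)%:E.
  by apply: int_ge0 => y; rewrite lee_fin mulr_ge0 ?G_ge0.
have h0 (r : E -> R) x : (forall x, 0 <= r x)%R -> 0 <= heat t (fun y => (r y)%:E) x.
  by move=> r0; apply: heat_ge0 => y; rewrite lee_fin.
have mh (r : E -> R) : measurable_fun setT r -> (forall x, 0 <= r x)%R ->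
    measurable_fun setT (fun x => heat t (fun y => (r y)%:E) x).
  by move=> mr r0; apply: measurable_heat; mea => y; rewrite lee_fin.
have mh1 := mh _ m1 p1; have mh2 := mh _ m2 p2.
apply: int_le5; try by mea.
- by move=> x; rewrite mule_ge0 ?lee_fin.
- by move=> x; rewrite mule_ge0 ?lee_fin// h0.
- by move=> x; rewrite mule_ge0 ?lee_fin// h0.
- by move=> x; rewrite mule_ge0 ?lee_fin.
- by move=> x; rewrite mule_ge0 ?lee_fin.
move=> x; rewrite -!ge0_muleDr ?lee_fin ?h0 ?o0 ?p1 ?p2//; last by rewrite adde_ge0 ?h0 ?lee_fin.
apply: lee_wpmul2l; first by rewrite lee_fin.
have cst_int (c : R) : (0 <= c)%R -> c%:E = \int[mu]_y ((G t (y - x))%:E * c%:E).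
  by move=> c0; rewrite intZr ?G_mass_shift ?mul1e//; mea.
rewrite {1}(cst_int _ (p1 x)) {1}(cst_int _ (p2 x)) !heatE.
apply: int_le5; try by mea.
- by move=> y; rewrite mule_ge0 ?lee_fin ?G_ge0.
- by move=> y; rewrite mule_ge0 ?lee_fin ?G_ge0.
- by move=> y; rewrite mule_ge0 ?lee_fin ?G_ge0.
- by move=> y; rewrite mule_ge0 ?lee_fin ?G_ge0.
- by move=> y; rewrite lee_fin mulr_ge0 ?G_ge0.
move=> y; rewrite -!EFinM -!EFinD lee_fin -!mulrDr; apply: ler_wpM2l; first exact: G_ge0.
have := ler_norm (- (r1 y - r2 y - (r1 x - r2 x))); rewrite normrN.
lra.
Qed.

End heat_comparison.

Section hinv_average.
Local Open Scope ereal_scope.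
Context {R : realType}.
Notation leb := (@lebesgue_measure R).

Lemma hinv_average (b : R) (A : R -> \bar R) (B c : R) : (0 < b < 1)%R ->
  measurable_fun setT A -> (forall r, 0 <= A r) -> (0 <= B)%R ->
  (forall r, (0 < r)%R -> A r <= B%:E) -> (0 <= c)%R ->
  (forall s, (0 < s)%R -> fine (A (k.+1%:R^-1 * s)%R) @[k --> \oo] --> c) ->
  \int[leb]_s (A (k.+1%:R^-1 * s)%R * (hinv b s)%:E) @[k --> \oo] --> (c * Hinv b)%:E.
Proof.
move=> b01 mA A0 B0 AB c0 Ac; have mh := measurable_hinv b.
have h0 s : (0 <= hinv b s)%R by exact: hinv_ge0.
have hneg s : (s <= 0)%R -> hinv b s = 0%R by move=> s0; rewrite hinvE pw_neg// mul0r.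
have k0 (k : nat) (s : R) : (0 < s)%R -> (0 < k.+1%:R^-1 * s)%R.
  by move=> s0; rewrite mulr_gt0// invr_gt0.
have AE r : (0 < r)%R -> A r = (fine (A r))%:E.
  by move=> r0; rewrite fineK// ge0_fin_numE// (le_lt_trans (AB _ r0))// ltry.
have -> : (c * Hinv b)%:E = \int[leb]_s (c%:E * (hinv b s)%:E).
  by rewrite intZl ?HinvE//; mea.
apply: (@dominated_cvg _ _ _ leb setT _ _ _ (fun s => (B * hinv b s)%:E)) => //.
- by move=> k; mea.
- move=> s _; have [s0|s0] := ltP 0%R s; last first.
    by rewrite hneg// mule0; under eq_fun do rewrite mule0; exact: cvg_cst.
  rewrite (_ : (fun k : nat => _) = (fun k => (fine (A (k.+1%:R^-1 * s)%R) * hinv b s)%:E)); last first.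
    by apply/funext => k; rewrite EFinM -(AE _ (k0 k _ s0)).
  rewrite -EFinM; apply/cvg_EFin; first by near=> k.
  by apply: cvgM; [exact: Ac|exact: cvg_cst].
- apply/integrableP; split; first by mea.
  rewrite (_ : (fun s => _) = (fun s => B%:E * (hinv b s)%:E)); last first.
    by apply/funext => s; rewrite gee0_abs ?lee_fin ?mulr_ge0// EFinM.
  rewrite intZl//; last by mea.
  by rewrite HinvE// -EFinM ltry.
- move=> k s _; have [s0|s0] := ltP 0%R s; last by rewrite hneg// mule0 abse0 lee_fin mulr0.
  rewrite gee0_abs; last by rewrite mule_ge0 ?lee_fin.
  by rewrite EFinM; apply: lee_wpmul2r; [rewrite lee_fin|exact: AB (k0 _ _ s0)].
Unshelve. all: by end_near. Qed.

End hinv_average.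

(** * The heat flow at small times, tested against Lipschitz functions *)

Section approximate_identity.
Local Open Scope ereal_scope.
Context {R : realType} {n : nat}.
Notation mu := (@lebn R n).
Notation leb := (@lebesgue_measure R).
Notation E := ('rV[R]_n).
Variables (p : R) (f : E -> R) (N : R).
Hypothesis p1 : (1 <= p)%R.
Hypothesis mf : measurable_fun setT f.
Hypothesis fN : \int[mu]_x (`|f x| `^ p)%:E = N%:E.
Variables (psi : E -> R) (S L : R).
Hypothesis mpsi : measurable_fun setT psi.
Hypothesis psi01 : forall z, (0 <= psi z <= 1)%R.
Hypothesis psiS : \int[mu]_z (psi z)%:E = S%:E.
Hypothesis psiL : forall z w, (`|psi (z + w) - psi z| <= L * nrm1 w)%R.
Hypothesis L0 : (0 <= L)%R.
Variable g : E -> R.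
Hypothesis mg : measurable_fun setT g.
Hypothesis g0 : forall z, (0 <= g z)%R.
Hypothesis gf : forall z, (g z <= `|f z|)%R.

Let psi0 z : (0 <= psi z)%R. Proof. by have /andP[] := psi01 z. Qed.
Let psi1 z : (psi z <= 1)%R. Proof. by have /andP[] := psi01 z. Qed.
Let S0 : (0 <= S)%R. Proof. by rewrite -lee_fin -psiS int_ge0. Qed.
Let N0 : (0 <= N)%R.
Proof. by rewrite -lee_fin -fN int_ge0// => x; rewrite lee_fin powR_ge0. Qed.
Let psie0 (z : E) : 0 <= (psi z)%:E. Proof. by rewrite lee_fin. Qed.
Let ge0 (z : E) : 0 <= (g z)%:E. Proof. by rewrite lee_fin. Qed.
Let mpsie : measurable_fun setT (fun z : E => (psi z)%:E). Proof. by mea. Qed.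
Let mge : measurable_fun setT (fun z : E => (g z)%:E). Proof. by mea. Qed.

(** The excess of [phi1] over [phi2] is at most [min k phi1]. Splitting [g] by [young_power], the
    constant part [d] is charged to the mass of [phi1] and the part in [|f| ^ p] to the uniform
    bound [k]. *)
Lemma pair_compare (phi1 phi2 : E -> R) (k d : R) : measurable_fun setT phi1 ->
  measurable_fun setT phi2 -> (forall x, 0 <= phi1 x)%R -> (forall x, 0 <= phi2 x)%R ->
  (0 <= k)%R -> (0 < d)%R -> (forall x, phi1 x <= phi2 x + k)%R ->
  \int[mu]_x (g x * phi1 x)%:E <= \int[mu]_x (g x * phi2 x)%:E +
    d%:E * \int[mu]_x (phi1 x)%:E + (d `^ (1 - p) * k * N)%:E.
Proof.
move=> m1 m2 q1 q2 k0 d0 h.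
have dp0 := powR_ge0 d (1 - p).
rewrite [in X in _ + X]EFinM -fN.
rewrite -(@intZl _ _ _ mu (d `^ (1 - p) * k) (fun x => (`|f x| `^ p)%:E)); last 3 first.
- by mea.
- by move=> x; rewrite lee_fin powR_ge0.
- by rewrite mulr_ge0.
rewrite -(@intZl _ _ _ mu d (fun x => (phi1 x)%:E)); last 3 first.
- by mea.
- by move=> x; rewrite lee_fin.
- exact: ltW.
have z0 (x : E) : 0 <= (0 : \bar R) by [].
rewrite -[X in X <= _]adde0 -{1}(@integral0 _ _ _ mu setT).
apply: int_le5; try by mea.
- by move=> x; rewrite lee_fin mulr_ge0.
- by move=> x; rewrite lee_fin mulr_ge0.
- by move=> x; rewrite mule_ge0// lee_fin// ltW.
- by move=> x; rewrite mule_ge0// lee_fin ?mulr_ge0// powR_ge0.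
move=> x; rewrite adde0 -!EFinM -!EFinD lee_fin.
have gy : (g x <= d + d `^ (1 - p) * `|f x| `^ p)%R.
  by apply: (le_trans (gf x)); exact: young_power.
have fp0 := powR_ge0 `|f x| p.
have A : (g x * phi1 x <= g x * phi2 x + g x * Num.min k (phi1 x))%R.
  rewrite -mulrDr ler_wpM2l//; have [kp|pk] := leP k (phi1 x) => //.
  by rewrite lerDr.
apply: (le_trans A); rewrite -addrA lerD2l.
have m0 : (0 <= Num.min k (phi1 x))%R by rewrite le_min k0 q1.
apply: (le_trans (ler_wpM2r m0 gy)); rewrite mulrDl; apply: lerD.
  by rewrite ler_wpM2l ?(ltW d0)// ge_min lexx orbT.
rewrite mulrAC ler_wpM2r// ler_wpM2l// ge_min lexx//.
Qed.

Section time.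
Variable r : R.
Hypothesis r0 : (0 < r)%R.
Let phi (y : E) : R := fine (heat r (fun z => (psi z)%:E) y).
Let k := (L * ((1 + cM n) * Num.sqrt r))%R.
Let k0 : (0 <= k)%R.
Proof. by rewrite mulr_ge0// mulr_ge0 ?sqrtr_ge0// addr_ge0// cM_ge0. Qed.

Lemma heat_psi_le1 y : heat r (fun z => (psi z)%:E) y <= 1.
Proof. by apply: heat_le_cst => // z; rewrite lee_fin. Qed.

Lemma phiE y : (phi y)%:E = heat r (fun z => (psi z)%:E) y.
Proof.
rewrite /phi fineK// ge0_fin_numE ?heat_ge0//.
by apply: (le_lt_trans (heat_psi_le1 y)); exact: ltry.
Qed.

Lemma phi_01 y : (0 <= phi y <= 1)%R.
Proof. by rewrite -!lee_fin phiE heat_ge0//= heat_psi_le1. Qed.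

Lemma measurable_phi : measurable_fun setT phi.
Proof. by apply: mf_fine; apply: measurable_heat => //; mea. Qed.

Lemma int_phi : \int[mu]_y (phi y)%:E = S%:E.
Proof. by under eq_integral do rewrite phiE; rewrite heat_mass. Qed.

Let lipint y : \int[mu]_x ((G r (x - y))%:E * (L * nrm1 (x - y))%:E) <= k%:E.
Proof.
rewrite (_ : (fun x => _) = (fun x => L%:E * (nrm1 (x - y) * G r (x - y))%:E)); last first.
  by apply/funext => x; rewrite -!EFinM; congr EFin; ring.
rewrite intZl//; [|by mea|by move=> x; rewrite lee_fin mulr_ge0 ?nrm1_ge0 ?G_ge0].
by rewrite /k EFinM; apply: lee_wpmul2l; [rewrite lee_fin|exact: moment1_shift].
Qed.

Let cst_int y (c : R) : (0 <= c)%R -> c%:E = \int[mu]_x ((G r (x - y))%:E * c%:E).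
Proof. by move=> c0; rewrite intZr ?G_mass_shift ?mul1e//; mea. Qed.

Let lipe y x : (psi x <= psi y + L * nrm1 (x - y))%R /\ (psi y <= psi x + L * nrm1 (x - y))%R.
Proof.
have := psiL y (x - y); rewrite addrCA subrr addr0 ler_norml => /andP[]; lra.
Qed.

Let n0 (x y : E) : 0 <= (G r (x - y))%:E * (L * nrm1 (x - y))%:E.
Proof. by rewrite mule_ge0 ?lee_fin ?G_ge0// mulr_ge0 ?nrm1_ge0. Qed.

(** The heat flow moves a Lipschitz function uniformly by at most [L] times the first moment of the
    kernel, of order [sqrt r]. As the flow is carried by [psi] and not by [f], no continuity of [f]
    enters. *)
Lemma phi_le y : (phi y <= psi y + k)%R.
Proof.
rewrite -lee_fin phiE EFinD heatE.
apply: (@le_trans _ _ (\int[mu]_x ((G r (x - y))%:E * (psi y)%:E +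
    (G r (x - y))%:E * (L * nrm1 (x - y))%:E))).
  apply: le_int; try by mea.
  - by move=> x; rewrite mule_ge0 ?lee_fin ?G_ge0.
  - move=> x; rewrite -!EFinM -EFinD lee_fin -mulrDr; apply: ler_wpM2l; first exact: G_ge0.
    by have [] := lipe y x.
rewrite intD; [|by mea|by mea|by move=> x; rewrite mule_ge0 ?lee_fin ?G_ge0|by move=> x; exact: n0].
by rewrite -cst_int//; apply: leeD.
Qed.

Lemma psi_le y : (psi y <= phi y + k)%R.
Proof.
rewrite -lee_fin EFinD phiE heatE {1}(@cst_int y (psi y))//.
apply: (@le_trans _ _ (\int[mu]_x ((G r (x - y))%:E * (psi x)%:E +
    (G r (x - y))%:E * (L * nrm1 (x - y))%:E))).
  apply: le_int; try by mea.
  - by move=> x; rewrite mule_ge0 ?lee_fin ?G_ge0.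
  - move=> x; rewrite -!EFinM -EFinD lee_fin -mulrDr; apply: ler_wpM2l; first exact: G_ge0.
    by have [] := lipe y x.
rewrite intD; [|by mea|by mea|by move=> x; rewrite mule_ge0 ?lee_fin ?G_ge0|by move=> x; exact: n0].
by apply: leeD.
Qed.

Lemma alE : al psi g r = \int[mu]_y (g y * phi y)%:E.
Proof.
rewrite /al heat_sym//.
by apply: eq_integral => y _; rewrite EFinM phiE.
Qed.

Lemma al_upper d : (0 < d)%R ->
  al psi g r <= \int[mu]_x (g x * psi x)%:E + (d * S + d `^ (1 - p) * k * N)%:E.
Proof.
move=> d0; rewrite alE EFinD addeA.
have := pair_compare measurable_phi mpsi _ psi0 k0 d0 phi_le.
rewrite int_phi -EFinM; apply.
by move=> x; have /andP[] := phi_01 x.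
Qed.

Lemma al_lower d : (0 < d)%R ->
  \int[mu]_x (g x * psi x)%:E <= al psi g r + (d * S + d `^ (1 - p) * k * N)%:E.
Proof.
move=> d0; rewrite alE EFinD addeA.
have := pair_compare mpsi measurable_phi psi0 _ k0 d0 psi_le.
rewrite psiS -EFinM; apply.
by move=> x; have /andP[] := phi_01 x.
Qed.

Lemma al_bound : al psi g r <= (S + N)%:E.
Proof.
rewrite alE.
apply: (@le_trans _ _ (\int[mu]_y ((phi y)%:E + (`|f y| `^ p)%:E))).
  have mp := measurable_phi.
  apply: le_int; try by mea.
  - by move=> y; rewrite lee_fin mulr_ge0//; have /andP[] := phi_01 y.
  - move=> y; rewrite -EFinD lee_fin; have /andP[f0 f1] := phi_01 y.
    have := @young_power _ p p1 1%R (f y) ltr01; rewrite powR1 mul1r => h.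
    have gh : (g y <= 1 + `|f y| `^ p)%R by exact: le_trans (gf y) h.
    apply: (le_trans (ler_wpM2r f0 gh)); rewrite mulrDl mul1r lerD2l.
    by rewrite ler_piMr// powR_ge0.
rewrite intD; last 4 first.
- by apply: mf_EFin; exact: measurable_phi.
- by mea.
- by move=> y; rewrite lee_fin; have /andP[] := phi_01 y.
- by move=> y; rewrite lee_fin powR_ge0.
by rewrite int_phi fN.
Qed.

End time.

Lemma g_psi_fin : \int[mu]_x (g x * psi x)%:E < +oo.
Proof.
apply: (le_lt_trans (al_lower ltr01 ltr01)).
by apply: lte_add_pinfty; [apply: (le_lt_trans (al_bound ltr01))|]; exact: ltry.
Qed.

Definition gpsi : R := fine (\int[mu]_x (g x * psi x)%:E).

Lemma gpsiE : \int[mu]_x (g x * psi x)%:E = gpsi%:E.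
Proof.
rewrite /gpsi fineK// ge0_fin_numE; first exact: g_psi_fin.
by apply: int_ge0 => x; rewrite lee_fin mulr_ge0.
Qed.

Lemma al_fin r : (0 < r)%R -> (fine (al psi g r))%:E = al psi g r.
Proof.
move=> r0; rewrite fineK// ge0_fin_numE; last first.
  by apply: int_ge0 => x; rewrite mule_ge0// heat_ge0.
by apply: (le_lt_trans (al_bound r0)); exact: ltry.
Qed.

Lemma al_dist r d : (0 < r)%R -> (0 < d)%R ->
  (`|gpsi - fine (al psi g r)| <= d * S + d `^ (1 - p) * (L * ((1 + cM n) * Num.sqrt r)) * N)%R.
Proof.
move=> r0 d0; have := al_upper r0 d0; have := al_lower r0 d0.
rewrite gpsiE -(al_fin r0) -!EFinD !lee_fin => h1 h2.
by rewrite ler_norml; apply/andP; split; lra.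
Qed.

(* With weight [d] small but fixed the first error term is small, and the
   second one then tends to [0] with the time. *)
Lemma al_cvg (s : R) : (0 < s)%R -> fine (al psi g (k.+1%:R^-1 * s)) @[k --> \oo] --> gpsi.
Proof.
move=> s0; apply/cvgrPdist_le => e e0.
pose d := (e / (2 * (S + 1)))%R.
have S10 : (0 < S + 1)%R by rewrite ltr_wpDl.
have d0 : (0 < d)%R by rewrite divr_gt0// mulr_gt0.
pose C := (d `^ (1 - p) * (L * (1 + cM n)) * N)%R.
have C0 : (0 <= C)%R by rewrite !mulr_ge0 ?powR_ge0// addr_ge0// cM_ge0.
pose q := (e / (2 * (C + 1)))%R.
have q0 : (0 < q)%R by rewrite divr_gt0// mulr_gt0// ltr_wpDl.
near=> k.
have k0 : (0 < k.+1%:R^-1 * s)%R by rewrite mulr_gt0// invr_gt0.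
apply: (le_trans (al_dist k0 d0)); rewrite [e]splitr; apply: lerD.
  rewrite /d mulrAC ler_pdivrMr ?mulr_gt0//.
  have -> : (e / 2 * (2 * (S + 1)) = e * (S + 1))%R by field.
  by rewrite ler_wpM2l ?(ltW e0)// lerDl.
have sq : (Num.sqrt (k.+1%:R^-1 * s) <= q)%R.
  rewrite -(ger0_norm (ltW q0)) -sqrtr_sqr ler_wsqrtr//.
  rewrite ler_pdivrMl// -ler_pdivrMr ?exprn_gt0//.
  rewrite -natr1; apply: (@le_trans _ _ k%:R); last by rewrite lerDl.
  near: k; exact: nbhs_infty_ger.
have -> : (d `^ (1 - p) * (L * ((1 + cM n) * Num.sqrt (k.+1%:R^-1 * s))) * N =
  C * Num.sqrt (k.+1%:R^-1 * s))%R by rewrite /C; ring.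
apply: (le_trans (ler_wpM2l C0 sq)).
rewrite /q mulrA ler_pdivrMr ?mulr_gt0// ?ltr_wpDl//.
have -> : (e / 2 * (2 * (C + 1)) = (C + 1) * e)%R by field.
by rewrite ler_wpM2r ?(ltW e0)// lerDl.
Unshelve. all: by end_near. Qed.

Lemma Ah_cvg b : (0 < b < 1)%R ->
  Ah b psi g (k.+1%:R^-1) @[k --> \oo] --> (gpsi * Hinv b)%:E.
Proof.
move=> b01; apply: (@hinv_average _ b (al psi g) (S + N)) => //.
- exact: measurable_al.
- by move=> r; apply: int_ge0 => x; rewrite mule_ge0// heat_ge0.
- by rewrite addr_ge0.
- exact: al_bound.
- by rewrite -lee_fin -gpsiE int_ge0// => x; rewrite lee_fin mulr_ge0.
- exact: al_cvg.
Qed.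

End approximate_identity.

Section cancellation.
Local Open Scope ereal_scope.
Context {R : realType}.
Notation leb := (@lebesgue_measure R).

(* [X1, X2] are finite, so everything but [D] can be cancelled. *)
Lemma weighted_cancellation (b e : R) (X1 X2 A1 A2 : \bar R) (Y1 Y2 D : R -> \bar R) :
  (0 < b)%R -> (0 < e)%R -> 0 <= X1 -> 0 <= X2 -> X1 < +oo -> X2 < +oo -> 0 <= A1 -> 0 <= A2 ->
  measurable_fun setT Y1 -> measurable_fun setT Y2 -> measurable_fun setT D ->
  (forall t, 0 <= Y1 t) -> (forall t, 0 <= Y2 t) -> (forall t, 0 <= D t) ->
  (forall t, (0 < t)%R -> X1 + Y2 t <= Y1 t + X2 + D t) ->
  (e `^ (- b) / b)%:E * X1 =
    \int[leb]_t ((pw (- b - 1) t * (e <= t)%R%:R)%:E * Y1 t) + b^-1%:E * A1 ->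
  (e `^ (- b) / b)%:E * X2 =
    \int[leb]_t ((pw (- b - 1) t * (e <= t)%R%:R)%:E * Y2 t) + b^-1%:E * A2 ->
  A1 <= A2 + b%:E * \int[leb]_t ((pw (- b - 1) t)%:E * D t).
Proof.
move=> b0 e0 X10 X20 X1f X2f A10 A20 mY1 mY2 mD Y10 Y20 D0 XY E1 E2.
pose w (t : R) : \bar R := (pw (- b - 1) t * (e <= t)%R%:R)%:E.
have w0 t : 0 <= w t by rewrite lee_fin mulr_ge0 ?pw_ge0.
have mw : measurable_fun setT w by rewrite /w; mea.
have W : \int[leb]_t w t = (e `^ (- b) / b)%:E by rewrite /w integral_pw_far.
have X1i : \int[leb]_t (w t * X1) = (e `^ (- b) / b)%:E * X1.
  rewrite -W; under eq_integral do rewrite muleC.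
  by rewrite intZle// muleC.
have X2i : \int[leb]_t (w t * X2) = (e `^ (- b) / b)%:E * X2.
  rewrite -W; under eq_integral do rewrite muleC.
  by rewrite intZle// muleC.
have K : \int[leb]_t (w t * X1) + \int[leb]_t (w t * Y2 t) <=
    \int[leb]_t (w t * Y1 t) + \int[leb]_t (w t * X2) + \int[leb]_t (w t * D t).
  apply: int_le5; try by mea.
  - by move=> t; rewrite mule_ge0.
  - by move=> t; rewrite mule_ge0.
  - by move=> t; rewrite mule_ge0.
  - by move=> t; rewrite mule_ge0.
  - by move=> t; rewrite mule_ge0.
  move=> t; have [t0|t0] := ltP 0%R t; last by rewrite /w pw_neg// mul0r !mul0e !adde0.
  rewrite -!ge0_muleDr ?adde_ge0//.
  by apply: lee_wpmul2l => //; exact: XY.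
rewrite X1i X2i E1 E2 in K.
have Dle : \int[leb]_t (w t * D t) <= \int[leb]_t ((pw (- b - 1) t)%:E * D t).
  apply: le_int; try by mea.
  - by move=> t; rewrite mule_ge0.
  - move=> t; apply: lee_wpmul2r => //; rewrite lee_fin ler_piMr ?pw_ge0//.
    by case: (e <= t)%R.
have Y1i0 : 0 <= \int[leb]_t (w t * Y1 t) by apply: int_ge0 => t; rewrite mule_ge0.
have Y2i0 : 0 <= \int[leb]_t (w t * Y2 t) by apply: int_ge0 => t; rewrite mule_ge0.
have Di0 : 0 <= \int[leb]_t (w t * D t) by apply: int_ge0 => t; rewrite mule_ge0.
have c0 : (0 <= e `^ (- b) / b)%R by rewrite divr_ge0 ?powR_ge0// ltW.
have f1 : (e `^ (- b) / b)%:E * X1 < +oo by rewrite lte_mul_pinfty// lee_fin.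
have f2 : (e `^ (- b) / b)%:E * X2 < +oo by rewrite lte_mul_pinfty// lee_fin.
rewrite E1 in f1; rewrite E2 in f2.
apply: (@le_trans _ _ (A2 + b%:E * \int[leb]_t (w t * D t))); last first.
  by rewrite leeD2l// lee_wpmul2l// lee_fin ltW.
move: K f1 f2 Y1i0 Y2i0 Di0; rewrite -/w.
move: (\int[leb]_t (w t * Y1 t)) (\int[leb]_t (w t * Y2 t)) (\int[leb]_t (w t * D t)).
clear -b0 A10 A20 => y1 y2 d K f1 f2 y10 y20 d0.
have bi : (0 < b^-1)%R by rewrite invr_gt0.
have [dy|] := eqVneq d +oo.
  rewrite dy gt0_muley ?lte_fin// addey ?leey// gt_eqF//.
  by rewrite (lt_le_trans _ A20).
move: y1 y2 d A1 A2 A10 A20 K f1 f2 y10 y20 d0.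
case=> [y1| |]//; case=> [y2| |]//; case=> [d| |]//; case=> [A1| |]//; case=> [A2| |]//;
  rewrite ?(gt0_muley (_ : 0 < b^-1%:E)) ?lte_fin//.
move=> A10 A20; rewrite -!EFinM -!EFinD !lee_fin => K _ _ y10 y20 d0 _.
have {}K : (b^-1 * A1 <= b^-1 * A2 + d)%R by lra.
have := ler_wpM2l (ltW b0) K.
by rewrite mulrDr !mulrA divff ?gt_eqF// !mul1r.
Qed.

End cancellation.

(** * The inversion inequality *)

Section inversion_inequality.
Local Open Scope ereal_scope.
Context {R : realType} {n : nat}.
Notation mu := (@lebn R n).
Notation leb := (@lebesgue_measure R).
Notation E := ('rV[R]_n).
Variables (p b : R) (f : E -> R) (N : R).
Hypothesis p1 : (1 <= p)%R.
Hypothesis b01 : (0 < b < 1)%R.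
Hypothesis bp : (b < n%:R / (2 * p))%R.
Hypothesis mf : measurable_fun setT f.
Hypothesis fN : \int[mu]_x (`|f x| `^ p)%:E = N%:E.
Variables (psi : E -> R) (S L : R).
Hypothesis mpsi : measurable_fun setT psi.
Hypothesis psi01 : forall z, (0 <= psi z <= 1)%R.
Hypothesis psiS : \int[mu]_z (psi z)%:E = S%:E.
Hypothesis psiL : forall z w, (`|psi (z + w) - psi z| <= L * nrm1 w)%R.
Hypothesis L0 : (0 <= L)%R.

Let b0 : (0 < b)%R. Proof. by have /andP[] := b01. Qed.
Let psi0 z : (0 <= psi z)%R. Proof. by have /andP[] := psi01 z. Qed.

Section pieces.
Variable g : E -> R.
Hypothesis mg : measurable_fun setT g.
Hypothesis g0 : forall z, (0 <= g z)%R.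
Hypothesis gf : forall z, (g z <= `|f z|)%R.

Let ge0 (z : E) : 0 <= (g z)%:E. Proof. by rewrite lee_fin. Qed.
Let mge : measurable_fun setT (fun z : E => (g z)%:E). Proof. by mea. Qed.
Let rg (z : E) : R := fine (riesz b (fun z => (g z)%:E) z).
Let mrz : measurable_fun setT (fun z : E => riesz b (fun z => (g z)%:E) z).
Proof. by apply: measurable_riesz => //; mea. Qed.
Let rz0 (z : E) : 0 <= riesz b (fun z => (g z)%:E) z.
Proof. exact: riesz_ge0. Qed.

Let mrg : measurable_fun setT rg. Proof. exact: mf_fine. Qed.
Let rg0 z : (0 <= rg z)%R. Proof. by rewrite fine_ge0. Qed.

Lemma Xp_fineE : Xp b psi g = \int[mu]_x ((psi x)%:E * (rg x)%:E).
Proof.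
rewrite /Xp -int_fine//.
exact: (Xp_fin p1 b01 bp mf fN mpsi psi01 psiS mg g0 gf).
Qed.

(** The heat flow of [psi] has values in the unit interval and the same mass, so it is again an
    admissible test function and its pairing with the potential is finite; infinite values are then
    removed as for [Xp]. *)
Lemma Yp_fineE t : (0 < t)%R -> Yp b psi g t = \int[mu]_x ((psi x)%:E * heat t (fun y => (rg y)%:E) x).
Proof.
move=> t0; have mpsie : measurable_fun setT (fun z : E => (psi z)%:E) by mea.
have psie0 z : 0 <= (psi z)%:E by rewrite lee_fin.
have mrge : measurable_fun setT (fun z : E => (rg z)%:E) by mea.
have rge0 z : 0 <= (rg z)%:E by rewrite lee_fin.
pose phi (y : E) : R := fine (heat t (fun z => (psi z)%:E) y).
have pE y : (phi y)%:E = heat t (fun z => (psi z)%:E) y by exact: phiE.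
have p01 y : (0 <= phi y <= 1)%R by exact: phi_01.
have p0 y : (0 <= phi y)%R by have /andP[] := p01 y.
have mphi : measurable_fun setT phi by exact: measurable_phi.
have iphi : \int[mu]_y (phi y)%:E = S%:E by exact: int_phi.
rewrite /Yp (heat_sym mrz rz0 t mpsie psie0) (heat_sym mrge rge0 t mpsie psie0).
transitivity (\int[mu]_y ((phi y)%:E * riesz b (fun z => (g z)%:E) y)).
  by apply: eq_integral => y _; rewrite muleC pE.
rewrite -int_fine//.
  by apply: eq_integral => y _; rewrite EFinM muleC pE.
exact: (Xp_fin p1 b01 bp mf fN mphi p01 iphi mg g0 gf).
Qed.

End pieces.

Notation u := (sriesz b f).
Let gp (z : E) : R := (Num.max (f z) 0)%R.
Let gm (z : E) : R := (Num.max (- f z) 0)%R.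
Let mgp : measurable_fun setT gp. Proof. by rewrite /gp; mea. Qed.
Let mgm : measurable_fun setT gm. Proof. by rewrite /gm; mea. Qed.
Let gp0 z : (0 <= gp z)%R. Proof. by rewrite /gp le_max lexx orbT. Qed.
Let gm0 z : (0 <= gm z)%R. Proof. by rewrite /gm le_max lexx orbT. Qed.
Let gpf z : (gp z <= `|f z|)%R. Proof. by rewrite /gp ge_max ler_norm normr_ge0. Qed.
Let gmf z : (gm z <= `|f z|)%R. Proof. by rewrite /gm ge_max -(normrN (f z)) ler_norm normr_ge0. Qed.

Lemma measurable_osc (w : E -> R) : measurable_fun setT w ->
  measurable_fun setT (fun t => osc t psi w).
Proof.
move=> mw.
apply: (measurable_int2 mu (fun (t : R) (x : E) => (psi x)%:E * \int[mu]_y (G t (y - x) * `|w y - w x|)%:E)).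
  apply: mf_mule; first by mea.
  apply: (measurable_int2 mu (fun (q : R * E) (y : E) => (G q.1 (y - q.2) * `|w y - w q.2|)%:E)).
    by mea.
  by move=> q y; rewrite lee_fin mulr_ge0 ?G_ge0.
move=> t x; rewrite mule_ge0 ?lee_fin//; apply: int_ge0 => y.
by rewrite lee_fin mulr_ge0 ?G_ge0.
Qed.

Lemma osc_ge0 t (w : E -> R) : 0 <= osc t psi w.
Proof.
apply: int_ge0 => x; rewrite mule_ge0 ?lee_fin//; apply: int_ge0 => y.
by rewrite lee_fin mulr_ge0 ?G_ge0.
Qed.

(** In the truncated inequality only the two terms [Ah] depend on the truncation [1 / (k + 1)]; they
    converge to [Hinv b] times the pairings of [psi] with the positive and the negative part of
    [f]. *)
Lemma inversion_ineq :
  (Hinv b * gpsi psi gp)%:E <= (Hinv b * gpsi psi gm)%:E +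
    b%:E * \int[leb]_t ((pw (- b - 1) t)%:E * osc t psi u).
Proof.
have mpsie : measurable_fun setT (fun z : E => (psi z)%:E) by mea.
have mu_ : measurable_fun setT u by exact: measurable_sriesz.
have mo := measurable_osc mu_.
pose D := \int[leb]_t ((pw (- b - 1) t)%:E * osc t psi u).
have step (k : nat) : Ah b psi gp k.+1%:R^-1 <= Ah b psi gm k.+1%:R^-1 + b%:E * D.
  have e0 : (0 < k.+1%:R^-1 :> R)%R by rewrite invr_gt0.
  have I1 := piece_identity b01 mpsi psi01 mgp gp0 e0.
  have I2 := piece_identity b01 mpsi psi01 mgm gm0 e0.
  have psie0 z : 0 <= (psi z)%:E by rewrite lee_fin.
  have Xge0 (g : E -> R) : (forall z, 0 <= g z)%R -> 0 <= Xp b psi g.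
    by move=> g0; apply: int_ge0 => x; rewrite mule_ge0// riesz_ge0.
  have Age0 (g : E -> R) : (forall z, 0 <= g z)%R -> 0 <= Ah b psi g k.+1%:R^-1.
    move=> g0; apply: int_ge0 => x; rewrite mule_ge0 ?lee_fin ?hinv_ge0//.
    exact: al_ge0.
  apply: (weighted_cancellation b0 e0 _ _ _ _ _ _ _ _ mo _ _ _ _ I1 I2).
  - exact: Xge0.
  - exact: Xge0.
  - exact: (Xp_fin p1 b01 bp mf fN mpsi psi01 psiS mgp gp0 gpf).
  - exact: (Xp_fin p1 b01 bp mf fN mpsi psi01 psiS mgm gm0 gmf).
  - exact: Age0.
  - exact: Age0.
  - exact: measurable_Yp.
  - exact: measurable_Yp.
  - by move=> t; exact: Yp_ge0.
  - by move=> t; exact: Yp_ge0.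
  - by move=> t; exact: osc_ge0.
  - move=> t t0; rewrite (Xp_fineE mgp gp0 gpf) (Xp_fineE mgm gm0 gmf).
    rewrite (Yp_fineE mgp gp0 gpf t0) (Yp_fineE mgm gm0 gmf t0).
    apply: (heat_comparison t0 mpsi _ _ psi0).
    + by apply: mf_fine; apply: measurable_riesz; mea => y; rewrite lee_fin.
    + by apply: mf_fine; apply: measurable_riesz; mea => y; rewrite lee_fin.
    + by move=> x; rewrite fine_ge0// riesz_ge0// => y; rewrite lee_fin.
    + by move=> x; rewrite fine_ge0// riesz_ge0// => y; rewrite lee_fin.
have D0 : 0 <= D by apply: int_ge0 => t; rewrite mule_ge0// osc_ge0.
rewrite -/D; have [->|Dn] := eqVneq D +oo.
  by rewrite gt0_muley ?lte_fin// addey// leey.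
have Df : D \is a fin_num by rewrite ge0_fin_numE// ltey.
have c1 := Ah_cvg p1 mf fN mpsi psi01 psiS psiL L0 mgp gp0 gpf b01.
have c2 := Ah_cvg p1 mf fN mpsi psi01 psiS psiL L0 mgm gm0 gmf b01.
rewrite mulrC (mulrC (Hinv b)).
have c3 : (Ah b psi gm k.+1%:R^-1 + b%:E * D) @[k --> \oo] --> (gpsi psi gm * Hinv b)%:E + b%:E * D.
  by apply: cvgeD; [|exact: c2|exact: cvg_cst].
rewrite -(cvg_lim _ c1)// -(cvg_lim _ c3)//.
apply: lee_lim; [by apply: cvgP c1|by apply: cvgP c3|].
by near=> k; exact: step.
Unshelve. all: by end_near. Qed.

End inversion_inequality.

(** * Heat content and isoperimetry *)

Section perimeter.
Local Open Scope ereal_scope.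
Context {R : realType} {n : nat}.
Notation mu := (@lebn R n).
Notation leb := (@lebesgue_measure R).
Notation E := ('rV[R]_n).

Definition tv (v : E -> R) (z : E) : \bar R := \int[mu]_x (`|v (x + z) - v x|)%:E.
(** The heat content of [v]. For the indicator of a set of finite perimeter it behaves like a
    constant times [sqrt t] times the perimeter as [t] tends to 0. *)
Definition per (t : R) (v : E -> R) : \bar R := \int[mu]_z ((G t z)%:E * tv v z).

Lemma tv_ge0 v z : 0 <= tv v z. Proof. exact: int_ge0. Qed.

Lemma per_ge0 t v : 0 <= per t v.
Proof. by apply: int_ge0 => z; rewrite mule_ge0// tv_ge0. Qed.

Section fixed_function.
Variable v : E -> R.
Hypothesis mv : measurable_fun setT v.

Lemma measurable_tv : measurable_fun setT (tv v).
Proof.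
apply: (measurable_int2 mu (fun z x : E => (`|v (x + z) - v x|)%:E)) => //.
by mea.
Qed.
Let mtv := measurable_tv.

Lemma tv_double z : tv v (2 *: z) <= 2%:E * tv v z.
Proof.
have m1 : measurable_fun setT (fun x : E => (`|v (x + z) - v x|)%:E) by mea.
have e1 := @ge0_integral_rV_shift R n z _ m1 (fun=> ltac:(by rewrite lee_fin)).
apply: (@le_trans _ _ (\int[mu]_x ((`|v (x + z + z) - v (x + z)|)%:E + (`|v (x + z) - v x|)%:E))).
  apply: le_int; try by mea.
  move=> x; rewrite -EFinD lee_fin scalerDl scale1r addrA.
  by rewrite -[X in (`|X| <= _)%R](subrKA (v (x + z))) ler_normD.
rewrite intD//; try by mea.
by rewrite e1 -/(tv v z) -[X in X + X]mul1e -ge0_muleDl// -EFinD.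
Qed.

(** Quadrupling the time doubles the displacements, and [tv] at most doubles. Hence [per t / sqrt t]
    can only grow when the time is divided by 4. *)
Lemma per_quadruple t : (0 < t)%R -> per (4 * t) v <= 2%:E * per t v.
Proof.
move=> t0; rewrite /per (@ge0_integral_rV_affine _ _ 2 0); last 3 first.
- by [].
- by mea.
- by move=> z; rewrite mule_ge0// tv_ge0.
have -> : \int[mu]_x ((G (4 * t) (2 *: x + 0))%:E * tv v (2 *: x + 0)%R) =
  \int[mu]_x ((2 ^- n)%:E * ((G t x)%:E * tv v (2 *: x)%R)).
  apply: eq_integral => x _; rewrite addr0 muleA; congr (_ * _).
  have GS : (G (2 ^+ 2 * t) (2 *: x) = 2 ^- n * G t x)%R by apply: G_scale.
  rewrite -EFinM; congr EFin; rewrite -GS.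
  by congr (G (_ * _) _); rewrite -natrX.
have m2 : measurable_fun setT (fun x : E => tv v (2 *: x)%R) by mea.
rewrite intZl; last 3 first.
- by mea.
- by move=> x; rewrite mule_ge0// tv_ge0.
- by rewrite invr_ge0 exprn_ge0.
rewrite muleA -EFinM divff ?mul1e; last by rewrite expf_neq0.
rewrite -intZl//; [|by mea|by move=> z; rewrite mule_ge0// tv_ge0].
apply: le_int; try by mea.
- by move=> z; rewrite mule_ge0// tv_ge0.
- by move=> z; rewrite muleCA; apply: lee_wpmul2l; [exact: Ge_ge0|exact: tv_double].
Qed.

Lemma per_compare s t : (0 < s)%R -> (s <= t)%R -> (t <= 4 * s)%R ->
  per s v <= (2 ^+ n)%:E * per t v.
Proof.
move=> s0 st ts; rewrite /per -intZl ?exprn_ge0//; [|by mea|]; last first.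
  by move=> z; rewrite mule_ge0// tv_ge0.
apply: le_int; try by mea.
- by move=> z; rewrite mule_ge0// tv_ge0.
- move=> z; rewrite muleA -EFinM; apply: lee_wpmul2r; first exact: tv_ge0.
  by rewrite lee_fin G_compare.
Qed.

Definition pseq (j : nat) : \bar R := (2 ^+ j)%:E * per (4 ^- j) v.
(** This supremum of [per t / sqrt t] over the times [4 ^- j] plays the role of the perimeter, up to
    a constant. Being a monotone limit, it is measurable in the level and accessible to Fatou's
    lemma. *)
Definition VE : \bar R := ereal_sup (range pseq).

Lemma pseq_le_VE j : pseq j <= VE.
Proof. by apply: ereal_sup_ubound; exists j. Qed.

Lemma VE_ge0 : 0 <= VE.
Proof.
apply: le_trans (pseq_le_VE 0); rewrite mule_ge0 ?per_ge0// lee_fin exprn_ge0//.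
Qed.

Lemma pseq_nondecreasing : nondecreasing_seq pseq.
Proof.
apply/nondecreasing_seqP => j; rewrite /pseq.
have h : (0 < 4 ^- j.+1 :> R)%R by rewrite invr_gt0 exprn_gt0.
have := per_quadruple h.
have -> : (4 * 4 ^- j.+1 = 4 ^- j :> R)%R.
  by rewrite exprS invfM mulrA divff// mul1r.
move=> H; apply: (@le_trans _ _ ((2 ^+ j)%:E * (2%:E * per (4 ^- j.+1) v))).
  by apply: lee_wpmul2l => //; rewrite lee_fin exprn_ge0.
by rewrite muleA -EFinM -exprSr.
Qed.

Lemma pseq_cvg : pseq j @[j --> \oo] --> VE.
Proof. by apply: ereal_nondecreasing_cvgn; exact: pseq_nondecreasing. Qed.

(** Times up to 1 are compared with the next larger power [4 ^- j], at the cost [2 ^ n] for the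
    kernel and 2 for the square root; larger times are reduced to these by quadrupling. *)
Lemma per_le_VE t : (0 < t)%R -> per t v <= (2 ^+ n.+1 * Num.sqrt t)%:E * VE.
Proof.
have A j s : (4 ^- j.+1 <= s)%R -> (s <= 4 ^- j)%R -> per s v <= (2 ^+ n.+1 * Num.sqrt s)%:E * VE.
  move=> js sj; have s0 : (0 < s)%R by apply: lt_le_trans js; rewrite invr_gt0 exprn_gt0.
  apply: (le_trans (per_compare s0 sj _)).
    by move: js; rewrite exprS invfM ler_pdivrMl.
  have P : per (4 ^- j) v <= (2 ^- j)%:E * VE.
    have j0 : (0 <= 2 ^- j :> R)%R by rewrite invr_ge0 exprn_ge0.
    apply: le_trans (lee_wpmul2l _ (pseq_le_VE j)); last by rewrite lee_fin.
    by rewrite /pseq muleA -EFinM mulVf ?expf_neq0// mul1e.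
  apply: (@le_trans _ _ ((2 ^+ n)%:E * ((2 ^- j)%:E * VE))).
    by apply: lee_wpmul2l => //; rewrite lee_fin exprn_ge0.
  rewrite muleA -EFinM; apply: lee_wpmul2r; first exact: VE_ge0.
  rewrite lee_fin exprSr -mulrA ler_wpM2l ?exprn_ge0//.
  have : (2 ^- j.+1 <= Num.sqrt s)%R.
    have -> : (2 ^- j.+1 = Num.sqrt (4 ^- j.+1) :> R)%R.
      have four : (4 = 2 ^+ 2 :> R)%R by rewrite -natrX.
      have -> : (4 ^- j.+1 = (2 ^- j.+1) ^+ 2 :> R)%R.
        by rewrite four exprVn -!exprM mulnC.
      by rewrite sqrtr_sqr ger0_norm// invr_ge0 exprn_ge0.
    by rewrite ler_wsqrtr.
  by rewrite exprS invfM ler_pdivrMl.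
have B J s : (4 ^- J <= s)%R -> (s <= 1)%R -> per s v <= (2 ^+ n.+1 * Num.sqrt s)%:E * VE.
  elim: J => [|J ih] Js s1.
    apply: (A 0%N s); last by rewrite expr0 invr1.
    apply: le_trans Js; rewrite lef_pV2 ?posrE ?exprn_gt0// expr0 expr1.
    by rewrite ler1n.
  have [h|h] := leP (4 ^- J) s; first exact: ih.
  by apply: (A J) => //; exact: ltW.
have C s : (0 < s)%R -> (s <= 1)%R -> per s v <= (2 ^+ n.+1 * Num.sqrt s)%:E * VE.
  move=> s0; apply: (B (Num.bound s^-1)).
  rewrite -[X in (_ <= X)%R]invrK lef_pV2 ?posrE ?invr_gt0 ?exprn_gt0//.
  have s0' : (0 <= s^-1)%R by rewrite invr_ge0 ltW.
  apply: (le_trans (ltW (archi_boundP s0'))); rewrite -natrX ler_nat.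
  by apply: ltnW; exact: ltn_expl.
have D m s : (0 < s)%R -> (s <= 4 ^+ m)%R -> per s v <= (2 ^+ n.+1 * Num.sqrt s)%:E * VE.
  elim: m s => [|m ih] s s0; first by rewrite expr0; exact: C.
  move=> sm; have s40 : (0 < s / 4)%R by rewrite divr_gt0.
  have := per_quadruple s40; rewrite mulrC divfK// => h.
  apply: (le_trans h); apply: (@le_trans _ _ (2%:E * ((2 ^+ n.+1 * Num.sqrt (s / 4))%:E * VE))).
    apply: lee_wpmul2l; first by rewrite lee_fin.
    by apply: ih => //; rewrite ler_pdivrMr// mulrC -exprS.
  rewrite muleA -EFinM; apply: lee_wpmul2r; first exact: VE_ge0.
  rewrite lee_fin sqrtrM ?(ltW s0)// sqrtrV// (_ : (4 = 2 ^+ 2 :> R)%R); last by rewrite -natrX.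
  rewrite sqrtr_sqr ger0_norm// le_eqVlt; apply/orP; left; apply/eqP.
  set A' := (2 ^+ n.+1)%R; set B' := Num.sqrt s; by field.
move=> t0; apply: (D (Num.bound t)) => //.
apply: (le_trans (ltW (archi_boundP (ltW t0)))); rewrite -natrX ler_nat.
by apply: ltnW; exact: ltn_expl.
Qed.

Lemma osc_le_per (psi : E -> R) t : measurable_fun setT psi ->
  (forall x, 0 <= psi x <= 1)%R -> osc t psi v <= per t v.
Proof.
move=> mpsi psi01; rewrite /osc /per.
have mo := measurable_osc_inner t mv.
have o0 (x : E) : 0 <= \int[mu]_y (G t (y - x) * `|v y - v x|)%:E.
  by apply: int_ge0 => y; rewrite lee_fin mulr_ge0 ?G_ge0.
apply: (@le_trans _ _ (\int[mu]_x \int[mu]_y (G t (y - x) * `|v y - v x|)%:E)).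
  apply: le_int => //; first by mea.
  - by move=> x; rewrite mule_ge0// lee_fin; have /andP[] := psi01 x.
  - move=> x; rewrite -[X in _ <= X]mul1e; apply: lee_wpmul2r => //.
    by rewrite lee_fin; have /andP[] := psi01 x.
have e1 (x : E) : \int[mu]_y (G t (y - x) * `|v y - v x|)%:E =
    \int[mu]_z (G t z * `|v (x + z) - v x|)%:E.
  have m1 : measurable_fun setT (fun y : E => (G t (y - x) * `|v y - v x|)%:E) by mea.
  have p1 y : 0 <= (G t (y - x) * `|v y - v x|)%:E by rewrite lee_fin mulr_ge0 ?G_ge0.
  rewrite -(@ge0_integral_rV_shift R n x _ m1 p1).
  by apply: eq_integral => z _; rewrite addrK (addrC z).
under eq_integral do rewrite e1.
have m2 : measurable_fun setT (fun p : E * E => (G t p.2 * `|v (p.1 + p.2) - v p.1|)%:E) by mea.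
rewrite (tonelli mu mu (fun x z : E => (G t z * `|v (x + z) - v x|)%:E) m2); last first.
  by move=> x z; rewrite lee_fin mulr_ge0 ?G_ge0.
rewrite le_eqVlt; apply/orP; left; apply/eqP; apply: eq_integral => z _.
rewrite /tv -intZl ?G_ge0//; mea.
Qed.

End fixed_function.

Section indicator.
Variable e : E -> bool.
Hypothesis me : measurable_fun setT e.
Let v (x : E) : R := (e x)%:R.
Let mv : measurable_fun setT v. Proof. by rewrite /v; mea. Qed.
Let v0 x : (0 <= v x)%R. Proof. by rewrite /v. Qed.
Let v1 x : (v x <= 1)%R. Proof. by rewrite /v; case: (e x). Qed.
Let Gv0 (t : R) (x y : E) (r : R) : (0 <= r)%R -> 0 <= (G t (y - x) * r)%:E.
Proof. by move=> r0; rewrite lee_fin mulr_ge0 ?G_ge0. Qed.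

Lemma osc_le_mass (psi : E -> R) (S t : R) : (0 < t)%R -> measurable_fun setT psi ->
  (forall x, 0 <= psi x <= 1)%R -> \int[mu]_x (psi x)%:E = S%:E -> osc t psi v <= S%:E.
Proof.
move=> t0 mpsi psi01 psiS; rewrite -psiS /osc.
have psi0 x : 0 <= (psi x)%:E by rewrite lee_fin; have /andP[] := psi01 x.
have mo := measurable_osc_inner t mv.
apply: le_int; [by mea|by mea| |].
- by move=> x; rewrite mule_ge0//; apply: int_ge0 => y; exact: Gv0.
- move=> x; rewrite -[X in _ <= X]mule1; apply: lee_wpmul2l => //.
  rewrite -(G_mass_shift x t0); apply: le_int; try by mea.
  + by move=> y; exact: Gv0.
  + move=> y; rewrite lee_fin ler_piMr ?G_ge0// ler_norml.
    by have := v0 x; have := v0 y; have := v1 x; have := v1 y; lra.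
Qed.

Lemma osc_le_vol (psi : E -> R) (t : R) : (0 < t)%R -> measurable_fun setT psi ->
  (forall x, 0 <= psi x <= 1)%R -> osc t psi v <= 2%:E * \int[mu]_x (v x)%:E.
Proof.
move=> t0 mpsi psi01; rewrite /osc.
have psi0 x : 0 <= (psi x)%:E by rewrite lee_fin; have /andP[] := psi01 x.
have mo := measurable_osc_inner t mv.
have ve0 x : 0 <= (v x)%:E by rewrite lee_fin.
have mve : measurable_fun setT (fun x : E => (v x)%:E) by mea.
have mh : measurable_fun setT (fun x : E => heat t (fun y => (v y)%:E) x) by mea.
have h0 (x : E) : 0 <= heat t (fun y => (v y)%:E) x by exact: heat_ge0.
apply: (@le_trans _ _ (\int[mu]_x (heat t (fun y => (v y)%:E) x + (v x)%:E))).
  apply: le_int => //; [by mea|by mea| |].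
  - by move=> x; rewrite mule_ge0//; apply: int_ge0 => y; exact: Gv0.
  - move=> x; apply: (@le_trans _ _ (\int[mu]_y (G t (y - x) * `|v y - v x|)%:E)).
      rewrite -[X in _ <= X]mul1e; apply: lee_wpmul2r.
        by apply: int_ge0 => y; exact: Gv0.
      by rewrite lee_fin; have /andP[] := psi01 x.
    rewrite heatE -[X in _ + X]mul1e -(G_mass_shift x t0) -intZr//; last by mea.
    rewrite -intD//; [|by mea|by mea| |]; last 2 first.
    - by move=> y; rewrite mule_ge0.
    - by move=> y; rewrite mule_ge0.
    apply: le_int; [by mea|by mea|by move=> y; exact: Gv0|].
    move=> y; rewrite -!EFinM -EFinD lee_fin -mulrDr ler_wpM2l ?G_ge0// ler_norml.
    by have := v0 x; have := v0 y; lra.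
rewrite intD//.
by rewrite heat_mass// -[X in X + X]mul1e -ge0_muleDl// -EFinD.
Qed.

(* At the time where [heat t 1_e <= 1/2], half of the volume is seen by the
   heat flow across the boundary. *)
Lemma isoperimetric (m : R) : (0 < n)%N -> \int[mu]_x (v x)%:E = m%:E -> (0 < m)%R ->
  m%:E <= (2 ^+ n.+2 * (2 * @cG R n) `^ n%:R^-1 * m `^ n%:R^-1)%:E * VE v.
Proof.
move=> n0 vm m0; have cg := @cG_gt0 R n.
have n0' : (n%:R : R) != 0%R by rewrite pnatr_eq0 -lt0n.
pose q := (2 * @cG R n * m)%R.
have q0 : (0 < q)%R by rewrite !mulr_gt0.
pose t := (q `^ (2 / n%:R))%R.
have t0 : (0 < t)%R by rewrite powR_gt0.
have st : (Num.sqrt t = q `^ n%:R^-1)%R.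
  rewrite -powR12_sqrt ?(ltW t0)// /t -powRrM; congr (powR _ _).
  by field.
have tq : (t `^ (- (n%:R / 2)) = q^-1)%R.
  rewrite /t -powRrM (_ : (2 / n%:R * - (n%:R / 2) = -1)%R); last by field.
  by rewrite powR_inv1// ltW.
have ve0 x : 0 <= (v x)%:E by rewrite lee_fin.
have mve : measurable_fun setT (fun x : E => (v x)%:E) by mea.
have hb (x : E) : heat t (fun y => (v y)%:E) x <= (2^-1)%:E.
  have := heat_le_int mve ve0 x t0; rewrite vm tq -EFinM => h.
  apply: (le_trans h); rewrite lee_fin le_eqVlt; apply/orP; left; apply/eqP.
  by rewrite /q; field; rewrite !gt_eqF.
have mo := measurable_osc_inner t mv.
have half : (m / 2)%:E <= osc t v v.
  have -> : (m / 2)%:E = \int[mu]_x ((v x)%:E * (2^-1)%:E).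
    by rewrite intZr// vm -EFinM.
  apply: le_int; [by mea|by mea| |].
  - by move=> x; rewrite mule_ge0 ?lee_fin.
  - move=> x; have [ex|ex] := boolP (e x); last first.
      by rewrite (_ : v x = 0%R) ?mul0e// /v (negbTE ex).
    have vx : v x = 1%R by rewrite /v ex.
    rewrite vx !mul1e.
    have G1 := G_mass_shift x t0.
    have : 1 <= \int[mu]_y (G t (y - x) * `|v y - 1|)%:E + heat t (fun y => (v y)%:E) x.
      rewrite heatE -intD; [|by mea|by mea| |]; last 2 first.
      - by move=> y; exact: Gv0.
      - by move=> y; rewrite mule_ge0.
      rewrite -G1; apply: le_int; [by mea|by mea|by []|].
      move=> y; rewrite -EFinM -EFinD lee_fin -mulrDr ler_peMr ?G_ge0//.
      by rewrite /v; case: (e y) => /=; rewrite ?subrr ?sub0r ?normrN ?normr0 ?normr1 ?addr0 ?add0r lexx.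
    move: (\int[mu]_y (G t (y - x) * `|v y - 1|)%:E) => I1 I1h.
    have := le_trans I1h (leeD2l _ (hb x)).
    case: I1 I1h => [i| |] _ //=; last by move=> _; rewrite leey.
    by rewrite -EFinD !lee_fin; lra.
have v01 x : (0 <= v x <= 1)%R by rewrite v0 v1.
have h := le_trans half (le_trans (osc_le_per mv t mv v01) (per_le_VE mv t0)).
 have two : (0 : \bar R) <= 2%:E by rewrite lee_fin ler0n.
have := lee_wpmul2l two h.
rewrite -EFinM muleA -EFinM (mulrC 2%R) divfK// => H.
apply: (le_trans H); apply: lee_wpmul2r; first exact: VE_ge0.
rewrite lee_fin st /q [in X in (X <= _)%R]powRM ?mulr_ge0 ?(ltW cg) ?(ltW m0)//.
by rewrite !mulrA -exprS.
Qed.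

End indicator.
End perimeter.

(** * Optimisation in time for a single set *)

Section kappa.
Local Open Scope ereal_scope.
Context {R : realType} {n : nat}.
Notation mu := (@lebn R n).
Notation leb := (@lebesgue_measure R).
Notation E := ('rV[R]_n).
Variable a : R.
Hypothesis a01 : (0 < a < 1)%R.
Hypothesis n0 : (0 < n)%N.
Let b := ((1 - a) / 2)%R.
Let a0 : (0 < a)%R. Proof. by have /andP[] := a01. Qed.
Let a1 : (a < 1)%R. Proof. by have /andP[] := a01. Qed.
Let b0 : (0 < b)%R. Proof. by rewrite /b; have := a1; lra. Qed.
Let b2 : (b < 2^-1)%R. Proof. by rewrite /b; have := a0; lra. Qed.
Let nn : (1 <= n%:R :> R)%R. Proof. by rewrite ler1n. Qed.
Let nr0 : (0 < n%:R :> R)%R. Proof. exact: lt_le_trans nn. Qed.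

(** [t] stands for the mass of the test function; the absolute value keeps the integrand nonnegative
    and measurable for every real [t]. *)
Definition kap (t : R) (v : E -> R) : \bar R :=
  \int[leb]_s ((pw (- b - 1) s)%:E *
    Order.min (per s v) (Order.min (`|t|)%:E (2%:E * \int[mu]_x (v x)%:E))).

Section one_set.
Variable e : E -> bool.
Hypothesis me : measurable_fun setT e.
Let v (x : E) : R := (e x)%:R.
Let mv : measurable_fun setT v. Proof. by rewrite /v; mea. Qed.
Let vol := \int[mu]_x (v x)%:E.
Let vol0 : 0 <= vol. Proof. by apply: int_ge0 => x; rewrite lee_fin /v. Qed.

Let mper : measurable_fun setT (fun s => per s v).
Proof.
have mtv := measurable_tv mv.
apply: (measurable_int2 mu (fun (s : R) (z : E) => (G s z)%:E * tv v z)); first by mea.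
by move=> s z; rewrite mule_ge0// tv_ge0.
Qed.

Definition ck : R := (2 ^+ n.+1 / (2^-1 - b) + b^-1)%R.

Lemma ck_gt0 : (0 < ck)%R.
Proof.
by rewrite /ck addr_gt0 ?invr_gt0// divr_gt0 ?exprn_gt0// subr_gt0.
Qed.

(* Splitting the time integral at [(m / V) ^ 2], where the two arguments of the
   minimum are comparable. *)
Lemma kap_le (t m V : R) : (0 < m)%R -> (0 < V)%R -> VE v = V%:E ->
  Order.min (`|t|)%:E (2%:E * vol) = m%:E -> kap t v <= (ck * V `^ (1 - a) * m `^ a)%:E.
Proof.
move=> m0 V0 vV tm.
pose T := ((m / V) ^+ 2)%R.
have mV : (0 < m / V)%R by rewrite divr_gt0.
have T0 : (0 < T)%R by rewrite exprn_gt0.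
have TE c : (T `^ c = m `^ (2 * c) * V `^ (- (2 * c)))%R.
  rewrite /T -powR_mulrn ?(ltW mV)// -powRrM powRM ?(ltW m0) ?invr_ge0 ?(ltW V0)//.
  by congr (_ * _)%R; rewrite -powR_inv1 ?(ltW V0)// -powRrM mulN1r.
have c20 : (0 < 2^-1 - b)%R by rewrite subr_gt0.
apply: (@le_trans _ _ ((2 ^+ n.+1 * V) * (T `^ (2^-1 - b) / (2^-1 - b)) + m * (T `^ (- b) / b))%:E).
  apply: pw_split_bound => //.
  - by rewrite mulr_ge0 ?exprn_ge0// ltW.
  - exact: ltW.
  - by rewrite tm; mea.
  - move=> s; rewrite tm mule_ge0// le_min per_ge0/= lee_fin ltW//.
  - by move=> s s0; rewrite pw_neg// mul0e.
  - move=> s /andP[s0 _]; rewrite pwE//.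
    apply: (@le_trans _ _ ((s `^ (- b - 1))%:E * ((2 ^+ n.+1 * Num.sqrt s)%:E * V%:E))).
      apply: lee_wpmul2l; first by rewrite lee_fin powR_ge0.
      by rewrite ge_min -vV per_le_VE.
    rewrite -!EFinM lee_fin -powR12_sqrt ?(ltW s0)//.
    have -> : (2^-1 - b - 1 = (- b - 1) + 2^-1)%R by ring.
    rewrite [in X in (_ <= X)%R]powRD ?(gt_eqF s0) ?implybT//.
    by rewrite le_eqVlt; apply/orP; left; apply/eqP; ring.
  - move=> s Ts; have s0 : (0 < s)%R by exact: lt_le_trans Ts.
    rewrite pwE// mulrC EFinM; apply: lee_wpmul2l; first by rewrite lee_fin powR_ge0.
    by rewrite tm ge_min lexx orbT.
rewrite lee_fin !TE.
have e1 : (2 * (2^-1 - b) = a)%R by rewrite /b; field.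
have e2 : (2 * - b = - (1 - a))%R by rewrite /b; field.
rewrite e1 e2 opprK.
have eV : (V * V `^ (- a) = V `^ (1 - a))%R.
  by rewrite -{1}(powRr1 (ltW V0)) -powRD ?(gt_eqF V0) ?implybT.
have em : (m * m `^ (- (1 - a)) = m `^ a)%R.
  rewrite -{1}(powRr1 (ltW m0)) -powRD ?(gt_eqF m0) ?implybT//.
  by congr (powR _ _); ring.
rewrite le_eqVlt; apply/orP; left; apply/eqP.
have -> : (2 ^+ n.+1 * V * (m `^ a * V `^ (- a) / (2^-1 - b)) =
  2 ^+ n.+1 / (2^-1 - b) * ((V * V `^ (- a)) * m `^ a))%R by ring.
have -> : (m * (m `^ (- (1 - a)) * V `^ (1 - a) / b) =
  b^-1 * (V `^ (1 - a) * (m * m `^ (- (1 - a)))))%R by ring.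
by rewrite eV em /ck; ring.
Qed.

Lemma kap0 t : vol = 0 -> kap t v = 0.
Proof.
move=> v0; rewrite /kap (_ : (fun s => _) = cst 0) ?integral0//.
apply/funext => s /=; rewrite -/vol v0 mule0.
rewrite [X in Order.min _ X]min_r ?lee_fin// min_r ?per_ge0//.
by rewrite mule0.
Qed.

Definition ciso : R := (2 ^+ n.+2 * (2 * @cG R n) `^ n%:R^-1)%R.

Lemma ciso_gt0 : (0 < ciso)%R.
Proof. by rewrite /ciso mulr_gt0 ?exprn_gt0// powR_gt0// mulr_gt0 ?cG_gt0. Qed.

(** Null sets and sets of infinite perimeter are trivial for bounds linear in the perimeter. For the
    others the parameter t is effectively capped at a height [T] that the isoperimetric inequality
    controls. *)
Lemma kap_cases : vol < +oo -> [\/ (forall t, kap t v = 0), VE v = +oo |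
  exists V T : R, [/\ (0 < V)%R, (0 < T)%R, VE v = V%:E,
    (T `^ (1 - n%:R^-1) <= 2 * ciso * V)%R &
    forall t, (0 < t)%R -> kap t v <= (ck * V `^ (1 - a) * (Num.min t T) `^ a)%:E]].
Proof.
move=> volf.
have : vol \is a fin_num by rewrite ge0_fin_numE.
move=> /fineK; move: (fine vol) => m vm.
have m0 : (0 <= m)%R by rewrite -lee_fin vm.
have [m0'|m0'] := eqVneq m 0%R.
  by apply: Or31 => t; apply: kap0 => //; rewrite -vm m0'.
have mp : (0 < m)%R by rewrite lt0r m0'.
have := isoperimetric me n0 (esym vm) mp; rewrite -/v -/ciso.
case VV : (VE v) (VE_ge0 v) => [V| |] V0 //; last by move=> _; apply: Or32.
rewrite -EFinM lee_fin => iso; apply: Or33.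
have Vp : (0 < V)%R.
  rewrite lt_neqAle -lee_fin V0 andbT eq_sym; apply/eqP => V0'.
  by move: iso; rewrite V0' mulr0 leNgt mp.
(* [T] is twice the volume, the constant entry of the minimum; passing from [m] to [2 m] costs at
   most a factor 2 in the isoperimetric inequality. *)
exists V, (2 * m)%R; split => //.
- by rewrite mulr_gt0.
- have iso' : (m `^ (1 - n%:R^-1) <= ciso * V)%R.
    rewrite powRD ?(gt_eqF mp) ?implybT// powRr1 ?(ltW mp)// powRN.
    rewrite ler_pdivrMr ?powR_gt0//; apply: (le_trans iso).
    by rewrite mulrAC.
  rewrite powRM ?(ltW mp)// -mulrA; apply: ler_pM => //; rewrite ?powR_ge0//.
  rewrite -[leRHS]powRr1// ler_powR ?ler1n//.
- move=> t t0; apply: kap_le => //.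
    by rewrite lt_min t0 mulr_gt0.
  by rewrite -vm -EFinM EFin_min gtr0_norm.
Qed.

Definition cweak : R := (ck * (2 * ciso) `^ a)%R.

Lemma cweak_gt0 : (0 < cweak)%R.
Proof. by rewrite /cweak mulr_gt0 ?ck_gt0// powR_gt0// mulr_gt0 ?ciso_gt0. Qed.

(** [T ^ (a - a/n)] is the a-th power of [T ^ (1 - 1/n)], hence at most [(2 ciso V) ^ a], which
    completes [V ^ (1 - a)] to [V]. *)
Let combine (V T : R) : (0 < V)%R -> (0 < T)%R -> (T `^ (1 - n%:R^-1) <= 2 * ciso * V)%R ->
  (ck * V `^ (1 - a) * T `^ (a - a / n%:R) <= cweak * V)%R.
Proof.
move=> V0 T0 h.
have -> : (a - a / n%:R = (1 - n%:R^-1) * a)%R by ring.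
rewrite powRrM.
have h1 : (T `^ (1 - n%:R^-1) `^ a <= (2 * ciso * V) `^ a)%R.
  apply: ge0_ler_powR; rewrite ?nnegrE ?powR_ge0 ?(ltW a0)//.
  by apply: mulr_ge0; [apply: mulr_ge0; rewrite ?(ltW ciso_gt0)|exact: ltW].
have c0 : (0 <= ck * V `^ (1 - a))%R by rewrite mulr_ge0 ?(ltW ck_gt0) ?powR_ge0.
apply: (le_trans (ler_wpM2l c0 h1)).
rewrite (powRM _ (mulr_ge0 _ (ltW ciso_gt0)) (ltW V0))//.
have eV : (V `^ (1 - a) * V `^ a = V)%R.
  by rewrite -powRD ?(gt_eqF V0) ?implybT// subrK powRr1// ltW.
rewrite le_eqVlt; apply/orP; left; apply/eqP.
rewrite /cweak -[X in (_ = _ * X)%R]eV.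
by move: ck (V `^ (1 - a))%R ((2 * ciso) `^ a)%R (V `^ a)%R => A B C D; ring.
Qed.

(** With [m] the minimum of [t] and [T], the power [m ^ a] is split as [m ^ (a - a/n)] times
    [m ^ (a/n)]: the first factor is controlled by the perimeter, the second by [t]. *)
Lemma kap_weak t : (0 < t)%R -> vol < +oo -> kap t v <= (cweak * t `^ (a / n%:R))%:E * VE v.
Proof.
move=> t0 /kap_cases[k0|->|[V [T [V0 T0 -> VT kle]]]].
- by rewrite k0 mule_ge0 ?VE_ge0// lee_fin mulr_ge0 ?powR_ge0 ?(ltW cweak_gt0).
- by rewrite gt0_muley ?leey// lte_fin mulr_gt0 ?cweak_gt0 ?powR_gt0.
- apply: (le_trans (kle _ t0)); rewrite -EFinM lee_fin.
  set m := Num.min t T; have m0 : (0 < m)%R by rewrite lt_min t0.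
  have an0 : (0 <= a / n%:R)%R by rewrite divr_ge0 ?(ltW a0) ?(ltW nr0).
  have -> : (m `^ a = m `^ (a - a / n%:R) * m `^ (a / n%:R))%R.
    by rewrite -powRD ?(gt_eqF m0) ?implybT// subrK.
  have mt : (m `^ (a / n%:R) <= t `^ (a / n%:R))%R.
    by apply: ge0_ler_powR; rewrite ?nnegrE ?(ltW m0) ?(ltW t0)// /m ge_min lexx.
  have mT : (m `^ (1 - n%:R^-1) <= 2 * ciso * V)%R.
    apply: le_trans VT; apply: ge0_ler_powR; rewrite ?nnegrE ?(ltW m0) ?(ltW T0)//.
      by rewrite subr_ge0 invf_le1.
    by rewrite /m ge_min lexx orbT.
  rewrite mulrA (mulrAC _ _ V); apply: ler_pM => //; rewrite ?powR_ge0//.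
    by rewrite !mulr_ge0 ?powR_ge0 ?(ltW ck_gt0).
  exact: combine.
Qed.

Lemma kap_ge0 t : 0 <= kap t v.
Proof.
apply: int_ge0 => s; rewrite mule_ge0 ?lee_fin ?pw_ge0//.
by rewrite !le_min per_ge0/= lee_fin normr_ge0 mule_ge0// lee_fin.
Qed.

Lemma measurable_kap : measurable_fun setT (kap ^~ v).
Proof.
apply: (measurable_int2 leb (fun t s : R => (pw (- b - 1) s)%:E *
  Order.min (per s v) (Order.min (`|t|)%:E (2%:E * vol)))).
  have m2 : measurable_fun setT (fun p : R * R => per p.2 v).
    by apply: (mf_comp mper); mea.
  by mea.
move=> t s; rewrite mule_ge0 ?lee_fin ?pw_ge0//.
by rewrite !le_min per_ge0/= lee_fin normr_ge0 mule_ge0// lee_fin.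
Qed.

Definition cstrong : R := (cweak * ((a - a / n%:R)^-1 + (a / n%:R)^-1))%R.

(** Below [T] the integrand is of order [t ^ (a - a/n - 1)], above it of order
    [T ^ a * t ^ (-a/n - 1)]. Convergence at 0 needs [a/n < a], and this is where dimension 1 is
    excluded. *)
Lemma kap_strong : (1 < n)%N -> vol < +oo ->
  \int[leb]_t ((pw (- (a / n%:R) - 1) t)%:E * kap t v) <= cstrong%:E * VE v.
Proof.
move=> n1 volf; have mk := measurable_kap; have k0 := kap_ge0.
have an0 : (0 < a / n%:R)%R by rewrite divr_gt0.
have n1' : (n%:R^-1 < 1 :> R)%R by rewrite invf_lt1// ltr1n.
have aan0 : (0 < a - a / n%:R)%R by rewrite subr_gt0 -[ltRHS]mulr1 ltr_pM2l.
have cs0 : (0 < cstrong)%R by rewrite mulr_gt0 ?cweak_gt0// addr_gt0 ?invr_gt0.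
have := volf => /kap_cases[kz|->|[V [T [V0 T0 -> VT kle]]]].
- rewrite (_ : (fun t => _) = cst 0) ?integral0 ?mule_ge0 ?VE_ge0 ?lee_fin ?(ltW cs0)//.
  apply/funext => t /=; have [t0|t0] := ltP 0%R t; last by rewrite pw_neg// mul0e.
  by rewrite kz mule0.
- by rewrite gt0_muley ?leey.
- pose A := (ck * V `^ (1 - a))%R.
  have A0 : (0 <= A)%R by rewrite mulr_ge0 ?(ltW ck_gt0) ?powR_ge0.
  apply: (@le_trans _ _ (A * (T `^ (a - a / n%:R) / (a - a / n%:R)) +
     (A * T `^ a) * (T `^ (- (a / n%:R)) / (a / n%:R)))%:E).
    apply: pw_split_bound => //.
    + by rewrite mulr_ge0 ?powR_ge0.
    + by mea.
    + by move=> t; rewrite mule_ge0.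
    + by move=> t t0; rewrite pw_neg// mul0e.
    + move=> t /andP[t0 tT]; rewrite pwE//.
      apply: (le_trans (lee_wpmul2l _ (kle t t0))); first by rewrite lee_fin powR_ge0.
      rewrite -EFinM lee_fin -/A min_l ?(ltW tT)//.
      have -> : (a - a / n%:R - 1 = (- (a / n%:R) - 1) + a)%R by ring.
      rewrite [in X in (_ <= X)%R]powRD ?(gt_eqF t0) ?implybT//.
      by rewrite mulrCA.
    + move=> t Tt; have t0 : (0 < t)%R by exact: lt_le_trans Tt.
      rewrite pwE//; apply: (le_trans (lee_wpmul2l _ (kle t t0))).
        by rewrite lee_fin powR_ge0.
      by rewrite -EFinM lee_fin -/A min_r// mulrC.
  have -> : ((A * T `^ a) * (T `^ (- (a / n%:R)) / (a / n%:R)) =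
      A * (T `^ (a - a / n%:R) / (a / n%:R)))%R.
    by rewrite (@powRD _ _ a) ?(gt_eqF T0) ?implybT// !mulrA.
  rewrite -EFinM lee_fin -mulrDr -mulrDr mulrA.
  rewrite /cstrong (mulrAC cweak); apply: ler_wpM2r; last exact: combine.
  by rewrite addr_ge0 ?invr_ge0 ?ltW.
Qed.

End one_set.
End kappa.

(** * Coarea *)

Section levels.
Local Open Scope ereal_scope.
Context {R : realType} {n : nat}.
Notation mu := (@lebn R n).
Notation leb := (@lebesgue_measure R).
Notation E := ('rV[R]_n).

(* Superlevel sets at positive heights and sublevel sets at negative ones, so
   that they have finite volume when [u] vanishes at infinity. *)
Definition lset (u : E -> R) (l : R) (x : E) : bool :=
  if (0 < l)%R then (l < u x)%R else if (l < 0)%R then (u x <= l)%R else false.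

Variable u : E -> R.
Hypothesis mu_ : measurable_fun setT u.
Notation lv l := (fun x : E => (lset u l x)%:R : R).

Lemma mf_lset d (T : measurableType d) (f : T -> R) (g : T -> E) :
  measurable_fun setT f -> measurable_fun setT g ->
  measurable_fun setT (fun p => lset u (f p) (g p)).
Proof.
move=> mf mg; have mug := mf_comp mu_ mg.
by apply: measurable_fun_ifT; [mea|mea|apply: measurable_fun_ifT; mea].
Qed.

Lemma mf_lv d (T : measurableType d) (f : T -> R) (g : T -> E) :
  measurable_fun setT f -> measurable_fun setT g ->
  measurable_fun setT (fun p => (lset u (f p) (g p))%:R : R).
Proof. by move=> mf mg; apply: mf_bool; exact: mf_lset. Qed.

Lemma coarea x y : \int[leb]_l (`|(lset u l y)%:R - (lset u l x)%:R|)%:E = (`|u y - u x|)%:E.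
Proof.
wlog xy : x y / (u x <= u y)%R.
  move=> H; have [h|h] := leP (u x) (u y); first exact: H.
  rewrite distrC -(H _ _ (ltW h)).
  by apply: eq_integral => l _; rewrite distrC.
have m1 : measurable_fun setT (fun l : R => `|(lset u l y)%:R - (lset u l x)%:R| : R)%R.
  have := @mf_lv _ _ (fun l : R => l) (fun=> x).
  have := @mf_lv _ _ (fun l : R => l) (fun=> y).
  move=> /(_ (@measurable_id _ _ _) (@measurable_cst _ _ _ _ _ _)) h1.
  move=> /(_ (@measurable_id _ _ _) (@measurable_cst _ _ _ _ _ _)) h2.
  by mea.
have mI : measurable (`[u x, u y[%classic : set R) by exact: measurable_itv.
have m2 : measurable_fun setT (fun l : R => \1_(`[u x, u y[%classic) l : R)%R by exact: mf_indic.
(* Away from level 0, where [lset] is false by convention, membership differs exactly for levels in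
   [[u x, u y[], for superlevel and for sublevel sets alike. *)
have mT0 : measurable ([set: R] `\ (0 : R)%R) by apply: measurableD.
have m1e : measurable_fun ([set: R] `\ (0 : R)%R) (fun l : R => (`|(lset u l y)%:R - (lset u l x)%:R : R|)%:E).
  by apply: (measurable_funS measurableT) => //; mea.
have m2e : measurable_fun ([set: R] `\ (0 : R)%R) (fun l : R => (\1_(`[u x, u y[%classic) l : R)%:E).
  by apply: (measurable_funS measurableT) => //; mea.
rewrite -(integral_setD1 mT0 m1e).
transitivity (\int[leb]_(l in [set: R] `\ (0 : R)%R) (\1_(`[u x, u y[%classic) l : R)%:E).
  apply: eq_integral => l; rewrite inE/= => -[_ /eqP l0]; congr EFin.
  rewrite indicE /lset mem_setE in_itv/=.
  case: ltgtP l0 => // l0 _; rewrite ?ltNge.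
    rewrite -!ltNge; have [h|h] := leP (u x) l; have [h'|h'] := leP (u y) l;
      rewrite /= ?subrr ?subr0 ?sub0r ?normrN ?normr0 ?normr1//; lra.
  have [h|h] := leP (u x) l; have [h'|h'] := leP (u y) l;
    rewrite /= ?subrr ?subr0 ?sub0r ?normrN ?normr0 ?normr1//; lra.
rewrite (integral_setD1 mT0 m2e).
rewrite integral_indic// setIT.
have := @lebesgue_measure_itv R `[u x, u y[; rewrite /= => ->.
rewrite lte_fin.
case: ltP => h; first by rewrite -EFinB ger0_norm// subr_ge0.
have -> : u x = u y by apply/eqP; rewrite eq_le xy.
by rewrite subrr normr0.
Qed.

Lemma mf_tv_lv d (T : measurableType d) (f : T -> R) (g : T -> E) :
  measurable_fun setT f -> measurable_fun setT g ->
  measurable_fun setT (fun p => tv (lv (f p)) (g p)).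
Proof.
move=> mf mg.
apply: (measurable_int2 mu (fun (p : T) (x : E) =>
   (`|(lset u (f p) (x + g p))%:R - (lset u (f p) x)%:R|)%:E)); last first.
  by move=> p x; rewrite lee_fin.
have m1 : measurable_fun setT (fun p : T * E => f p.1) by apply: (mf_comp mf); mea.
have m2 : measurable_fun setT (fun p : T * E => g p.1) by apply: (mf_comp mg); mea.
have m3 := @mf_lv _ _ (fun p : T * E => f p.1) (fun p => p.2) m1 ltac:(mea).
have m4 := @mf_lv _ _ (fun p : T * E => f p.1) (fun p => p.2 + g p.1)%R m1 ltac:(mea).
by mea.
Qed.

Lemma mf_per_lv d (T : measurableType d) (f g : T -> R) :
  measurable_fun setT f -> measurable_fun setT g ->
  measurable_fun setT (fun p => per (f p) (lv (g p))).
Proof.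
move=> mf mg.
apply: (measurable_int2 mu (fun (p : T) (z : E) => (G (f p) z)%:E * tv (lv (g p)) z)); last first.
  by move=> p z; rewrite mule_ge0// tv_ge0.
have m1 : measurable_fun setT (fun p : T * E => f p.1) by apply: (mf_comp mf); mea.
have m2 : measurable_fun setT (fun p : T * E => g p.1) by apply: (mf_comp mg); mea.
have m3 := @mf_tv_lv _ _ (fun p : T * E => g p.1) (fun p => p.2) m2 ltac:(mea).
by mea.
Qed.

Definition lvol (l : R) : \bar R := \int[mu]_x ((lset u l x)%:R : R)%:E.

Lemma lvol_ge0 l : 0 <= lvol l. Proof. by apply: int_ge0 => x; rewrite lee_fin. Qed.

Lemma measurable_lvol : measurable_fun setT lvol.
Proof.
apply: (measurable_int2 mu (fun (l : R) (x : E) => ((lset u l x)%:R : R)%:E)); last first.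
  by move=> p z; rewrite lee_fin.
have m3 := @mf_lv _ _ (fun p : R * E => p.1) (fun p => p.2) ltac:(mea) ltac:(mea).
by mea.
Qed.

Lemma measurable_VE_lv : measurable_fun setT (fun l => VE (lv l)).
Proof.
apply: (emeasurable_fun_cvg (fun j l => pseq (lv l) j)).
  move=> j; have m := @mf_per_lv _ _ (fun=> 4 ^- j)%R (fun l : R => l) ltac:(mea) ltac:(mea).
  by rewrite /pseq; mea.
move=> l _; apply: pseq_cvg.
exact: (@mf_lv _ _ (fun=> l) (fun x : E => x) ltac:(mea) ltac:(mea)).
Qed.

Let mlv l : measurable_fun setT (lset u l).
Proof. exact: (@mf_lset _ _ (fun=> l) (fun x : E => x) ltac:(mea) ltac:(mea)). Qed.

Lemma coarea_tv z : \int[leb]_l tv (lv l) z = tv u z.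
Proof.
rewrite (tonelli leb mu (fun (l : R) (x : E) => (`|(lset u l (x + z))%:R - (lset u l x)%:R|)%:E)).
- by apply: eq_integral => x _; exact: coarea.
- have m3 := @mf_lv _ _ (fun p : R * E => p.1) (fun p => p.2) ltac:(mea) ltac:(mea).
  have m4 := @mf_lv _ _ (fun p : R * E => p.1) (fun p => p.2 + z)%R ltac:(mea) ltac:(mea).
  by mea.
- by move=> l x; rewrite lee_fin.
Qed.

Lemma coarea_per t : \int[leb]_l per t (lv l) = per t u.
Proof.
rewrite (tonelli leb mu (fun (l : R) (z : E) => (G t z)%:E * tv (lv l) z)).
- apply: eq_integral => z _.
  rewrite intZl ?G_ge0//; first by rewrite coarea_tv.
  + exact: (@mf_tv_lv _ _ (fun l : R => l) (fun=> z) ltac:(mea) ltac:(mea)).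
  + by move=> l; exact: tv_ge0.
- have m := @mf_tv_lv _ _ (fun p : R * E => p.1) (fun p => p.2) ltac:(mea) ltac:(mea).
  by mea.
- by move=> l z; rewrite mule_ge0// tv_ge0.
Qed.

Lemma mf_osc_inner_lv d (T : measurableType d) (t : R) (f : T -> R) (g : T -> E) :
  measurable_fun setT f -> measurable_fun setT g ->
  measurable_fun setT (fun p => \int[mu]_y (G t (y - g p) *
     `|(lset u (f p) y)%:R - (lset u (f p) (g p))%:R|)%:E).
Proof.
move=> mf mg.
apply: (measurable_int2 mu (fun (p : T) (y : E) => (G t (y - g p) *
     `|(lset u (f p) y)%:R - (lset u (f p) (g p))%:R|)%:E)); last first.
  by move=> p y; rewrite lee_fin mulr_ge0 ?G_ge0.
have m1 : measurable_fun setT (fun p : T * E => f p.1) by apply: (mf_comp mf); mea.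
have m2 : measurable_fun setT (fun p : T * E => g p.1) by apply: (mf_comp mg); mea.
have m3 := @mf_lv _ _ (fun p : T * E => f p.1) (fun p => p.2) m1 ltac:(mea).
have m4 := @mf_lv _ _ (fun p : T * E => f p.1) (fun p => g p.1) m1 m2.
by mea.
Qed.

Lemma coarea_osc t (psi : E -> R) : measurable_fun setT psi -> (forall x, 0 <= psi x)%R ->
  \int[leb]_l osc t psi (lv l) = osc t psi u.
Proof.
move=> mpsi psi0.
have p0 (l : R) (x : E) : 0 <= \int[mu]_y (G t (y - x) * `|(lset u l y)%:R - (lset u l x)%:R|)%:E.
  by apply: int_ge0 => y; rewrite lee_fin mulr_ge0 ?G_ge0.
rewrite (tonelli leb mu (fun (l : R) (x : E) => (psi x)%:E *
   \int[mu]_y (G t (y - x) * `|(lset u l y)%:R - (lset u l x)%:R|)%:E)).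
- apply: eq_integral => x _.
  rewrite intZl//.
  + congr (_ * _).
    rewrite (tonelli leb mu (fun (l : R) (y : E) => (G t (y - x) *
       `|(lset u l y)%:R - (lset u l x)%:R|)%:E)).
    * apply: eq_integral => y _.
      rewrite [RHS]EFinM -coarea -intZl ?G_ge0//.
      have m3 := @mf_lv _ _ (fun l : R => l) (fun=> x) ltac:(mea) ltac:(mea).
      have m4 := @mf_lv _ _ (fun l : R => l) (fun=> y) ltac:(mea) ltac:(mea).
      by mea.
    * have m3 := @mf_lv _ _ (fun p : R * E => p.1) (fun p => p.2) ltac:(mea) ltac:(mea).
      have m4 := @mf_lv _ _ (fun p : R * E => p.1) (fun=> x) ltac:(mea) ltac:(mea).
      by mea.
    * by move=> l y; rewrite lee_fin mulr_ge0 ?G_ge0.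
  + exact: (@mf_osc_inner_lv _ _ t (fun l : R => l) (fun=> x) ltac:(mea) ltac:(mea)).
- have m := @mf_osc_inner_lv _ _ t (fun p : R * E => p.1) (fun p => p.2) ltac:(mea) ltac:(mea).
  by mea.
- by move=> l x; rewrite mule_ge0// lee_fin.
Qed.

(** At each fixed time the heat contents of the level sets add up exactly to that of [u]; letting
    the time tend to 0, Fatou's lemma gives the inequality of the coarea formula that is used. *)
Lemma coarea_VE (K : R) : (forall t, (0 < t)%R -> per t u <= (K * Num.sqrt t)%:E) ->
  \int[leb]_l VE (lv l) <= K%:E.
Proof.
move=> perK; apply: (@fatou_bound _ _ _ leb (fun j l => pseq (lv l) j)).
- move=> j; have m := @mf_per_lv _ _ (fun=> 4 ^- j)%R (fun l : R => l) ltac:(mea) ltac:(mea).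
  by rewrite /pseq; mea.
- by move=> j l; rewrite mule_ge0 ?per_ge0// lee_fin exprn_ge0.
- by move=> l; apply: pseq_cvg; apply: mf_bool; exact: mlv.
- move=> j; have m := @mf_per_lv _ _ (fun=> 4 ^- j)%R (fun l : R => l) ltac:(mea) ltac:(mea).
  rewrite /pseq (@intZl _ _ _ leb _ (fun l => per (4 ^- j) (lv l))) ?exprn_ge0//; last first.
    by move=> l; exact: per_ge0.
  have j0 : (0 < 4 ^- j :> R)%R by rewrite invr_gt0 exprn_gt0.
  rewrite coarea_per.
  apply: (le_trans (lee_wpmul2l _ (perK _ j0))); first by rewrite lee_fin exprn_ge0.
  rewrite -EFinM lee_fin.
  have -> : (Num.sqrt (4 ^- j) = 2 ^- j :> R)%R.
    have four : (4 = 2 ^+ 2 :> R)%R by rewrite -natrX.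
    have -> : (4 ^- j = (2 ^- j) ^+ 2 :> R)%R.
      by rewrite four exprVn -!exprM mulnC.
    by rewrite sqrtr_sqr ger0_norm// invr_ge0 exprn_ge0.
  by rewrite mulrCA divff ?mulr1// expf_neq0.
Qed.

(** * Summation over the levels *)

Section profile.
Variable a : R.
Hypothesis a01 : (0 < a < 1)%R.
Hypothesis n0 : (0 < n)%N.
Hypothesis volf : forall l, lvol l < +oo.
Variable K : R.
Hypothesis perK : forall t, (0 < t)%R -> per t u <= (K * Num.sqrt t)%:E.
Let b := ((1 - a) / 2)%R.

Definition profile (t : R) : \bar R := \int[leb]_l kap a t (lv l).

Lemma mf_kap_lv d (T : measurableType d) (f g : T -> R) :
  measurable_fun setT f -> measurable_fun setT g ->
  measurable_fun setT (fun p => kap a (f p) (lv (g p))).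
Proof.
move=> mf mg.
have m1 : measurable_fun setT (fun p : T * R => f p.1) by apply: (mf_comp mf); mea.
have m2 : measurable_fun setT (fun p : T * R => g p.1) by apply: (mf_comp mg); mea.
have m3 := @mf_per_lv _ _ (fun p : T * R => p.2) (fun p => g p.1) ltac:(mea) m2.
have m4 := mf_comp measurable_lvol m2.
apply: (measurable_int2 leb (fun (p : T) (s : R) => (pw (- b - 1) s)%:E *
  Order.min (per s (lv (g p))) (Order.min (`|f p|)%:E (2%:E * lvol (g p))))).
  by mea.
move=> t s; rewrite mule_ge0 ?lee_fin ?pw_ge0//.
by rewrite !le_min per_ge0/= lee_fin normr_ge0 mule_ge0// ?lvol_ge0// lee_fin.
Qed.

Lemma profile_ge0 t : 0 <= profile t.
Proof. by apply: int_ge0 => l; exact: kap_ge0. Qed.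

Lemma measurable_profile : measurable_fun setT profile.
Proof.
apply: (measurable_int2 leb (fun t l : R => kap a t (lv l))).
  exact: (@mf_kap_lv _ _ (fun p : R * R => p.1) (fun p => p.2) ltac:(mea) ltac:(mea)).
by move=> t l; exact: kap_ge0.
Qed.

Let mVE := measurable_VE_lv.

Lemma profile_weak t : (0 < t)%R -> profile t <= (@cweak R n a * t `^ (a / n%:R) * K)%:E.
Proof.
move=> t0; have c0 : (0 <= @cweak R n a * t `^ (a / n%:R))%R.
  by rewrite mulr_ge0 ?powR_ge0// ltW// cweak_gt0.
apply: (@le_trans _ _ (\int[leb]_l ((@cweak R n a * t `^ (a / n%:R))%:E * VE (lv l)))).
  apply: le_int.
  - exact: (@mf_kap_lv _ _ (fun=> t) (fun l : R => l) ltac:(mea) ltac:(mea)).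
  - by mea.
  - by move=> l; exact: kap_ge0.
  - by move=> l; apply: (kap_weak a01 n0 (mlv l) t0 (volf l)).
rewrite (@intZl _ _ _ leb _ (fun l => VE (lv l)))//; last by move=> l; exact: VE_ge0.
by rewrite [leRHS]EFinM; apply: lee_wpmul2l; [rewrite lee_fin|exact: coarea_VE].
Qed.

Lemma profile_strong : (1 < n)%N ->
  \int[leb]_t ((pw (- (a / n%:R) - 1) t)%:E * profile t) <= (@cstrong R n a * K)%:E.
Proof.
move=> n1; have c0 : (0 <= @cstrong R n a)%R.
  have n1' : (n%:R^-1 < 1 :> R)%R by rewrite invf_lt1 ?ltr0n// ltr1n.
  have [a0 a1] := andP a01.
  rewrite /cstrong; apply: mulr_ge0; first by rewrite ltW// cweak_gt0.
  rewrite addr_ge0 ?invr_ge0// ?divr_ge0 ?(ltW a0)// subr_ge0.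
  by rewrite -[leRHS]mulr1 ler_pM2l// ltW.
have mk2 := @mf_kap_lv _ _ (fun p : R * R => p.1) (fun p => p.2) ltac:(mea) ltac:(mea).
have mk t := @mf_kap_lv _ _ (fun=> t) (fun l : R => l) ltac:(mea) ltac:(mea).
under eq_integral => t _ do
  rewrite -(@intZl _ _ _ leb _ (fun l => kap a t (lv l)) (mk t)
     (fun l => kap_ge0 a (lset u l) t) (pw_ge0 _ _)).
rewrite (tonelli leb leb (fun t l : R => (pw (- (a / n%:R) - 1) t)%:E * kap a t (lv l))); last 2 first.
- by mea.
- by move=> t l; rewrite mule_ge0 ?kap_ge0// lee_fin pw_ge0.
apply: (@le_trans _ _ (\int[leb]_l ((@cstrong R n a)%:E * VE (lv l)))).
  apply: le_int.
  - apply: (measurable_int1 leb (fun t l : R => (pw (- (a / n%:R) - 1) t)%:E * kap a t (lv l))).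
      by mea.
    by move=> t l; rewrite mule_ge0 ?kap_ge0// lee_fin pw_ge0.
  - by mea.
  - by move=> l; apply: int_ge0 => t; rewrite mule_ge0 ?kap_ge0// lee_fin pw_ge0.
  - by move=> l; apply: (kap_strong a01 n0 (mlv l) n1 (volf l)).
rewrite (@intZl _ _ _ leb _ (fun l => VE (lv l)))//; last by move=> l; exact: VE_ge0.
by rewrite [leRHS]EFinM; apply: lee_wpmul2l; [rewrite lee_fin|exact: coarea_VE].
Qed.

(** Replacing the mass [S] by [t] in the minimum costs at most the factor [max 1 (S / t)], so the
    profile at one parameter [t] serves test functions of any mass. *)
Lemma osc_le_profile (psi : E -> R) (S t : R) : measurable_fun setT psi ->
  (forall x, 0 <= psi x <= 1)%R -> \int[mu]_x (psi x)%:E = S%:E -> (0 < t)%R ->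
  \int[leb]_s ((pw (- b - 1) s)%:E * osc s psi u) <= (Num.max 1 (S / t))%:E * profile t.
Proof.
move=> mpsi psi01 psiS t0.
have psi0 x : (0 <= psi x)%R by have /andP[] := psi01 x.
pose c := Num.max 1%R (S / t)%R.
have c1 : (1 <= c)%R by rewrite /c le_max lexx.
have cS : (S <= c * t)%R by rewrite -ler_pdivrMr// /c le_max lexx orbT.
have c0 : (0 <= c)%R by apply: le_trans c1.
have ml := measurable_lvol.
pose k s l := Order.min (per s (lv l)) (Order.min (`|t|)%:E (2%:E * lvol l)).
have k0 s l : 0 <= k s l.
  by rewrite /k !le_min per_ge0/= lee_fin normr_ge0 mule_ge0// ?lvol_ge0// lee_fin.
have mk2 : measurable_fun setT (fun p : R * R => k p.1 p.2).
  have m3 := @mf_per_lv _ _ (fun p : R * R => p.1) (fun p => p.2) ltac:(mea) ltac:(mea).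
  have m4 : measurable_fun setT (fun p : R * R => lvol p.2) by apply: (mf_comp ml); mea.
  by rewrite /k; mea.
have mk s : measurable_fun setT (k s).
  have m3 := @mf_per_lv _ _ (fun=> s) (fun l : R => l) ltac:(mea) ltac:(mea).
  by rewrite /k; mea.
have key s l : (0 < s)%R -> osc s psi (lv l) <= c%:E * k s l.
  move=> s0; have ml' : measurable_fun setT (lv l) by apply: mf_bool; exact: mlv.
  have o1 := osc_le_per ml' s mpsi psi01.
  have o2 := osc_le_mass (mlv l) s0 mpsi psi01 psiS.
  have o3 := osc_le_vol (mlv l) s0 mpsi psi01.
  have up (A : \bar R) : 0 <= A -> osc s psi (lv l) <= A -> osc s psi (lv l) <= c%:E * A.
    move=> A0 h; apply: (le_trans h); rewrite -[X in X <= _]mul1e.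
    by apply: lee_wpmul2r.
  rewrite /k; case: (leP (per s (lv l))) => _; first by apply: up; rewrite ?per_ge0.
  case: (leP (`|t|%:E)) => _; last first.
    by apply: up => //; rewrite mule_ge0 ?lvol_ge0// lee_fin.
  by apply: (le_trans o2); rewrite -EFinM lee_fin gtr0_norm.
have mosc (s : R) : measurable_fun setT (fun l => osc s psi (lv l)).
  apply: (measurable_int2 mu (fun (l : R) (x : E) => (psi x)%:E *
    \int[mu]_y (G s (y - x) * `|(lset u l y)%:R - (lset u l x)%:R|)%:E)).
    have m := @mf_osc_inner_lv _ _ s (fun p : R * E => p.1) (fun p => p.2) ltac:(mea) ltac:(mea).
    by mea.
  move=> l x; rewrite mule_ge0 ?lee_fin//.
  by apply: int_ge0 => y; rewrite lee_fin mulr_ge0 ?G_ge0.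
have mo := measurable_osc mpsi psi01 mu_.
have mK : measurable_fun setT (fun s => \int[leb]_l k s l) by exact: measurable_int2.
apply: (@le_trans _ _ (\int[leb]_s ((pw (- b - 1) s)%:E * (c%:E * \int[leb]_l k s l)))).
  apply: le_int; [by mea|by mea| |].
  - by move=> s; rewrite mule_ge0 ?lee_fin ?pw_ge0// osc_ge0.
  - move=> s; have [s0|s0] := ltP 0%R s; last by rewrite pw_neg// !mul0e.
    apply: lee_wpmul2l; first by rewrite lee_fin pw_ge0.
    rewrite -(coarea_osc s mpsi psi0) -(@intZl _ _ _ leb c (k s) (mk s) (k0 s) c0).
    apply: le_int; [exact: mosc|by apply: mf_mule; [mea|exact: mk]| |].
    + by move=> l; exact: osc_ge0.
    + by move=> l; exact: key.
under eq_integral => s _ do rewrite muleCA.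
rewrite intZl//; last 2 first.
- by mea.
- by move=> s; rewrite mule_ge0 ?lee_fin ?pw_ge0//; apply: int_ge0.
apply: lee_wpmul2l; first by rewrite lee_fin.
rewrite /profile /kap le_eqVlt; apply/orP; left; apply/eqP.
rewrite -(tonelli leb leb (fun s l : R => (pw (- b - 1) s)%:E * k s l)).
- apply: eq_integral => s _.
  by symmetry; apply: (@intZl _ _ _ leb _ (k s) (mk s) (k0 s) (pw_ge0 _ _)).
- by mea.
- by move=> s l; rewrite mule_ge0 ?lee_fin ?pw_ge0.
Qed.

End profile.
End levels.

(** * Distribution function *)

Section superlevel.
Local Open Scope ereal_scope.
Context {R : realType} {n : nat}.
Notation mu := (@lebn R n).
Notation leb := (@lebesgue_measure R).
Notation E := ('rV[R]_n).
Variables (p b : R) (f : E -> R) (N : R).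
Hypothesis p1 : (1 <= p)%R.
Hypothesis b01 : (0 < b < 1)%R.
Hypothesis bp : (b < n%:R / (2 * p))%R.
Hypothesis mf : measurable_fun setT f.
Hypothesis fN : \int[mu]_x (`|f x| `^ p)%:E = N%:E.
Variables (t P : R).
Hypothesis t0 : (0 < t)%R.
Hypothesis P0 : (0 <= P)%R.
Hypothesis oscP : forall (psi : E -> R) (S : R), measurable_fun setT psi ->
  (forall x, 0 <= psi x <= 1)%R -> \int[mu]_x (psi x)%:E = S%:E ->
  \int[leb]_s ((pw (- b - 1) s)%:E * osc s psi (sriesz b f)) <= (Num.max 1 (S / t) * P)%:E.
Let H := Hinv b.
Let H0 : (0 < H)%R. Proof. exact: Hinv_gt0. Qed.
Let b0 : (0 < b)%R. Proof. by have /andP[] := b01. Qed.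
Let Q := (b * P / H)%R.
Let Q0 : (0 <= Q)%R. Proof. by rewrite /Q divr_ge0 ?(ltW H0)// mulr_ge0// ltW. Qed.

Section at_height.
Variable c : R.
Hypothesis c0 : (0 < c)%R.
Hypothesis Qc : (Q < c * t)%R.
Let A : set E := [set x | (c < f x)%R].

Lemma measurable_superlevel : measurable A.
Proof.
have -> : A = setT `&` (fun x => c < f x)%R @^-1` [set true].
  by apply/seteqP; split => x //= -[].
have m : measurable_fun setT (fun x : E => c < f x)%R by mea.
exact: (m measurableT).
Qed.
Let mA := measurable_superlevel.
Let mI : measurable_fun setT (fun x : E => \1_A x : R). Proof. exact: mf_indic. Qed.
Let I01 x : (0 <= (\1_A x : R) <= 1)%R.
Proof. by rewrite indicE; case: (x \in A); rewrite ?ler01 ?lexx. Qed.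

Section cut.
Variable j : nat.
Let X : E -> R := cutoff j.
Let X01 x : (0 <= X x <= 1)%R. Proof. by have [] := cutoff_Sm01 (R := R) (n := n) j. Qed.
Let mX : measurable_fun setT X.
Proof. by have [/Sm_measurable] := cutoff_Sm01 (R := R) (n := n) j. Qed.
(** The summand 1 controls the mass of the approximating test function, the summand [|f|] its
    pairing with [f]; both are integrable on the support of the cut-off. *)
Let w x := (X x * (1 + `|f x|))%R.
Let mw : measurable_fun setT w. Proof. by rewrite /w; mea. Qed.
Let w0 x : (0 <= w x)%R.
Proof. by have /andP[? _] := X01 x; rewrite /w mulr_ge0// addr_ge0. Qed.

Let wfin : \int[mu]_x (w x)%:E < +oo.
Proof.
have X1 (z : E) : (`|X z| <= 1)%R by have /andP[? ?] := X01 z; rewrite ger0_norm.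
have Xf : \int[mu]_z (`|X z|)%:E < +oo.
  by apply: (@cube_support_fin _ _ X 1 j%:R) => // z k; exact: cutoff_support.
apply: (@le_lt_trans _ _ (\int[mu]_x (2%:E * (`|X x|)%:E + (`|f x| `^ p)%:E))).
  apply: le_int; [by mea|by mea|by move=> x; rewrite lee_fin|].
  move=> x; rewrite -EFinM -EFinD lee_fin /w.
  have /andP[h0 h1] := X01 x; rewrite (ger0_norm h0).
  have := young_power p1 (f x) (@ltr01 R); rewrite powR1 mul1r => h2.
  have h3 : (0 <= `|f x| `^ p)%R by exact: powR_ge0.
  move: (X x) (`|f x|)%R (`|f x| `^ p)%R h0 h1 h2 h3 => A1 A2 A3; nra.
rewrite intD; [|by mea|by mea|by move=> x; rewrite mule_ge0// lee_fin|by move=> x; rewrite lee_fin powR_ge0].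
rewrite (@intZl _ _ _ mu 2%R (fun x => (`|X x|)%:E)) ?fN//; last by mea.
by apply: lte_add_pinfty; [apply: lte_mul_pinfty|rewrite ltry].
Qed.

(** If the cut superlevel set had mass [M > t], a smooth test function close to it would have
    pairing at least about [c M] with [f], while inversion bounds this pairing by about [Q M / t].
    This contradicts [Q < c t]. *)
Lemma cut_superlevel : \int[mu]_x (X x * \1_A x)%:E <= t%:E.
Proof.
have X0 x : (0 <= X x)%R by have /andP[] := X01 x.
have I0 x : (0 <= (\1_A x : R))%R by have /andP[] := I01 x.
have XI0 x : 0 <= (X x * \1_A x)%:E by rewrite lee_fin mulr_ge0.
have mXI : measurable_fun setT (fun x => (X x * \1_A x)%:E) by mea.
have Mfin : \int[mu]_x (X x * \1_A x)%:E < +oo.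
  apply: le_lt_trans wfin; apply: le_int => //; first by mea.
  move=> x; rewrite lee_fin /w ler_wpM2l//; have /andP[_ h] := I01 x.
  by apply: (le_trans h); rewrite lerDl.
have : \int[mu]_x (X x * \1_A x)%:E \is a fin_num by rewrite ge0_fin_numE// int_ge0.
move=> /fineK; move: (fine _) => M EM; rewrite -EM lee_fin leNgt; apply/negP => tM.
have M0 : (0 < M)%R by exact: lt_trans tM.
have tQ : (0 < t + Q)%R by rewrite ltr_wpDr.
have cQ : (0 < c * t - Q)%R by rewrite subr_gt0.
(* The final inequality will read [(c t - Q) M <= e (t + Q)]; this choice makes the right side half
   of the left. *)
pose e := ((c * t - Q) * M / (2 * (t + Q)))%R.
have e0 : (0 < e)%R by rewrite divr_gt0 ?mulr_gt0.
have [g [Sg g01] ge] := smooth_approx w0 mw wfin mA e0.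
have mg := Sm_measurable Sg.
have g0 x : (0 <= g x)%R by have /andP[] := g01 x.
pose psi x := (X x * g x)%R.
have [Spsi psi01] : Sm01 psi by apply: Sm01_mul => //; exact: cutoff_Sm01.
have mpsi := Sm_measurable Spsi.
have [L L0 psiL] := Sm_lipschitz Spsi.
have psi0 x : (0 <= psi x)%R by have /andP[] := psi01 x.
pose D x := (`|\1_A x - g x| * w x)%R.
have D0 x : (0 <= D x)%R by rewrite mulr_ge0.
have mD : measurable_fun setT D by rewrite /D; mea.
have De : \int[mu]_x (D x)%:E <= e%:E by exact: ltW.
have s1 : \int[mu]_x (psi x)%:E <= (M + e)%:E.
  apply: (@le_trans _ _ (\int[mu]_x ((X x * \1_A x)%:E + (D x)%:E))).
    apply: le_int; [by mea|by mea|by move=> x; rewrite lee_fin|].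
    move=> x; rewrite -EFinD lee_fin /psi /D /w.
    have hx := X0 x; have hf := normr_ge0 (f x).
    have h := ler_norm (g x - \1_A x); rewrite distrC in h.
    have h2 := normr_ge0 (\1_A x - g x)%R.
    move: (X x) (\1_A x : R)%R (g x) (`|f x|)%R hx hf (`|_ - _|)%R h h2 => A1 A2 A3 A4 hx hf A5 h h2.
    have : (0 <= A1 * (A5 * A4))%R by rewrite !mulr_ge0.
    have : (0 <= A1 * (A5 - (A3 - A2)))%R by rewrite mulr_ge0// subr_ge0.
    by nra.
  rewrite intD//; last by mea.
  by rewrite -EM EFinD leeD2l.
have : \int[mu]_x (psi x)%:E \is a fin_num.
  by rewrite ge0_fin_numE ?int_ge0//; apply: le_lt_trans s1 _; rewrite ltry.
move=> /fineK/esym; move: (fine _) => S ES.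
have SM : (S <= M + e)%R by rewrite -lee_fin -ES.
pose fp x := (Num.max (f x) 0)%R; pose fm x := (Num.max (- f x) 0)%R.
have mfp : measurable_fun setT fp by rewrite /fp; mea.
have mfm : measurable_fun setT fm by rewrite /fm; mea.
have fp0 x : (0 <= fp x)%R by rewrite /fp le_max lexx orbT.
have fm0 x : (0 <= fm x)%R by rewrite /fm le_max lexx orbT.
have fpf x : (fp x <= `|f x|)%R by rewrite /fp ge_max ler_norm normr_ge0.
have fmf x : (fm x <= `|f x|)%R by rewrite /fm ge_max -(normrN (f x)) ler_norm normr_ge0.
have Ep := gpsiE p1 mf fN mpsi psi01 ES psiL L0 mfp fp0 fpf.
have Em := gpsiE p1 mf fN mpsi psi01 ES psiL L0 mfm fm0 fmf.
have := inversion_ineq p1 b01 bp mf fN mpsi psi01 ES psiL L0.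
rewrite -/fp -/fm => inv.
have := lee_wpmul2l _ (oscP mpsi psi01 ES).
move=> /(_ b%:E); rewrite lee_fin (ltW b0) => /(_ isT) ob.
have {ob}inv := le_trans inv (leeD2l _ ob).
move: inv; rewrite -EFinM -EFinD lee_fin -/H => inv.
(* On [A] one has [f > c] and the negative part vanishes; off [A] the test function itself is an
   error. Both discrepancies are absorbed by [D]. *)
have s2 : (c * M + gpsi psi fm <= gpsi psi fp + e)%R.
  rewrite -lee_fin !EFinD -Ep -Em EFinM EM.
  rewrite -(@intZl _ _ _ mu c (fun x => (X x * \1_A x)%:E) mXI XI0 (ltW c0)).
  rewrite -intD; [|by mea|by mea|by move=> x; rewrite mule_ge0// lee_fin ltW
    |by move=> x; rewrite lee_fin mulr_ge0].
  apply: (@le_trans _ _ (\int[mu]_x ((fp x * psi x)%:E + (D x)%:E))); last first.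
    rewrite intD; [|by mea|by mea|by move=> x; rewrite lee_fin mulr_ge0
      |by move=> x; rewrite lee_fin].
    by rewrite leeD2l.
  apply: le_int; [by mea|by mea| |].
    by move=> x; rewrite adde_ge0// ?mule_ge0// lee_fin ?mulr_ge0// ltW.
  move=> x; rewrite -EFinM -!EFinD lee_fin /psi /D /w.
  have hx := X0 x; have hg := g01 x.
  rewrite indicE; have [xA|xA] := boolP (x \in A).
    have cf : (c < f x)%R by move: xA; rewrite inE.
    have f0 : (0 < f x)%R by exact: lt_trans cf.
    have -> : fm x = 0%R by rewrite /fm max_r// oppr_le0 ltW.
    have -> : fp x = f x by rewrite /fp max_l// ltW.
    rewrite (gtr0_norm f0).
    rewrite mul0r addr0 mulr1.
    have g1 : (0 <= 1 - g x)%R by have := g01 x; lra.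
    rewrite (ger0_norm g1).
    have : (0 <= X x * (f x - c))%R by rewrite mulr_ge0// subr_ge0 ltW.
    have : (0 <= X x * (1 - g x))%R by rewrite mulr_ge0.
    by nra.
  rewrite sub0r normrN (ger0_norm (g0 x)) mulr0 mulr0 add0r.
  apply: (@le_trans _ _ (g x * (X x * `|f x|))%R).
    have -> : (fm x * (X x * g x) = g x * (X x * fm x))%R.
      by move: (fm x) (X x) (g x) => A1 A2 A3; ring.
    by rewrite ler_wpM2l// ler_wpM2l.
  by rewrite ler_wpDl ?mulr_ge0// ler_wpM2l// ler_wpM2l// lerDr ler01.
have Smax : (Num.max 1 (S / t) <= (M + e) / t)%R.
  rewrite ge_max; apply/andP; split; last by rewrite ler_wpM2r// invr_ge0 ltW.
  by rewrite ler_pdivlMr// mul1r ltW// (lt_le_trans tM)// lerDl ltW.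
have i1 : (H * (c * M - e) <= b * ((M + e) / t * P))%R.
  have h1 : (b * (Num.max 1 (S / t) * P) <= b * ((M + e) / t * P))%R.
    by rewrite ler_wpM2l ?(ltW b0)// ler_wpM2r.
  have h2 : (H * (c * M - e) <= H * (gpsi psi fp - gpsi psi fm))%R.
    by rewrite ler_wpM2l ?(ltW H0)// lerBrDr addrAC lerBlDr.
  by rewrite mulrBr in h2; lra.
have i2 : (t * (c * M - e) <= (M + e) * Q)%R.
  have h1 : (H^-1 * t * (H * (c * M - e)) <= H^-1 * t * (b * ((M + e) / t * P)))%R.
    by rewrite ler_wpM2l// mulr_ge0 ?invr_ge0 ?ltW.
  have e1 : (H^-1 * t * (H * (c * M - e)) = t * (c * M - e))%R.
    by move: (c * M - e)%R => B; field; rewrite gt_eqF.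
  have e2 : (H^-1 * t * (b * ((M + e) / t * P)) = (M + e) * Q)%R.
    by rewrite /Q; move: (M + e)%R => B; field; rewrite !gt_eqF.
  by rewrite -e1 -e2.
have i3 : ((c * t - Q) * M <= e * (t + Q))%R by lra.
have e4 : (e * (t + Q) = (c * t - Q) * M / 2)%R by rewrite /e; field; rewrite gt_eqF.
by have : (0 < (c * t - Q) * M)%R by [rewrite mulr_gt0]; lra.
Qed.

End cut.

Lemma superlevel_le : mu [set x | (c < f x)%R] <= t%:E.
Proof.
rewrite -/A -[A]setIT -integral_indic//.
apply: (@fatou_bound _ _ _ mu (fun j y => (cutoff j y * \1_A y)%:E)).
- move=> j; have [/Sm_measurable mX _] := cutoff_Sm01 (R := R) (n := n) j.
  by mea.
- move=> j x; have [_ /(_ x)/andP[? _]] := cutoff_Sm01 (R := R) (n := n) j.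
  by rewrite lee_fin mulr_ge0//; have /andP[] := I01 x.
- move=> y; apply: cvg_EFin; first by near=> k.
  rewrite -[X in _ --> X]mul1r; apply: cvgM; first exact: cutoff_cvg1.
  exact: cvg_cst.
- by move=> j; exact: cut_superlevel.
Unshelve. all: by end_near. Qed.

End at_height.
End superlevel.

Lemma oscN (R : realType) (n : nat) (t : R) (psi v : 'rV[R]_n -> R) :
  osc t psi (fun x => - v x) = osc t psi v.
Proof.
apply: eq_integral => x _; congr (_ * _)%E; apply: eq_integral => y _.
by rewrite -opprD normrN.
Qed.

(** * The distribution function of f *)

Section distribution.
Local Open Scope ereal_scope.
Context {R : realType} {n : nat}.
Notation mu := (@lebn R n).
Notation leb := (@lebesgue_measure R).
Notation E := ('rV[R]_n).
Variables (a p : R) (f : E -> R) (N V : R).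
Hypothesis a01 : (0 < a < 1)%R.
Hypothesis n0 : (0 < n)%N.
Let b := ((1 - a) / 2)%R.
Hypothesis p1 : (1 <= p)%R.
Hypothesis bp : (b < n%:R / (2 * p))%R.
Hypothesis mf : measurable_fun setT f.
Hypothesis fN : \int[mu]_x (`|f x| `^ p)%:E = N%:E.
Hypothesis fV : frac_var a f <= V%:E.
Hypothesis V0 : (0 <= V)%R.
Let u := sriesz b f.
Let mu_ : measurable_fun setT u. Proof. exact: measurable_sriesz. Qed.
Let b01 : (0 < b < 1)%R. Proof. by rewrite /b; have := a01; lra. Qed.
Let b0 : (0 < b)%R. Proof. by have /andP[] := b01. Qed.
Let K := (@cV R n a * V * (1 + cM n))%R.

Let perK t : (0 < t)%R -> per t u <= (K * Num.sqrt t)%:E.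
Proof.
move=> t0; have mtv := measurable_tv mu_.
have c0 : (0 <= @cV R n a * V)%R by rewrite mulr_ge0// ltW// cV_gt0.
apply: (@le_trans _ _ (\int[mu]_z ((@cV R n a * V)%:E * (nrm1 z * G t z)%:E))).
  apply: le_int; [by mea|by mea|by move=> z; rewrite mule_ge0// tv_ge0|].
  move=> z; have := L1_sriesz a01 p1 bp mf fN fV z; rewrite -/b -/u => h.
  apply: (le_trans (lee_wpmul2l _ h)); first by rewrite lee_fin G_ge0.
  rewrite -!EFinM lee_fin le_eqVlt; apply/orP; left; apply/eqP.
  by move: (G t z) (nrm1 z) (@cV R n a) => A B C; ring.
rewrite (@intZl _ _ _ mu _ (fun z => (nrm1 z * G t z)%:E))//; last 2 first.
- by mea.
- by move=> z; rewrite lee_fin mulr_ge0 ?G_ge0 ?nrm1_ge0.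
apply: (@le_trans _ _ ((@cV R n a * V)%:E * ((1 + cM n) * Num.sqrt t)%:E)).
  by apply: lee_wpmul2l; [rewrite lee_fin|exact: moment1].
by rewrite -EFinM lee_fin /K mulrA.
Qed.

Let absf (x : E) := (`|f x|)%:E.

Let level_fin (s : R) (P : E -> bool) : (0 < s)%R -> measurable_fun setT P ->
  (forall x, P x -> s%:E < riesz b absf x) -> \int[mu]_x ((P x)%:R : R)%:E < +oo.
Proof.
move=> s0 mP Ps; have mabs : measurable_fun setT absf by rewrite /absf; mea.
have abs0 x : 0 <= absf x by rewrite lee_fin.
have mr : measurable_fun setT (riesz b absf).
  exact: (@measurable_riesz _ _ b absf _ _ (fun x : E => x)).
have mB : measurable [set x | s%:E < riesz b absf x].
  by rewrite -[X in measurable X]setTI; apply: emeasurable_fun_o_infty.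
apply: le_lt_trans (riesz_level_fin p1 b0 bp mf fN s0); rewrite -/absf.
rewrite -[X in mu X]setIT -integral_indic//; apply: le_int; [by mea| | |].
- by apply: mf_EFin; exact: mf_indic.
- by move=> x; rewrite lee_fin.
- move=> x; rewrite lee_fin indicE; case Px : (P x) => //=.
  by rewrite mem_set//=; exact: Ps.
Qed.

Let level_incl (h : E -> R) (s : R) x : measurable_fun setT h ->
  (forall x, `|h x| = `|f x|)%R -> (0 < s)%R -> (s < fine (riesz b (pp h) x))%R ->
  s%:E < riesz b absf x.
Proof.
move=> mh hf s0 hs; have mabs : measurable_fun setT absf by rewrite /absf; mea.
have le : riesz b (pp h) x <= riesz b absf x.
  apply: le_riesz => //; [exact: measurable_pp|exact: pp_ge0|].
  by move=> y; rewrite /absf -hf; exact: pp_le.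
apply: lt_le_trans le; case: (riesz b (pp h) x) hs => [r| |] //=.
  by rewrite ltNge (ltW s0).
by rewrite ltNge (ltW s0).
Qed.

Let volf l : lvol u l < +oo.
Proof.
have mnf : measurable_fun setT (fun y => - f y)%R by mea.
have f0 (h : E -> R) x : (0 <= fine (riesz b (pp h) x :> \bar R))%R.
  by apply: fine_ge0; apply: riesz_ge0; exact: pp_ge0.
have [l0|l0|l0] := ltgtP 0%R l; rewrite /lvol /lset.
- rewrite l0; apply: (@level_fin l) => //; first by mea.
  move=> x lx; apply: (@level_incl f) => //; apply: (lt_le_trans lx).
  by rewrite /u /sriesz gerBl.
(* Sublevel sets are defined by a non-strict inequality; halving the level makes it strict. *)
- have l2 : (0 < - l / 2)%R by rewrite divr_gt0// oppr_gt0.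
  rewrite (lt_gtF l0) l0 /=; apply: (@level_fin (- l / 2)) => //; first by mea.
  move=> x lx; apply: (@level_incl (fun y => - f y)%R) => //.
    by move=> y; rewrite normrN.
  move: lx; rewrite /u /sriesz; have := f0 f x; lra.
- by rewrite -l0 ltxx integral0.
Qed.

Let prof := profile u a.
Let prof0 t : 0 <= prof t. Proof. exact: profile_ge0. Qed.
Let mprof : measurable_fun setT prof. Proof. exact: measurable_profile. Qed.
Let prof_le t : (0 < t)%R -> prof t <= (@cweak R n a * t `^ (a / n%:R) * K)%:E.
Proof. by move=> t0; apply: (profile_weak mu_ a01 n0 volf perK t0). Qed.
Let profE t : (0 < t)%R -> (fine (prof t))%:E = prof t.
Proof.
by move=> t0; rewrite fineK// ge0_fin_numE// (le_lt_trans (prof_le t0))// ltry.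
Qed.

(** The factor 2 counts [f > c] and [- f > c]. The potential of [- f] is [- u], whose oscillation is
    the same, so one profile serves both. *)
Let distr t c : (0 < t)%R -> (0 < c)%R -> (b * fine (prof t) / Hinv b < c * t)%R ->
  mu [set x | (c < `|f x|)%R] <= (2 * t)%:E.
Proof.
move=> t0 c0 h.
have oscP (psi : E -> R) (S : R) : measurable_fun setT psi ->
  (forall x, 0 <= psi x <= 1)%R -> \int[mu]_x (psi x)%:E = S%:E ->
  \int[leb]_s ((pw (- b - 1) s)%:E * osc s psi u) <= (Num.max 1 (S / t) * fine (prof t))%:E.
  move=> mpsi psi01 psiS; rewrite EFinM profE//.
  exact: (osc_le_profile mu_ a mpsi psi01 psiS t0).
have P0 : (0 <= fine (prof t))%R by exact: fine_ge0.
have A1 := superlevel_le p1 b01 bp mf fN t0 P0 oscP c0 h.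
have mnf : measurable_fun setT (fun x => - f x)%R by mea.
have fN' : \int[mu]_x (`|- f x| `^ p)%:E = N%:E.
  by rewrite -fN; apply: eq_integral => x _; rewrite normrN.
have uN x : sriesz b (fun x => - f x)%R x = (- u x)%R.
  have e : (fun y => - - f y)%R = f by apply/funext => y; rewrite opprK.
  transitivity (fine (riesz b (pp (fun y => - f y)%R) x) -
     fine (riesz b (pp (fun y => - - f y)%R) x))%R; first by [].
  by rewrite e /u /sriesz opprB.
have oscP' (psi : E -> R) (S : R) : measurable_fun setT psi ->
  (forall x, 0 <= psi x <= 1)%R -> \int[mu]_x (psi x)%:E = S%:E ->
  \int[leb]_s ((pw (- b - 1) s)%:E * osc s psi (sriesz b (fun x => - f x)%R))
     <= (Num.max 1 (S / t) * fine (prof t))%:E.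
  move=> mpsi psi01 psiS; apply: le_trans (oscP psi S mpsi psi01 psiS).
  rewrite le_eqVlt; apply/orP; left; apply/eqP; apply: eq_integral => s _.
  have -> : sriesz b (fun x => - f x)%R = (fun x => - u x)%R by apply/funext.
  by rewrite oscN.
have A2 := superlevel_le p1 b01 bp mnf fN' t0 P0 oscP' c0 h.
have m1 := measurable_superlevel mf c; have m2 := measurable_superlevel mnf c.
have -> : (2 * t)%:E = t%:E + t%:E by rewrite -EFinD mulrDl mul1r.
apply: le_trans (leeD A1 A2).
apply: le_trans (@measureU2 _ _ _ mu _ _ m1 m2).
apply: le_measure; rewrite ?inE//.
- have mn : measurable_fun setT (fun x => `|f x|)%R by mea.
  exact: (measurable_superlevel mn c).
- exact: measurableU.
- move=> x /=; have [fx|fx] := leP 0%R (f x).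
    by rewrite ger0_norm//; left.
  by rewrite ltr0_norm//; right.
Qed.

(** [b / Hinv b] comes from the inversion, [cV] from the variation of [u], and [1 + cM] from the
    first moment of the heat kernel; none of them depends on [p]. *)
Definition cprof : R := (b / Hinv b * @cV R n a * (1 + cM n))%R.

Lemma cprof_gt0 : (0 < cprof)%R.
Proof.
have c1 : (0 < 1 + cM n :> R)%R by rewrite ltr_wpDr ?cM_ge0.
have h := Hinv_gt0 b01; have v := @cV_gt0 R n a a01.
by rewrite /cprof; apply: mulr_gt0 => //; apply: mulr_gt0 => //; exact: divr_gt0.
Qed.

Lemma distribution_profile : exists Phi : R -> R, [/\ measurable_fun setT Phi,
  (forall t, 0 <= Phi t)%R,
  (forall t c, (0 < t)%R -> (Phi t < c)%R -> mu [set x | (c < `|f x|)%R] <= (2 * t)%:E),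
  (forall t, (0 < t)%R -> (Phi t <= cprof * @cweak R n a * V * t `^ (a / n%:R - 1))%R) &
  ((1 < n)%N -> \int[leb]_t (pw (- (a / n%:R)) t * Phi t)%:E <= (cprof * @cstrong R n a * V)%:E)].
Proof.
have H0 := Hinv_gt0 b01.
have bH : (0 <= b / Hinv b)%R by rewrite divr_ge0 ?ltW.
pose Phi t := (b / Hinv b * (fine (prof t) * pw (-1) t))%R.
have fp0 t : (0 <= fine (prof t))%R by exact: fine_ge0.
exists Phi; split.
- by rewrite /Phi; mea.
- by move=> t; rewrite /Phi mulr_ge0// mulr_ge0 ?pw_ge0.
- move=> t c t0 h; apply: distr => //.
    by apply: le_lt_trans h; rewrite /Phi mulr_ge0// mulr_ge0 ?pw_ge0.
  move: h; rewrite /Phi pwE// powR_inv1 ?(ltW t0)// mulrA ltr_pdivrMr//.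
  by rewrite mulrAC.
- move=> t t0; rewrite /Phi pwE//.
  have h : (fine (prof t) <= @cweak R n a * t `^ (a / n%:R) * K)%R.
    by rewrite -lee_fin profE// prof_le.
  apply: (@le_trans _ _ (b / Hinv b * (@cweak R n a * t `^ (a / n%:R) * K * t `^ (-1)))%R).
    by rewrite ler_wpM2l// ler_wpM2r// powR_ge0.
  rewrite powRD ?(gt_eqF t0) ?implybT// le_eqVlt; apply/orP; left; apply/eqP.
  rewrite /cprof /K.
  by move: (b / Hinv b)%R (@cweak R n a) (t `^ (a / n%:R))%R (t `^ (-1))%R (@cV R n a) (1 + cM n)%R
     => A B C D F J; ring.
- move=> n1; have S := profile_strong mu_ a01 n0 volf perK n1.
  apply: (@le_trans _ _ (\int[leb]_t ((b / Hinv b)%:E * ((pw (- (a / n%:R) - 1) t)%:E * prof t)))).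
    rewrite le_eqVlt; apply/orP; left; apply/eqP; apply: eq_integral => t _.
    have [t0|t0] := ltP 0%R t; last by rewrite !pw_neg// !(mul0r, mul0e, mule0).
    rewrite -profE// -!EFinM; congr EFin; rewrite /Phi pwD.
    by move: (b / Hinv b)%R (pw (- (a / n%:R)) t) (fine (prof t)) (pw (-1) t) => A B C D; ring.
  rewrite (@intZl _ _ _ leb _ (fun t => (pw (- (a / n%:R) - 1) t)%:E * prof t))//; last 2 first.
  - by mea.
  - by move=> t; rewrite mule_ge0// lee_fin pw_ge0.
  apply: (le_trans (lee_wpmul2l _ S)); first by rewrite lee_fin.
  rewrite -EFinM lee_fin le_eqVlt; apply/orP; left; apply/eqP.
  rewrite /cprof /K.
  by move: (b / Hinv b)%R (@cstrong R n a) (@cV R n a) (1 + cM n)%R => A B C D; ring.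
Qed.

End distribution.

(** * Layer cake comparison with the profile *)

Section layer_cake.
Local Open Scope ereal_scope.
Context {R : realType} {n : nat}.
Notation mu := (@lebn R n).
Notation leb := (@lebesgue_measure R).
Notation E := ('rV[R]_n).

Lemma integral_below (y : R) : (0 <= y)%R -> \int[leb]_s (((0 < s) && (s < y))%R%:R : R)%:E = y%:E.
Proof.
move=> y0; transitivity (\int[leb]_s (\1_(`]0%R, y[%classic) s : R)%:E).
  by apply: eq_integral => s _; rewrite indicE mem_setE in_itv/=.
rewrite integral_indic// setIT.
have := @lebesgue_measure_itv R `]0%R, y[; rewrite /= => ->.
rewrite lte_fin; case: ltP => h; first by rewrite sube0.
by have -> : y = 0%R by apply/eqP; rewrite eq_le h.
Qed.

Lemma integral_below_le (y : R) : (0 <= y)%R -> \int[leb]_s (((0 < s) && (s <= y))%R%:R : R)%:E = y%:E.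
Proof.
move=> y0; transitivity (\int[leb]_s (\1_(`]0%R, y]%classic) s : R)%:E).
  by apply: eq_integral => s _; rewrite indicE mem_setE in_itv/=.
rewrite integral_indic// setIT.
have := @lebesgue_measure_itv R `]0%R, y]; rewrite /= => ->.
rewrite lte_fin; case: ltP => h; first by rewrite sube0.
by have -> : y = 0%R by apply/eqP; rewrite eq_le h.
Qed.

Lemma mf_and d (T : measurableType d) (P Q : T -> bool) : measurable_fun setT P ->
  measurable_fun setT Q -> measurable_fun setT (fun x => P x && Q x).
Proof. by move=> mP mQ; exact: measurable_and. Qed.

Variables (g : E -> R) (Phi : R -> R).
Hypothesis mg : measurable_fun setT g.
Hypothesis g0 : forall x, (0 <= g x)%R.
Hypothesis mPhi : measurable_fun setT Phi.
Hypothesis Phi0 : forall t, (0 <= Phi t)%R.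
Hypothesis gPhi : forall t c, (0 < t)%R -> (Phi t < c)%R ->
  mu [set x | (c < g x)%R] <= (2 * t)%:E.

(** If [2 r] is at most the distribution function at [c], then [Phi s < c] is impossible for
    [0 < s < r], so the set where [Phi] is at least [c] has measure at least [r]. *)
Lemma distribution_le (c : R) : (0 < c)%R ->
  mu [set x | (c < g x)%R] <= 2%:E * \int[leb]_t (((0 < t) && (c <= Phi t))%R%:R : R)%:E.
Proof.
move=> c0.
set d := mu _; set I := \int[leb]_t _.
have I0 : 0 <= I by apply: int_ge0 => t; rewrite lee_fin.
have key (r : R) : (0 < r)%R -> (2 * r)%:E <= d -> r%:E <= I.
  move=> r0 rd; rewrite -(integral_below (ltW r0)); apply: le_int.
  - by apply: mf_EFin; apply: mf_bool; apply: mf_and; mea.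
  - by apply: mf_EFin; apply: mf_bool; apply: mf_and; mea.
  - by move=> s; rewrite lee_fin.
  - move=> s; rewrite lee_fin; case: ltP => //= s0; case: ltP => //= sr.
    have [h|h] := leP c (Phi s) => //=; exfalso.
    have := gPhi s0 h; rewrite leNgt => /negP; apply.
    by apply: lt_le_trans rd; rewrite lte_fin ltr_pM2l.
move: I I0 key => [i| |] I0 key //; last by rewrite gt0_muley ?leey// lte_fin.
move: I0; rewrite lee_fin => i0; rewrite -EFinM leNgt; apply/negP => id.
  have [r ir rd] : exists2 r : R, (i < r)%R & (2 * r)%:E <= d.
    move: id; case: (d) => [e| |]//.
    + rewrite lte_fin => ie; exists (e / 2)%R; first by lra.
      by rewrite lee_fin; lra.
    + by move=> _; exists (i + 1)%R; [lra|rewrite leey].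
  have r0 : (0 < r)%R by exact: le_lt_trans ir.
by have := key r r0 rd; rewrite lee_fin leNgt ir.
Qed.

Lemma layer_cake (q : R) : (0 < q)%R ->
  \int[mu]_x (g x `^ q)%:E <= 2%:E * \int[leb]_t ((0 < t)%R%:R * Phi t `^ q)%:E.
Proof.
move=> q0.
have pow (y c : R) : (0 < c)%R -> (0 <= y)%R -> ((c < y `^ q) = (c `^ q^-1 < y))%R.
  move=> c0 y0.
  have e : (y = (y `^ q) `^ q^-1)%R by rewrite -powRrM divff ?gt_eqF// powRr1.
  apply/idP/idP => h.
    rewrite e; apply: gt0_ltr_powR; rewrite ?nnegrE ?powR_ge0 ?invr_gt0 ?(ltW c0)//.
  have -> : c = ((c `^ q^-1) `^ q)%R by rewrite -powRrM mulVf ?gt_eqF// powRr1// ltW.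
  by apply: gt0_ltr_powR; rewrite ?nnegrE ?powR_ge0.
have powle (y c : R) : (0 < c)%R -> (0 <= y)%R -> ((c <= y `^ q) = (c `^ q^-1 <= y))%R.
  move=> c0 y0.
  have e : (y = (y `^ q) `^ q^-1)%R by rewrite -powRrM divff ?gt_eqF// powRr1.
  apply/idP/idP => h.
    rewrite e; apply: ge0_ler_powR; rewrite ?nnegrE ?powR_ge0 ?invr_ge0 ?(ltW c0) ?(ltW q0)//.
  have -> : c = ((c `^ q^-1) `^ q)%R by rewrite -powRrM mulVf ?gt_eqF// powRr1// ltW.
  by apply: ge0_ler_powR; rewrite ?nnegrE ?powR_ge0 ?(ltW q0).
have mg2 : measurable_fun setT (fun p : E * R => g p.1) by apply: (mf_comp mg); mea.
have mP2 : measurable_fun setT (fun p : R * R => Phi p.2) by apply: (mf_comp mPhi); mea.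
under eq_integral => x _ do rewrite -(integral_below (powR_ge0 (g x) q)).
have mF : measurable_fun setT (fun p : E * R => (((0 < p.2) && (p.2 < g p.1 `^ q))%R%:R : R)%:E).
  by apply: mf_EFin; apply: mf_bool; apply: mf_and; mea.
have mH : measurable_fun setT (fun p : R * R =>
    (((0 < p.1) && ((0 < p.2) && (p.1 <= Phi p.2 `^ q)))%R%:R : R)%:E).
  by apply: mf_EFin; apply: mf_bool; apply: mf_and; [mea|apply: mf_and; mea].
rewrite (tonelli mu leb (fun x s => (((0 < s) && (s < g x `^ q))%R%:R : R)%:E)) //.
have -> : \int[leb]_t ((0 < t)%R%:R * Phi t `^ q)%:E =
  \int[leb]_s \int[leb]_t (((0 < s) && ((0 < t) && (s <= Phi t `^ q)))%R%:R : R)%:E.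
  rewrite (tonelli leb leb (fun s t => (((0 < s) && ((0 < t) && (s <= Phi t `^ q)))%R%:R : R)%:E))//.
  apply: eq_integral => t _; case: ltP => t0 /=.
    by rewrite mul1r -(integral_below_le (powR_ge0 (Phi t) q)).
  rewrite mul0r (_ : (fun s => _) = cst 0) ?integral0//.
  by apply/funext => s /=; rewrite andbF.
have mI2 : measurable_fun setT (fun s : R => \int[leb]_t (((0 < s) && ((0 < t) && (s <= Phi t `^ q)))%R%:R : R)%:E).
  apply: (measurable_int2 leb (fun s t : R => (((0 < s) && ((0 < t) && (s <= Phi t `^ q)))%R%:R : R)%:E)) => // *; rewrite lee_fin.
rewrite -intZl//; last by move=> s; apply: int_ge0 => t; rewrite lee_fin.
apply: le_int.
- apply: (measurable_int1 mu (fun (x : E) (s : R) => (((0 < s) && (s < g x `^ q))%R%:R : R)%:E)) => // *; rewrite lee_fin.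
- by mea.
- by move=> s; apply: int_ge0 => t; rewrite lee_fin.
- move=> s; have [s0|s0] := ltP 0%R s; last first.
    by rewrite !(integral0, mule0) /= ?integral0 ?mule0.
  have c0 : (0 < s `^ q^-1)%R by rewrite powR_gt0.
  have := distribution_le c0.
  rewrite -[X in mu X]setIT -integral_indic//; last exact: measurable_superlevel.
  congr (_ <= _ * _).
    apply: eq_integral => x _; rewrite indicE pow//=; congr (_%:R%:E).
    case h : (s `^ q^-1 < g x)%R; first by rewrite mem_set.
    by rewrite memNset//= h.
  by apply: eq_integral => t _; rewrite powle.
Qed.

End layer_cake.

Lemma frac_var_ge0 (R : realType) (n : nat) (a : R) (f : 'rV[R]_n -> R) :
  (0 <= frac_var a f)%E.
Proof.
have rV0 : rV_int (fun _ : 'rV[R]_n => 0%:E) = 0%E :> \bar R.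
  by rewrite (@rV_int_ge0 R n (fun=> 0%:E)) ?integral0//; exact: measurable_cst.
apply: ereal_sup_ubound; exists (fun=> 0).
- have it l : iter_partial l (fun _ : 'rV[R]_n => 0 : 'rV[R]_n) = (fun=> 0).
    elim: l => [|i l ih] //=; rewrite ih; apply/funext => x; exact: derive_cst.
  split.
  + move=> l; rewrite it; split; first exact: cst_continuous.
    by move=> i x; exact: derivable_cst.
  + rewrite (_ : [set x | _] = set0) ?closure0; first exact: compact0.
    by rewrite predeqE => x /=; rewrite eqxx.
  + move=> x; rewrite /enorm /dotv big1 ?sqrtr0//.
    by move=> i _; rewrite !mxE mulr0.
- rewrite -[RHS]rV0; congr rV_int; apply/funext => x; congr EFin.
  rewrite /frac_div (_ : (fun y => _) = (fun=> 0%:E)) ?rV0 ?mulr0//.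
  apply/funext => y; congr EFin; rewrite /dotv big1 ?mul0r//.
  by move=> i _; rewrite !mxE subrr mulr0.
Qed.

(** The comparison goes through the supremum over simple functions; it is applied to the
    rearrangement, whose measurability is not established here. *)
Lemma ge0_le_int d (T : measurableType d) (R : realType) (m : {measure set T -> \bar R})
  (f g : T -> \bar R) : (forall x, 0 <= f x)%E -> (forall x, f x <= g x)%E ->
  (\int[m]_x f x <= \int[m]_x g x)%E.
Proof.
move=> f0 fg; have g0 x : (0 <= g x)%E by exact: le_trans (fg x).
rewrite !ge0_integralTE//; apply: ge_ereal_sup => _ [h hf <-].
by apply: ereal_sup_ubound; exists h => // x; exact: le_trans (hf x) (fg x).
Qed.

Lemma cstrong_gt0 (R : realType) (n : nat) (a : R) : 0 < a < 1 -> (1 < n)%N -> 0 < @cstrong R n a.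
Proof.
move=> a01 n1; have [a0 a1] := andP a01; have n0 : (0 < n)%N by exact: ltnW.
have n1' : (n%:R^-1 < 1 :> R) by rewrite invf_lt1 ?ltr0n// ltr1n.
rewrite /cstrong; apply: mulr_gt0; first exact: cweak_gt0.
rewrite addr_gt0 ?invr_gt0// ?divr_gt0 ?ltr0n// subr_gt0.
by rewrite -[ltRHS]mulr1 ltr_pM2l.
Qed.

(** * Lorentz and Lebesgue bounds from the profile *)

Section conclusion.
Local Open Scope ereal_scope.
Context {R : realType} {n : nat}.
Notation mu := (@lebn R n).
Notation leb := (@lebesgue_measure R).
Notation E := ('rV[R]_n).

Section profile_bounds.
Variables (a : R) (f : E -> R) (Phi : R -> R) (V : R) (C1 C2 : R).
Hypothesis a01 : (0 < a < 1)%R.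
Hypothesis n0 : (0 < n)%N.
Hypothesis mf : measurable_fun setT f.
Hypothesis mPhi : measurable_fun setT Phi.
Hypothesis Phi0 : forall t, (0 <= Phi t)%R.
Hypothesis distr : forall t c, (0 < t)%R -> (Phi t < c)%R ->
  mu [set x | (c < `|f x|)%R] <= (2 * t)%:E.
Hypothesis V0 : (0 <= V)%R.
Hypothesis C10 : (0 < C1)%R.
Hypothesis PhiV : forall t, (0 < t)%R -> (Phi t <= C1 * V * t `^ (a / n%:R - 1))%R.
Let s := (n%:R / (n%:R - a))%R.
Let k := (a / n%:R)%R.
Let nr : (1 <= n%:R :> R)%R. Proof. by rewrite ler1n. Qed.
Let a0 : (0 < a)%R. Proof. by have /andP[] := a01. Qed.
Let a1 : (a < 1)%R. Proof. by have /andP[] := a01. Qed.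
Let nr0 : (0 < n%:R :> R)%R. Proof. exact: lt_le_trans nr. Qed.
Let na0 : (0 < n%:R - a)%R. Proof. by have := nr; have := a1; lra. Qed.
Let sV : (s^-1 = 1 - k)%R.
Proof. by rewrite /s /k invf_div; field; rewrite gt_eqF. Qed.
Let k0 : (0 < k)%R. Proof. by rewrite divr_gt0. Qed.
Let k1 : (k < 1)%R. Proof. by rewrite ltr_pdivrMr// mul1r; have := nr; have := a1; lra. Qed.
Let mnf : measurable_fun setT (fun x => `|f x|)%R. Proof. by mea. Qed.

Lemma rearrangement_le t : (0 < t)%R -> rearrangement f t <= (Phi (t / 2))%:E.
Proof.
move=> t0; apply/lee_addgt0Pr => e e0; rewrite -EFinD.
apply: ereal_inf_lbound; exists (Phi (t / 2) + e)%R => //; split.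
  by rewrite addr_ge0// ltW.
rewrite /distrib_fun leb_nE; last exact: (measurable_superlevel mnf).
have t20 : (0 < t / 2)%R by rewrite divr_gt0.
apply: le_trans (distr t20 _) _; first by rewrite ltrDl.
by rewrite mulrC divfK.
Qed.

Lemma rearrangement_ge0 t : 0 <= rearrangement f t.
Proof. by apply: le_ereal_inf_tmp => _ [l [l0 _] <-]; rewrite lee_fin. Qed.

Lemma lorentz_weak : lorentz_norm s +oo f <= (C1 * 2^-1 `^ (k - 1) * V)%:E.
Proof.
apply: ge_ereal_sup => _ [t /= t0 <-].
apply: (le_trans (lee_wpmul2l _ (rearrangement_le t0))); first by rewrite lee_fin powR_ge0.
rewrite -EFinM lee_fin sV.
have t20 : (0 < t / 2)%R by rewrite divr_gt0.
apply: (le_trans (ler_wpM2l (powR_ge0 _ _) (PhiV t20))); rewrite -/k.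
rewrite (powRM _ (ltW t0))//.
have tt : (t `^ (1 - k) * t `^ (k - 1) = 1)%R.
  by rewrite -powRD ?(gt_eqF t0) ?implybT// (_ : (1 - k + (k - 1) = 0)%R) ?powRr0//; ring.
rewrite le_eqVlt; apply/orP; left; apply/eqP.
have -> : (t `^ (1 - k) * (C1 * V * (t `^ (k - 1) * 2^-1 `^ (k - 1))) =
    (t `^ (1 - k) * t `^ (k - 1)) * (C1 * 2^-1 `^ (k - 1) * V))%R.
  by move: (t `^ (1 - k))%R (t `^ (k - 1))%R (2^-1 `^ (k - 1))%R => A B C; ring.
by rewrite tt mul1r.
Qed.

Hypothesis C20 : (0 < C2)%R.
Hypothesis PhiI : \int[leb]_t (pw (- k) t * Phi t)%:E <= (C2 * V)%:E.

Lemma lorentz_strong : lorentz_norm s 1%:E f <= (2 * 2 `^ (- k) * C2 * V)%:E.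
Proof.
rewrite /lorentz_norm invr1 poweRe1; last first.
  apply: integral_ge0 => t /= t0; rewrite mule_ge0 ?poweR_ge0// lee_fin invr_ge0 ltW//.
rewrite integral_mkcond.
pose F t := (pw (- k) t * Phi (t / 2))%:E.
have mF : measurable_fun setT F.
  have m2 : measurable_fun setT (fun t : R => Phi (t / 2)) by apply: (mf_comp mPhi); mea.
  by rewrite /F; mea.
have F0 t : 0 <= F t by rewrite lee_fin mulr_ge0 ?pw_ge0.
apply: (@le_trans _ _ (\int[leb]_t F t)).
  apply: ge0_le_int => t; rewrite patchE; case: ifPn => //.
    rewrite inE/= => t0; rewrite mule_ge0 ?poweR_ge0// lee_fin invr_ge0 ltW//.
  rewrite inE/= => t0; rewrite poweRe1; last by rewrite mule_ge0 ?rearrangement_ge0// lee_fin powR_ge0.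
  rewrite muleAC -EFinM.
  have -> : (t `^ s^-1 * t^-1 = pw (- k) t)%R.
    rewrite pwE// sV -powR_inv1 ?(ltW t0)// -powRD ?(gt_eqF t0) ?implybT//.
    by congr powR; ring.
  rewrite /F EFinM; apply: lee_wpmul2l; first by rewrite lee_fin pw_ge0.
  exact: rearrangement_le.
have two : (0 < 2 :> R)%R by [].
rewrite (@ge0_integral_affine R 2 0 two F mF F0).
have -> : \int[leb]_x F (2 * x + 0)%R = (2 `^ (- k))%:E * \int[leb]_x (pw (- k) x * Phi x)%:E.
  rewrite -intZl ?powR_ge0//; [|by mea|by move=> x; rewrite lee_fin mulr_ge0 ?pw_ge0].
  apply: eq_integral => x _; rewrite /F addr0 pwM// -EFinM; congr EFin.
  by rewrite mulrA (mulrC 2%R) mulfK.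
rewrite muleA -EFinM.
apply: (le_trans (lee_wpmul2l _ PhiI)); first by rewrite lee_fin mulr_ge0 ?powR_ge0.
by rewrite -EFinM lee_fin !mulrA.
Qed.

(** In [Phi ^ s = Phi ^ (s - 1) * Phi] the pointwise bound turns the first factor into a multiple of
    [t ^ (-a/n)], since [(a/n - 1) (s - 1) = -a/n]; the weighted integral of [Phi] then finishes. *)
Lemma critical_power : (1 < n)%N ->
  \int[mu]_x (`|f x| `^ s)%:E <= (2 * (C1 * V) `^ (s - 1) * C2 * V)%:E.
Proof.
move=> n1; have s0 : (0 < s)%R by rewrite divr_gt0.
have s1 : (0 < s - 1)%R by rewrite subr_gt0 ltr_pdivlMr// mul1r gtrBl.
have CV : (0 <= C1 * V)%R by rewrite mulr_ge0// ltW.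
apply: (le_trans (layer_cake mnf (fun=> normr_ge0 _) mPhi Phi0 distr s0)).
have -> : (2 * (C1 * V) `^ (s - 1) * C2 * V)%:E =
    2%:E * (((C1 * V) `^ (s - 1))%:E * (C2 * V)%:E).
  by rewrite -!EFinM !mulrA.
apply: lee_wpmul2l; first by rewrite lee_fin.
apply: (@le_trans _ _ (((C1 * V) `^ (s - 1))%:E * \int[leb]_t (pw (- k) t * Phi t)%:E)); last first.
  by apply: lee_wpmul2l; [rewrite lee_fin powR_ge0|exact: PhiI].
rewrite -intZl ?powR_ge0//; [|by mea|by move=> x; rewrite lee_fin mulr_ge0 ?pw_ge0].
apply: le_int; [by mea|by mea|by move=> t; rewrite lee_fin mulr_ge0 ?powR_ge0|].
move=> t; rewrite -EFinM lee_fin; have [t0|t0] := ltP 0%R t; last first.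
  by rewrite mul0r pw_neg// mul0r mulr0.
rewrite mul1r pwE//.
have -> : (Phi t `^ s = Phi t `^ (s - 1) * Phi t)%R.
  have [->|P0] := eqVneq (Phi t) 0%R; first by rewrite mulr0 powR0// gt_eqF.
  rewrite -[X in (_ = _ * X)%R](powRr1 (Phi0 t)) -powRD; first by rewrite subrK.
  by rewrite P0 implybT.
rewrite mulrA; apply: ler_wpM2r => //.
have h : (Phi t `^ (s - 1) <= (C1 * V * t `^ (k - 1)) `^ (s - 1))%R.
  apply: ge0_ler_powR; rewrite ?nnegrE ?(ltW s1)//; last exact: PhiV.
  by rewrite mulr_ge0 ?powR_ge0.
apply: (le_trans h); rewrite powRM ?powR_ge0// -powRrM.
rewrite (_ : ((k - 1) * (s - 1) = - k)%R)// /k /s.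
by field; rewrite !gt_eqF.
Qed.

Variables (p N q : R).
Hypothesis p1 : (1 <= p)%R.
Hypothesis fN : \int[mu]_x (`|f x| `^ p)%:E = N%:E.
Hypothesis pq : (p <= q)%R.
Hypothesis qs : (q < s)%R.
Let kap_ := (1 + (k - 1) * q)%R.
Let kap0 : (0 < kap_)%R.
Proof.
have : (q * (1 - k) < 1)%R by rewrite -sV ltr_pdivrMr ?invr_gt0 ?divr_gt0// mul1r.
by rewrite /kap_; lra.
Qed.

(** [f] is cut at height [A], which bounds both its L^p norm and its variation. Below [A], [|f| ^ q]
    is at most [A ^ (q - p) |f| ^ p]. Above [A], Chebyshev's inequality leaves a set of measure at
    most 1, so only small [t] matter, where [t ^ ((k - 1) q)] is integrable because [q < s]. *)
Lemma subcritical_power (A : R) : (0 < A)%R -> (N <= A `^ p)%R -> (V <= A)%R ->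
  \int[mu]_x (`|f x| `^ q)%:E <= (A `^ q * (1 + 2 * (C1 `^ q * (2^-1 `^ kap_ / kap_))))%:E.
Proof.
move=> A0 NA VA.
have p0 : (0 < p)%R by exact: lt_le_trans p1.
have q0 : (0 < q)%R by exact: lt_le_trans pq.
have CV : (0 <= C1 * V)%R by rewrite mulr_ge0// ltW.
pose g x := (if A < `|f x| then `|f x| else 0)%R.
have mg : measurable_fun setT g by rewrite /g; mea.
have g0 x : (0 <= g x)%R by rewrite /g; case: ifP.
(* The distribution bound is by [2 t], so a set of measure at most 1 satisfies it for free once [t]
   is at least [1/2]. *)
pose P t := (if t < 2^-1 then C1 * V * t `^ (k - 1) else 0)%R.
have mP : measurable_fun setT P by rewrite /P; mea.
have P0 t : (0 <= P t)%R by rewrite /P; case: ifP => // _; rewrite mulr_ge0 ?powR_ge0.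
have chebyshev : mu [set x | (A < `|f x|)%R] <= 1.
  have mA := measurable_superlevel mnf A.
  rewrite -[X in mu X]setIT -integral_indic//.
  apply: (@le_trans _ _ (\int[mu]_x ((A `^ (- p))%:E * (`|f x| `^ p)%:E))).
    apply: le_int; [|by mea|by move=> x; rewrite lee_fin|].
      by apply: mf_EFin; exact: mf_indic.
    move=> x; rewrite -EFinM lee_fin indicE; case: (boolP (x \in _)) => [|_] /=; last first.
      by rewrite mulr_ge0 ?powR_ge0.
    rewrite inE/= => Ax.
    rewrite -[leLHS](powRr0 A) -(addNr p) powRD ?(gt_eqF A0) ?implybT//.
    rewrite ler_wpM2l ?powR_ge0//.
    by apply: ge0_ler_powR; rewrite ?nnegrE ?(ltW A0) ?(ltW p0) ?(ltW Ax).
  rewrite (@intZl _ _ _ mu _ (fun x => (`|f x| `^ p)%:E)) ?powR_ge0//; last by mea.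
  rewrite fN -EFinM lee_fin powRN mulrC ler_pdivrMr ?powR_gt0// mul1r//.
have gP t c : (0 < t)%R -> (P t < c)%R -> mu [set x | (c < g x)%R] <= (2 * t)%:E.
  move=> t0 Pc; have c0 : (0 < c)%R by exact: le_lt_trans Pc.
  have mgc := measurable_superlevel mg c.
  have [t2|t2] := ltP t 2^-1%R.
    have Pc' : (Phi t < c)%R.
      by apply: le_lt_trans Pc; rewrite /P t2; exact: PhiV.
    apply: le_trans (distr t0 Pc').
    apply: le_measure; rewrite ?inE//; first exact: (measurable_superlevel mnf c).
    by move=> x /=; rewrite /g; case: ifP => // _; rewrite ltNge (ltW c0).
  apply: (@le_trans _ _ 1); last by rewrite lee_fin; move: t2; lra.
  apply: le_trans chebyshev.
  apply: le_measure; rewrite ?inE//; first exact: (measurable_superlevel mnf A).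
  by move=> x /=; rewrite /g; case: ifP => // _; rewrite ltNge (ltW c0).
have I1 : \int[mu]_x (g x `^ q)%:E <= (2 * ((C1 * V) `^ q * (2^-1 `^ kap_ / kap_)))%:E.
  apply: (le_trans (layer_cake mg g0 mP P0 gP q0)); rewrite [leRHS]EFinM.
  apply: lee_wpmul2l; first by rewrite lee_fin.
  rewrite [leRHS]EFinM -integral_pw_near//.
  rewrite -intZl ?powR_ge0//; [|by mea|by move=> x; rewrite lee_fin mulr_ge0 ?pw_ge0].
  apply: le_int; [by mea|by mea|by move=> t; rewrite lee_fin mulr_ge0 ?powR_ge0|].
  move=> t; rewrite -EFinM lee_fin; have [t0|t0] := ltP 0%R t; last first.
    by rewrite mul0r pw_neg// mul0r mulr0.
  rewrite mul1r pwE// /P; case: ifP => t2 /=; last by rewrite mulr0 mulr0 powR0// gt_eqF.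
  rewrite mulr1 powRM ?powR_ge0// -powRrM.
  by rewrite (_ : (kap_ - 1 = (k - 1) * q)%R)// /kap_; ring.
apply: (@le_trans _ _ (\int[mu]_x ((A `^ (q - p))%:E * (`|f x| `^ p)%:E + (g x `^ q)%:E))).
  apply: le_int; [by mea|by mea|by move=> x; rewrite lee_fin powR_ge0|].
  move=> x; rewrite -EFinM -EFinD lee_fin /g; case: ltP => Af.
    by rewrite lerDr mulr_ge0 ?powR_ge0.
  rewrite powR0 ?gt_eqF// addr0.
  have [f0|f0] := eqVneq (`|f x|)%R 0%R.
    by rewrite f0 !powR0 ?gt_eqF// mulr0.
  have -> : (`|f x| `^ q = `|f x| `^ (q - p) * `|f x| `^ p)%R.
    by rewrite -powRD ?subrK// f0 implybT.
  rewrite ler_wpM2r ?powR_ge0//.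
  by apply: ge0_ler_powR; rewrite ?nnegrE ?(ltW A0)// subr_ge0.
rewrite intD; [|by mea|by mea|by move=> x; rewrite mule_ge0// lee_fin powR_ge0
  |by move=> x; rewrite lee_fin powR_ge0].
rewrite (@intZl _ _ _ mu _ (fun x => (`|f x| `^ p)%:E)) ?powR_ge0//; last by mea.
rewrite fN mulrDr mulr1 EFinD; apply: leeD.
  rewrite -EFinM lee_fin.
  have -> : (A `^ q = A `^ (q - p) * A `^ p)%R.
    by rewrite -powRD ?subrK// (gt_eqF A0) implybT.
  by rewrite ler_wpM2l ?powR_ge0.
apply: (le_trans I1); rewrite lee_fin.
have VAq : ((C1 * V) `^ q <= C1 `^ q * A `^ q)%R.
  rewrite powRM ?(ltW C10)// ler_wpM2l ?powR_ge0//.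
  by apply: ge0_ler_powR; rewrite ?nnegrE ?(ltW A0) ?(ltW q0).
have d0 : (0 <= 2^-1 `^ kap_ / kap_)%R by rewrite divr_ge0 ?powR_ge0 ?ltW.
apply: (@le_trans _ _ (2 * (C1 `^ q * A `^ q * (2^-1 `^ kap_ / kap_)))%R).
  by rewrite ler_wpM2l// ler_wpM2r.
rewrite le_eqVlt; apply/orP; left; apply/eqP.
by move: (C1 `^ q)%R (A `^ q)%R (2^-1 `^ kap_ / kap_)%R => A1 A2 A3; ring.
Qed.

End profile_bounds.

Lemma Lp_norm_le (f : E -> R) (q B : R) : measurable_fun setT f -> (0 < q)%R -> (0 <= B)%R ->
  \int[mu]_x (`|f x| `^ q)%:E <= (B `^ q)%:E -> Lp_mem q f /\ Lp_norm q f <= B%:E.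
Proof.
move=> mf q0 B0 h.
have e : rV_int (fun x => (`|f x| `^ q)%:E) = \int[mu]_x (`|f x| `^ q)%:E.
  by rewrite rV_int_ge0//; mea.
have I0 : 0 <= \int[mu]_x (`|f x| `^ q)%:E by apply: int_ge0 => x; rewrite lee_fin powR_ge0.
split.
  split; first exact/measurable_rV_fun.
  by rewrite e (le_lt_trans h)// ltry.
rewrite /Lp_norm e.
case: (\int[mu]_x _) h I0 => [r| |] //; rewrite !lee_fin => h r0.
have -> : B = ((B `^ q) `^ q^-1)%R by rewrite -powRrM divff ?gt_eqF// powRr1.
by apply: ge0_ler_powR; rewrite ?nnegrE ?powR_ge0 ?invr_ge0 ?(ltW q0).
Qed.

Lemma BV_profile (a p : R) (f : E -> R) : (0 < n)%N -> (0 < a < 1)%R ->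
  (1 <= p < n%:R / (n%:R - a))%R -> BV_mem a p f ->
  exists (N V : R) (Phi : R -> R), [/\ [/\ measurable_fun setT f,
    \int[mu]_x (`|f x| `^ p)%:E = N%:E, frac_var a f = V%:E & (0 <= V)%R],
  measurable_fun setT Phi, (forall t, 0 <= Phi t)%R,
  (forall t c, (0 < t)%R -> (Phi t < c)%R -> mu [set x | (c < `|f x|)%R] <= (2 * t)%:E) &
  (forall t, (0 < t)%R -> (Phi t <= @cprof R n a * @cweak R n a * V * t `^ (a / n%:R - 1))%R) /\
  ((1 < n)%N -> \int[leb]_t (pw (- (a / n%:R)) t * Phi t)%:E <= (@cprof R n a * @cstrong R n a * V)%:E)].
Proof.
move=> n0 a01 /andP[p1 ps] [[/measurable_rV_fun mf fp] fV].
have nr : (1 <= n%:R :> R)%R by rewrite ler1n.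
have [a0 a1] := andP a01; have na0 : (0 < n%:R - a)%R by lra.
have p0 : (0 < p)%R by exact: lt_le_trans p1.
(* Since [n] is at least 1, [p (1 - a) <= p (n - a) < n]: every admissible [p] lies in the range
   where the potential converges. *)
have bp : ((1 - a) / 2 < n%:R / (2 * p))%R.
  move: ps; rewrite ltr_pdivlMr// => ps.
  rewrite ltr_pdivrMr// -mulrA (_ : ((2 * p)^-1 * 2 = p^-1)%R); last by field; rewrite gt_eqF.
  rewrite ltr_pdivlMr//; apply: le_lt_trans ps; rewrite mulrC ler_wpM2l ?(ltW p0)//; lra.
move: fp; rewrite rV_int_ge0; [|by mea|by move=> x; rewrite lee_fin powR_ge0] => fp.
have fpE : \int[mu]_x (`|f x| `^ p)%:E = (fine (\int[mu]_x (`|f x| `^ p)%:E))%:E.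
  by rewrite fineK// ge0_fin_numE// int_ge0// => x; rewrite lee_fin powR_ge0.
have v0 := frac_var_ge0 a f.
have fVE : frac_var a f = (fine (frac_var a f))%:E by rewrite fineK// ge0_fin_numE.
have V0 : (0 <= fine (frac_var a f))%R by exact: fine_ge0.
have fVle : frac_var a f <= (fine (frac_var a f))%:E by rewrite -fVE.
have [Phi [h1 h2 h3 h4 h5]] := distribution_profile a01 n0 p1 bp mf fpE fVle V0.
by exists (fine (\int[mu]_x (`|f x| `^ p)%:E)), (fine (frac_var a f)), Phi; split.
Qed.

End conclusion.

Theorem theorem3p5 (R : realType) (n : nat) (a : R) :
  (0 < n)%N -> 0 < a < 1 ->
  (exists c : R, 0 < c /\
     forall (p : R) (f : 'rV[R]_n -> R),
       1 <= p < n%:R / (n%:R - a) -> BV_mem a p f ->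
       (lorentz_norm (n%:R / (n%:R - a)) (if n == 1%N then +oo%E else 1%:E) f
          <= c%:E * frac_var a f)%E)
  /\
  (forall p q : R,
     1 <= p < n%:R / (n%:R - a) ->
     (p <= q < n%:R / (n%:R - a) \/ ((2 <= n)%N /\ q = n%:R / (n%:R - a))) ->
     exists C : R, 0 < C /\
       forall f : 'rV[R]_n -> R, BV_mem a p f ->
         Lp_mem q f /\ (Lp_norm q f <= C%:E * (Lp_norm p f + frac_var a f))%E).
Proof.
move=> n0 a01.
have [a0 a1] := andP a01.
have nr : 1 <= n%:R :> R by rewrite ler1n.
have na0 : 0 < n%:R - a by lra.
set s := n%:R / (n%:R - a).
have s0 : 0 < s by rewrite divr_gt0// (lt_le_trans _ nr).
have s1 : 1 < s by rewrite ltr_pdivlMr// mul1r gtrBl.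
pose k := a / n%:R.
pose C1 := @cprof R n a * @cweak R n a.
have C10 : 0 < C1 by rewrite mulr_gt0 ?cprof_gt0 ?cweak_gt0.
pose C2 := @cprof R n a * @cstrong R n a.
have C20 : (1 < n)%N -> 0 < C2.
  by move=> n1; rewrite mulr_gt0 ?cprof_gt0 ?cstrong_gt0.
split.
- case n1 : (n == 1%N).
    exists (C1 * 2^-1 `^ (k - 1)); split; first by rewrite mulr_gt0 ?powR_gt0 ?invr_gt0.
    move=> p f ps bv.
    have [N [V [Phi [[mf fN -> V0] mPhi P0 d [Pw _]]]]] := BV_profile n0 a01 ps bv.
    by rewrite -EFinM; exact: (lorentz_weak n0 mf P0 d Pw).
  have n2 : (1 < n)%N by rewrite ltn_neqAle eq_sym n1.
  exists (2 * 2 `^ (- k) * C2); split.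
    by rewrite mulr_gt0 ?C20// mulr_gt0 ?powR_gt0.
  move=> p f ps bv.
  have [N [V [Phi [[mf fN -> V0] mPhi P0 d [_ Ps]]]]] := BV_profile n0 a01 ps bv.
  by rewrite -EFinM; exact: (lorentz_strong n0 mf mPhi P0 d (Ps n2)).
- move=> p q ps qs; have [p1 p2] := andP ps.
  have p0 : 0 < p by exact: lt_le_trans p1.
  have NpE (f : 'rV[R]_n -> R) (N : R) : measurable_fun setT f ->
      (\int[lebn n]_x (`|f x| `^ p)%:E = N%:E)%E -> Lp_norm p f = (N `^ p^-1)%:E.
    by move=> mf fN; rewrite /Lp_norm rV_int_ge0 ?fN//; mea.
  have root (D r : R) : 0 <= D -> 0 < r -> (D `^ r^-1) `^ r = D.
    by move=> D0 r0; rewrite -powRrM mulVf ?gt_eqF// powRr1.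
  case: qs => [/andP[pq qs]|[n2 qs]].
    have q0 : 0 < q by exact: lt_le_trans pq.
    pose kp := 1 + (k - 1) * q.
    pose D := 1 + 2 * (C1 `^ q * (2^-1 `^ kp / kp)).
    have kp0 : 0 < kp.
      have : q / s < 1 by rewrite ltr_pdivrMr// mul1r.
      have -> : s^-1 = 1 - k.
        by rewrite /s /k invf_div; field; rewrite gt_eqF// (lt_le_trans _ nr).
      by rewrite /kp; lra.
    have D0 : 0 < D.
      by rewrite ltr_wpDr// mulr_ge0// mulr_ge0 ?powR_ge0// divr_ge0 ?powR_ge0// ltW.
    pose C := D `^ q^-1.
    have C0 : 0 < C by rewrite powR_gt0.
    exists C; split => // f bv.
    have [N [V [Phi [[mf fN -> V0] mPhi P0 d [Pw _]]]]] := BV_profile n0 a01 ps bv.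
    rewrite (NpE _ _ mf fN).
    have N0 : 0 <= N by rewrite -lee_fin -fN int_ge0// => x; rewrite lee_fin powR_ge0.
    (* Both norms may vanish, while the cut-off height must be positive; [dl] is added to their sum
       and sent to 0 afterwards. *)
    have key dl : 0 < dl -> Lp_mem q f /\
        (Lp_norm q f <= (C * (N `^ p^-1 + V + dl))%:E)%E.
      move=> dl0; set A := _ + dl.
      have Np0 : 0 <= N `^ p^-1 by exact: powR_ge0.
      have A0 : 0 < A by rewrite /A ltr_wpDl// addr_ge0.
      have NA : N <= A `^ p.
        rewrite -[leLHS](root N p)//; apply: ge0_ler_powR; rewrite ?nnegrE ?(ltW p0) ?(ltW A0)//.
        by rewrite /A -addrA lerDl addr_ge0// ltW.
      have VA : V <= A by rewrite /A; lra.
      apply: Lp_norm_le => //; first by rewrite mulr_ge0 ?ltW.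
      rewrite powRM ?(ltW C0) ?(ltW A0)// root ?(ltW D0)// mulrC.
      exact: (subcritical_power a01 n0 mf d V0 C10 Pw p1 fN pq qs A0 NA VA).
    split; first by have [] := key 1 ltr01.
    apply/lee_addgt0Pr => e e0.
    have eC : 0 < e / C by rewrite divr_gt0.
    have [_ h] := key _ eC; apply: (le_trans h).
    have -> : (C%:E * ((N `^ p^-1)%:E + V%:E) + e%:E = (C * (N `^ p^-1 + V) + e)%:E)%E by [].
    by rewrite lee_fin mulrDr (mulrC C (e / C)) divfK// gt_eqF.
  have q1 : 0 < q - 1 by rewrite qs subr_gt0.
  have q0 : 0 < q by rewrite qs.
  pose D := 2 * C1 `^ (q - 1) * C2.
  have D0 : 0 < D by rewrite mulr_gt0 ?C20// mulr_gt0 ?powR_gt0.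
  exists (D `^ q^-1); split; first by rewrite powR_gt0.
  move=> f bv.
  have [N [V [Phi [[mf fN -> V0] mPhi P0 d [Pw Ps]]]]] := BV_profile n0 a01 ps bv.
  (* At the critical exponent the bound is homogeneous of degree [q] in [V], so the variation alone
     controls the norm. *)
  have h : (\int[lebn n]_x (`|f x| `^ q)%:E <= ((D `^ q^-1 * V) `^ q)%:E)%E.
    rewrite powRM ?powR_ge0// root ?(ltW D0)//.
    have -> : D * V `^ q = 2 * (C1 * V) `^ (q - 1) * C2 * V.
      rewrite powRM ?(ltW C10)//.
      have -> : V `^ q = V `^ (q - 1) * V.
        have [->|Vn0] := eqVneq V 0; first by rewrite mulr0 powR0// gt_eqF.
        by rewrite -[X in _ * X](powRr1 V0) -powRD ?subrK// Vn0 implybT.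
      rewrite /D; move: (C1 `^ (q - 1)) (V `^ (q - 1)) => A B; ring.
    by rewrite qs; exact: (critical_power a01 n0 mf mPhi P0 d V0 C10 Pw (Ps n2) n2).
  have [m le] := Lp_norm_le mf q0 (mulr_ge0 (powR_ge0 _ _) V0) h.
  split => //; apply: (le_trans le); rewrite (NpE _ _ mf fN) -EFinD -EFinM lee_fin.
  by rewrite ler_wpM2l ?powR_ge0// lerDr powR_ge0.
Qed.
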